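(* Let $(a,b)=(a_n,b_n)$ be intervals with $-\infty\le a_n<b_n\le\infty$, and let $\alpha_n=\sqrt n\,\alpha(a,b)$. If either $\alpha_n\le0$ (for all $n$) or $\alpha_n\to\infty$ as $n\to\infty$, then $N_n(a,b)$ satisfies the central limit theorem: $$\frac{N_n(a,b)-\mathbb E[N_n(a,b)]}{\sqrt{\operatorname{Var}[N_n(a,b)]}}\xrightarrow{d}\mathcal N(0,1)\quad\text{as }n\to\infty.$$
   Context: $P_n(x)=\sum_{j=0}^n\omega_j\sqrt{\binom nj}\,x^j$ with $\omega_j$ i.i.d. standard real Gaussian random variables. $N_n(a,b)$ is the number of real zeros of $P_n$ in $(a,b)$. $\alpha(a,b)=\frac{b-a}{1+ab}$, understood in the extended sense: $\alpha(a,b)=+\infty$ if $ab=-1$; $\alpha(a,\infty)=1/a$ for finite $a\neq0$; $\alpha(-\infty,b)=-1/b$ for finite $b\neq0$; $\alpha(0,\infty)=\alpha(-\infty,0)=+\infty$; $\alpha(-\infty,\infty)=0$. $\mathcal N(0,1)$ is the standard normal distribution. *)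

(* Defs.v *)
From mathcomp Require Import all_boot all_order all_algebra finmap.
From mathcomp Require Import all_classical all_reals all_analysis.

Set Implicit Arguments.
Unset Strict Implicit.
Unset Printing Implicit Defensive.

Import Order.TTheory GRing.Theory Num.Theory.
Import numFieldNormedType.Exports.

Local Open Scope classical_set_scope.
Local Open Scope ring_scope.

Definition mutually_independent (d : measure_display) (T : measurableType d)
    (R : realType) (P : probability T R) (X : nat -> {RV P >-> R}) : Prop :=
  forall (J : {fset nat}) (B : nat -> set R), (forall j, measurable (B j)) ->
    P (\bigcap_(j in [set` J]) X j @^-1` B j) =
    (\prod_(j <- J) P (X j @^-1` B j))%E.

(* The two laws are only compared on measurable sets: both sides are set
   functions defined on all of [set R]. *)
Definition iid_standard_gaussian (d : measure_display) (T : measurableType d)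
    (R : realType) (P : probability T R) (X : nat -> {RV P >-> R}) : Prop :=
  mutually_independent X /\
  forall j (B : set R), measurable B ->
    distribution P (X j) B = normal_prob 0 1 B.

Definition random_poly (T : Type) (R : realType) (omega : nat -> T -> R)
    (n : nat) (t : T) : {poly R} :=
  \poly_(j < n.+1) (omega j t * Num.sqrt ('C(n, j)%:R)).

(* Distinct zeros. On the event that the polynomial vanishes identically, which
   is null in the Gaussian case, the counting measure is +oo and the value of
   [nb_zeros] is 0. *)
Definition nb_zeros (T : Type) (R : realType) (omega : nat -> T -> R)
    (n : nat) (a b : \bar R) (t : T) : R :=
  fine (counting [set x : R | (a < x%:E < b)%E /\
                              root (random_poly omega n t) x] : \bar R).

(* (b - a) / (1 + a b) extended to -oo <= a < b <= +oo; the last case is never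
   reached when a < b. *)
Definition alpha (R : realType) (a b : \bar R) : \bar R :=
  match a, b with
  | r%:E, s%:E =>
      if r * s == -1 then +oo%E else ((s - r) / (1 + r * s))%:E
  | r%:E, +oo%E => if r == 0 then +oo%E else r^-1%:E
  | -oo%E, s%:E => if s == 0 then +oo%E else (- s^-1)%:E
  | -oo%E, +oo%E => 0%E
  | _, _ => 0%E
  end.

(* Convergence of distribution functions at every continuity point of the limit
   distribution function. *)
Definition cvg_in_distribution (d : measure_display) (T : measurableType d)
    (R : realType) (P : probability T R) (X : nat -> T -> R)
    (mu : probability (measurableTypeR R) R) : Prop :=
  forall x : R, {for x, continuous (fun y : R => mu [set` `]-oo, y]])} ->
    P [set t | X n t <= x] @[n --> \oo] --> mu [set` `]-oo, x]].

(* Main.v *)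
(* Put x = tan th. Up to the factor cos(th)^n, P_n becomes the Gaussian process
   X(th) = sum_j omega_j sqrt(C(n,j)) sin(th)^j cos(th)^(n-j), which is stationary
   with covariance cos(th - th')^n, so that N_n(a,b) counts its zeros on an
   interval of angles; the hypothesis on alpha_n says exactly that sqrt(n) times
   the length L of this interval tends to infinity.

   Almost surely the zeros are simple, and the number of zeros is the limit of
   the numbers of sign changes along dyadic grids; the limit holds in L^2 because
   a sign change seen only after halving a mesh of width h requires a sign pattern
   of probability O((sqrt(n) h)^3). Cut the interval into long blocks separated by
   gaps of M units of length 1/sqrt(n). Since laws of sign vectors depend only on
   the Gram matrix, a tiny noise makes the blocks exactly uncorrelated, hence
   independent, at a cost that is exponentially small in M^2, and the gaps
   contribute negligibly to the variance. The variance of a block grows at least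
   linearly in its length: correlate its sign changes with the weights
   exp(-e X(th)^2), which tilt the Gaussian law explicitly, and use Sheppard's
   formula for the probability of a sign change. Moment bounds on the block
   counts then give the central limit theorem for the sum of the independent
   copies through E[cos(u Z + v)], and polynomials in sin(y / K) approximating a
   step function carry it over to distribution functions. The scales are tied
   together by M^28 <= sqrt(n) L < (M+1)^28. *)

Require Import Defs.
From mathcomp Require Import all_boot all_order all_algebra finmap.
From mathcomp Require Import all_classical all_reals all_analysis.
From mathcomp Require Import measurable_realfun.
From mathcomp Require Import ring lra zify.

Set Implicit Arguments.
Unset Strict Implicit.
Unset Printing Implicit Defensive.

Import Order.TTheory GRing.Theory Num.Theory.
Import numFieldNormedType.Exports.

Local Open Scope classical_set_scope.
Local Open Scope ring_scope.

(** All laws are compared through expectations of [cos (u x + v)]. Powers of a sine are combinations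
    of such cosines, so signs and Gaussian weights are reached as bounded limits of polynomials in a
    sine.

    Origin of the exponent 28: with units of length about 1/sqrt(n), periods of M^5 units and gaps
    of M units, there are Q ~ M^23 periods. The gaps bring Q M^4 to the variance, the blocks at
    least a constant times Q M^5. The mesh is 2^(-64 M) units, so that the counts are close to the
    zeros in L^2; the third moment of a count pays the cube of the number of halvings, so that of a
    block is of order M^18 instead of M^15. The Lyapunov ratio Q M^18 / V^(3/2) is O(1/M) as soon as
    the variance V exceeds constant multiples of both Q M^5 and M^28. The exponentially fine mesh
    does not spoil the decoupling, because exp(-M^2/4) beats every power 2^(c M). *)

Section Bounded.
Context d (T : measurableType d) (R : realType) (P : probability T R).
Implicit Types f g : T -> R.

(** Counts, weights, cosines and indicators are all bounded, so each expectation is a real number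
    and linearity asks for nothing but [bdd]. *)
Definition bdd f := measurable_fun setT f /\ exists M : R, forall x, `|f x| <= M.

Definition Ex f : R := \int[P]_x f x.

Lemma eq_bdd f g : f =1 g -> bdd g -> bdd f.
Proof. by move=> /funext ->. Qed.

Lemma bdd_meas f : bdd f -> measurable_fun setT f. Proof. by case. Qed.

Lemma bdd_cst c : bdd (fun=> c).
Proof. by split; [exact: measurable_cst|exists `|c|]. Qed.

Lemma bddD f g : bdd f -> bdd g -> bdd (fun x => f x + g x).
Proof.
move=> [mf [M fM]] [mg [K gK]]; split; first exact: measurable_funD.
by exists (M + K) => x; rewrite (le_trans (ler_normD _ _))// lerD.
Qed.

Lemma bddM f g : bdd f -> bdd g -> bdd (fun x => f x * g x).
Proof.
move=> [mf [M fM]] [mg [K gK]]; split; first exact: measurable_funM.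
by exists (M * K) => x; rewrite normrM ler_pM.
Qed.

Lemma bddZ c f : bdd f -> bdd (fun x => c * f x).
Proof. by apply: bddM; exact: bdd_cst. Qed.

Lemma bddN f : bdd f -> bdd (fun x => - f x).
Proof.
move=> [mf [M fM]]; split; first exact: measurableT_comp.
by exists M => x; rewrite normrN.
Qed.

Lemma bddB f g : bdd f -> bdd g -> bdd (fun x => f x - g x).
Proof. by move=> bf bg; apply: bddD => //; exact: bddN. Qed.

Lemma bddX f n : bdd f -> bdd (fun x => f x ^+ n).
Proof.
move=> bf; elim: n => [|n IH]; first by apply: eq_bdd (bdd_cst 1) => x; rewrite expr0.
by apply: eq_bdd (bddM bf IH) => x; rewrite exprS.
Qed.

Lemma bdd_norm f : bdd f -> bdd (fun x => `|f x|).
Proof.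
move=> [mf [M fM]]; split; first exact: measurableT_comp.
by exists M => x; rewrite normr_id.
Qed.

Lemma bdd_sum I (r : seq I) (Q : pred I) (F : I -> T -> R) :
  (forall i, Q i -> bdd (F i)) -> bdd (fun x => \sum_(i <- r | Q i) F i x).
Proof.
move=> bF; elim: r => [|i r IH].
  by apply: eq_bdd (bdd_cst 0) => x; rewrite big_nil.
have [Qi|nQi] := boolP (Q i).
  by apply: eq_bdd (bddD (bF i Qi) IH) => x; rewrite big_cons Qi.
by apply: eq_bdd IH => x; rewrite big_cons (negbTE nQi).
Qed.

Lemma bdd_prod I (r : seq I) (Q : pred I) (F : I -> T -> R) :
  (forall i, Q i -> bdd (F i)) -> bdd (fun x => \prod_(i <- r | Q i) F i x).
Proof.
move=> bF; elim: r => [|i r IH].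
  by apply: eq_bdd (bdd_cst 1) => x; rewrite big_nil.
have [Qi|nQi] := boolP (Q i).
  by apply: eq_bdd (bddM (bF i Qi) IH) => x; rewrite big_cons Qi.
by apply: eq_bdd IH => x; rewrite big_cons (negbTE nQi).
Qed.

Lemma bdd_indic (A : set T) : measurable A -> bdd (\1_A : T -> R).
Proof.
move=> mA; split; first exact: measurable_indic.
by exists 1 => x; rewrite indicE; case: (_ \in _); rewrite ?normr1 ?normr0.
Qed.

Lemma bdd_integrable f : bdd f -> P.-integrable setT (EFin \o f).
Proof.
move=> [mf [M fM]].
apply: (@le_integrable _ _ _ _ _ _ _ (EFin \o cst M)) => //.
- exact/measurable_EFinP.
- by move=> x _ /=; rewrite lee_fin (le_trans (fM x))// ler_norm.
- exact: finite_measure_integrable_cst.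
Qed.

Lemma Ex_cst c : Ex (fun=> c) = c.
Proof. by rewrite /Ex Rintegral_cst// [X in fine X]probability_setT mulr1. Qed.

Lemma ExD f g : bdd f -> bdd g -> Ex (fun x => f x + g x) = Ex f + Ex g.
Proof. by move=> bf bg; rewrite /Ex RintegralD//; exact: bdd_integrable. Qed.

Lemma ExB f g : bdd f -> bdd g -> Ex (fun x => f x - g x) = Ex f - Ex g.
Proof. by move=> bf bg; rewrite /Ex RintegralB//; exact: bdd_integrable. Qed.

Lemma ExZ c f : bdd f -> Ex (fun x => c * f x) = c * Ex f.
Proof. by move=> bf; rewrite /Ex RintegralZl//; exact: bdd_integrable. Qed.

Lemma eq_Ex f g : f =1 g -> Ex f = Ex g.
Proof. by move=> fg; apply: eq_Rintegral => x _. Qed.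

Lemma Ex_sum I (r : seq I) (Q : pred I) (F : I -> T -> R) :
  (forall i, Q i -> bdd (F i)) ->
  Ex (fun x => \sum_(i <- r | Q i) F i x) = \sum_(i <- r | Q i) Ex (F i).
Proof.
move=> bF; elim: r => [|i r IH].
  by rewrite big_nil -[RHS]Ex_cst; apply: eq_Ex => x; rewrite big_nil.
rewrite big_cons; case: ifPn => Qi; last first.
  by rewrite -IH; apply: eq_Ex => x; rewrite big_cons (negbTE Qi).
rewrite -IH -ExD//; [|exact: bF|exact: bdd_sum].
by apply: eq_Ex => x; rewrite big_cons Qi.
Qed.

Lemma Ex_le f g : bdd f -> bdd g -> (forall x, f x <= g x) -> Ex f <= Ex g.
Proof. by move=> bf bg fg; apply: le_Rintegral => //; exact: bdd_integrable. Qed.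

Lemma Ex_ge0 f : (forall x, 0 <= f x) -> 0 <= Ex f.
Proof. by move=> f0; exact: Rintegral_ge0. Qed.

Lemma Ex_norm f : bdd f -> `|Ex f| <= Ex (fun x => `|f x|).
Proof. by move=> bf; apply: le_normr_Rintegral => //; exact: bdd_integrable. Qed.

Lemma Ex_normc f c : bdd f -> (forall x, `|f x| <= c) -> `|Ex f| <= c.
Proof.
move=> bf fc; rewrite (le_trans (Ex_norm bf))// -[leRHS]Ex_cst.
by apply: Ex_le => //; [exact: bdd_norm|exact: bdd_cst].
Qed.

Lemma Ex_indic (A : set T) : measurable A -> Ex (\1_A) = fine (P A).
Proof.
by move=> mA; rewrite /Ex /Rintegral integral_indic// setIT.
Qed.

(** Convergence off a null set is the form needed for dyadic sign counts, which tend to the number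
    of zeros only almost surely. *)
Lemma Ex_ae_cvg (f_ : nat -> T -> R) f (M : R) : (forall n, bdd (f_ n)) ->
  measurable_fun setT f -> (forall n x, `|f_ n x| <= M) ->
  {ae P, forall x, f_ ^~ x @ \oo --> f x} ->
  Ex (f_ n) @[n --> \oo] --> Ex f.
Proof.
move=> bf mf fM cf.
have cfE : {ae P, forall x, setT x -> (EFin \o f_ n) x @[n --> \oo] --> (EFin \o f) x}.
  by apply: filterS cf => x fx _; apply: cvg_EFin => //; exact: nearW.
have dE : {ae P, forall x n, setT x -> (`|(EFin \o f_ n) x| <= (EFin \o cst M) x)%E}.
  by apply: aeW => x n _; rewrite lee_fin.
have [h1 _ h2] := @dominated_convergence _ _ _ P setT measurableT
   (fun n => EFin \o f_ n) (EFin \o f) (EFin \o cst M)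
   (fun n => (measurable_EFinP _ _).2 (bdd_meas (bf n)))
   ((measurable_EFinP _ _).2 mf)
   cfE (finite_measure_integrable_cst P M measurableT) dE.
apply: fine_cvg; rewrite fineK; last exact: integrable_fin_num.
exact: h2.
Qed.

Lemma Ex_cvg (f_ : nat -> T -> R) f (M : R) : (forall n, bdd (f_ n)) ->
  (forall n x, `|f_ n x| <= M) ->
  (forall x, f_ ^~ x @ \oo --> f x) ->
  bdd f /\ (Ex (f_ n) @[n --> \oo] --> Ex f).
Proof.
move=> bf fM cf.
have mf : measurable_fun setT f.
  by apply: (measurable_fun_cvg (fun n => bdd_meas (bf n))) => x _; exact: cf.
split; last by apply: (Ex_ae_cvg bf mf fM); exact: aeW.
split=> //; exists M => x.
have cx : cvgn (fun n => `|f_ n x|) by apply/cvg_ex; exists `|f x|; exact: cvg_norm (cf x).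
rewrite -(cvg_lim _ (cvg_norm (cf x)))//.
by apply: limr_le => //; exact: nearW.
Qed.

End Bounded.

Section BoundedInduction.
Import HBNNSimple.
Context d (T : measurableType d) (R : realType).

(** A functional monotone class principle. Simple functions increase to a nonnegative function while
    staying below its bound; adding the constant [|M|] reduces the general case to this one. *)
Lemma bdd_ind (Q : (T -> R) -> Prop) :
  (forall A : set T, measurable A -> Q (\1_A : T -> R)) ->
  (forall f g (c : R), bdd f -> bdd g -> Q f -> Q g -> Q (fun x => c * f x + g x)) ->
  (forall (f_ : nat -> T -> R) f (M : R), (forall n, bdd (f_ n)) -> (forall n, Q (f_ n)) ->
     (forall n x, `|f_ n x| <= M) ->
     (forall x, f_ ^~ x @ \oo --> f x) -> Q f) ->
  forall f, bdd f -> Q f.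
Proof.
move=> Q1 QD Qlim.
have Qs (g : {nnsfun T >-> R}) : Q g.
  pose s := fset_set (range g).
  rewrite (_ : (g : T -> R) =
     fun x => \sum_(i < #|` s|) s`_i * \1_(g @^-1` [set s`_i]) x); last first.
    by apply/funext => x; rewrite (fimfunEord g).
  elim: (index_enum _) => [|i r IH].
    rewrite (_ : (fun=> _) = (\1_(set0 : set T) : T -> R)); first exact: Q1.
    by apply/funext => x; rewrite big_nil indicE in_set0.
  rewrite (_ : (fun=> _) = (fun x => s`_i * \1_(g @^-1` [set s`_i]) x +
     \sum_(j <- r) s`_j * \1_(g @^-1` [set s`_j]) x)); last first.
    by apply/funext => x; rewrite big_cons.
  apply: QD => //.
  - by apply: bdd_indic.
  - by apply: bdd_sum => j _; apply: bddZ; exact: bdd_indic.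
  - exact: Q1.
have Qpos f : bdd f -> (forall x, 0 <= f x) -> Q f.
  move=> [mf [M fM]] f0.
  have mF : measurable_fun setT (EFin \o f) by exact/measurable_EFinP.
  have F0 x : setT x -> (0 <= (EFin \o f) x)%E by move=> _; rewrite lee_fin.
  pose g n := nnsfun_approx measurableT mF n.
  have cg x : (EFin \o g^~ x) @ \oo --> (EFin \o f) x.
    exact: (cvg_nnsfun_approx measurableT mF F0).
  have gf n x : g n x <= f x.
    have cgx : g^~ x @ \oo --> f x by exact: (fine_cvg (cg x)).
    rewrite -(cvg_lim _ cgx)//; apply: nondecreasing_cvgn_le.
      by move=> m p mp; have /lefP/(_ x) := nd_nnsfun_approx measurableT mF mp.
    by apply/cvg_ex; exists (f x).
  apply: (Qlim (fun n => g n : T -> R) f M).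
  - move=> n; split; first exact: measurable_funPT.
    by exists M => x; rewrite ger0_norm// (le_trans (gf n x))// (le_trans (ler_norm _)).
  - by move=> n; exact: Qs.
  - by move=> n x; rewrite ger0_norm// (le_trans (gf n x))// (le_trans (ler_norm _)).
  - by move=> x; exact: (fine_cvg (cg x)).
move=> f bf.
have [mf [M fM]] := bf.
rewrite (_ : f = (fun x => - `|M| * \1_(setT : set T) x + (f x + `|M|))); last first.
  by apply/funext => x; rewrite indicT/= mulr1 addrC addrK.
apply: QD.
- exact: bdd_indic.
- by apply: bddD => //; exact: bdd_cst.
- exact: Q1.
- apply: Qpos; first by apply: bddD => //; exact: bdd_cst.
  move=> x; have := fM x; have := ler_norm M; have := ler_norm (- f x); rewrite normrN; lra.
Qed.

End BoundedInduction.

(** * Products of functions of independent variables *)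

Section Product.
Context d (T : measurableType d) (R : realType) (P : probability T R).
Variable omega : nat -> {RV P >-> R}.
Hypothesis indep : mutually_independent omega.

Lemma bdd_rv (f : R -> R) j : bdd (f : R -> R) -> bdd (fun t => f (omega j t)).
Proof.
move=> [mf [M fM]]; split; last by exists M => x; exact: fM.
by apply: (measurableT_comp mf); exact: measurable_funPT.
Qed.

Lemma Ex_prod_indic (B : nat -> set R) N : (forall j, measurable (B j)) ->
  Ex P (fun t => \prod_(j < N) (\1_(B j) (omega j t) : R)) =
  \prod_(j < N) Ex P (fun t => (\1_(B j) (omega j t) : R)).
Proof.
move=> mB.
pose J := [fset j | j in iota 0 N]%fset.
have memJ j : (j \in J) = (j < N)%N.
  apply/imfsetP/idP => [[k /=]|jN]; first by rewrite mem_iota => /andP[_ kN] ->.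
  by exists j => //=; rewrite mem_iota.
have mO j : measurable (omega j @^-1` B j).
  exact: (measurable_funPTI (omega j) (mB j)).
have mI : measurable (\bigcap_(j in [set` J]) omega j @^-1` B j).
  by apply: fin_bigcap_measurable => //; exact: finite_fset.
transitivity (fine (P (\bigcap_(j in [set` J]) omega j @^-1` B j))).
  rewrite -Ex_indic//; apply: eq_Ex => t.
  rewrite !indicE; have [tB|tB] := boolP (t \in _).
    apply: big1 => j _; rewrite indicE mem_set//.
    by move/set_mem : tB; apply; rewrite /= memJ.
  have /existsNP[j /not_implyP[/=]] : ~ (forall j, [set` J] j -> (omega j @^-1` B j) t).
    by move=> h; move/negP: tB; apply; exact/mem_set.
  rewrite memJ => jN nB.
  by rewrite (bigD1 (Ordinal jN))//= indicE memNset// mul0r.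
rewrite indep//.
rewrite (perm_big (iota 0 N)); last first.
  apply: uniq_perm; [exact: fset_uniq|exact: iota_uniq|].
  by move=> j; rewrite memJ mem_iota.
have -> : (\prod_(j <- iota 0 N) P (omega j @^-1` B j) =
  (\prod_(j <- iota 0 N) fine (P (omega j @^-1` B j)))%:E)%E.
  elim: (iota 0 N) => [|j r IH]; first by rewrite !big_nil.
  by rewrite !big_cons IH EFinM fineK//; exact: fin_num_measure.
rewrite /= -[RHS](big_mkord xpredT (fun j => Ex P (fun t => (\1_(B j) (omega j t) : R)))).
rewrite /index_iota subn0.
by apply: eq_bigr => j _; rewrite -Ex_indic//; apply: eq_Ex => t; rewrite !indicE.
Qed.

(** Induction on [k]: factors with index below [k] are arbitrary, the others are indicators. Raising
    [k] frees one factor, by [bdd_ind] applied to that factor alone. *)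
Lemma Ex_prod (f : nat -> R -> R) N :
  (forall j, bdd (f j : R -> R)) ->
  Ex P (fun t => \prod_(j < N) f j (omega j t)) =
  \prod_(j < N) Ex P (fun t => f j (omega j t)).
Proof.
suff H k : (k <= N)%N -> forall f : nat -> R -> R,
   (forall j, bdd (f j : R -> R)) ->
   (forall j, (k <= j)%N -> exists2 A, measurable A & f j = \1_A) ->
   Ex P (fun t => \prod_(j < N) f j (omega j t)) =
   \prod_(j < N) Ex P (fun t => f j (omega j t)).
  (* From [N] on the functions do not enter the product; indicators there meet the side condition of
     the induction at [k = N]. *)
  move=> bf; pose g j := if (j < N)%N then f j else \1_setT.
  have := H N (leqnn N) g.
  have gf (j : 'I_N) : g j = f j by rewrite /g ltn_ord.
  under eq_Ex do under eq_bigr do rewrite gf.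
  under eq_bigr do rewrite gf.
  apply.
  - by move=> j; rewrite /g; case: ifP => // _; exact: bdd_indic.
  - by move=> j Nj; exists setT => //; rewrite /g ltnNge Nj.
elim: k => [_ {}f bf fB|k IH kN {}f bf fB].
  have /choice[B HB] : forall j, exists A, measurable A /\ f j = \1_A.
    by move=> j; have [A] := fB j isT; exists A.
  rewrite (_ : f = fun j => \1_(B j)); last by apply/funext => j; case: (HB j).
  by apply: Ex_prod_indic => j; case: (HB j).
pose F (h : R -> R) j := if j == k then h else f j.
pose K := Ordinal kN.
pose G t := \prod_(j < N | j != K) f j (omega j t).
pose C := \prod_(j < N | j != K) Ex P (fun t => f j (omega j t)).
have EF h : Ex P (fun t => \prod_(j < N) F h j (omega j t)) =
            Ex P (fun t => h (omega k t) * G t).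
  apply: eq_Ex => t; rewrite (bigD1 K)//= /F eqxx; congr (_ * _).
  by apply: eq_bigr => j jK; rewrite ifN.
have CF h : \prod_(j < N) Ex P (fun t => F h j (omega j t)) =
            Ex P (fun t => h (omega k t)) * C.
  rewrite (bigD1 K)//= /F eqxx; congr (_ * _).
  by apply: eq_bigr => j jK; rewrite ifN.
have bG : bdd G by apply: bdd_prod => j _; exact: bdd_rv.
suff Q h : bdd (h : R -> R) ->
    Ex P (fun t => h (omega k t) * G t) = Ex P (fun t => h (omega k t)) * C.
  have := Q (f k) (bf k); rewrite -EF -CF.
  have -> : F (f k) = f by apply/funext => j; rewrite /F; case: eqP => [->|].
  by [].
move: h; apply: bdd_ind.
- move=> A mA; rewrite -EF -CF; apply: IH; first exact: ltnW.
    by move=> j; rewrite /F; case: ifP => // _; exact: bdd_indic.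
  move=> j kj; rewrite /F; case: eqP => [_|/eqP jk]; first by exists A.
  by apply: fB; rewrite ltn_neqAle eq_sym jk.
- move=> g1 g2 c b1 b2 Q1 Q2.
  have c1 := bdd_rv k b1; have c2 := bdd_rv k b2.
  rewrite ExD//; last exact: bddZ.
  rewrite ExZ// mulrDl -mulrA -Q1 -Q2 -ExZ; last exact: bddM.
  rewrite -ExD; [|by apply: bddZ; exact: bddM|exact: bddM].
  by apply: eq_Ex => t; rewrite mulrDl mulrA.
- move=> f_ h M bf_ Qf fM cf.
  have [bh ch] := Ex_cvg P (fun n => bdd_rv k (bf_ n)) (fun n t => fM n (omega k t))
     (fun t => cf (omega k t)).
  have := bG => -[_ [Mg GM]].
  have GG n t : `|f_ n (omega k t) * G t| <= M * Mg by rewrite normrM ler_pM.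
  have [_ chG] := @Ex_cvg _ _ _ P _ (fun t => h (omega k t) * G t) (M * Mg)
    (fun n => bddM (bdd_rv k (bf_ n)) bG) GG
    (fun t => cvgM (cf (omega k t)) (cvg_cst _)).
  apply: (cvg_unique _ chG) => //.
  rewrite /mkset (funext Qf).
  exact: cvgMl.
Qed.

End Product.

(** * Gaussian vectors *)

Section GaussianCF.
Context (R : realType).
Local Notation mu := (@lebesgue_measure R).
Implicit Types (s t x a w : R).
(** The phase [w] lets a single statement cover the cosine and the sine, that is, both parts of a
    characteristic function. *)
Variable w : R.

Lemma is_derive_mull t x : is_derive x 1 (fun y : R => t * y) t.
Proof.
have -> : (fun y : R => t * y) = t \*: (id : R -> R) by [].
by apply: trigger_derive; rewrite /GRing.scale/= mulr1.
Qed.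

Lemma is_derive_affine t x : is_derive x 1 (fun y : R => t * y + w) t.
Proof.
have h := is_derive_mull t x.
have -> : (fun y : R => t * y + w) = (fun y : R => t * y) + cst w by [].
by apply: trigger_derive; rewrite addr0.
Qed.

Lemma is_derive_sinM t x : is_derive x 1 (fun y : R => sin (t * y + w)) (t * cos (t * x + w)).
Proof.
have := @is_derive1_comp R sin (fun y => t * y + w) x _ _ (is_derive_sin _) (is_derive_affine t x).
by rewrite mulrC.
Qed.

Lemma is_derive_cosM t x : is_derive x 1 (fun y : R => cos (t * y + w)) (- (t * sin (t * x + w))).
Proof.
have := @is_derive1_comp R cos (fun y => t * y + w) x _ _ (is_derive_cos _) (is_derive_affine t x).
by rewrite mulNr mulrC.
Qed.

Lemma is_derive_expsq a x : is_derive x 1 (fun y : R => expR (a * y ^+ 2))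
  (2 * a * x * expR (a * x ^+ 2)).
Proof.
have h : is_derive x 1 (fun y : R => a * y ^+ 2) (2 * a * x).
  have -> : (fun y : R => a * y ^+ 2) = a \*: ((id : R -> R) ^+ 2).
    by apply/funext => y.
  by apply: trigger_derive; rewrite /GRing.scale/=; ring.
have := @is_derive1_comp R expR (fun y => a * y ^+ 2) x _ _ (is_derive_expR _) h.
by rewrite mulrC.
Qed.

Lemma is_derive_continuous (f df : R -> R) :
  (forall x, is_derive x 1 f (df x)) -> continuous f.
Proof.
move=> h x; apply: differentiable_continuous.
by apply/derivable1_diffP; case: (h x).
Qed.

Lemma measurable_cont (f : R -> R) : continuous f -> measurable_fun setT f.
Proof. exact: continuous_measurable_fun. Qed.

Variable s : R.
Hypothesis s0 : 0 < s.
Let phi := normal_pdf 0 s.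

Lemma integrableZlE c (f : R -> R) : mu.-integrable setT (fun x => (f x)%:E) ->
  mu.-integrable setT (fun x => (c * f x)%:E).
Proof. by move=> fi; under eq_fun do rewrite EFinM; exact: integrableZl. Qed.

Lemma phiE x : phi x = normal_peak s * expR (- (2 * s ^+ 2)^-1 * x ^+ 2).
Proof.
rewrite /phi normal_pdfE ?gt_eqF// /normal_fun subr0; congr (_ * expR _).
by rewrite mulNr mulrC mulNr -mulr_natl.
Qed.

Lemma phi_ge0 x : 0 <= phi x. Proof. exact: normal_pdf_ge0. Qed.

Lemma int_phi (f : R -> R) : bdd f -> mu.-integrable setT (fun x => (f x * phi x)%:E).
Proof.
move=> [mf [M fM]].
apply: (@le_integrable _ _ _ mu _ _ _ (fun x => (M * phi x)%:E)) => //.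
- apply/measurable_EFinP; apply: measurable_funM => //; exact: measurable_normal_pdf.
- move=> x _ /=; rewrite lee_fin !normrM ler_wpM2r//.
  by rewrite (le_trans (fM x))// ler_norm.
- under eq_fun do rewrite EFinM; apply: integrableZl => //.
  exact: integrable_normal_pdf.
Qed.

(** Doubling the standard deviation absorbs the factor [|x|]. This gives both the integrability of
    [x * phi x] and the decay of [phi] used for the boundary terms. *)
Lemma x_phi_le x : `|x| * phi x <= 2 * s * normal_pdf 0 (2 * s) x.
Proof.
rewrite phiE normal_pdfE ?gt_eqF ?mulr_gt0// /normal_fun subr0.
have pk : normal_peak (2 * s) = normal_peak s / 2.
  rewrite /normal_peak exprMn -mulrA -mulrnAr sqrtrM ?exprn_ge0//.
  by rewrite sqrtr_sqr ger0_norm// invfM mulrC.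
have x2 : x ^+ 2 = `|x| ^+ 2 by rewrite real_normK// num_real.
rewrite pk x2; pose y : R := `|x|; rewrite -/y; have y0 : 0 <= y by exact: normr_ge0.
have -> : 2 * s * (normal_peak s / 2 * expR (- y ^+ 2 / ((2 * s) ^+ 2 *+ 2))) =
    normal_peak s * (s * expR (- y ^+ 2 / ((2 * s) ^+ 2 *+ 2))) by field.
rewrite mulrCA ler_wpM2l ?normal_peak_ge0//.
have -> : - y ^+ 2 / ((2 * s) ^+ 2 *+ 2) =
   - (2 * s ^+ 2)^-1 * y ^+ 2 + 3 / 8 * (y / s) ^+ 2.
  by rewrite -mulr_natl; field; rewrite gt_eqF.
rewrite expRD; set E := expR _; set E2 := expR _.
have -> : s * (E * E2) = E * (s * E2) by ring.
rewrite mulrC ler_wpM2l ?expR_ge0// /E2 {E E2}.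
have -> : y = s * (y / s) by field; rewrite gt_eqF.
rewrite ler_wpM2l ?(ltW s0)// (le_trans _ (expR_ge1Dx _))//.
have -> : s * (y / s) / s = y / s by field; rewrite gt_eqF.
(* The coefficient 3/8 = 1/2 - 1/8 is the gap between the two Gaussian exponents, and 1 + 3/8 z^2
   stays above z. *)
by pose z := y / s; rewrite -/z; have := sqr_ge0 (z - 4 / 3); nra.
Qed.

Lemma int_xphi (f : R -> R) : bdd f -> mu.-integrable setT (fun x => (x * (f x * phi x))%:E).
Proof.
move=> [mf [M fM]].
apply: (@le_integrable _ _ _ mu _ _ _ (fun x => (M * (2 * s) * normal_pdf 0 (2 * s) x)%:E)) => //.
- apply/measurable_EFinP; apply: measurable_funM => //.
  apply: measurable_funM => //; exact: measurable_normal_pdf.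
- move=> x _ /=; rewrite lee_fin mulrCA normrM [leRHS]ger0_norm//; last first.
    rewrite !mulr_ge0 ?normal_pdf_ge0 ?(ltW s0)//.
    exact: le_trans (normr_ge0 _) (fM 0).
  rewrite -mulrA ler_pM// normrM (ger0_norm (phi_ge0 _)).
  exact: x_phi_le.
- under eq_fun do rewrite EFinM; apply: integrableZl => //.
  exact: integrable_normal_pdf.
Qed.

Lemma bdd_cosM t : bdd (fun x : R => cos (t * x + w)).
Proof.
split; last by exists 1 => x; exact: cos_max.
exact: measurable_cont (is_derive_continuous (is_derive_cosM t)).
Qed.

Lemma bdd_sinM t : bdd (fun x : R => sin (t * x + w)).
Proof.
split; last by exists 1 => x; exact: sin_max.
exact: measurable_cont (is_derive_continuous (is_derive_sinM t)).
Qed.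

Lemma is_derive_phi x : is_derive x 1 phi (- (s ^+ 2)^-1 * x * phi x).
Proof.
rewrite (_ : phi = normal_peak s \*: (fun y => expR (- (2 * s ^+ 2)^-1 * y ^+ 2))).
  have h := is_derive_expsq (- (2 * s ^+ 2)^-1) x.
  apply: trigger_derive; rewrite /GRing.scale/= invfM.
  rewrite -[_ *: _ in RHS]/(normal_peak s * _).
  by field; rewrite gt_eqF.
by apply/funext => y; rewrite phiE.
Qed.

Lemma is_derive_sinphi t x : is_derive x 1 (fun y => sin (t * y + w) * phi y)
  (t * (cos (t * x + w) * phi x) - (s ^+ 2)^-1 * (x * (sin (t * x + w) * phi x))).
Proof.
have h1 := is_derive_sinM t x; have h2 := is_derive_phi x.
have -> : (fun y => sin (t * y + w) * phi y) = (fun y => sin (t * y + w)) * phi by [].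
apply: trigger_derive; rewrite /GRing.scale/=; ring.
Qed.

(* Stein's identity for the test function [sin (t x)]. *)
Lemma stein_sin t : \int[mu]_x (x * (sin (t * x + w) * phi x)) =
  s ^+ 2 * (t * \int[mu]_x (cos (t * x + w) * phi x)).
Proof.
pose F y := sin (t * y + w) * phi y.
pose k x := t * (cos (t * x + w) * phi x) - (s ^+ 2)^-1 * (x * (sin (t * x + w) * phi x)).
have ik : mu.-integrable setT (EFin \o k).
  rewrite (_ : EFin \o k = fun x => (t%:E * (cos (t * x + w) * phi x)%:E -
      ((s ^+ 2)^-1)%:E * (x * (sin (t * x + w) * phi x))%:E)%E)//.
  apply: integrableB => //; apply: integrableZl => //.
    exact: (int_phi (bdd_cosM t)).
  exact: (int_xphi (bdd_sinM t)).
have cphi : continuous phi := is_derive_continuous is_derive_phi.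
have ck : continuous k.
  move=> x; apply: cvgB; (apply: cvgM; first exact: cvg_cst).
    by apply: cvgM; [exact: (is_derive_continuous (is_derive_cosM t))|exact: cphi].
  apply: cvgM; first exact: cvg_id.
  by apply: cvgM; [exact: (is_derive_continuous (is_derive_sinM t))|exact: cphi].
have cF : continuous F := is_derive_continuous (is_derive_sinphi t).
have FTC (n : nat) : \int[mu]_(x in `[(- n.+1%:R : R), n.+1%:R]) k x = F n.+1%:R - F (- n.+1%:R).
  rewrite /Rintegral (@continuous_FTC2 _ k F)//.
  - by rewrite gtrN.
  - by apply: continuous_subspaceT; exact: ck.
  - split.
    + by move=> x _; case: (is_derive_sinphi t x).
    + exact/cvg_at_right_filter/cF.
    + exact/cvg_at_left_filter/cF.
  - by move=> x _; rewrite derive1E; have := is_derive_sinphi t x => h; rewrite derive_val.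
have Fphi x : `|F x| <= phi x.
  by rewrite normrM (ger0_norm (phi_ge0 _)) ler_piMl ?phi_ge0 ?sin_max.
have lim0 : \int[mu]_(x in `[(- n.+1%:R : R), n.+1%:R]) k x @[n --> \oo] --> 0.
  under eq_fun do rewrite FTC.
  have phiN x : phi (- x) = phi x by rewrite !phiE sqrrN.
  have phib (n : nat) : phi n.+1%:R <= 2 * s * normal_peak (2 * s) * harmonic n.
    rewrite /harmonic ler_pdivlMr ?ltr0n// mulrC.
    have := x_phi_le n.+1%:R; rewrite ger0_norm ?ler0n// => /le_trans; apply.
    by rewrite ler_wpM2l ?mulr_ge0 ?(ltW s0)// normal_pdf_ub// gt_eqF// mulr_gt0.
  apply/norm_cvg0P; apply: (@squeeze_cvgr _ _ _ _ (cst 0)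
      (fun n => 2 * (2 * s * normal_peak (2 * s)) * harmonic n)).
  - apply: nearW => n; rewrite /= normr_ge0/= (le_trans (ler_normB _ _))//.
    have := Fphi n.+1%:R; have := Fphi (- n.+1%:R); rewrite phiN => A B.
    apply: le_trans (lerD B A) _; rewrite -(mulrA 2) mulr_natl mulr2n.
    exact: lerD (phib n) (phib n).
  - exact: cvg_cst.
  - rewrite -[X in _ --> X](mulr0 (2 * (2 * s * normal_peak (2 * s)))).
    by apply: cvgM; [exact: cvg_cst|exact: cvg_harmonic].
have limk : \int[mu]_(x in `[(- n.+1%:R : R), n.+1%:R]) k x @[n --> \oo] --> \int[mu]_x k x.
  under eq_fun do rewrite Rintegral_mkcond.
  apply: fine_cvg; rewrite fineK; last exact: integrable_fin_num.
  apply: (@dominated_cvg _ _ _ mu setT measurableT _ _ (fun x => `|(k x)%:E|)%E).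
  - move=> n; apply/measurable_EFinP; apply/(measurable_restrictT _ _).1 => //.
    by apply: measurable_funTS; exact: measurable_cont.
  - move=> x _; apply: cvg_EFin; first exact: nearW.
    apply: cvg_near_cst; near=> n.
    rewrite /= patchE ifT// inE/= in_itv/= -ler_norml.
    rewrite (@le_trans _ _ n%:R)// ?ler_nat//.
    by near: n; exact: nbhs_infty_ger.
  - by [].
  - exact/integrable_abse.
  - move=> n x _; rewrite /= patchE; case: ifP => // _; by rewrite normr0 lee_fin.
have k0 : \int[mu]_x k x = 0 by apply: (cvg_unique _ limk lim0).
move: k0; rewrite /k RintegralB//; last 2 first.
- exact: (integrableZlE _ (int_phi (bdd_cosM t))).
- exact: (integrableZlE _ (int_xphi (bdd_sinM t))).
rewrite !RintegralZl//; [|exact: (int_xphi (bdd_sinM t))|exact: (int_phi (bdd_cosM t))].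
move=> /eqP; rewrite subr_eq0 => /eqP ->.
by rewrite mulrA divff ?mul1r// gt_eqF// exprn_gt0.
Unshelve. all: by end_near. Qed.

Let h t := \int[mu]_x (cos (t * x + w) * phi x).

(** Differentiation under the integral is dominated by [|x| * phi x]; Stein's identity turns the
    result into a linear differential equation for [h]. *)
Lemma is_derive_cf t : is_derive t 1 h (- s ^+ 2 * t * h t).
Proof.
have Ia : `](t - 1), (t + 1)[%classic t by rewrite /= in_itv/=; lra.
pose f u x := cos (u * x + w) * phi x.
have df (u x : R) : is_derive u 1 (fun v => f v x) (- (x * (sin (u * x + w) * phi x))).
  have := is_derive_cosM x u => h1.
  rewrite /f (_ : (fun v => cos (v * x + w) * phi x) = phi x \*: (fun v => cos (x * v + w))).
    by apply: trigger_derive; rewrite /GRing.scale/= (mulrC u); ring.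
  by apply/funext => v; rewrite /GRing.scale/= mulrC (mulrC v).
have intf u : `](t - 1), (t + 1)[%classic u -> mu.-integrable setT (EFin \o f u).
  by move=> _; exact: (int_phi (bdd_cosM u)).
have pf u x : partial1of2 f u x = - (x * (sin (u * x + w) * phi x)).
  by rewrite partial1of2E; have := df u x => h1; rewrite derive_val.
have iG : mu.-integrable setT (EFin \o (fun x => `|x| * phi x)).
  have := int_xphi (@bdd_cst _ _ R 1) => /integrable_abse.
  by apply: eq_integrable => // x _ /=; rewrite mul1r normrM (ger0_norm (phi_ge0 _)).
have G0 x : 0 <= `|x| * phi x by rewrite mulr_ge0 ?phi_ge0.
have fG u x : `](t - 1), (t + 1)[%classic u -> setT x -> `|partial1of2 f u x| <= `|x| * phi x.
  move=> _ _; rewrite pf normrN !normrM (ger0_norm (phi_ge0 _)) ler_wpM2l//.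
  by rewrite ler_piMl ?phi_ge0 ?sin_max.
have dd u x : `](t - 1), (t + 1)[%classic u -> setT x -> derivable (f ^~ x) u 1.
  by move=> _ _; case: (df u x).
have h1 := derivable_under_integral measurableT Ia intf dd G0 iG fG.
have h2 := differentiation_under_integral measurableT Ia intf dd G0 iG fG.
apply: DeriveDef; first exact: h1.
rewrite -derive1E h2.
under eq_Rintegral do rewrite pf -mulN1r.
rewrite RintegralZl//; last exact: (int_xphi (bdd_sinM t)).
by rewrite stein_sin mulN1r !mulNr mulrA.
Qed.

(** By the differential equation, [h t * expR (s^2 t^2 / 2)] is constant, and it equals [cos w] at
    0. *)
Lemma normal_cos t : h t = expR (- (s ^+ 2 * t ^+ 2 / 2)) * cos w.
Proof.
pose g u := h u * expR (s ^+ 2 / 2 * u ^+ 2).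
have dg (u : R) : is_derive u 1 g 0.
  have h1 := is_derive_cf u; have h2 := is_derive_expsq (s ^+ 2 / 2) u.
  rewrite (_ : g = h * (fun u => expR (s ^+ 2 / 2 * u ^+ 2)))//.
  by apply: trigger_derive; rewrite /GRing.scale/=; field.
have := is_derive_0_is_cst t 0 dg.
rewrite /g expr0n/= mulr0 expR0 mulr1 => e.
have h0 : h 0 = cos w.
  rewrite /h; under eq_Rintegral do rewrite mul0r add0r.
  rewrite RintegralZl//; last exact: integrable_normal_pdf.
  by rewrite /Rintegral integral_normal_pdf mulr1.
apply: (@mulIf _ (expR (s ^+ 2 / 2 * t ^+ 2))); first by rewrite gt_eqF ?expR_gt0.
rewrite e h0 mulrAC -expRD; set z := (X in expR X).
have -> : z = 0 by rewrite /z; field.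
by rewrite expR0 mul1r.
Qed.

End GaussianCF.

Section GaussianForms.
Context d (T : measurableType d) (R : realType) (P : probability T R).
Variable omega : nat -> {RV P >-> R}.
Hypothesis iid : iid_standard_gaussian omega.
Local Notation mu := (@lebesgue_measure R).
Implicit Types (a b c : nat -> R) (v : R).

Lemma Ex_omega (f : R -> R) j : bdd f ->
  Ex P (fun t => f (omega j t)) = \int[mu]_x (f x * normal_pdf 0 1 x).
Proof.
move: f; apply: bdd_ind.
- move=> A mA.
  transitivity (fine (distribution P (omega j) A)).
    have mO := measurable_funPTI (omega j) mA.
    by rewrite -[RHS]/(fine (P (omega j @^-1` A))) -Ex_indic//.
  rewrite iid.2// /normal_prob -/(Rintegral _ _ _) Rintegral_mkcond.
  apply: eq_Rintegral => x _; rewrite patchE [in RHS]indicE.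
  by case: (x \in A); rewrite ?mul1r ?mul0r.
- move=> f g c bf bg Hf Hg.
  have cf := bdd_rv omega j bf; have cg := bdd_rv omega j bg.
  rewrite ExD//; last exact: bddZ.
  rewrite ExZ//.
  have If := int_phi 1 bf; have Ig := int_phi 1 bg.
  rewrite Hf Hg -RintegralZl// -RintegralD//.
  + by apply: eq_Rintegral => x _; rewrite mulrDl mulrA.
  + exact: (integrableZlE _ If).
- move=> f_ f M bf_ Hf fM cf.
  have [bf ch] := Ex_cvg P (fun n => bdd_rv omega j (bf_ n)) (fun n t => fM n (omega j t))
     (fun t => cf (omega j t)).
  apply: (cvg_unique _ ch) => //; rewrite /mkset (funext Hf).
  have mf : measurable_fun setT f.
    by apply: (measurable_fun_cvg (fun n => bdd_meas (bf_ n))) => x _; exact: cf.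
  have mphi : measurable_fun setT (normal_pdf (0 : R) 1) by exact: measurable_normal_pdf.
  have bM : bdd (f : R -> R).
    split=> //; exists M => x.
    have cx : cvgn (fun n => `|f_ n x|) by apply/cvg_ex; exists `|f x|; exact: cvg_norm (cf x).
    rewrite -(cvg_lim _ (cvg_norm (cf x)))//.
    by apply: limr_le => //; exact: nearW.
  apply: fine_cvg; rewrite fineK; last by apply: integrable_fin_num => //; exact: int_phi.
  apply: (@dominated_cvg _ _ _ mu setT measurableT _ _ (fun x => (M * normal_pdf 0 1 x)%:E)).
  + move=> n; apply/measurable_EFinP; apply: measurable_funM => //.
    by have [] := bf_ n.
  + move=> x _; apply: cvg_EFin; first exact: nearW.
    by apply: cvgM; [exact: cf|exact: cvg_cst].
  + by [].
  + apply: integrableZlE; exact: integrable_normal_pdf.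
  + move=> n x _; rewrite lee_fin normrM (ger0_norm (normal_pdf_ge0 _ _ _)).
    by rewrite ler_wpM2r ?normal_pdf_ge0.
Qed.

Lemma Ex_cos_omega j (s v : R) :
  Ex P (fun t => cos (s * omega j t + v)) = expR (- (s ^+ 2 / 2)) * cos v.
Proof.
rewrite (Ex_omega j (bdd_cosM v s)) normal_cos//.
by rewrite expr1n mul1r.
Qed.

Lemma bdd_expsq (c : R) : 0 <= c -> bdd (fun x : R => expR (- (c * x ^+ 2))).
Proof.
move=> c0; split.
  apply: measurable_cont; apply: (is_derive_continuous (df := fun x => 2 * - c * x * expR (- c * x ^+ 2))) => x.
  have -> : (fun x : R => expR (- (c * x ^+ 2))) = (fun x => expR (- c * x ^+ 2)).
    by apply/funext => y; rewrite mulNr.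
  exact: is_derive_expsq.
exists 1 => x; rewrite ger0_norm ?expR_ge0// -expR0 ler_expR oppr_le0.
by rewrite mulr_ge0 ?sqr_ge0.
Qed.

(* Tilting: up to the factor [s], the weight turns the standard normal law into the one of variance [s ^+ 2]. *)
Lemma Ex_weight_cos_omega j (s u v : R) : 0 < s <= 1 ->
  Ex P (fun t => expR (- ((s ^- 2 - 1) / 2 * omega j t ^+ 2)) * cos (u * omega j t + v)) =
  s * (expR (- (s ^+ 2 * u ^+ 2 / 2)) * cos v).
Proof.
move=> /andP[s0 s1].
pose f x := expR (- ((s ^- 2 - 1) / 2 * x ^+ 2)) * cos (u * x + v).
have bc := bdd_cosM v u.
transitivity (s * \int[mu]_x (cos (u * x + v) * normal_pdf 0 s x)); last first.
  by rewrite normal_cos.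
have E x : f x * normal_pdf 0 1 x = s * (cos (u * x + v) * normal_pdf 0 s x).
  rewrite /f !phiE//.
  have -> : normal_peak (1:R) = s * normal_peak s.
    rewrite /normal_peak expr1n mul1r -mulrnAr sqrtrM ?sqr_ge0//.
    by rewrite sqrtr_sqr gtr0_norm// invfM mulrA divff ?mul1r// gt_eqF.
  set e1 := expR _; set e2 := expR _; set e3 := expR _.
  have -> : e3 = e1 * e2.
    by rewrite /e1 /e2 /e3 -expRD; congr expR; field; rewrite gt_eqF.
  ring.
rewrite -RintegralZl//; last exact: int_phi.
have bf : bdd f; last first.
  rewrite -[LHS]/(Ex P (fun t => f (omega j t))) (Ex_omega j bf).
  by apply: eq_Rintegral => x _; exact: E.
by apply: bddM => //; apply: bdd_expsq; rewrite divr_ge0// subr_ge0 invf_ge1 ?exprn_gt0// expr_le1 ?(ltW s0).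
Qed.

Definition linear_form N a t := \sum_(j < N) a j * omega j t.
Local Notation lin := linear_form.
Definition dot N a b : R := \sum_(j < N) a j * b j.

Lemma measurable_lin N a : measurable_fun setT (lin N a).
Proof.
apply: measurable_sum => j.
by apply: measurable_funM => //; exact: measurable_funPT.
Qed.

Lemma bdd_cos_lin N a v : bdd (fun t => cos (lin N a t + v)).
Proof.
split; last by exists 1 => x; exact: cos_max.
have -> : (fun t => cos (lin N a t + v)) = (fun x => cos (1 * x + v)) \o lin N a.
  by apply/funext => t /=; rewrite mul1r.
apply: measurableT_comp; last exact: measurable_lin.
by have [] := bdd_cosM v 1.
Qed.

(** Coordinates enter the cosine one at a time, while the others stay in an arbitrary product; at
    each stage the expectation factors by independence. *)
Lemma Ex_cos_lin N a v :
  Ex P (fun t => cos (lin N a t + v)) = expR (- (dot N a a / 2)) * cos v.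
Proof.
suff H k : (k <= N)%N -> forall (g : nat -> R -> R) v, (forall j, bdd (g j)) ->
   Ex P (fun t => cos (lin k a t + v) * \prod_(j < N | (k <= j)%N) g j (omega j t)) =
   expR (- (dot k a a / 2)) * cos v * \prod_(j < N | (k <= j)%N) Ex P (fun t => g j (omega j t)).
  have := H N (leqnn N) (fun _ _ => 1) v (fun _ => bdd_cst _ 1).
  rewrite [X in _ = _ * X -> _]big1 ?mulr1 => [<-|j _]; last by rewrite Ex_cst.
  by apply: eq_Ex => t; rewrite big1 ?mulr1.
elim: k => [_ g w bg|k IH kN g w bg].
  under eq_Ex do rewrite /lin big_ord0 add0r.
  rewrite ExZ; last by apply: bdd_prod => j _; exact: (bdd_rv omega j (bg j)).
  by rewrite /dot big_ord0 mul0r oppr0 expR0 mul1r (Ex_prod iid.1).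
pose K := Ordinal kN.
pose g1 h j := if j == k then h else g j.
have pE h t : \prod_(j < N | (k <= j)%N) g1 h j (omega j t) =
     h (omega k t) * \prod_(j < N | (k < j)%N) g j (omega j t).
  rewrite (bigD1 K)//= /g1 eqxx; congr (_ * _); apply: eq_big => [j|j /andP[_ jK]].
    by rewrite -val_eqE/= ltn_neqAle eq_sym andbC.
  by rewrite -val_eqE/= in jK; rewrite (negbTE jK).
have pC h : \prod_(j < N | (k <= j)%N) Ex P (fun t => g1 h j (omega j t)) =
     Ex P (fun t => h (omega k t)) * \prod_(j < N | (k < j)%N) Ex P (fun t => g j (omega j t)).
  rewrite (bigD1 K)//= /g1 eqxx; congr (_ * _); apply: eq_big => [j|j /andP[_ jK]].
    by rewrite -val_eqE/= ltn_neqAle eq_sym andbC.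
  by rewrite -val_eqE/= in jK; rewrite (negbTE jK).
have bcos u : bdd (fun x : R => cos (a k * x + u)) by exact: bdd_cosM.
have bg1 h : bdd h -> forall j, bdd (g1 h j) by move=> bh j; rewrite /g1; case: ifP.
have step u w' : Ex P (fun t => cos (lin k a t + w') *
    (cos (a k * omega k t + u) * \prod_(j < N | (k < j)%N) g j (omega j t))) =
    expR (- (dot k a a / 2)) * cos w' * (expR (- (a k ^+ 2 / 2)) * cos u *
     \prod_(j < N | (k < j)%N) Ex P (fun t => g j (omega j t))).
  have := IH (ltnW kN) (g1 (fun x => cos (a k * x + u))) w' (bg1 _ (bcos u)).
  rewrite pC Ex_cos_omega => <-; apply: eq_Ex => t.
  by rewrite pE.
have bstep u w' : bdd (fun t => cos (lin k a t + w') *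
    (cos (a k * omega k t + u) * \prod_(j < N | (k < j)%N) g j (omega j t))).
  apply: bddM; first exact: bdd_cos_lin.
  apply: bddM; first exact: (bdd_rv omega k (bcos u)).
  by apply: bdd_prod => j _; exact: (bdd_rv omega j (bg j)).
(* Addition formula with every sine written as a cosine of phase [- pi / 2]. The second product has
   expectation zero, since it contains [cos (0 - pi / 2)]. *)
transitivity (Ex P (fun t => cos (lin k a t + w) *
    (cos (a k * omega k t + 0) * \prod_(j < N | (k < j)%N) g j (omega j t)) -
    cos (lin k a t + (w - pi / 2)) *
    (cos (a k * omega k t + (0 - pi / 2)) * \prod_(j < N | (k < j)%N) g j (omega j t)))).
  apply: eq_Ex => t; rewrite /lin big_ord_recr/= addrAC cosD !addrA.
  by rewrite !cosBpihalf !addr0; ring.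
rewrite ExB// !step cos0 sub0r cosN cos_pihalf mulr0 mul0r mulr0 subr0 mulr1 !mulrA.
congr (_ * _); rewrite mulrAC -expRD /dot big_ord_recr/=; congr (expR _ * _).
by field.
Qed.

End GaussianForms.

(** * Polynomials converging to the sign function *)

Section SignPolynomials.
Context {R : realType}.
Implicit Types (x y : R).

(** The Newton-Schulz iteration x (3 - x^2) / 2 for the sign: 1 and -1 attract the positive and the
    negative points of [-1, 1], and 0 is fixed. *)
Definition newton : {poly R} := 'X * (3%:P - 'X ^+ 2) * (2^-1)%:P.

Definition sgnp (n : nat) : {poly R} := iter n (fun p => newton \Po p) 'X.

Lemma newtonE x : newton.[x] = x * (3 - x ^+ 2) / 2.
Proof. by rewrite /newton !hornerE. Qed.

Lemma sgnpS n x : (sgnp n.+1).[x] = newton.[(sgnp n).[x]].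
Proof. by rewrite /sgnp iterS horner_comp. Qed.

Lemma sgnp0 n : (sgnp n).[0] = 0.
Proof.
elim: n => [|n IH]; first by rewrite /sgnp/= hornerX.
by rewrite sgnpS IH newtonE mul0r mul0r.
Qed.

Lemma sgnpN n x : (sgnp n).[- x] = - (sgnp n).[x].
Proof.
elim: n => [|n IH]; first by rewrite /sgnp/= !hornerX.
by rewrite !sgnpS IH !newtonE sqrrN !mulNr.
Qed.

(** One step multiplies the distance 1 - z by (1 - z)(2 + z)/2, which is at most 1 - x/2 for z in
    [x, 1]. The bound from below keeps the iterates in this range. *)
Lemma sgnp_bounds n x : 0 < x <= 1 ->
  x <= (sgnp n).[x] <= 1 /\ 1 - (sgnp n).[x] <= (1 - x / 2) ^+ n.
Proof.
move=> /andP[x0 x1]; elim: n => [|n [/andP[IH1 IH2] IH3]].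
  by rewrite /sgnp/= hornerX lexx x1 expr0; split=> //; lra.
rewrite sgnpS newtonE; set z := (sgnp n).[x] in IH1 IH2 IH3 *.
have z0 : 0 <= z by rewrite (le_trans _ IH1)// ltW.
have z1 : 0 <= 1 - z by rewrite subr_ge0.
have A : 0 <= z * ((1 - z) * (1 + z)) by rewrite !mulr_ge0// addr_ge0.
have B : 0 <= (1 - z) * ((1 - z) * (2 + z)) by rewrite !mulr_ge0// addr_ge0.
split; first by apply/andP; split; lra.
rewrite [in leRHS]exprS.
have h : 1 - z * (3 - z ^+ 2) / 2 = (1 - z) * ((1 - z) * (2 + z) / 2) by field.
rewrite h mulrC; apply: ler_pM => //; last by nra.
by rewrite divr_ge0// mulr_ge0// addr_ge0.
Qed.

Lemma sgnp_norm n x : `|x| <= 1 -> `|(sgnp n).[x]| <= 1.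
Proof.
move=> x1; have [x0|x0|<-] := ltgtP 0 x.
- have [|/andP[h1 h2] _] := @sgnp_bounds n x; first by rewrite x0 (le_trans (ler_norm _)).
  by rewrite ger0_norm// (le_trans _ h1)// ltW.
- have [|/andP[h1 h2] _] := @sgnp_bounds n (- x).
    by rewrite oppr_gt0 x0 (le_trans _ x1)// -normrN ler_norm.
  by rewrite -normrN -sgnpN ger0_norm// (le_trans _ h1)// oppr_ge0 ltW.
- by rewrite sgnp0 normr0.
Qed.

Lemma sgnp_cvg x : `|x| <= 1 -> (sgnp n).[x] @[n --> \oo] --> Num.sg x.
Proof.
have pos y : 0 < y <= 1 -> (sgnp n).[y] @[n --> \oo] --> (1 : R).
  move=> y01; apply/cvgrPdist_le => /= e e0.
  have q1 : `|1 - y / 2| < 1 by move: y01 => /andP[? ?]; rewrite ger0_norm; lra.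
  have := cvg_expr q1 => /cvgrPdist_le /(_ e e0); apply: filterS => n /=.
  rewrite sub0r normrN; have [/andP[_ h2] h3] := sgnp_bounds n y01.
  move=> h; rewrite ger0_norm ?subr_ge0// (le_trans h3)//.
  exact: le_trans (ler_norm _) h.
move=> x1; have [x0|x0|<-] := ltgtP 0 x.
- by rewrite gtr0_sg//; apply: pos; rewrite x0 (le_trans (ler_norm _)).
- rewrite ltr0_sg//.
  have -> : (fun n => (sgnp n).[x]) = (fun n => - (sgnp n).[- x]).
    by apply/funext => n; rewrite sgnpN opprK.
  apply: cvgN; apply: pos; rewrite oppr_gt0 x0 (le_trans _ x1)//.
  by rewrite -normrN ler_norm.
- rewrite sgr0; under eq_fun do rewrite sgnp0; exact: cvg_cst.
Qed.

(** The indicator of the positive numbers is (sg^2 + sg)/2, which is correct at 0 as well. *)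
Definition bitp n : {poly R} := (sgnp n ^+ 2 + sgnp n) * (2^-1)%:P.

Definition bit y : R := (0 < y)%R%:R.

Lemma bitE x : bit x = (Num.sg x ^+ 2 + Num.sg x) / 2.
Proof.
rewrite /bit; have [x0|x0|<-] := ltgtP 0 x.
- by rewrite /= gtr0_sg// expr1n mulr1n; field.
- by rewrite /= ltr0_sg// sqrrN expr1n mulr0n; field.
- by rewrite /= sgr0 mulr0n; field.
Qed.

Lemma bitp_norm n x : `|x| <= 1 -> `|(bitp n).[x]| <= 1.
Proof.
move=> x1; rewrite /bitp !hornerE; have := sgnp_norm n x1.
rewrite !ler_norml => /andP[h1 h2]; apply/andP; split; nra.
Qed.

Lemma bitp_cvg x : `|x| <= 1 -> (bitp n).[x] @[n --> \oo] --> bit x.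
Proof.
move=> x1; rewrite bitE /bitp.
under eq_fun do rewrite !hornerE.
have c := sgnp_cvg x1.
by apply: cvgM; [apply: cvgD => //; exact: (cvgM c c)|exact: cvg_cst].
Qed.

(** Once [|x| / n < 2] the sine of [x / n] has the sign of [x]. Passing to a sine brings the
    argument into [-1, 1], where the sign polynomials converge, and keeps everything in the span of
    cosines. *)
Lemma bit_sin_cvg x : bit (sin (n.+1%:R^-1 * x)) @[n --> \oo] --> bit x.
Proof.
have near_small : \forall n \near \oo, `|n.+1%:R^-1 * x| < 2.
  near=> n; rewrite normrM ger0_norm ?invr_ge0 ?ler0n// mulrC ltr_pdivrMr ?ltr0n//.
  rewrite (@le_lt_trans _ _ n%:R)//; last by rewrite -natrM ltr_nat; lia.
  by near: n; exact: nbhs_infty_ger.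
apply: cvg_near_cst; apply: filterS near_small => n h.
have i0 : 0 < n.+1%:R^-1 :> R by rewrite invr_gt0 ltr0n.
rewrite /bit; have [x0|x0|<-] := ltgtP 0 x.
- have y0 : 0 < n.+1%:R^-1 * x by rewrite mulr_gt0.
  by rewrite sin2_gt0// y0/= (le_lt_trans (ler_norm _)).
- have y0 : 0 < n.+1%:R^-1 * - x by rewrite mulr_gt0// oppr_gt0.
  have : 0 < sin (n.+1%:R^-1 * - x).
    by rewrite sin2_gt0// y0/= (le_lt_trans (ler_norm _))// mulrN normrN.
  by rewrite mulrN sinN oppr_gt0 => /lt_gtF ->.
- by rewrite mulr0 sin0 ltxx.
Unshelve. all: by end_near. Qed.

End SignPolynomials.

(** * Elementary inequalities for sine, cosine and exponential *)

Section TrigBounds.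
Context {R : realType}.
Implicit Types (x y : R).

Lemma derive_ge0_itv (f df : R -> R) (B : R) : (forall x, is_derive x 1 f (df x)) -> 0 <= f 0 ->
  (forall x, 0 <= x <= B -> 0 <= df x) -> forall x, 0 <= x <= B -> 0 <= f x.
Proof.
move=> fd f0 df0 x /andP[x0 xB].
have cf : continuous f.
  by move=> y; apply: differentiable_continuous; apply/derivable1_diffP; case: (fd y).
have [y] := @MVT_segment R f df 0 x x0 (fun y _ => fd y) (continuous_subspaceT cf).
rewrite in_itv/= subr0 => /andP[y0 yx] e.
by rewrite -(subrK (f 0) (f x)) e addr_ge0// mulr_ge0// df0// y0 (le_trans yx).
Qed.

Lemma derive_ge0 (f df : R -> R) : (forall x, is_derive x 1 f (df x)) -> 0 <= f 0 ->
  (forall x, 0 <= x -> 0 <= df x) -> forall x, 0 <= x -> 0 <= f x.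
Proof.
move=> fd f0 df0 x x0; apply: (@derive_ge0_itv f df x) => //; last by rewrite x0 lexx.
by move=> y /andP[y0 _]; exact: df0.
Qed.

Lemma sin_le_id x : 0 <= x -> sin x <= x.
Proof.
move=> x0; rewrite -subr_ge0; move: x x0; apply: (@derive_ge0 (fun x => x - sin x) (fun x => 1 - cos x)).
- by rewrite sin0 subr0.
- by move=> y _; rewrite subr_ge0 cos_le1.
Qed.

Lemma cos_ge2 x : 0 <= x -> 1 - x ^+ 2 / 2 <= cos x.
Proof.
move=> x0; rewrite -subr_ge0; move: x x0; apply: (@derive_ge0 (fun x => cos x - (1 - x ^+ 2 / 2)) (fun x => x - sin x)).
- move=> y; have h := is_derive_cos y.
  have -> : (fun x : R => cos x - (1 - x ^+ 2 / 2)) =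
     @cos R - (cst 1 - 2^-1 \*: ((id : R -> R) ^+ 2)).
    by apply/funext => z; rewrite /GRing.scale/= mulrC.
  by apply: trigger_derive; rewrite /GRing.scale/=; field.
- by rewrite cos0 expr0n/= mul0r !subr0.
- by move=> y y0; rewrite subr_ge0 sin_le_id.
Qed.

Lemma sin_ge3 x : 0 <= x -> x - x ^+ 3 / 6 <= sin x.
Proof.
move=> x0; rewrite -subr_ge0; move: x x0; apply: (@derive_ge0 (fun x => sin x - (x - x ^+ 3 / 6))
  (fun x => cos x - (1 - x ^+ 2 / 2))).
- move=> y; have h := is_derive_sin y.
  have -> : (fun x : R => sin x - (x - x ^+ 3 / 6)) =
     @sin R - (id - 6^-1 \*: ((id : R -> R) ^+ 3)).
    by apply/funext => z; rewrite /GRing.scale/= mulrC.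
  by apply: trigger_derive; rewrite /GRing.scale/=; field.
- by rewrite sin0 expr0n/= mul0r !subr0.
- by move=> y y0; rewrite subr_ge0 cos_ge2.
Qed.

Lemma cos_le4 x : 0 <= x -> cos x <= 1 - x ^+ 2 / 2 + x ^+ 4 / 24.
Proof.
move=> x0; rewrite -subr_ge0; move: x x0; apply: (@derive_ge0 (fun x => 1 - x ^+ 2 / 2 + x ^+ 4 / 24 - cos x)
  (fun x => sin x - (x - x ^+ 3 / 6))).
- move=> y; have h := is_derive_cos y.
  have -> : (fun x : R => 1 - x ^+ 2 / 2 + x ^+ 4 / 24 - cos x) =
     cst 1 - 2^-1 \*: ((id : R -> R) ^+ 2) + 24^-1 \*: ((id : R -> R) ^+ 4) - @cos R.
    by apply/funext => z; rewrite -[RHS]/(1 - 2^-1 * z ^+ 2 + 24^-1 * z ^+ 4 - cos z); field.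
  by apply: trigger_derive; rewrite /GRing.scale/=; field.
- by rewrite cos0 !expr0n/= !mul0r subr0 addr0 subrr.
- by move=> y y0; rewrite subr_ge0 sin_ge3.
Qed.

Lemma mulcos_le_sin x : 0 <= x <= pi -> x * cos x <= sin x.
Proof.
move=> x0; rewrite -subr_ge0; move: x x0.
apply: (@derive_ge0_itv (fun x => sin x - x * cos x) (fun x => x * sin x)).
- move=> y; have h := is_derive_sin y; have h' := is_derive_cos y.
  have -> : (fun x : R => sin x - x * cos x) = @sin R - id * @cos R by [].
  by apply: trigger_derive; rewrite /GRing.scale/=; ring.
- by rewrite sin0 mul0r subr0.
- by move=> y /andP[y0 y1]; rewrite mulr_ge0// sin_ge0_pi// y0.
Qed.

(** The derivative of 1 - cos x exp(x^2/2) is (sin x - x cos x) exp(x^2/2), nonnegative here. This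
    is the source of the Gaussian decay of the covariance cos^n. *)
Lemma cos_le_exp x : 0 <= x <= pi / 2 -> cos x <= expR (- (x ^+ 2 / 2)).
Proof.
move=> x0; have p0 := pi_gt0 R.
suff h : 0 <= 1 - cos x * expR (2^-1 * x ^+ 2).
  rewrite expRN -[leRHS]mul1r ler_pdivlMr ?expR_gt0//.
  by rewrite mulrC (mulrC _ 2^-1) mulrC -subr_ge0.
move: x x0; apply: (@derive_ge0_itv (fun x => 1 - cos x * expR (2^-1 * x ^+ 2))
  (fun x => (sin x - x * cos x) * expR (2^-1 * x ^+ 2))).
- move=> y; have h := is_derive_cos y; have h' := is_derive_expsq 2^-1 y.
  have -> : (fun x : R => 1 - cos x * expR (2^-1 * x ^+ 2)) =
     cst 1 - @cos R * (fun x => expR (2^-1 * x ^+ 2)) by [].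
  by apply: trigger_derive; rewrite /GRing.scale/=; field.
- by rewrite cos0 expr0n/= mulr0 expR0 mulr1 subrr.
- move=> y /andP[y0 y1]; rewrite mulr_ge0 ?expR_ge0// subr_ge0.
  by apply: mulcos_le_sin; rewrite y0/=; lra.
Qed.

Lemma expN_le x : 0 <= x -> expR (- x) <= 1 - x + x ^+ 2 / 2.
Proof.
move=> x0; rewrite -subr_ge0; move: x x0.
apply: (@derive_ge0 (fun x => 1 - x + x ^+ 2 / 2 - expR (- x)) (fun x => expR (- x) - (1 - x))).
- move=> y.
  have hN : is_derive y 1 (fun z : R => - z) (-1).
    by have -> : (fun z : R => - z) = - (id : R -> R) by []; apply: trigger_derive.
  have h := @is_derive1_comp R expR (fun z => - z) y _ _ (is_derive_expR _) hN.
  have h' : is_derive y 1 (fun z : R => expR (- z)) (expR (- y) * -1) by exact: h.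
  have -> : (fun x : R => 1 - x + x ^+ 2 / 2 - expR (- x)) =
     cst 1 - id + 2^-1 \*: ((id : R -> R) ^+ 2) - (fun z => expR (- z)).
    by apply/funext => z; rewrite -[RHS]/(1 - z + 2^-1 * z ^+ 2 - expR (- z)); field.
  by apply: trigger_derive; rewrite /GRing.scale/=; field.
- by rewrite oppr0 expR0 expr0n/= mul0r !addr0 subrr.
- by move=> y y0; rewrite subr_ge0 expR_ge1Dx.
Qed.

Lemma sin_sub_id x : `|sin x - x| <= `|x| ^+ 3 / 6.
Proof.
wlog x0 : x / 0 <= x => [H|].
  have [/H//|/ltW x0] := leP 0 x.
  have := H (- x); rewrite oppr_ge0 sinN => /(_ x0).
  by rewrite -opprD normrN normrN.
rewrite (ger0_norm x0) ler_norml; have := sin_le_id x0; have := sin_ge3 x0.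
by have := exprn_ge0 3 x0; lra.
Qed.

(** Lets Gaussian weights in [y] be approximated by bounded functions of a sine. *)
Lemma mul_sin_cvg y : n.+1%:R * sin (n.+1%:R^-1 * y) @[n --> \oo] --> y.
Proof.
apply/cvgrPdist_le => /= e e0.
have c0 : `|y| ^+ 3 * harmonic n @[n --> \oo] --> (0 : R).
  by rewrite -[X in _ --> X](mulr0 (`|y| ^+ 3)); apply: cvgM; [exact: cvg_cst|exact: cvg_harmonic].
have := c0 => /cvgrPdist_le /(_ e e0); apply: filterS => n; rewrite sub0r normrN => h.
have n0 : (0 : R) < n.+1%:R by rewrite ltr0n.
rewrite (le_trans _ h)// [leRHS]ger0_norm ?mulr_ge0 ?exprn_ge0 ?harmonic_ge0//.
have -> : y - n.+1%:R * sin (n.+1%:R^-1 * y) = - (n.+1%:R * (sin (n.+1%:R^-1 * y) - n.+1%:R^-1 * y)).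
  by field; rewrite gt_eqF.
rewrite normrN normrM (gtr0_norm n0).
rewrite (le_trans (ler_wpM2l (ltW n0) (sin_sub_id _)))//.
rewrite normrM gtr0_norm ?invr_gt0// exprMn /harmonic/=.
set a := `|y| ^+ 3; have a0 : 0 <= a by rewrite exprn_ge0.
rewrite [leLHS](_ : _ = (a / n.+1%:R) * (n.+1%:R^-1 / 6)); last by field; rewrite gt_eqF.
rewrite ler_piMr ?divr_ge0 ?ler0n//.
by rewrite -invfM invf_le1 ?mulr_gt0// -natrM ler1n.
Qed.

Lemma series_exp_norm x m : `|series (exp_coeff x) m| <= expR `|x|.
Proof.
have H y : 0 <= y -> series (exp_coeff y) m <= expR y.
  move=> y0; apply: nondecreasing_cvgn_le; last exact: is_cvg_series_exp_coeff.
  by apply: nondecreasing_series => k _ _; rewrite /exp_coeff/= divr_ge0 ?exprn_ge0.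
rewrite (le_trans _ (H _ (normr_ge0 x)))// /series/= (le_trans (ler_norm_sum _ _ _))//.
by apply: ler_sum => i _; rewrite /exp_coeff/= normrM normrX [X in _ * X <= _]ger0_norm ?invr_ge0.
Qed.

Definition expp (c : R) (m : nat) : {poly R} :=
  \sum_(i < m) ((- c) ^+ i / i`!%:R) *: 'X^(2 * i).

Lemma exppE c m x : (expp c m).[x] = series (exp_coeff (- c * x ^+ 2)) m.
Proof.
rewrite /expp /series/= horner_sum big_mkord; apply: eq_bigr => i _.
by rewrite hornerZ hornerXn /exp_coeff/= exprMn -exprM mulrAC.
Qed.

End TrigBounds.

(** * Laws of sign vectors depend only on the Gram matrix *)

Section Transfer.
Context d (T : measurableType d) (R : realType) (P : probability T R).
Implicit Types (g : T -> R).

Lemma bit_norm (y : R) : `|bit y| <= 1.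
Proof. by rewrite /bit; case: (0 < y); rewrite ?normr1 ?normr0. Qed.

Lemma measurable_bit : measurable_fun setT (@bit R).
Proof.
have -> : @bit R = (\1_(`]0, +oo[%classic : set R) : R -> R).
  apply/funext => y; rewrite indicE /bit; congr (_%:R); congr nat_of_bool.
  by apply/idP/idP => [y0|]; [apply/mem_set|move/set_mem]; rewrite /= in_itv/= andbT.
exact: measurable_indic.
Qed.

Lemma bdd_bit (Y : T -> R) : measurable_fun setT Y -> bdd (fun t => bit (Y t)).
Proof.
move=> mY; split; last by exists 1 => t; exact: bit_norm.
exact: (measurableT_comp measurable_bit mY).
Qed.

Lemma bdd_cosY (Y : T -> R) : measurable_fun setT Y -> bdd (fun t => cos (Y t)).
Proof.
move=> mY; split; last by exists 1 => t; exact: cos_max.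
by apply: (measurableT_comp _ mY); exact: (measurable_cont (@continuous_cos R)).
Qed.

(** Equality, up to the factor [c], of joint characteristic functions under the weights [g] and
    [g']. Arbitrary weights make the relation stable under multiplication by functions of one
    coordinate, so signs can be inserted one after another. *)
Definition same_cf (I : finType) (Y Y' : I -> T -> R) (c : R) g g' :=
  forall (l : I -> R) (v : R),
    Ex P (fun t => g t * cos (\sum_i l i * Y i t + v)) =
    c * Ex P (fun t => g' t * cos (\sum_i l i * Y' i t + v)).

Section OneStep.
Variables (I : finType) (Y Y' : I -> T -> R) (c : R) (g g' : T -> R).
Hypothesis mY : forall i, measurable_fun setT (Y i).
Hypothesis mY' : forall i, measurable_fun setT (Y' i).
Hypothesis bg : bdd g.
Hypothesis bg' : bdd g'.
Hypothesis gg' : same_cf Y Y' c g g'.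
Variable i : I.

Lemma bdd_cos_sum (Z : I -> T -> R) (l : I -> R) v :
  (forall i, measurable_fun setT (Z i)) -> bdd (fun t => cos (\sum_i l i * Z i t + v)).
Proof.
move=> mZ; apply: bdd_cosY; apply: measurable_funD => //.
by apply: measurable_sum => j; apply: measurable_funM.
Qed.

(** The functions of coordinate [i] that may be absorbed into the weights. The class is closed under
    linear combinations, multiplication by sines and bounded pointwise limits. *)
Let H (f : R -> R) := bdd f /\
  same_cf Y Y' c (fun t => g t * f (Y i t)) (fun t => g' t * f (Y' i t)).

Lemma bdd_compY (f : R -> R) (Z : T -> R) : bdd f -> measurable_fun setT Z ->
  bdd (fun t => f (Z t)).
Proof.
move=> [mf [M fM]] mZ; split; last by exists M => t; exact: fM.
exact: (measurableT_comp mf mZ).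
Qed.

Let H_lin f1 f2 k : H f1 -> H f2 -> H (fun y => k * f1 y + f2 y).
Proof.
move=> [b1 h1] [b2 h2]; split; first by apply: bddD => //; exact: bddZ.
move=> l v.
have E (Z : I -> T -> R) (mZ : forall i, measurable_fun setT (Z i)) (w : T -> R) (bw : bdd w) :
   Ex P (fun t => w t * (k * f1 (Z i t) + f2 (Z i t)) * cos (\sum_i l i * Z i t + v)) =
   k * Ex P (fun t => w t * f1 (Z i t) * cos (\sum_i l i * Z i t + v)) +
   Ex P (fun t => w t * f2 (Z i t) * cos (\sum_i l i * Z i t + v)).
  have bc := bdd_cos_sum l v mZ.
  have B1 := bdd_compY b1 (mZ i); have B2 := bdd_compY b2 (mZ i).
  have C1 := bddM (bddM bw B1) bc; have C2 := bddM (bddM bw B2) bc.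
  rewrite -ExZ// -ExD//; last exact: bddZ.
  by apply: eq_Ex => t; ring.
by rewrite !E// h1 h2; ring.
Qed.

Let H_sin f (k : R) : H f -> H (fun y => sin (k * y) * f y).
Proof.
move=> [bf hf]; have bs : bdd (fun y : R => sin (k * y)).
  have := bdd_sinM 0 k; apply: eq_bdd => y; by rewrite addr0.
split; first exact: bddM.
move=> l v.
(* Product to sum: multiplying by [sin (k * Z i t)] shifts the coefficient of coordinate [i] by [k]
   either way and the phase by [pi / 2]. *)
have E (Z : I -> T -> R) (mZ : forall i, measurable_fun setT (Z i)) (w : T -> R) (bw : bdd w) :
   Ex P (fun t => w t * (sin (k * Z i t) * f (Z i t)) * cos (\sum_i l i * Z i t + v)) =
   2^-1 * (Ex P (fun t => w t * f (Z i t) *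
             cos (\sum_j (l j - k * (j == i)%:R) * Z j t + (v + pi / 2))) -
           Ex P (fun t => w t * f (Z i t) *
             cos (\sum_j (l j + k * (j == i)%:R) * Z j t + (v + pi / 2)))).
  have B1 := bdd_compY bf (mZ i).
  have C (m : I -> R) u := bddM (bddM bw B1) (bdd_cos_sum m u mZ).
  rewrite -ExB// -ExZ; last exact: bddB.
  apply: eq_Ex => t.
  have S (s : R) : \sum_j (l j + s * (k * (j == i)%:R)) * Z j t =
      \sum_j l j * Z j t + s * (k * Z i t).
    under eq_bigr do rewrite mulrDl.
    rewrite big_split/=; congr (_ + _); rewrite (bigD1 i)//= eqxx mulr1 big1 ?addr0 ?mulrA//.
    by move=> j /negbTE ->; rewrite mulr0 mulr0 mul0r.
  have := S 1; under eq_bigr do rewrite mul1r; move=> ->.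
  have := S (-1); under eq_bigr do rewrite mulN1r; move=> ->.
  rewrite !addrA !cosDpihalf mul1r mulN1r.
  set A := \sum_j _; set B := k * _.
  have -> : A - B + v = (A + v) - B by ring.
  have -> : A + B + v = (A + v) + B by ring.
  by move: (A + v) (B) => D {}B; rewrite sinB sinD; field.
by rewrite !E// !hf; ring.
Qed.

Let H_lim (f_ : nat -> R -> R) f (M : R) : (forall n, H (f_ n)) ->
  (forall n x, `|f_ n x| <= M) -> (forall x, f_ ^~ x @ \oo --> f x) -> H f.
Proof.
move=> hf fM cf.
have bf : bdd f.
  split.
    by apply: (measurable_fun_cvg (fun n => bdd_meas (hf n).1)) => x _; exact: cf.
  exists M => x.
  have cx : cvgn (fun n => `|f_ n x|) by apply/cvg_ex; exists `|f x|; exact: cvg_norm (cf x).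
  rewrite -(cvg_lim _ (cvg_norm (cf x)))//.
  by apply: limr_le => //; exact: nearW.
split=> // l v.
have L (Z : I -> T -> R) (mZ : forall i, measurable_fun setT (Z i)) (w : T -> R) (bw : bdd w) :
   Ex P (fun t => w t * f_ n (Z i t) * cos (\sum_i l i * Z i t + v)) @[n --> \oo] -->
   Ex P (fun t => w t * f (Z i t) * cos (\sum_i l i * Z i t + v)).
  have [mw [K wK]] := bw.
  have bc := bdd_cos_sum l v mZ.
  have b_ n := bddM (bddM bw (bdd_compY (hf n).1 (mZ i))) bc.
  apply: (@Ex_cvg _ _ _ P _ _ (K * M) b_ _ _).2.
  - move=> n t; rewrite !normrM -[leRHS]mulr1 ler_pM ?mulr_ge0 ?cos_max//.
    by rewrite ler_pM.
  - by move=> t; apply: cvgM; [apply: cvgM; [exact: cvg_cst|exact: cf]|exact: cvg_cst].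
apply: (cvg_unique _ (L Y mY g bg)) => //.
rewrite /mkset (funext (fun n => (hf n).2 l v)).
by apply: cvgM; [exact: cvg_cst|exact: L].
Qed.

Let H_cst k : H (fun=> k).
Proof.
split; first exact: bdd_cst.
move=> l v.
have E (Z : I -> T -> R) (mZ : forall i, measurable_fun setT (Z i)) (w : T -> R) (bw : bdd w) :
   Ex P (fun t => w t * k * cos (\sum_i l i * Z i t + v)) =
   k * Ex P (fun t => w t * cos (\sum_i l i * Z i t + v)).
  rewrite -ExZ; last by apply: bddM => //; exact: bdd_cos_sum.
  by apply: eq_Ex => t; ring.
by rewrite !E// gg'; ring.
Qed.

Lemma H_poly (q : {poly R}) (k : R) : H (fun y => q.[sin (k * y)]).
Proof.
elim/poly_ind: q => [|q a IH].
  rewrite (_ : (fun y => _) = (fun=> 0)); first exact: H_cst.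
  by apply/funext => y; rewrite horner0.
rewrite (_ : (fun y => _) = (fun y => 1 * (sin (k * y) * q.[sin (k * y)]) + a)).
  by apply: H_lin; [exact: H_sin|exact: H_cst].
by apply/funext => y; rewrite !hornerE mulrC.
Qed.

(** Two limits: first in the degree of the polynomial, giving the sign of [sin (y / n)], then in
    [n]. *)
Lemma same_cf_bit : same_cf Y Y' c (fun t => g t * bit (Y i t)) (fun t => g' t * bit (Y' i t)).
Proof.
suff [] : H (@bit R) by [].
apply: (@H_lim (fun n y => bit (sin (n.+1%:R^-1 * y))) _ 1).
- move=> n; apply: (@H_lim (fun m y => (bitp m).[sin (n.+1%:R^-1 * y)]) _ 1).
  + by move=> m; exact: H_poly.
  + by move=> m x; apply: bitp_norm; exact: sin_max.
  + by move=> x; apply: bitp_cvg; exact: sin_max.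
- by move=> n x; exact: bit_norm.
- by move=> x; exact: bit_sin_cvg.
Qed.

(** The same two limits, with Taylor polynomials of the exponential evaluated at [K * sin (y / K)]
    in place of [y]. *)
Lemma same_cf_weight (e : R) : 0 <= e ->
  same_cf Y Y' c (fun t => g t * expR (- (e * Y i t ^+ 2))) (fun t => g' t * expR (- (e * Y' i t ^+ 2))).
Proof.
move=> e0.
suff [] : H (fun y => expR (- (e * y ^+ 2))) by [].
apply: (@H_lim (fun n y => expR (- (e * (n.+1%:R * sin (n.+1%:R^-1 * y)) ^+ 2))) _ 1).
- move=> n; set K : R := n.+1%:R.
  apply: (@H_lim (fun m y => (expp (e * K ^+ 2) m).[sin (K^-1 * y)]) _ (expR (e * K ^+ 2))).
  + by move=> m; exact: H_poly.
  + move=> m x; rewrite exppE (le_trans (series_exp_norm _ _))// ler_expR.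
    have s1 : sin (K^-1 * x) ^+ 2 <= 1.
      by rewrite sin2cos2; have := sqr_ge0 (cos (K^-1 * x)); lra.
    have eK : 0 <= e * K ^+ 2 by rewrite mulr_ge0 ?sqr_ge0.
    by rewrite mulNr normrN ger0_norm ?ler_piMr// mulr_ge0 ?sqr_ge0.
  + move=> x; under eq_fun do rewrite exppE.
    have -> : - (e * (K * sin (K^-1 * x)) ^+ 2) = - (e * K ^+ 2) * sin (K^-1 * x) ^+ 2 by ring.
    exact: is_cvg_series_exp_coeff.
- by move=> n x; rewrite ger0_norm ?expR_ge0// -expR0 ler_expR oppr_le0 mulr_ge0 ?sqr_ge0.
- move=> x; apply: (cvg_comp (fun n : nat => - (e * (n.+1%:R * sin (n.+1%:R^-1 * x)) ^+ 2)) expR);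
    last exact: continuous_expR.
  apply: cvgN; apply: cvgM; first exact: cvg_cst.
  by have h := @mul_sin_cvg R x; exact: (cvgM h h).
Qed.

End OneStep.

Lemma same_cf_bits (I : finType) (Y Y' : I -> T -> R) (c : R) g g' (s : seq I) (tau : I -> bool) :
  (forall i, measurable_fun setT (Y i)) -> (forall i, measurable_fun setT (Y' i)) ->
  bdd g -> bdd g' -> same_cf Y Y' c g g' ->
  same_cf Y Y' c (fun t => g t * \prod_(i <- s) ((0 < Y i t) == tau i)%:R)
                 (fun t => g' t * \prod_(i <- s) ((0 < Y' i t) == tau i)%:R).
Proof.
move=> mY mY' bg bg' h.
have bb b (Z : T -> R) : measurable_fun setT Z -> bdd (fun t => ((0 < Z t)%R == b)%:R : R).
  move=> mZ; case: b.
    by apply: (eq_bdd _ (bdd_bit mZ)) => t; rewrite eqb_id.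
  apply: (eq_bdd _ (bddB (bdd_cst _ 1) (bdd_bit mZ))) => t.
  by rewrite /bit; case: (0 < Z t); rewrite /= ?subrr ?subr0.
have bp (Z : I -> T -> R) (mZ : forall i, measurable_fun setT (Z i)) r :
    bdd (fun t => \prod_(i <- r) ((0 < Z i t)%R == tau i)%:R : R).
  by apply: bdd_prod => i _; exact: bb.
elim: s => [|i s IH].
  move=> l v; have := h l v.
  by under eq_Ex do [rewrite -[g _]mulr1]; under [in X in _ -> X]eq_Ex do rewrite big_nil;
   move=> ->; congr (_ * _); apply: eq_Ex => t; rewrite big_nil mulr1.
pose G t := g t * \prod_(i <- s) ((0 < Y i t)%R == tau i)%:R.
pose G' t := g' t * \prod_(i <- s) ((0 < Y' i t)%R == tau i)%:R.
have bG : bdd G by apply: bddM => //; exact: bp.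
have bG' : bdd G' by apply: bddM => //; exact: bp.
have hb := same_cf_bit mY mY' bG bG' IH i.
case ti : (tau i); move=> l v.
- have := hb l v; rewrite /G /G' => e.
  transitivity (Ex P (fun t => G t * bit (Y i t) * cos (\sum_j l j * Y j t + v))).
    by apply: eq_Ex => t; rewrite big_cons ti eqb_id /G /bit; ring.
  rewrite e; congr (_ * _).
  by apply: eq_Ex => t; rewrite big_cons ti eqb_id /bit; ring.
- have cE b (x : bool) : (x == b)%:R = (if b then x%:R else 1 - x%:R) :> R.
    by case: b x => [] []; rewrite /= ?subrr ?subr0.
  have E (Z : I -> T -> R) (mZ : forall i, measurable_fun setT (Z i)) (w : T -> R) (bw : bdd w) :
     Ex P (fun t => w t * \prod_(i <- i :: s) ((0 < Z i t)%R == tau i)%:R *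
                    cos (\sum_j l j * Z j t + v)) =
     Ex P (fun t => w t * \prod_(i <- s) ((0 < Z i t)%R == tau i)%:R *
                    cos (\sum_j l j * Z j t + v)) -
     Ex P (fun t => w t * \prod_(i <- s) ((0 < Z i t)%R == tau i)%:R * bit (Z i t) *
                    cos (\sum_j l j * Z j t + v)).
    have bc := bdd_cos_sum l v mZ.
    have b1 := bddM bw (bp Z mZ s); have b2 := bddM (bddM b1 (bdd_bit (mZ i))) bc.
    rewrite -ExB//; last exact: bddM.
    by apply: eq_Ex => t; rewrite big_cons ti cE /bit; ring.
  rewrite !E// mulrBr; congr (_ - _); first exact: IH.
  exact: hb.
Qed.

(** Expand [F] over the finitely many sign patterns. The indicator of a pattern is a product treated
    by [same_cf_bits], read at zero frequency and zero phase, where the cosine is 1. *)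
Lemma transfer (I : finType) (Y Y' : I -> T -> R) (c : R) g g' (F : {ffun I -> bool} -> R) :
  (forall i, measurable_fun setT (Y i)) -> (forall i, measurable_fun setT (Y' i)) ->
  bdd g -> bdd g' -> same_cf Y Y' c g g' ->
  Ex P (fun t => g t * F [ffun i => (0 < Y i t)%R]) =
  c * Ex P (fun t => g' t * F [ffun i => (0 < Y' i t)%R]).
Proof.
move=> mY mY' bg bg' h.
have bb b (Z : T -> R) : measurable_fun setT Z -> bdd (fun t => ((0 < Z t)%R == b)%:R : R).
  move=> mZ; case: b.
    by apply: (eq_bdd _ (bdd_bit mZ)) => t; rewrite eqb_id.
  apply: (eq_bdd _ (bddB (bdd_cst _ 1) (bdd_bit mZ))) => t.
  by rewrite /bit; case: (0 < Z t); rewrite /= ?subrr ?subr0.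
have E (Z : I -> T -> R) (mZ : forall i, measurable_fun setT (Z i)) (w : T -> R) (bw : bdd w) :
   Ex P (fun t => w t * F [ffun i => (0 < Z i t)%R]) =
   \sum_(tau : {ffun I -> bool}) F tau *
     Ex P (fun t => w t * \prod_(i <- enum I) ((0 < Z i t)%R == tau i)%:R *
        cos (\sum_j 0 * Z j t + 0)).
  have b1 tau : bdd (fun t => w t * \prod_(i <- enum I) ((0 < Z i t)%R == tau i)%:R *
        cos (\sum_j 0 * Z j t + 0)).
    apply: bddM; last exact: (bdd_cos_sum (fun=> 0) 0 mZ).
    by apply: bddM => //; apply: bdd_prod => i _; exact: bb.
  under [RHS]eq_bigr do rewrite -ExZ//.
  rewrite -Ex_sum; last by move=> tau _; exact: bddZ.
  apply: eq_Ex => t.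
  have -> : cos (\sum_j 0 * Z j t + 0) = 1.
    by rewrite addr0 big1 ?cos0// => j _; rewrite mul0r.
  set t0 := [ffun i => _].
  rewrite (bigD1 t0)//= [X in _ + X]big1 ?addr0.
    by rewrite big1 ?mulr1 1?mulrC// => i _; rewrite ffunE eqxx.
  move=> tau ntau.
  have /existsP[i ti] : [exists i, tau i != t0 i].
    rewrite -negb_forall; apply: contra ntau => /forallP h'.
    by apply/eqP/ffunP => i; apply/eqP; exact: h'.
  rewrite (bigD1_seq i) ?mem_enum ?enum_uniq//=.
  have -> : ((0 < Z i t) == tau i) = false.
    by apply/negbTE; rewrite eq_sym; move: ti; rewrite ffunE.
  by rewrite mul0r mulr0 mul0r mulr0.
rewrite !E// mulr_sumr; apply: eq_bigr => tau _.
rewrite mulrCA; congr (_ * _).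
exact: (same_cf_bits (enum I) tau mY mY' bg bg' h (fun=> 0) 0).
Qed.

End Transfer.

(** * Independence and tilting for signs of Gaussian linear forms *)

Section GaussianBits.
Context d (T : measurableType d) (R : realType) (P : probability T R).
Variable omega : nat -> {RV P >-> R}.
Hypothesis iid : iid_standard_gaussian omega.
Implicit Types (a b c : nat -> R) (N : nat).

Local Notation lin := (linear_form omega).

Lemma dotC N a b : dot N a b = dot N b a.
Proof. by apply: eq_bigr => j _; rewrite mulrC. Qed.

Lemma dotDl N a b c : dot N (fun j => a j + b j) c = dot N a c + dot N b c.
Proof. by rewrite -big_split/=; apply: eq_bigr => j _; rewrite mulrDl. Qed.

Lemma dotZl N k a c : dot N (fun j => k * a j) c = k * dot N a c.
Proof. by rewrite /dot mulr_sumr; apply: eq_bigr => j _; rewrite mulrA. Qed.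

Lemma dotDr N a b c : dot N c (fun j => a j + b j) = dot N c a + dot N c b.
Proof. by rewrite dotC dotDl !(dotC _ c). Qed.

Lemma dotZr N k a c : dot N c (fun j => k * a j) = k * dot N c a.
Proof. by rewrite dotC dotZl (dotC _ c). Qed.

Lemma linD N a b t : lin N (fun j => a j + b j) t = lin N a t + lin N b t.
Proof. by rewrite -big_split/=; apply: eq_bigr => j _; rewrite mulrDl. Qed.

Lemma linZ N k a t : lin N (fun j => k * a j) t = k * lin N a t.
Proof. by rewrite /linear_form mulr_sumr; apply: eq_bigr => j _; rewrite mulrA. Qed.

Definition comb (I : finType) (l : I -> R) (A : I -> nat -> R) (j : nat) : R :=
  \sum_i l i * A i j.

Lemma lin_comb (I : finType) (l : I -> R) A N t :
  lin N (comb l A) t = \sum_i l i * lin N (A i) t.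
Proof.
rewrite /linear_form /comb; under eq_bigr do rewrite mulr_suml.
rewrite exchange_big/=; apply: eq_bigr => i _; rewrite mulr_sumr.
by apply: eq_bigr => j _; rewrite mulrA.
Qed.

Lemma dot_comb (I J : finType) (l : I -> R) A (m : J -> R) B N :
  dot N (comb l A) (comb m B) = \sum_i \sum_j l i * m j * dot N (A i) (B j).
Proof.
rewrite /dot /comb; under eq_bigr do rewrite mulr_suml.
rewrite exchange_big/=; apply: eq_bigr => i _.
under eq_bigr do rewrite mulr_sumr; rewrite exchange_big/=; apply: eq_bigr => j _.
by rewrite mulr_sumr; apply: eq_bigr => k _; ring.
Qed.

Lemma same_cf_gram (I : finType) (A A' : I -> nat -> R) N N' (th : I -> R) :
  (forall i j, dot N (A i) (A j) = dot N' (A' i) (A' j)) ->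
  same_cf P (fun i t => lin N (A i) t - th i) (fun i t => lin N' (A' i) t - th i) 1
     (fun=> 1) (fun=> 1).
Proof.
move=> AA' l v.
have E M (B : I -> nat -> R) : Ex P (fun t => 1 * cos (\sum_i l i * (lin M (B i) t - th i) + v)) =
   expR (- (dot M (comb l B) (comb l B) / 2)) * cos (v - \sum_i l i * th i).
  rewrite -(Ex_cos_lin iid); apply: eq_Ex => t; rewrite mul1r; congr cos.
  by rewrite lin_comb; under eq_bigr do rewrite mulrBr; rewrite sumrB; ring.
rewrite !E mul1r !dot_comb; congr (expR (- (_ / 2)) * _).
by apply: eq_bigr => i _; apply: eq_bigr => j _; rewrite AA'.
Qed.

Lemma bits_gram (I : finType) (A A' : I -> nat -> R) N N' (th : I -> R)
    (F : {ffun I -> bool} -> R) :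
  (forall i j, dot N (A i) (A j) = dot N' (A' i) (A' j)) ->
  Ex P (fun t => F [ffun i => (th i < lin N (A i) t)%R]) =
  Ex P (fun t => F [ffun i => (th i < lin N' (A' i) t)%R]).
Proof.
move=> AA'.
have m M (B : I -> nat -> R) i : measurable_fun setT (fun t => lin M (B i) t - th i).
  by apply: measurable_funB => //; exact: measurable_lin.
have := transfer F (m N A) (m N' A') (bdd_cst T 1) (bdd_cst T 1) (same_cf_gram th AA').
rewrite mul1r.
have E M (B : I -> nat -> R) :
   Ex P (fun t => 1 * F [ffun i => 0 < lin M (B i) t - th i]) =
   Ex P (fun t => F [ffun i => (th i < lin M (B i) t)%R]).
  by apply: eq_Ex => t; rewrite mul1r; congr F; apply/ffunP => i; rewrite !ffunE subr_gt0.
by rewrite !E.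
Qed.

Lemma bdd_bits (I : finType) (Y : I -> T -> R) (F : {ffun I -> bool} -> R) :
  (forall i, measurable_fun setT (Y i)) -> bdd (fun t => F [ffun i => (0 < Y i t)%R]).
Proof.
move=> mY.
have E t : F [ffun i => (0 < Y i t)%R] =
   \sum_(tau : {ffun I -> bool}) F tau * \prod_i (if tau i then bit (Y i t) else 1 - bit (Y i t)).
  set t0 := [ffun i => _].
  rewrite (bigD1 t0)//= [X in _ + X]big1 ?addr0.
    rewrite big1 ?mulr1// => i _; rewrite ffunE /bit.
    by case: (0 < Y i t); rewrite /= ?subr0.
  move=> tau ntau.
  have /existsP[i ti] : [exists i, tau i != t0 i].
    rewrite -negb_forall; apply: contra ntau => /forallP h'.
    by apply/eqP/ffunP => i; apply/eqP; exact: h'.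
  have z0 : (if tau i then bit (Y i t) else 1 - bit (Y i t)) = 0; last first.
    by rewrite (bigD1 i)//= z0 mul0r mulr0.
  by move: ti; rewrite ffunE /bit; case: (tau i); case: (0 < Y i t); rewrite //= ?subrr.
apply: (eq_bdd E); apply: bdd_sum => tau _; apply: bddZ; apply: bdd_prod => i _.
have b := bdd_bit (mY i).
by case: (tau i) => //; apply: bddB => //; exact: bdd_cst.
Qed.

(** Product to sum: for orthogonal [a] and [b], both a + b and a - b have squared norm equal to the
    sum of the two squared norms. *)
Lemma Ex_cos_indep N a b (v w : R) : dot N a b = 0 ->
  Ex P (fun t => cos (lin N a t + v) * cos (lin N b t + w)) =
  Ex P (fun t => cos (lin N a t + v)) * Ex P (fun t => cos (lin N b t + w)).
Proof.
move=> ab.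
transitivity (Ex P (fun t => 2^-1 * (cos (lin N (fun j => a j + 1 * b j) t + (v + w)) +
    cos (lin N (fun j => a j + -1 * b j) t + (v - w))))).
  apply: eq_Ex => t; rewrite !linD !linZ mul1r mulN1r.
  have -> : lin N a t + lin N b t + (v + w) = (lin N a t + v) + (lin N b t + w) by ring.
  have -> : lin N a t - lin N b t + (v - w) = (lin N a t + v) - (lin N b t + w) by ring.
  by move: (lin N a t + v) (lin N b t + w) => x y; rewrite cosD cosB; field.
have bc c u := bdd_cos_lin omega N c u.
rewrite ExZ; last by apply: bddD.
rewrite ExD// !(Ex_cos_lin iid).
have E k : dot N (fun j => a j + k * b j) (fun j => a j + k * b j) =
   dot N a a + k ^+ 2 * dot N b b.
  by rewrite dotDl !dotDr !dotZl !dotZr (dotC N b a) ab; ring.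
rewrite !E sqrrN !expr1n !mul1r -mulrDr cosD cosB.
have -> : - ((dot N a a + dot N b b) / 2) = - (dot N a a / 2) + - (dot N b b / 2) by ring.
by rewrite expRD; field.
Qed.

(** [transfer] is applied twice: with a cosine of the forms [B] as weight for the signs of [A], then
    with the resulting function of the signs of [A] as weight for those of [B]. *)
Lemma bits_indep (I J : finType) (A : I -> nat -> R) (B : J -> nat -> R) N
    (F : {ffun I -> bool} -> R) (G : {ffun J -> bool} -> R) :
  (forall i j, dot N (A i) (B j) = 0) ->
  Ex P (fun t => F [ffun i => (0 < lin N (A i) t)%R] * G [ffun j => (0 < lin N (B j) t)%R]) =
  Ex P (fun t => F [ffun i => (0 < lin N (A i) t)%R]) *
  Ex P (fun t => G [ffun j => (0 < lin N (B j) t)%R]).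
Proof.
move=> AB.
have mA i := measurable_lin omega N (A i).
have mB j := measurable_lin omega N (B j).
have b1 := bdd_cst T (1 : R).
have s1 (m : J -> R) w : same_cf P (fun i => lin N (A i)) (fun i => lin N (A i))
    (Ex P (fun t => cos (lin N (comb m B) t + w)))
    (fun t => cos (lin N (comb m B) t + w)) (fun=> 1).
  move=> l v.
  have -> : Ex P (fun t => 1 * cos (\sum_i l i * lin N (A i) t + v)) =
            Ex P (fun t => cos (lin N (comb l A) t + v)).
    by apply: eq_Ex => t; rewrite mul1r lin_comb.
  rewrite -Ex_cos_indep; last first.
    by rewrite dotC dot_comb big1// => i _; rewrite big1// => j _; rewrite AB mulr0.
  by apply: eq_Ex => t; rewrite (lin_comb l A).
pose F' t := F [ffun i => (0 < lin N (A i) t)%R].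
have bF : bdd F' by apply: bdd_bits.
have s2 : same_cf P (fun j => lin N (B j)) (fun j => lin N (B j)) (Ex P F') F' (fun=> 1).
  move=> m w.
  have := transfer F mA mA (bdd_cos_lin omega N (comb m B) w) b1 (s1 m w).
  have -> : Ex P (fun t => 1 * F [ffun i => 0 < lin N (A i) t]) = Ex P F'.
    by apply: eq_Ex => t; rewrite mul1r.
  rewrite mulrC => e.
  transitivity (Ex P (fun t => cos (lin N (comb m B) t + w) * F [ffun i => 0 < lin N (A i) t])).
    by apply: eq_Ex => t; rewrite mulrC lin_comb.
  by rewrite e; congr (_ * _); apply: eq_Ex => t; rewrite mul1r lin_comb.
rewrite (transfer G mB mB bF b1 s2); congr (_ * _).
by apply: eq_Ex => t; rewrite mul1r.
Qed.

(** Split [a = c z + y] with [y] orthogonal to [z]. The pair (z, y) has the Gram matrix of two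
    independent coordinates, the second scaled by [tau], so the one-dimensional tilting formula
    applies to the first. *)
Lemma Ex_weight_cos_lin N z a (s v : R) : 0 < s <= 1 -> dot N z z = 1 ->
  Ex P (fun t => expR (- ((s ^- 2 - 1) / 2 * lin N z t ^+ 2)) * cos (lin N a t + v)) =
  s * (expR (- ((dot N a a - (1 - s ^+ 2) * dot N a z ^+ 2) / 2)) * cos v).
Proof.
move=> s01 zz; set c := dot N a z.
pose y j := a j + - c * z j.
have yz : dot N y z = 0 by rewrite /y dotDl dotZl zz mulr1 subrr.
have yy : dot N y y = dot N a a - c ^+ 2.
  by rewrite {2}/y dotDr dotZr yz mulr0 addr0 /y dotDl dotZl (dotC _ z) -/c; ring.
pose tau : R := Num.sqrt (dot N y y).
have tau2 : tau ^+ 2 = dot N y y.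
  by rewrite sqr_sqrtr// sumr_ge0// => j _; rewrite -expr2 sqr_ge0.
pose A (b : bool) := if b then z else y.
pose A' (b : bool) (j : nat) : R := if b then (j == 0)%:R else tau * (j == 1)%:R.
have l2 (b : bool) t : lin 2 (A' b) t = if b then omega 0 t else tau * omega 1 t.
  by rewrite /linear_form !big_ord_recr big_ord0 /A'/=; case: b => /=; ring.
have AA' i j : dot N (A i) (A j) = dot 2 (A' i) (A' j).
  rewrite [RHS]/dot !big_ord_recr big_ord0/= /A'; case: i; case: j => /=.
  - by rewrite zz; ring.
  - by rewrite dotC yz; ring.
  - by rewrite yz; ring.
  - by rewrite -tau2; ring.
have m M (B : bool -> nat -> R) i : measurable_fun setT (fun t => lin M (B i) t - 0).
  by apply: measurable_funB => //; exact: measurable_lin.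
set e := (s ^- 2 - 1) / 2.
have e0 : 0 <= e.
  move: s01 => /andP[s0 s1].
  by rewrite /e divr_ge0// subr_ge0 invf_ge1 ?exprn_gt0// expr_le1 ?(ltW s0).
have := same_cf_weight (m N A) (m 2 A') (bdd_cst T 1) (bdd_cst T 1)
   (same_cf_gram (fun=> 0) AA') true e0 (fun b : bool => if b then c else 1) v.
rewrite mul1r.
have -> : Ex P (fun t => 1 * expR (- (e * (lin N (A true) t - 0) ^+ 2)) *
    cos (\sum_i (if i then c else 1) * (lin N (A i) t - 0) + v)) =
    Ex P (fun t => expR (- (e * lin N z t ^+ 2)) * cos (lin N a t + v)).
  apply: eq_Ex => t; rewrite mul1r !subr0; congr (_ * cos (_ + _)).
  rewrite (bigD1 true)//= (bigD1 false)//= big1 ?addr0; last by case.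
  by rewrite !subr0 /A /y linD linZ; ring.
move=> ->.
pose f1 (u x : R) := expR (- (e * x ^+ 2)) * cos (c * x + u).
pose f2 (u x : R) := cos (tau * x + u).
have b2 u : bdd (f2 u) by exact: bdd_cosM.
have bf1 u : bdd (f1 u) by apply: bddM; [exact: bdd_expsq|exact: bdd_cosM].
have pr u w : Ex P (fun t => f1 u (omega 0 t) * f2 w (omega 1 t)) =
   s * (expR (- (s ^+ 2 * c ^+ 2 / 2)) * cos u) * (expR (- (tau ^+ 2 / 2)) * cos w).
  have := @Ex_prod _ _ _ _ _ iid.1 (fun j => if j == 0%N then f1 u else f2 w) 2.
  rewrite !big_ord_recr !big_ord0/= !mul1r (Ex_weight_cos_omega iid)// (Ex_cos_omega iid) => <-.
    by apply: eq_Ex => t; rewrite !big_ord_recr big_ord0/= mul1r.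
  by move=> j; case: ifP.
transitivity (Ex P (fun t => f1 0 (omega 0 t) * f2 v (omega 1 t) -
    f1 (- (pi / 2)) (omega 0 t) * f2 (v - pi / 2) (omega 1 t))).
  apply: eq_Ex => t; rewrite mul1r /f1 /f2.
  rewrite (bigD1 true)//= (bigD1 false)//= big1 ?addr0; last by case.
  rewrite !subr0 !l2 mul1r -addrA cosD addrA cosBpihalf.
  by rewrite cosBpihalf; ring.
have bb u w : bdd (fun t => f1 u (omega 0 t) * f2 w (omega 1 t)).
  by apply: bddM; [exact: (bdd_rv omega 0 (bf1 u))|exact: (bdd_rv omega 1 (b2 w))].
rewrite ExB// !pr cos0 cosN cos_pihalf tau2 yy.
have -> : - ((dot N a a - (1 - s ^+ 2) * c ^+ 2) / 2) =
   - (s ^+ 2 * c ^+ 2 / 2) + - ((dot N a a - c ^+ 2) / 2) by ring.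
by rewrite expRD; ring.
Qed.

(** Under the weight, the component along [z] gets variance [s ^+ 2] and the orthogonal part is
    unchanged. Adding [(s - 1) * dot N (A i) z * z] to [A i] multiplies exactly its [z]-component by
    [s]. *)
Lemma bits_tilt (I : finType) (A : I -> nat -> R) N z (s : R) (F : {ffun I -> bool} -> R) :
  0 < s <= 1 -> dot N z z = 1 ->
  Ex P (fun t => expR (- ((s ^- 2 - 1) / 2 * lin N z t ^+ 2)) *
                 F [ffun i => (0 < lin N (A i) t)%R]) =
  s * Ex P (fun t => F [ffun i => (0 < lin N (fun j => (A i) j + (s - 1) * dot N (A i) z * z j) t)%R]).
Proof.
move=> s01 zz.
pose A' i j := A i j + (s - 1) * dot N (A i) z * z j.
have e0 : 0 <= (s ^- 2 - 1) / 2.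
  move: s01 => /andP[s0 s1].
  by rewrite divr_ge0// subr_ge0 invf_ge1 ?exprn_gt0// expr_le1 ?(ltW s0).
have bW : bdd (fun t => expR (- ((s ^- 2 - 1) / 2 * lin N z t ^+ 2))).
  exact: (bdd_compY (bdd_expsq e0) (measurable_lin omega N z)).
have mA i := measurable_lin omega N (A i).
have mA' i := measurable_lin omega N (A' i).
have cf : same_cf P (fun i => lin N (A i)) (fun i => lin N (A' i)) s
   (fun t => expR (- ((s ^- 2 - 1) / 2 * lin N z t ^+ 2))) (fun=> 1).
  move=> l v.
  have := Ex_weight_cos_lin (comb l A) v s01 zz.
  have -> : Ex P (fun t => expR (- ((s ^- 2 - 1) / 2 * lin N z t ^+ 2)) *
      cos (lin N (comb l A) t + v)) =
      Ex P (fun t => expR (- ((s ^- 2 - 1) / 2 * lin N z t ^+ 2)) *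
      cos (\sum_i l i * lin N (A i) t + v)).
    by apply: eq_Ex => t; rewrite lin_comb.
  move=> ->; congr (_ * _).
  transitivity (Ex P (fun t => cos (lin N (comb l A') t + v))); last first.
    by apply: eq_Ex => t; rewrite mul1r lin_comb.
  rewrite (Ex_cos_lin iid); congr (expR (- (_ / 2)) * _).
  have cz : dot N (comb l A) z = \sum_i l i * dot N (A i) z.
    rewrite /dot /comb; under eq_bigr do rewrite mulr_suml.
    rewrite exchange_big/=; apply: eq_bigr => i _; rewrite mulr_sumr.
    by apply: eq_bigr => j _; rewrite mulrA.
  have -> : comb l A' = fun j => comb l A j + (s - 1) * dot N (comb l A) z * z j.
    apply/funext => j; rewrite /comb /A' cz !mulr_sumr mulr_suml -big_split/=.
    by apply: eq_bigr => i _; ring.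
  by rewrite dotDl !dotDr !dotZl !dotZr zz (dotC _ z); ring.
rewrite (transfer F mA mA' bW (bdd_cst T 1) cf); congr (_ * _).
by apply: eq_Ex => t; rewrite mul1r.
Qed.

End GaussianBits.

(** * Sheppard's formula for the probability of a sign change *)

Section Additive.
Context {R : realType}.

(** Cauchy's functional equation. Nonnegativity makes [f] monotone, and comparison with the
    multiples of L / (n + 1) pins it down. *)
Lemma additive_linear (f : R -> R) (L : R) : 0 < L ->
  (forall x, 0 <= x <= L -> 0 <= f x) ->
  (forall x y, 0 <= x -> 0 <= y -> x + y <= L -> f (x + y) = f x + f y) ->
  forall x, 0 <= x <= L -> f x = f L * (x / L).
Proof.
move=> L0 f0 fD.
have fL0 : 0 <= f L by rewrite f0// lexx ltW.
have fM n (x : R) : 0 <= x -> n%:R * x <= L -> f (n%:R * x) = n%:R * f x.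
  move=> x0; elim: n => [_|n IH].
    have := fD 0 0 (lexx _) (lexx _); rewrite addr0 => /(_ (ltW L0)) e.
    by rewrite !mul0r; lra.
  rewrite -natr1 !mulrDl !mul1r => h.
  have h' : n%:R * x <= L by rewrite (le_trans _ h)// lerDl.
  by rewrite fD ?IH// mulr_ge0.
have fmono x y : 0 <= x -> x <= y -> y <= L -> f x <= f y.
  move=> x0 xy yL; have e : y = x + (y - x) by rewrite addrC subrK.
  rewrite e fD ?subr_ge0// -?e//; rewrite lerDl f0// subr_ge0 xy/=; lra.
have lower (x : R) n : 0 <= x <= L -> f L * (x / L - n.+1%:R^-1) <= f x.
  move=> /andP[x0 xL].
  have n0 : (0 : R) < n.+1%:R by rewrite ltr0n.
  have fLn : f L = n.+1%:R * f (L / n.+1%:R).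
    have e : L = n.+1%:R * (L / n.+1%:R) by field; rewrite gt_eqF.
    by rewrite {1}e fM -?e// divr_ge0 ?ltW.
  pose k := Num.truncn (n.+1%:R * x / L).
  have z0 : 0 <= n.+1%:R * x / L by rewrite divr_ge0 ?mulr_ge0// ltW.
  have /andP[k1 k2] := truncn_itv z0.
  rewrite -/k in k1 k2.
  have kx : k%:R * (L / n.+1%:R) <= x.
    by rewrite mulrA ler_pdivrMr// (mulrC x) -ler_pdivlMr.
  have Ln0 : 0 <= L / n.+1%:R by rewrite divr_ge0 ?ltW.
  apply: (le_trans _ (fmono _ _ (mulr_ge0 (ler0n _ k) Ln0) kx xL)).
  rewrite fM//; last exact: le_trans kx xL.
  have g0 : 0 <= f (L / n.+1%:R).
    by apply: f0; rewrite Ln0/= ler_pdivrMr// ler_peMr ?(ltW L0)// ler1n.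
  rewrite fLn (mulrC n.+1%:R) -mulrA mulrC ler_wpM2r//.
  rewrite mulrBr divff ?gt_eqF// mulrA lerBlDr natr1; exact: ltW.
move=> x xL; have /andP[x0 xL'] := xL.
(* The lower bound at [L - x], together with additivity. *)
have upper n : f x <= f L * (x / L + n.+1%:R^-1).
  have := lower (L - x) n; rewrite subr_ge0 xL'/= gerBl => /(_ x0).
  have := fD x (L - x) x0; rewrite subr_ge0 addrC subrK => /(_ xL' (lexx _)) e.
  have -> : (L - x) / L = 1 - x / L by field; rewrite gt_eqF.
  by move: e; move: (f L) (f x) (f (L - x)) (x / L) (n.+1%:R^-1) => A B C u v e h; lra.
have H n : `|f x - f L * (x / L)| <= f L * harmonic n.
  rewrite ler_distl /harmonic/=; move: (upper n) (lower x n xL).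
  move: (f L) (f x) (x / L) (n.+1%:R^-1) => A B u v h1 h2; apply/andP; split; lra.
apply/eqP; rewrite -subr_eq0 -normr_le0.
have c : f L * harmonic n @[n --> \oo] --> (0:R).
  by rewrite -[X in _ --> X](mulr0 (f L)); apply: cvgM; [exact: cvg_cst|exact: cvg_harmonic].
rewrite -(cvg_lim _ c)//; apply: limr_ge; first by apply/cvg_ex; exists 0.
by apply: nearW.
Qed.

End Additive.

Section Sheppard.
Context d (T : measurableType d) (R : realType) (P : probability T R).
Variable omega : nat -> {RV P >-> R}.
Hypothesis iid : iid_standard_gaussian omega.
Implicit Types (a b : nat -> R).
Local Notation lin := (linear_form omega).

Definition chg (x y : R) : R := ((0 < x) != (0 < y))%:R.

Lemma chgE x y : chg x y = bit x + bit y - 2 * (bit x * bit y).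
Proof. by rewrite /chg /bit; case: (0 < x); case: (0 < y) => /=; ring. Qed.

Lemma chg_ge0 x y : 0 <= chg x y. Proof. by rewrite /chg. Qed.

Lemma chg_norm x y : `|chg x y| <= 1.
Proof. by rewrite /chg; case: (_ != _); rewrite ?normr1 ?normr0. Qed.

Lemma bdd_chg (Y Z : T -> R) : measurable_fun setT Y -> measurable_fun setT Z ->
  bdd (fun t => chg (Y t) (Z t)).
Proof.
move=> mY mZ; have bY := bdd_bit mY; have bZ := bdd_bit mZ.
apply: (eq_bdd (fun t => chgE (Y t) (Z t))).
by apply: bddB; [exact: bddD|apply: bddZ; exact: bddM].
Qed.

Lemma Ex_chg_gram N N' a b a' b' :
  dot N a a = dot N' a' a' -> dot N a b = dot N' a' b' -> dot N b b = dot N' b' b' ->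
  Ex P (fun t => chg (lin N a t) (lin N b t)) = Ex P (fun t => chg (lin N' a' t) (lin N' b' t)).
Proof.
move=> aa ab bb.
pose A (i : bool) := if i then a else b.
pose A' (i : bool) := if i then a' else b'.
pose F (s : {ffun bool -> bool}) : R := (s true != s false)%:R.
have AA' i j : dot N (A i) (A j) = dot N' (A' i) (A' j).
  by case: i; case: j; rewrite /A /A'//= dotC ab dotC.
have := bits_gram iid (fun=> 0) F AA'.
have E M (B : bool -> nat -> R) : Ex P (fun t => F [ffun i => 0 < lin M (B i) t]) =
   Ex P (fun t => chg (lin M (B true) t) (lin M (B false) t)).
  by apply: eq_Ex => t; rewrite /F !ffunE.
by rewrite !E.
Qed.

Lemma omega_neq0 j : Ex P (fun t => (omega j t == 0)%:R : R) = 0.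
Proof.
have b0 : bdd (\1_[set (0 : R)] : R -> R) by exact: bdd_indic.
have := Ex_omega iid j b0.
have -> : Ex P (fun t => \1_[set 0] (omega j t)) = Ex P (fun t => (omega j t == 0)%:R : R).
  apply: eq_Ex => t; rewrite indicE; congr (_%:R); congr nat_of_bool.
  by apply/idP/eqP => [/set_mem|h]; [|apply/mem_set].
move=> ->.
transitivity (\int[(@lebesgue_measure R)]_(x in [set (0 : R)]) normal_pdf 0 1 x);
  last exact: Rintegral_set1.
rewrite [in RHS]Rintegral_mkcond.
apply: eq_Rintegral => x _; rewrite patchE indicE.
by case: (x \in _); rewrite ?mul1r ?mul0r.
Qed.

Let e0 (j : nat) : R := (j == 0%N)%:R.
Let u (th : R) (j : nat) : R := cos th * (j == 0%N)%:R + sin th * (j == 1%N)%:R.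

Let dot2 a b : dot 2 a b = a 0%N * b 0%N + a 1%N * b 1%N.
Proof. by rewrite /dot !big_ord_recr big_ord0/= add0r. Qed.

Let lin2 a t : lin 2 a t = a 0%N * omega 0 t + a 1%N * omega 1 t.
Proof. by rewrite /linear_form !big_ord_recr big_ord0/= add0r. Qed.

Let uu th th' : dot 2 (u th) (u th') = cos (th' - th).
Proof. by rewrite dot2 /u/= cosB; ring. Qed.

Let f th := Ex P (fun t => chg (lin 2 (u 0) t) (lin 2 (u th) t)).

Let f_shift th th' : Ex P (fun t => chg (lin 2 (u th) t) (lin 2 (u (th + th')) t)) = f th'.
Proof. by apply: Ex_chg_gram; rewrite !uu ?subrr// addrC addKr subr0. Qed.

Let bddu th th' : bdd (fun t => chg (lin 2 (u th) t) (lin 2 (u th') t)).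
Proof. by apply: bdd_chg; exact: measurable_lin. Qed.

(** The form at the middle angle is a positive combination of the two outer ones, so it has their
    sign when they agree. Sign changes therefore add up pointwise, and [f_shift] identifies the
    second term. *)
Let fD x y : 0 <= x -> 0 <= y -> x + y <= pi / 2 -> f (x + y) = f x + f y.
Proof.
move=> x0 y0 xy.
have ff : f 0 = 0.
  rewrite /f -[RHS](@Ex_cst _ _ _ P 0); apply: eq_Ex => t.
  by rewrite /chg eqxx.
have [->|xn0] := eqVneq x 0; first by rewrite ff !add0r.
have [->|yn0] := eqVneq y 0; first by rewrite ff !addr0.
have xp : 0 < x by rewrite lt_def xn0.
have yp : 0 < y by rewrite lt_def yn0.
have p0 := pi_gt0 R.
have sx : 0 < sin x by apply: sin_gt0_pi; rewrite xp/=; lra.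
have sy : 0 < sin y by apply: sin_gt0_pi; rewrite yp/=; lra.
have sxy : 0 < sin (x + y) by apply: sin_gt0_pi; rewrite addr_gt0//=; lra.
rewrite -(f_shift x y) /f -ExD//.
apply: eq_Ex => t.
have E : sin (x + y) * lin 2 (u x) t = sin y * lin 2 (u 0) t + sin x * lin 2 (u (x + y)) t.
  rewrite !lin2 /u/= cos0 sin0 sinD cosD; have := cos2Dsin2 x => h.
  set A := omega 0 t; set B := omega 1 t.
  apply/eqP; rewrite -subr_eq0; apply/eqP.
  transitivity (sin y * A * (cos x ^+ 2 + sin x ^+ 2 - 1)); first ring.
  by rewrite h subrr mulr0.
have [a0|a0] := ltP 0 (lin 2 (u 0) t); have [b0|b0] := ltP 0 (lin 2 (u (x + y)) t).
- have : 0 < sin (x + y) * lin 2 (u x) t by rewrite E addr_gt0// mulr_gt0.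
  by rewrite pmulr_rgt0// /chg => ->; rewrite a0 b0/=; ring.
- by rewrite /chg a0 (ltNge _ (lin 2 (u (x + y)) t)) b0/=; case: (0 < lin 2 (u x) t) => /=; ring.
- by rewrite /chg b0 (ltNge _ (lin 2 (u 0) t)) a0/=; case: (0 < lin 2 (u x) t) => /=; ring.
- have : sin (x + y) * lin 2 (u x) t <= 0.
    by rewrite E -oppr_ge0 opprD addr_ge0// -mulrN mulr_ge0 ?oppr_ge0// ltW.
  rewrite pmulr_rle0// /chg => c0.
  by rewrite (ltNge _ (lin 2 (u 0) t)) a0 (ltNge _ (lin 2 (u x) t)) c0
     (ltNge _ (lin 2 (u (x + y)) t)) b0/=; ring.
Qed.

(** Turning by [pi / 2] or by [- pi / 2] gives the same law, and exactly one of the two turns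
    changes the sign unless [omega 1] vanishes, which has probability zero. *)
Let f_half : f (pi / 2) = 2^-1.
Proof.
have e : f (pi / 2) = Ex P (fun t => chg (lin 2 (u 0) t) (lin 2 (u (- (pi / 2))) t)).
  by apply: Ex_chg_gram; rewrite !uu ?subrr// !subr0 cosN.
have s : f (pi / 2) + f (pi / 2) = 1.
  rewrite {2}e /f -ExD//.
  transitivity (Ex P (fun t => 1 + (bit (omega 0 t) * 2 - 1) * (omega 1 t == 0)%:R)).
    apply: eq_Ex => t; rewrite !lin2 /u/= cosN sinN cos_pihalf sin_pihalf cos0 sin0.
    have -> : (1 * 1 + 0 * 0) * omega 0 t + (1 * 0 + 0 * 1) * omega 1 t = omega 0 t by ring.
    have -> : (0 * 1 + 1 * 0) * omega 0 t + (0 * 0 + 1 * 1) * omega 1 t = omega 1 t by ring.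
    have -> : (0 * 1 + -1 * 0) * omega 0 t + (0 * 0 + -1 * 1) * omega 1 t = - omega 1 t by ring.
    rewrite /chg /bit; have [h|h|h] := ltgtP 0 (omega 1 t).
    + by rewrite oppr_gt0 (lt_gtF h)/=; case: (0 < omega 0 t) => /=; ring.
    + by rewrite oppr_gt0 h/=; case: (0 < omega 0 t) => /=; ring.
    + by rewrite -h oppr0 ltxx/=; case: (0 < omega 0 t) => /=; ring.
  have m1 : measurable_fun setT (omega 0 : T -> R) by exact: measurable_funPT.
  have be : bdd (fun t => (omega 1 t == 0)%:R : R).
    have b0 : bdd (\1_[set (0 : R)] : R -> R) by exact: bdd_indic.
    apply: (eq_bdd _ (bdd_rv omega 1 b0)) => t; rewrite indicE; congr (_%:R); congr nat_of_bool.
    by apply/eqP/idP => [h|/set_mem//]; apply/mem_set.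
  have b2 : bdd (fun t => bit (omega 0 t) * 2 - 1).
    apply: bddB; last exact: bdd_cst.
    by apply: bddM; [exact: bdd_bit|exact: bdd_cst].
  have bp := bddM b2 be.
  rewrite ExD//; last exact: bdd_cst.
  rewrite Ex_cst -[RHS]addr0; congr (_ + _).
  apply/eqP; rewrite -normr_le0; apply: (le_trans (Ex_norm P bp)).
  rewrite -[leRHS](omega_neq0 1).
  apply: Ex_le => //; first exact: bdd_norm.
  move=> t; rewrite normrM [X in _ * X]ger0_norm// ler_piMl//.
  by rewrite /bit; case: (0 < omega 0 t) => /=; rewrite ler_norml; apply/andP; split; lra.
lra.
Qed.

(** With [th] the angle between them, [a] and [b] have the Gram matrix of [u 0] and [u th]; [f] is
    linear on [0, pi/2] with value 1/2 at the end. *)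
Lemma sheppard N a b : dot N a a = 1 -> dot N b b = 1 -> 0 <= dot N a b ->
  Ex P (fun t => chg (lin N a t) (lin N b t)) = acos (dot N a b) / pi.
Proof.
move=> aa bb ab.
have ab1 : dot N a b <= 1.
  have : 0 <= dot N (fun j => a j + -1 * b j) (fun j => a j + -1 * b j).
    by apply: sumr_ge0 => j _; rewrite -expr2 sqr_ge0.
  by rewrite dotDl !dotDr !dotZl !dotZr aa bb (dotC N b a); lra.
have i1 : -1 <= dot N a b <= 1 by rewrite ab1 andbT; lra.
set th := acos _.
have t0 : 0 <= th by exact: acos_ge0.
have p0 := pi_gt0 R.
have t1 : th <= pi / 2.
  rewrite leNgt; apply/negP => h.
  have : cos th < cos (pi / 2).
    rewrite ltr_cos ?in_itv/= ?t0 ?acos_lepi//.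
    by apply/andP; split; lra.
  by rewrite cos_pihalf /th acosK ?in_itv//=; lra.
transitivity (f th).
  by apply: Ex_chg_gram; rewrite uu ?aa ?bb ?subrr ?cos0// subr0 acosK// in_itv.
have L0 : 0 < pi / 2 :> R by lra.
rewrite (additive_linear L0 _ fD) ?t0//.
  rewrite f_half; have pn : pi != 0 :> R by rewrite gt_eqF.
  by move: (pi : R) pn => p pn; field.
by move=> x _; apply: Ex_ge0 => t; exact: chg_ge0.
Qed.

(** A form and its opposite differ in sign exactly when they do not vanish, so the probability of a
    zero depends only on the Gram matrix and can be computed on [omega 0]. *)
Lemma lin_neq0 N a : dot N a a = 1 -> Ex P (fun t => (lin N a t == 0)%:R : R) = 0.
Proof.
move=> aa.
have E M (c : nat -> R) : Ex P (fun t => (lin M c t == 0)%:R : R) =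
   1 - Ex P (fun t => chg (lin M c t) (lin M (fun j => -1 * c j) t)).
  have bc := bdd_chg (measurable_lin omega M c) (measurable_lin omega M (fun j => -1 * c j)).
  rewrite -[X in X - _](@Ex_cst _ _ _ P) -ExB//; last exact: bdd_cst.
  apply: eq_Ex => t; rewrite linZ mulN1r /chg oppr_gt0.
  by have [h|h|h] := ltgtP (lin M c t) 0 => /=; ring.
rewrite E (@Ex_chg_gram _ 1 _ _ e0 (fun j => -1 * e0 j)); first last.
- by rewrite !dotZl !dotZr aa /dot big_ord_recr big_ord0/= /e0/=; ring.
- by rewrite !dotZr aa /dot big_ord_recr big_ord0/= /e0/=; ring.
- by rewrite aa /dot big_ord_recr big_ord0/= /e0/=; ring.
rewrite -E; transitivity (Ex P (fun t => (omega 0 t == 0)%:R : R)); last exact: omega_neq0.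
apply: eq_Ex => t; by rewrite /linear_form big_ord_recr big_ord0/= /e0/= mul1r add0r.
Qed.

End Sheppard.

(** * The process on the circle and its sign changes *)

Section Process.
Context d (T : measurableType d) (R : realType) (P : probability T R).
Variable omega : nat -> {RV P >-> R}.
Hypothesis iid : iid_standard_gaussian omega.
Implicit Types (n : nat) (th ph : R).
Local Notation lin := (linear_form omega).

Definition xi n th (j : nat) : R := Num.sqrt ('C(n, j)%:R) * sin th ^+ j * cos th ^+ (n - j).

Definition kostlan n th t := lin n.+1 (xi n th) t.
Local Notation X := kostlan.

(** The binomial theorem for cos th cos th' + sin th sin th'. *)
Lemma dot_xi n th th' : dot n.+1 (xi n th) (xi n th') = cos (th - th') ^+ n.
Proof.
rewrite cosB exprDn /dot; apply: eq_bigr => j _; rewrite /xi.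
set c := Num.sqrt _.
have cc : c * c = 'C(n, j)%:R by rewrite -expr2 sqr_sqrtr// ler0n.
rewrite -mulr_natr -cc !exprMn; ring.
Qed.

Lemma dot_xi1 n th : dot n.+1 (xi n th) (xi n th) = 1.
Proof. by rewrite dot_xi subrr cos0 expr1n. Qed.

Lemma measurable_X n th : measurable_fun setT (X n th).
Proof. exact: measurable_lin. Qed.

Lemma cosX_le_exp n (x : R) : 0 <= x <= pi / 2 -> cos x ^+ n <= expR (- ((Num.sqrt n%:R * x) ^+ 2 / 2)).
Proof.
move=> x0; have c0 : 0 <= cos x.
  by apply: cos_ge0_pihalf; move: x0 => /andP[? ->]; rewrite andbT; have := pi_gt0 R; lra.
have -> : - ((Num.sqrt n%:R * x) ^+ 2 / 2) = n%:R * - (x ^+ 2 / 2).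
  by rewrite exprMn sqr_sqrtr ?ler0n//; ring.
by rewrite expRM_natl lerXn2r ?nnegrE ?expR_ge0// cos_le_exp.
Qed.

Lemma cosX_ge n (x : R) : 0 <= x <= pi / 2 -> 1 - (Num.sqrt n%:R * x) ^+ 2 / 2 <= cos x ^+ n.
Proof.
move=> x0; have c0 : 0 <= cos x.
  by apply: cos_ge0_pihalf; move: x0 => /andP[? ->]; rewrite andbT; have := pi_gt0 R; lra.
rewrite exprMn sqr_sqrtr ?ler0n//.
have c1 := cos_le1 x; have : 1 - x ^+ 2 / 2 <= cos x by apply: cos_ge2; case/andP: x0.
elim: n => [|n IH] h; first by rewrite mul0r mul0r subr0 expr0.
have h2 := IH h; rewrite -natr1 [leRHS](exprS (cos x) n).
have q1 : cos x ^+ n <= 1 by rewrite exprn_ile1.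
have : 0 <= (1 - cos x) * (1 - cos x ^+ n) by rewrite mulr_ge0// subr_ge0.
move: h2 h; move: (cos x) (cos x ^+ n) (x ^+ 2) (n%:R : R) => c q y m.
lra.
Qed.

(** Together with [acos_lower] this inverts the Taylor bounds on the cosine. In [Ex_dip] the linear
    terms cancel, so the cubic errors decide. *)
Lemma acos_upper (r h : R) : 0 <= r <= 1 -> 0 <= h -> 1 - h ^+ 2 / 2 <= r ->
  acos r <= h + h ^+ 3 / 10.
Proof.
move=> /andP[r0 r1] h0 hr.
have i1 : -1 <= r <= 1 by rewrite r1 andbT; lra.
set b := acos r; have b0 : 0 <= b by exact: acos_ge0.
have cb : cos b = r by rewrite acosK// in_itv.
have b2 : b <= 2.
  have /andP[_ p2] := @pihalf_02 R; rewrite (le_trans _ (ltW p2))// leNgt; apply/negP => h'.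
  have : cos b < cos (pi / 2).
    rewrite ltr_cos ?in_itv/= ?b0 ?acos_lepi//.
    by apply/andP; split; have := pi_gt0 R; lra.
  by rewrite cos_pihalf cb; lra.
have := cos_le4 b0; rewrite cb => c4.
have bb : 0 <= b ^+ 2 <= 4 by rewrite sqr_ge0/=; nra.
have e4 : b ^+ 4 = b ^+ 2 * b ^+ 2 by ring.
(* Since [b <= 2], the quartic term b^4/24 takes away at most a third of b^2/2. *)
have B1 : b ^+ 2 <= 3 / 2 * h ^+ 2 by rewrite e4 in c4; nra.
have B2 : b ^+ 2 <= (h + h ^+ 3 / 10) ^+ 2.
  have -> : (h + h ^+ 3 / 10) ^+ 2 = h ^+ 2 + (h ^+ 2) ^+ 2 / 5 + (h ^+ 3) ^+ 2 / 100 by field.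
  have := sqr_ge0 (h ^+ 3); rewrite e4 in c4.
  have : b ^+ 2 * b ^+ 2 <= (3 / 2 * h ^+ 2) * (3 / 2 * h ^+ 2).
    by case/andP: bb => ? _; apply: ler_pM.
  have -> : (h ^+ 2) ^+ 2 = h ^+ 2 * h ^+ 2 by ring.
  have := sqr_ge0 h; nra.
by rewrite -(ler_pXn2r (n := 2))// nnegrE// addr_ge0// divr_ge0// exprn_ge0.
Qed.

Lemma acos_lower (r h : R) : 0 <= r <= 1 -> 0 <= h -> r <= 1 - h ^+ 2 / 2 + h ^+ 4 / 8 ->
  h - h ^+ 3 / 4 <= acos r.
Proof.
move=> /andP[r0 r1] h0 hr.
have i1 : -1 <= r <= 1 by rewrite r1 andbT; lra.
set b := acos r; have b0 : 0 <= b by exact: acos_ge0.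
have cb : cos b = r by rewrite acosK// in_itv.
have := cos_ge2 b0; rewrite cb => c2.
have [h2|h2] := leP 2 h.
  rewrite (le_trans _ b0)//.
  have -> : h - h ^+ 3 / 4 = h * (1 - h ^+ 2 / 4) by field.
  rewrite mulr_ge0_le0//; nra.
have B : (h - h ^+ 3 / 4) ^+ 2 <= b ^+ 2.
  have -> : (h - h ^+ 3 / 4) ^+ 2 = h ^+ 2 - h ^+ 4 / 2 + h ^+ 4 * h ^+ 2 / 16 by field.
  have h4 : 0 <= h ^+ 4 by rewrite exprn_ge0.
  have : 0 <= h ^+ 4 * (4 - h ^+ 2) by rewrite mulr_ge0//; nra.
  nra.
have [lt0|ge0] := leP 0 (h - h ^+ 3 / 4); last by rewrite (le_trans _ b0)// ltW.
by rewrite -(ler_pXn2r (n := 2))// nnegrE.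
Qed.

Lemma cosX_ge0 n (x : R) : 0 <= x <= pi / 2 -> 0 <= cos x ^+ n <= 1.
Proof.
move=> x0; have c0 : 0 <= cos x.
  by apply: cos_ge0_pihalf; move: x0 => /andP[? ->]; rewrite andbT; have := pi_gt0 R; lra.
by rewrite exprn_ge0//= exprn_ile1// cos_le1.
Qed.

Lemma bdd_chgX n th th' : bdd (fun t => chg (X n th t) (X n th' t)).
Proof. by apply: bdd_chg; exact: measurable_X. Qed.

Lemma Ex_chgX n th ph : 0 <= ph <= pi / 2 ->
  Ex P (fun t => chg (X n th t) (X n (th + ph) t)) = acos (cos ph ^+ n) / pi.
Proof.
move=> ph0; rewrite (sheppard iid) ?dot_xi ?subrr ?cos0 ?expr1n//.
  by rewrite opprD addNKr cosN.
by rewrite opprD addNKr cosN; case/andP: (cosX_ge0 n ph0).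
Qed.

(* Twice the indicator that the sign at the middle point differs from the
   common sign at the two outer points. *)
Definition dip_count n th ph t := chg (X n th t) (X n (th + ph) t) +
  chg (X n (th + ph) t) (X n (th + ph + ph) t) - chg (X n th t) (X n (th + ph + ph) t).
Local Notation dip := dip_count.

Lemma dip_cases n th ph t : dip n th ph t = 0 \/ dip n th ph t = 2.
Proof.
rewrite /dip /chg.
by case: (0 < _); case: (0 < _); case: (0 < _) => /=; (left; ring) || (right; ring).
Qed.

Lemma bdd_dip n th ph : bdd (dip n th ph).
Proof. by apply: bddB; [apply: bddD|]; exact: bdd_chgX. Qed.

(** By Sheppard this is 2 acos r(ph) - acos r(2 ph) over pi. With h = sqrt(n) ph the terms 2 h
    cancel, and at most 11/5 h^3 remains before the division by pi. *)
Lemma Ex_dip n th ph : 0 <= ph <= pi / 4 ->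
  Ex P (dip n th ph) <= 3 * (Num.sqrt n%:R * ph) ^+ 3.
Proof.
move=> /andP[p0 p4]; have pp := pi_gt0 R; have p2 := pi_ge2 R.
have b := bdd_chgX n.
rewrite /dip ExB//; last exact: bddD.
have -> : th + ph + ph = th + (ph + ph) by rewrite addrA.
rewrite ExD// (_ : Ex P (fun x => chg (X n (th + ph) x) (X n (th + (ph + ph)) x)) =
   acos (cos ph ^+ n) / pi); last first.
  by rewrite addrA Ex_chgX//; apply/andP; split; lra.
rewrite !Ex_chgX; [|by apply/andP; split; lra..].
set h := Num.sqrt n%:R * ph.
have h0 : 0 <= h by rewrite mulr_ge0.
have ph2 : 0 <= ph <= pi / 2 by apply/andP; split; lra.
have pp2 : 0 <= ph + ph <= pi / 2 by apply/andP; split; lra.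
have U := acos_upper (cosX_ge0 n ph2) h0 (cosX_ge n ph2).
have L : 2 * h - (2 * h) ^+ 3 / 4 <= acos (cos (ph + ph) ^+ n).
  apply: acos_lower; [exact: cosX_ge0|by rewrite mulr_ge0|].
  rewrite (le_trans (cosX_le_exp n pp2))//.
  have -> : Num.sqrt n%:R * (ph + ph) = 2 * h by rewrite /h; ring.
  have := @expN_le R ((2 * h) ^+ 2 / 2); rewrite divr_ge0 ?sqr_ge0// => /(_ isT) e.
  by rewrite (le_trans e)// le_eqVlt; apply/orP; left; apply/eqP; field.
have h3 : 0 <= h ^+ 3 by rewrite exprn_ge0.
rewrite -mulrDl -mulrBl ler_pdivrMr//.
have e : (2 * h) ^+ 3 = 8 * h ^+ 3 by ring.
rewrite e in L.
have h6 : 3 * h ^+ 3 * 2 <= 3 * h ^+ 3 * pi by rewrite ler_wpM2l// mulr_ge0.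
rewrite (le_trans _ h6)//; move: U L h3; move: (acos _) (acos _) (h ^+ 3) => A B C; lra.
Qed.

Definition sign_changes n th ph (m : nat) t := \sum_(k < m)
  chg (X n (th + k%:R * ph) t) (X n (th + k.+1%:R * ph) t).
Local Notation cnt := sign_changes.

Lemma bdd_cnt n th ph m : bdd (cnt n th ph m).
Proof. by apply: bdd_sum => k _; exact: bdd_chgX. Qed.

Lemma cnt_ge0 n th ph m t : 0 <= cnt n th ph m t.
Proof. by apply: sumr_ge0 => k _; exact: chg_ge0. Qed.

Lemma cnt_le n th ph m t : cnt n th ph m t <= m%:R.
Proof.
rewrite /cnt -[m in leRHS]card_ord -sum1_card natr_sum; apply: ler_sum => k _.
by apply: le_trans (ler_norm _) (chg_norm _ _).
Qed.

(** [dip_count] is precisely what halving one cell adds to the count. *)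
Lemma cnt_double n th ph m t : cnt n th (ph / 2) (2 * m) t = cnt n th ph m t +
  \sum_(k < m) dip n (th + k%:R * ph) (ph / 2) t.
Proof.
rewrite /cnt -big_split/=.
transitivity (\sum_(k < m) (chg (X n (th + (2 * k)%:R * (ph / 2)) t) (X n (th + (2 * k).+1%:R * (ph / 2)) t) +
    chg (X n (th + (2 * k).+1%:R * (ph / 2)) t) (X n (th + (2 * k).+2%:R * (ph / 2)) t))).
  elim: m => [|m IH]; first by rewrite muln0 !big_ord0.
  by rewrite mulnS !big_ord_recr/= IH addrA.
apply: eq_bigr => k _; rewrite /dip.
have -> : th + (2 * k)%:R * (ph / 2) = th + k%:R * ph by rewrite natrM; field.
have -> : th + (2 * k).+1%:R * (ph / 2) = th + k%:R * ph + ph / 2.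
  by rewrite -natr1 natrM; field.
have -> : th + (2 * k).+2%:R * (ph / 2) = th + k%:R * ph + ph / 2 + ph / 2.
  by rewrite -2!natr1 natrM; field.
have -> : th + k%:R * ph + ph / 2 + ph / 2 = th + k.+1%:R * ph.
  by rewrite -natr1; field.
by ring.
Qed.

End Process.

(** * Moments of sign counts under refinement of the mesh *)

Section PowerMean.
Context {R : realFieldType}.

Lemma sum_sqr_le (m : nat) (f : nat -> R) :
  (\sum_(k < m) f k) ^+ 2 <= m%:R * \sum_(k < m) f k ^+ 2.
Proof.
elim: m => [|m IH]; first by rewrite !big_ord0 expr0n mulr0.
rewrite !big_ord_recr/=; move: IH; set S := \sum_(k < m) f k; set Q := \sum_(k < m) f k ^+ 2.
case: m @S @Q => [|m] S Q IH; first by rewrite /S /Q !big_ord0 !add0r mul1r.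
have m0 : (0 : R) < m.+1%:R by rewrite ltr0n.
rewrite -natr1; move: m0 IH; move: (m.+1%:R : R) S Q (f m.+1) => M S Q x M0 IH.
have h : 0 <= (S - M * x) ^+ 2 / M by rewrite divr_ge0 ?sqr_ge0// ltW.
have h' : S ^+ 2 / M <= Q by rewrite ler_pdivrMr// mulrC.
have e : (S - M * x) ^+ 2 / M = S ^+ 2 / M - 2 * S * x + M * x ^+ 2 by field; rewrite gt_eqF.
rewrite e in h; lra.
Qed.

(** Induction with [s] the mean of the first M terms: if all of these equal [s], the defect of the
    inequality is M (s - x)^2 ((2M + 1) s + (M + 2) x), and the induction hypothesis pays for their
    spread. *)
Lemma sum_cube_le (m : nat) (f : nat -> R) : (forall k, 0 <= f k) ->
  (\sum_(k < m) f k) ^+ 3 <= m%:R ^+ 2 * \sum_(k < m) f k ^+ 3.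
Proof.
move=> f0; elim: m => [|m IH]; first by rewrite !big_ord0 expr0n mulr0.
rewrite !big_ord_recr/=.
have S0 : 0 <= \sum_(k < m) f k by apply: sumr_ge0.
move: IH S0; set S := \sum_(k < m) f k; set Q := \sum_(k < m) f k ^+ 3.
case: m @S @Q => [|m] S Q IH S0; first by rewrite /S /Q !big_ord0 !add0r expr1n mul1r.
have m0 : (0 : R) < m.+1%:R by rewrite ltr0n.
rewrite -natr1; move: m0 IH S0 (f0 m.+1); move: (m.+1%:R : R) S Q (f m.+1) => M S Q x M0 IH S0 x0.
pose s := S / M; have sE : S = M * s by rewrite /s; field; rewrite gt_eqF.
have s0 : 0 <= s by rewrite divr_ge0// ltW.
have h' : M * s ^+ 3 <= Q.
  rewrite -(ler_pM2l (exprn_gt0 2 M0)) (le_trans _ IH)// sE.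
  by rewrite le_eqVlt; apply/orP; left; apply/eqP; ring.
have h : 0 <= M * ((s - x) ^+ 2 * ((2 * M + 1) * s + (M + 2) * x)).
  by rewrite mulr_ge0 ?(ltW M0)// mulr_ge0 ?sqr_ge0// addr_ge0// mulr_ge0// addr_ge0 ?mulr_ge0// ltW.
have h2 : 0 <= (M + 1) ^+ 2 * (Q - M * s ^+ 3) by rewrite mulr_ge0 ?sqr_ge0// subr_ge0.
rewrite -subr_ge0 sE.
rewrite (_ : _ - _ = M * ((s - x) ^+ 2 * ((2 * M + 1) * s + (M + 2) * x)) +
   (M + 1) ^+ 2 * (Q - M * s ^+ 3)); first exact: addr_ge0.
by ring.
Qed.

End PowerMean.

Section Moments.
Context d (T : measurableType d) (R : realType) (P : probability T R).
Variable omega : nat -> {RV P >-> R}.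
Hypothesis iid : iid_standard_gaussian omega.
Local Notation cnt := (sign_changes omega).
Local Notation dip := (dip_count omega).
Implicit Types (n m J : nat) (th ph : R).

Lemma Ex_sum_sqr (f : nat -> T -> R) m (A : R) : (forall k, bdd (f k)) ->
  (forall k, (k < m)%N -> Ex P (fun t => f k t ^+ 2) <= A) ->
  Ex P (fun t => (\sum_(k < m) f k t) ^+ 2) <= m%:R ^+ 2 * A.
Proof.
move=> bf fA.
have b2 : bdd (fun t => m%:R * \sum_(k < m) f k t ^+ 2).
  by apply: bddZ; apply: bdd_sum => k _; exact: bddX.
have b1 : bdd (fun t => (\sum_(k < m) f k t) ^+ 2).
  by apply: bddX; apply: bdd_sum.
rewrite (le_trans (Ex_le P b1 b2 (fun t => sum_sqr_le m (fun k => f k t))))//.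
rewrite ExZ; last by apply: bdd_sum => k _; exact: bddX.
rewrite Ex_sum; last by move=> k _; exact: bddX.
rewrite expr2 -mulrA ler_wpM2l//.
rewrite -[m in leRHS]card_ord -sum1_card natr_sum mulr_suml; apply: ler_sum => k _.
by rewrite mul1r fA.
Qed.

Lemma Ex_sum_cube (f : nat -> T -> R) m (A : R) : (forall k, bdd (f k)) ->
  (forall k t, 0 <= f k t) ->
  (forall k, (k < m)%N -> Ex P (fun t => f k t ^+ 3) <= A) ->
  Ex P (fun t => (\sum_(k < m) f k t) ^+ 3) <= m%:R ^+ 3 * A.
Proof.
move=> bf f0 fA.
have b2 : bdd (fun t => m%:R ^+ 2 * \sum_(k < m) f k t ^+ 3).
  by apply: bddZ; apply: bdd_sum => k _; exact: bddX.
have b1 : bdd (fun t => (\sum_(k < m) f k t) ^+ 3).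
  by apply: bddX; apply: bdd_sum.
rewrite (le_trans (Ex_le P b1 b2 (fun t => sum_cube_le m (fun k => f0 k t))))//.
rewrite ExZ; last by apply: bdd_sum => k _; exact: bddX.
rewrite Ex_sum; last by move=> k _; exact: bddX.
rewrite [in leRHS]exprSr -mulrA ler_wpM2l//.
rewrite -[m in leRHS]card_ord -sum1_card natr_sum mulr_suml; apply: ler_sum => k _.
by rewrite mul1r fA.
Qed.

(** A variable with values 0 and 2 has all its powers proportional to itself. *)
Lemma Ex_dip_pow n th ph (p : nat) : 0 <= ph <= pi / 4 ->
  Ex P (fun t => dip n th ph t ^+ p.+1) <= 2 ^+ p * (3 * (Num.sqrt n%:R * ph) ^+ 3).
Proof.
move=> ph0; rewrite (_ : Ex P _ = 2 ^+ p * Ex P (dip n th ph)).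
  by rewrite ler_wpM2l ?exprn_ge0// (Ex_dip iid).
rewrite -ExZ; last exact: bdd_dip.
apply: eq_Ex => t; have [->|->] := dip_cases omega n th ph t.
  by rewrite expr0n mulr0.
by rewrite exprSr.
Qed.

Lemma dip_ge0 n th ph t : 0 <= dip n th ph t.
Proof. by have [->|->] := dip_cases omega n th ph t. Qed.

(** The sign changes gained when the mesh [ph / 2 ^+ j] is halved. *)
Definition level n th ph m (j : nat) t : R :=
  \sum_(k < 2 ^ j * m) dip n (th + k%:R * (ph / 2 ^+ j)) (ph / 2 ^+ j / 2) t.

Lemma cnt_level n th ph m j t : cnt n th (ph / 2 ^+ j.+1) (2 ^ j.+1 * m) t =
  cnt n th (ph / 2 ^+ j) (2 ^ j * m) t + level n th ph m j t.
Proof.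
rewrite -cnt_double mulnA -expnS; congr (sign_changes _ _ _ _ _ _).
by rewrite exprSr invfM mulrA.
Qed.

Lemma bdd_level n th ph m j : bdd (level n th ph m j).
Proof. by apply: bdd_sum => k _; exact: bdd_dip. Qed.

Lemma level_ge0 n th ph m j t : 0 <= level n th ph m j t.
Proof. by apply: sumr_ge0 => k _; exact: dip_ge0. Qed.

Lemma level_ph ph j : 0 <= ph <= pi / 2 -> 0 <= ph / 2 ^+ j / 2 <= pi / 4.
Proof.
move=> /andP[p0 p2]; have h1 : (1 : R) <= 2 ^+ j by rewrite exprn_ege1// ler1n.
have h0 : (0 : R) < 2 ^+ j by rewrite exprn_gt0.
rewrite divr_ge0 ?divr_ge0 ?(ltW h0)//= ler_pdivrMr// ler_pdivrMr//.
have : ph * 1 <= ph * 2 ^+ j by rewrite ler_wpM2l.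
have pp := pi_gt0 R; have : pi / 4 * 2 * 1 <= pi / 4 * 2 * 2 ^+ j :> R.
  by rewrite ler_wpM2l//; lra.
lra.
Qed.

(** The cube of the number of cells grows like 8^j and the probability of a gain in one cell decays
    like 8^(-j). The bound is uniform in [j], so J halvings cost only a factor of order J^3. *)
Lemma Ex_level3 n th ph m j : 0 <= ph <= pi / 2 ->
  Ex P (fun t => level n th ph m j t ^+ 3) <= 2 * m%:R ^+ 3 * (Num.sqrt n%:R * ph) ^+ 3.
Proof.
move=> ph0.
have := @Ex_sum_cube (fun k => dip n (th + k%:R * (ph / 2 ^+ j)) (ph / 2 ^+ j / 2)) (2 ^ j * m) _
   (fun k => bdd_dip _ _ _ _) (fun k t => dip_ge0 _ _ _ _)
   (fun k _ => Ex_dip_pow n _ 2 (level_ph j ph0)).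
move=> h; apply: (le_trans h); rewrite natrM natrX.
have h0 : (2 : R) ^+ j != 0 by rewrite gt_eqF// exprn_gt0.
have c0 : 0 <= m%:R ^+ 3 * (Num.sqrt n%:R * ph) ^+ 3.
  by rewrite mulr_ge0 ?exprn_ge0// mulr_ge0//; case/andP: ph0.
rewrite [leLHS](_ : _ = 3 / 2 * (m%:R ^+ 3 * (Num.sqrt n%:R * ph) ^+ 3)).
  lra.
by move: h0 (Num.sqrt _) => h0 q; field.
Qed.

(** Here 4^j meets 8^(-j), which leaves a geometric decay in [j]. *)
Lemma Ex_level2 n th ph m j : 0 <= ph <= pi / 2 ->
  Ex P (fun t => level n th ph m j t ^+ 2) <= m%:R ^+ 2 * (Num.sqrt n%:R * ph) ^+ 3 / 2 ^+ j.
Proof.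
move=> ph0.
have := @Ex_sum_sqr (fun k => dip n (th + k%:R * (ph / 2 ^+ j)) (ph / 2 ^+ j / 2)) (2 ^ j * m) _
   (fun k => bdd_dip _ _ _ _)
   (fun k _ => Ex_dip_pow n _ 1 (level_ph j ph0)).
move=> h; apply: (le_trans h); rewrite natrM natrX.
have h1 : (0 : R) < 2 ^+ j by rewrite exprn_gt0.
have h0 : (2 : R) ^+ j != 0 by rewrite gt_eqF.
have c0 : 0 <= m%:R ^+ 2 * (Num.sqrt n%:R * ph) ^+ 3 / 2 ^+ j.
  rewrite divr_ge0 ?(ltW h1)// mulr_ge0 ?exprn_ge0// mulr_ge0//; by case/andP: ph0.
rewrite [leLHS](_ : _ = 3 / 4 * (m%:R ^+ 2 * (Num.sqrt n%:R * ph) ^+ 3 / 2 ^+ j)).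
  lra.
by move: h0 (Num.sqrt _) => h0 q; field.
Qed.

Lemma cnt_sum n th ph m J t : cnt n th (ph / 2 ^+ J) (2 ^ J * m) t =
  cnt n th ph m t + \sum_(j < J) level n th ph m j t.
Proof.
elim: J => [|J IH]; first by rewrite expr0 divr1 expn0 mul1n big_ord0 addr0.
by rewrite cnt_level IH big_ord_recr addrA.
Qed.

Lemma Ex_cnt3 n th ph m J : 0 <= ph <= pi / 2 ->
  Ex P (fun t => cnt n th (ph / 2 ^+ J) (2 ^ J * m) t ^+ 3) <=
  J.+1%:R ^+ 3 * (m%:R ^+ 3 * (1 + 2 * (Num.sqrt n%:R * ph) ^+ 3)).
Proof.
move=> ph0.
pose f k := if k is j.+1 then level n th ph m j else cnt n th ph m.
have E t : cnt n th (ph / 2 ^+ J) (2 ^ J * m) t = \sum_(k < J.+1) f k t.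
  by rewrite cnt_sum big_ord_recl.
under eq_Ex do rewrite E.
have H0 : 0 <= m%:R ^+ 3 * (Num.sqrt n%:R * ph) ^+ 3.
  by rewrite mulr_ge0 ?exprn_ge0// mulr_ge0//; case/andP: ph0.
apply: Ex_sum_cube.
- by case=> [|j]; [exact: bdd_cnt|exact: bdd_level].
- by case=> [|j] t; [exact: cnt_ge0|exact: level_ge0].
- case=> [|j] _ /=.
    apply: (@le_trans _ _ (m%:R ^+ 3)); last by rewrite mulrDr; lra.
    rewrite -[leRHS](Ex_cst P); apply: Ex_le.
    + by apply: bddX; exact: bdd_cnt.
    + exact: bdd_cst.
    + by move=> t; rewrite lerXn2r ?nnegrE ?cnt_ge0 ?cnt_le.
  by rewrite (le_trans (Ex_level3 _ _ _ _ ph0))// mulrDr; have := exprn_ge0 3 (ler0n R m); lra.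
Qed.

(** Uniform in [k], so it survives the limit to the number of zeros. Induction with (a + b)^2 <= 3
    a^2 + 3/2 b^2; the constant satisfies 12 = 3 + (3/2)(12/2). *)
Lemma Ex_cnt_diff n th ph m J k : 0 <= ph <= pi / 2 ->
  Ex P (fun t => (cnt n th (ph / 2 ^+ (J + k)) (2 ^ (J + k) * m) t -
                  cnt n th (ph / 2 ^+ J) (2 ^ J * m) t) ^+ 2) <=
  12 * (m%:R ^+ 2 * (Num.sqrt n%:R * ph) ^+ 3) / 2 ^+ J.
Proof.
move=> ph0.
have H0 : 0 <= m%:R ^+ 2 * (Num.sqrt n%:R * ph) ^+ 3.
  by rewrite mulr_ge0 ?exprn_ge0// mulr_ge0//; case/andP: ph0.
have bc j : bdd (cnt n th (ph / 2 ^+ j) (2 ^ j * m)) by exact: bdd_cnt.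
elim: k J => [|k IH] J.
  have J0 : (0 : R) <= 2 ^+ J by rewrite exprn_ge0.
  rewrite addn0; under eq_Ex do rewrite subrr expr0n.
  by rewrite Ex_cst divr_ge0// mulr_ge0.
pose a t := level n th ph m J t.
pose b t := cnt n th (ph / 2 ^+ (J.+1 + k)) (2 ^ (J.+1 + k) * m) t -
            cnt n th (ph / 2 ^+ J.+1) (2 ^ J.+1 * m) t.
have ba : bdd a by exact: bdd_level.
have bb : bdd b by exact: bddB.
apply: (@le_trans _ _ (Ex P (fun t => 3 * a t ^+ 2 + 3 / 2 * b t ^+ 2))).
  apply: Ex_le.
  - by apply: bddX; exact: bddB.
  - by apply: bddD; apply: bddZ; exact: bddX.
  - move=> t; rewrite addnS -addSn.
    have -> : cnt n th (ph / 2 ^+ (J.+1 + k)) (2 ^ (J.+1 + k) * m) t -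
       cnt n th (ph / 2 ^+ J) (2 ^ J * m) t = a t + b t by rewrite /a /b cnt_level; ring.
    by have := sqr_ge0 (2 * a t - b t); lra.
rewrite ExD; [|by apply: bddZ; exact: bddX..].
rewrite !ExZ; [|exact: bddX..].
have h1 := Ex_level2 n th m J ph0; have h2 := IH J.+1.
apply: (@le_trans _ _ (3 * (m%:R ^+ 2 * (Num.sqrt n%:R * ph) ^+ 3 / 2 ^+ J) +
   3 / 2 * (12 * (m%:R ^+ 2 * (Num.sqrt n%:R * ph) ^+ 3) / 2 ^+ J.+1))).
  by apply: lerD; rewrite ler_wpM2l//; lra.
have J0 : (0 : R) < 2 ^+ J by rewrite exprn_gt0.
rewrite (exprS 2 J) le_eqVlt; apply/orP; left; apply/eqP.
move: J0 (m%:R ^+ 2 * _); move: (2 ^+ J) => q q0 y; field; by rewrite gt_eqF.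
Qed.

End Moments.

(** * Decoupling distant blocks *)

Section Decoupling.
Context d (T : measurableType d) (R : realType) (P : probability T R).
Variable omega : nat -> {RV P >-> R}.
Hypothesis iid : iid_standard_gaussian omega.
Local Notation lin := (linear_form omega).
Local Notation X := (kostlan omega).

(** The form [b] is [a] plus an orthogonal noise of variance [e]. After normalization the
    correlation is 1/sqrt(1 + e), and its arc cosine is of order sqrt(e). *)
Lemma Ex_chg_perturb N (a b : nat -> R) (e : R) : dot N a a = 1 -> dot N a b = 1 ->
  dot N b b = 1 + e -> 0 <= e ->
  Ex P (fun t => chg (lin N a t) (lin N b t)) <= Num.sqrt e.
Proof.
move=> aa ab bb e0; set h := Num.sqrt e.
have h0 : 0 <= h by exact: sqrtr_ge0.
have hh : h ^+ 2 = e by rewrite sqr_sqrtr.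
have [h1|h1] := leP 1 h.
  rewrite (le_trans _ h1)// -[leRHS](Ex_cst P); apply: Ex_le.
  - by apply: bdd_chg; exact: measurable_lin.
  - exact: bdd_cst.
  - by move=> t; rewrite (le_trans (ler_norm _))// chg_norm.
pose s := Num.sqrt (1 + e).
have s0 : 0 < s by rewrite sqrtr_gt0; lra.
have ss : s ^+ 2 = 1 + e by rewrite sqr_sqrtr//; lra.
have -> : Ex P (fun t => chg (lin N a t) (lin N b t)) =
          Ex P (fun t => chg (lin N a t) (lin N (fun j => s^-1 * b j) t)).
  by apply: eq_Ex => t; rewrite linZ /chg pmulr_rgt0// invr_gt0.
rewrite (sheppard iid)//; last 2 first.
- by rewrite dotZl dotZr bb -ss; field; rewrite gt_eqF.
- by rewrite dotZr ab mulr1 invr_ge0 ltW.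
rewrite dotZr ab mulr1.
have s1 : 1 <= s by rewrite -(ler_pXn2r (n := 2)) ?nnegrE ?(ltW s0)// ss expr1n; lra.
have i1 : s^-1 <= 1 by rewrite invf_le1.
have r0 : 0 <= s^-1 <= 1 by rewrite invr_ge0 (ltW s0).
have lo : 1 - h ^+ 2 / 2 <= s^-1.
  rewrite -[leRHS]mul1r ler_pdivlMr// hh.
  have : s <= 1 + e / 2.
    rewrite -(ler_pXn2r (n := 2)) ?nnegrE ?(ltW s0)//; last lra.
    by rewrite ss; have := sqr_ge0 (e / 2); lra.
  have e1 : e <= 1 by rewrite -hh expr_le1// ltW.
  nra.
have := acos_upper r0 h0 lo.
have p2 := pi_ge2 R; have p0 := pi_gt0 R.
rewrite ler_pdivrMr// => u; rewrite (le_trans u)//.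
have : h ^+ 3 <= h by rewrite exprS ler_piMr// exprn_ile1// ltW.
have : h * 2 <= h * pi by rewrite ler_wpM2l.
lra.
Qed.

Section Noise.
Variables (I : finType) (n : nat) (th : I -> R) (blk : I -> nat) (e : R).
Hypothesis blkP : forall i j, blk i != blk j -> `|cos (th i - th j)| ^+ n <= e.

Let r i j : R := cos (th i - th j) ^+ n.

(** One fresh coordinate for each ordered pair of points in different blocks. Its two members
    receive coefficients with product -r/2, so the pairs (i, j) and (j, i) together cancel the
    covariance r. *)
Let w (i : I) (p : I * I) : R :=
  if blk p.1 == blk p.2 then 0
  else if i == p.1 then Num.sqrt (`|r p.1 p.2| / 2)
  else if i == p.2 then - Num.sg (r p.1 p.2) * Num.sqrt (`|r p.1 p.2| / 2) else 0.

Let N := (n.+1 + #|{: I * I}|)%N.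

(** The original process, placed in the enlarged coordinate space so that it can be paired with
    [noisy]. *)
Definition pad i (j : nat) : R := if (j < n.+1)%N then xi n (th i) j else 0.

Definition noisy i (j : nat) : R := if (j < n.+1)%N then xi n (th i) j
  else if insub (j - n.+1)%N is Some k then w i (enum_val (k : 'I_#|{: I * I}|)) else 0.

Let dotN (a b : nat -> R) : dot N a b = \sum_(j < n.+1) a j * b j +
  \sum_(k < #|{: I * I}|) a (n.+1 + k)%N * b (n.+1 + k)%N.
Proof.
by rewrite /dot /N big_split_ord.
Qed.

Let noisyS i (k : 'I_#|{: I * I}|) : noisy i (n.+1 + k) = w i (enum_val k).
Proof.
rewrite /noisy ltnNge leq_addr/= addKn insubT//= => kk.
by congr (w i (enum_val _)); exact: val_inj.
Qed.

Let padS i k : pad i (n.+1 + k) = 0.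
Proof. by rewrite /pad ltnNge leq_addr. Qed.

Let xi_lo (f g : I -> nat -> R) i j :
  (forall i (k : 'I_n.+1), f i k = xi n (th i) k) ->
  (forall i (k : 'I_n.+1), g i k = xi n (th i) k) ->
  \sum_(k < n.+1) f i k * g j k = r i j.
Proof.
move=> hf hg; rewrite /r -dot_xi; apply: eq_bigr => k _; by rewrite hf hg.
Qed.

Let noisyl i (k : 'I_n.+1) : noisy i k = xi n (th i) k.
Proof. by rewrite /noisy ltn_ord. Qed.

Let padl i (k : 'I_n.+1) : pad i k = xi n (th i) k.
Proof. by rewrite /pad ltn_ord. Qed.

Lemma lin_pad i t : lin N (pad i) t = X n (th i) t.
Proof.
have := dotN (pad i) (fun j => omega j t); rewrite /dot => h.
rewrite /linear_form h [X in _ + X]big1 ?addr0; last by move=> k _; rewrite padS mul0r.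
by apply: eq_bigr => k _; rewrite padl.
Qed.

Let sumw (f : I * I -> R) : \sum_(k < #|{: I * I}|) f (enum_val k) = \sum_p f p.
Proof.
rewrite (reindex (@enum_rank (I * I)%type)); last exact/onW_bij/enum_rank_bij.
by apply: eq_bigr => p _; rewrite enum_rankK.
Qed.

Lemma dot_noisy i j : blk i != blk j -> dot N (noisy i) (noisy j) = 0.
Proof.
move=> bij; have ij : i != j by apply: contra bij => /eqP ->.
rewrite dotN (xi_lo _ _ noisyl noisyl).
under eq_bigr do rewrite !noisyS.
rewrite (sumw (fun p => w i p * w j p)) (bigD1 (i, j))//= (bigD1 (j, i))/=; last first.
  by apply: contra ij => /eqP [-> _].
rewrite big1 ?addr0; last first.
  move=> [a b] /= /andP[n1 n2]; rewrite /w/=; case: ifP => [|_]; first by rewrite mul0r.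
  have [ia|ia] := eqVneq i a.
    rewrite -ia (eq_sym j i) (negbTE ij); have [jb|jb] := eqVneq j b; last by rewrite mulr0.
    by move: n1; rewrite ia jb eqxx.
  have [ib|ib] := eqVneq i b; last by rewrite mul0r.
  have [ja|ja] := eqVneq j a; first by move: n2; rewrite ja ib eqxx.
  by rewrite -ib eq_sym (negbTE ij) mulr0.
have rC : r j i = r i j by rewrite /r -opprB cosN.
have bji : blk j != blk i by rewrite eq_sym.
have ji : j != i by rewrite eq_sym.
rewrite /w/= (negbTE bij) (negbTE bji) !eqxx (negbTE ij) (negbTE ji) rC.
have s2 : Num.sqrt (`|r i j| / 2) * Num.sqrt (`|r i j| / 2) = `|r i j| / 2.
  by rewrite -expr2 sqr_sqrtr// divr_ge0.
transitivity (r i j - Num.sg (r i j) * 2 * (Num.sqrt (`|r i j| / 2) * Num.sqrt (`|r i j| / 2))).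
  by ring.
rewrite s2; have e3 := numEsg (r i j).
by rewrite {1}e3; field.
Qed.

Lemma dot_pad_noisy i : dot N (pad i) (noisy i) = 1.
Proof.
rewrite dotN (xi_lo _ _ padl noisyl) big1 ?addr0; first by rewrite /r subrr cos0 expr1n.
by move=> k _; rewrite padS mul0r.
Qed.

Lemma dot_pad i : dot N (pad i) (pad i) = 1.
Proof.
rewrite dotN (xi_lo _ _ padl padl) big1 ?addr0; first by rewrite /r subrr cos0 expr1n.
by move=> k _; rewrite padS mul0r.
Qed.

(** A point occurs at most #|I| times as first and #|I| times as second member of a pair, each time
    adding variance at most e/2. *)
Lemma noisy_close i : 0 <= e ->
  Ex P (fun t => chg (X n (th i) t) (lin N (noisy i) t)) <= Num.sqrt (#|I|%:R * e).
Proof.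
move=> e0.
have D : dot N (noisy i) (noisy i) = 1 + \sum_p w i p ^+ 2.
  rewrite dotN (xi_lo _ _ noisyl noisyl) {1}/r subrr cos0 expr1n; congr (_ + _).
  by under eq_bigr do rewrite !noisyS -expr2; rewrite (sumw (fun p => w i p ^+ 2)).
have w0 : 0 <= \sum_p w i p ^+ 2 by apply: sumr_ge0 => p _; exact: sqr_ge0.
have := Ex_chg_perturb (dot_pad i) (dot_pad_noisy i) D w0.
under eq_Ex do rewrite lin_pad.
move=> h; rewrite (le_trans h)// ler_wsqrtr//.
have wle (p : I * I) : w i p ^+ 2 <= e / 2 * (i == p.1)%:R + e / 2 * (i == p.2)%:R.
  have R0 (b b' : bool) : 0 <= e / 2 * b%:R + e / 2 * b'%:R by rewrite addr_ge0// mulr_ge0// divr_ge0.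
  rewrite /w; case: ifPn => [_|nb]; first by rewrite expr0n.
  have re : `|r p.1 p.2| <= e by rewrite /r normrX; exact: blkP.
  have sq : Num.sqrt (`|r p.1 p.2| / 2) ^+ 2 <= e / 2.
    by rewrite sqr_sqrtr ?divr_ge0//; lra.
  have [_|_] := eqVneq i p.1.
    by rewrite mulr1 (le_trans sq)// lerDl mulr_ge0// divr_ge0.
  have [_|_] := eqVneq i p.2; last by rewrite expr0n.
  rewrite mulr0 mulr1 add0r exprMn (le_trans _ sq)// ler_piMl ?sqr_ge0//.
  by rewrite sqrrN sqr_sg; case: (_ != 0).
apply: (le_trans (ler_sum _ (fun p _ => wle p))).
rewrite big_split/= -!mulr_sumr.
have s1 : \sum_(p : I * I) (i == p.1)%:R = #|I|%:R :> R.
  rewrite (eq_bigr (fun p : I * I => (i == p.1)%:R * 1)); last by move=> p _; rewrite mulr1.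
  rewrite -(pair_bigA _ (fun a b => (i == a)%:R * 1))/=.
  rewrite (bigD1 i)//= [X in _ + X]big1 ?addr0; last first.
    by move=> a ai; rewrite big1// => b _; rewrite eq_sym (negbTE ai) mul0r.
  by rewrite -[#|I|]sum1_card natr_sum; apply: eq_bigr => b _; rewrite eqxx mulr1.
have s2 : \sum_(p : I * I) (i == p.2)%:R = #|I|%:R :> R.
  rewrite -(pair_bigA _ (fun a b => (i == b)%:R))/= exchange_big/=.
  rewrite (bigD1 i)//= [X in _ + X]big1 ?addr0; last first.
    by move=> a ai; rewrite big1// => b _; rewrite eq_sym (negbTE ai).
  by rewrite -[#|I|]sum1_card natr_sum; apply: eq_bigr => b _; rewrite eqxx.
by rewrite s1 s2; lra.
Qed.

End Noise.

(* Perturbing the process by an independent noise of tiny variance makes well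
   separated blocks exactly uncorrelated, hence independent. *)
Lemma decouple (I : finType) n (th : I -> R) (blk : I -> nat) (e : R) : 0 <= e ->
  (forall i j, blk i != blk j -> `|cos (th i - th j)| ^+ n <= e) ->
  exists N (y : I -> nat -> R),
   (forall i j, blk i != blk j -> dot N (y i) (y j) = 0) /\
   (forall i, Ex P (fun t => chg (X n (th i) t) (lin N (y i) t)) <= Num.sqrt (#|I|%:R * e)).
Proof.
move=> e0 h; exists (n.+1 + #|{: I * I}|)%N; exists (noisy n th blk); split.
  by move=> i j bij; apply: dot_noisy.
by move=> i; exact: (noisy_close h).
Qed.

End Decoupling.

Section Blocks.
Context d (T : measurableType d) (R : realType) (P : probability T R).
Variable omega : nat -> {RV P >-> R}.
Hypothesis iid : iid_standard_gaussian omega.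
Local Notation lin := (linear_form omega).
Local Notation X := (kostlan omega).
Local Notation cnt := (sign_changes omega).

(** Points at distance near pi are as strongly correlated as neighbours, up to sign, so angle
    differences must keep away from both 0 and pi. *)
Lemma norm_cos_le (g x : R) : 0 <= g <= pi / 2 -> g <= x <= pi - g -> `|cos x| <= cos g.
Proof.
move=> /andP[g0 g2] /andP[gx xg]; have p0 := pi_gt0 R.
have mono u v : 0 <= u -> u <= v -> v <= pi -> cos v <= cos u.
  move=> u0 uv vp; rewrite le_eqVlt; have [->|uv'] := eqVneq u v; first by rewrite eqxx.
  apply/orP; right; rewrite ltr_cos ?in_itv/= ?u0 ?vp ?(le_trans u0 uv) ?(le_trans uv vp)//.
  by rewrite lt_neqAle uv'.
have h1 : cos x <= cos g by apply: mono; lra.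
have h2 : cos (pi - g) <= cos x by apply: mono; lra.
have e : cos (pi - g) = - cos g by rewrite cosB cospi sinpi; ring.
by rewrite ler_norml h1 -e h2.
Qed.

(** A period has [w] cells: a block of [l], then a gap. The last gap lies inside the total length,
    at most pi, which keeps the first and last blocks away from antipodal points. *)
Variables (n q w l : nat) (th0 ph : R).
Hypothesis ph0 : 0 <= ph.
Hypothesis lw : (l <= w)%N.
Hypothesis gap2 : (w - l)%:R * ph <= pi / 2.
Hypothesis total : (q.+1 * w)%:R * ph <= pi.

Let e := cos ((w - l)%:R * ph) ^+ n.

Definition block_changes c t := cnt n (th0 + (c * w)%:R * ph) ph l t.
Local Notation block := block_changes.

Let I : finType := ('I_q.+1 * 'I_l.+1)%type.
Let th (p : I) : R := th0 + (p.1 * w)%:R * ph + (p.2 : nat)%:R * ph.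
Let blk (p : I) : nat := p.1.

Let blkP i j : blk i != blk j -> `|cos (th i - th j)| ^+ n <= e.
Proof.
wlog : i j / (blk i < blk j)%N => [H|ij _].
  rewrite neq_ltn => /orP[h|h]; first by apply: H => //; rewrite neq_ltn h.
  by rewrite -opprB cosN; apply: H => //; rewrite neq_ltn h.
have g0 : 0 <= (w - l)%:R * ph by rewrite mulr_ge0.
have p0 := pi_gt0 R.
rewrite /e lerXn2r ?nnegrE//.
  by apply: cos_ge0_pihalf; rewrite gap2 andbT; lra.
rewrite -opprB cosN; apply: norm_cos_le; first by rewrite g0.
have -> : th j - th i = (j.1 * w + j.2 - (i.1 * w + i.2))%:R * ph.
  rewrite natrB; first by rewrite /th !natrD; ring.
  rewrite /blk in ij; have := ltn_ord i.2; have : (i.1.+1 * w <= j.1 * w)%N by rewrite leq_mul2r ij orbT.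
  rewrite mulSn; move: lw; clear; lia.
have ij' : (i.1.+1 * w <= j.1 * w)%N by rewrite leq_mul2r ij orbT.
have jq : (j.1 * w <= q * w)%N by rewrite leq_mul2r -ltnS ltn_ord orbT.
have i2 := ltn_ord i.2; have j2 := ltn_ord j.2.
rewrite mulSn in ij'.
apply/andP; split.
  by rewrite ler_wpM2r// ler_nat; move: ij' i2 lw; clear; lia.
rewrite lerBrDr -mulrDl -natrD (le_trans _ total)// ler_wpM2r// ler_nat mulSn.
by move: jq j2 lw; clear; lia.
Qed.

(** Independence is stated as factorization between the centred partial sums and the next copy, the
    form used in inductions over blocks. The functions [f] and [g] are arbitrary because the copies
    depend on finitely many signs. *)
Lemma decouple_blocks : exists Bt : nat -> T -> R,
  [/\ (forall c, bdd (Bt c) /\ forall t, 0 <= Bt c t <= l%:R),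
      (forall c, (c < q.+1)%N ->
         Ex P (fun t => `|block c t - Bt c t|) <=
           2 * l.+1%:R * Num.sqrt ((q.+1 * l.+1)%:R * e)) &
      (forall b (f g : R -> R) (m : nat -> R), (b < q.+1)%N ->
         Ex P (fun t => f (\sum_(c < b) (Bt c t - m c)) * g (Bt b t)) =
         Ex P (fun t => f (\sum_(c < b) (Bt c t - m c))) * Ex P (fun t => g (Bt b t)))].
Proof.
have p0 := pi_gt0 R.
have g0 : 0 <= (w - l)%:R * ph by rewrite mulr_ge0.
have e0 : 0 <= e.
  by rewrite /e exprn_ge0// cos_ge0_pihalf// gap2 andbT; lra.
have [N [y [yorth yclose]]] := decouple iid e0 blkP.
pose Y c k := y (inord c, inord k).
pose Bt c t := \sum_(k < l) chg (lin N (Y c k) t) (lin N (Y c k.+1) t).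
have bY c k : bdd (fun t => chg (lin N (Y c k) t) (lin N (Y c k.+1) t)).
  by apply: bdd_chg; exact: measurable_lin.
exists Bt; split.
- move=> c; split; first by apply: bdd_sum.
  move=> t; apply/andP; split; first by apply: sumr_ge0 => k _; exact: chg_ge0.
  rewrite /Bt -[l in leRHS]card_ord -sum1_card natr_sum; apply: ler_sum => k _.
  by apply: le_trans (ler_norm _) (chg_norm _ _).
- move=> c cq.
  pose dl k t := chg (X n (th0 + (c * w)%:R * ph + k%:R * ph) t) (lin N (Y c k) t).
  have bdl k : bdd (dl k) by apply: bdd_chg; exact: measurable_lin.
  have Edl k : (k <= l)%N -> Ex P (dl k) <= Num.sqrt ((q.+1 * l.+1)%:R * e).
    move=> kl; have := yclose (inord c, inord k).
    by rewrite /I card_prod !card_ord /th/= !inordK// ltnS.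
  (* A cell is counted differently only if the noise altered the sign at one of its two ends. *)
  apply: (@le_trans _ _ (Ex P (fun t => \sum_(k < l) (dl k t + dl k.+1 t)))).
    apply: Ex_le.
    + by apply: bdd_norm; apply: bddB; [exact: bdd_cnt|exact: bdd_sum].
    + by apply: bdd_sum => k _; exact: bddD.
    + move=> t; rewrite /block /sign_changes /Bt -sumrB (le_trans (ler_norm_sum _ _ _))//.
      apply: ler_sum => k _; rewrite /dl /chg.
      by do 4 case: (0 < _) => //=; rewrite ?subr0 ?sub0r ?normrN ?normr1 ?normr0 ?subrr ?normr0 ?addr0 ?add0r//.
  rewrite Ex_sum; last by move=> k _; exact: bddD.
  set s := Num.sqrt _ in Edl *.
  have s0 : 0 <= s by exact: sqrtr_ge0.
  apply: (@le_trans _ _ (\sum_(k < l) (2 * s))).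
    apply: ler_sum => k _; rewrite ExD//.
    by have := Edl k (ltnW (ltn_ord k)); have := Edl k.+1 (ltn_ord k); lra.
  rewrite sumr_const card_ord -[_ *+ l]mulr_natr.
  have -> : l.+1%:R = l%:R + 1 :> R by rewrite natr1.
  by clear Edl; move: s0 (ler0n R l); move: (l%:R : R) s => x s; lra.
- move=> b f g m bq.
  (* Blocks from [b] on are replaced by zero forms, so the same index type serves every [b] and
     stays orthogonal to block [b]. *)
  pose A (p : I) : nat -> R := if (p.1 < b)%N then y p else fun=> 0.
  pose B (k : 'I_l.+1) : nat -> R := Y b k.
  have AB i j : dot N (A i) (B j) = 0.
    rewrite /A; case: ifP => ib; last by rewrite /dot big1// => k _; rewrite mul0r.
    by apply: yorth; rewrite /blk/= inordK// neq_ltn ib.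
  pose F (s : {ffun I -> bool}) := f (\sum_(c < b)
    (\sum_(k < l) (s (inord c, inord k) != s (inord c, inord k.+1))%:R - m c)).
  pose G (s : {ffun 'I_l.+1 -> bool}) := g (\sum_(k < l) (s (inord k) != s (inord k.+1))%:R).
  have := bits_indep iid F G AB.
  have FE t : F [ffun i => 0 < lin N (A i) t] = f (\sum_(c < b) (Bt c t - m c)).
    congr f; apply: eq_bigr => c _; congr (_ - _); apply: eq_bigr => k _.
    rewrite !ffunE /A/= inordK ?ltn_ord//.
    by rewrite (ltn_trans (ltn_ord c)).
  have GE t : G [ffun j => 0 < lin N (B j) t] = g (Bt b t).
    congr g; apply: eq_bigr => k _; rewrite !ffunE /B !inordK ?ltnS ?ltn_ord//.
    exact: ltnW.
  under eq_Ex do rewrite FE GE.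
  under [X in _ = X * _ -> _]eq_Ex do rewrite FE.
  by under [X in _ = _ * X -> _]eq_Ex do rewrite GE.
Qed.

End Blocks.

(** * Moments of the sign changes in a block *)

Section CellEstimates.
Context {R : realType}.
Implicit Types (a b h r x : R).

(** The arc cosine is concave on [0, 1], so it lies below its tangent at [r']; the proof is the mean
    value theorem with the monotonicity of the sine on [0, pi/2]. *)
Lemma acos_diff (r r' : R) : 0 <= r <= 1 -> 0 <= r' < 1 ->
  (r - r') / Num.sqrt (1 - r' ^+ 2) <= acos r' - acos r.
Proof.
move=> /andP[r0 r1] /andP[s0 s1].
have p0 := pi_gt0 R.
have i1 : -1 <= r <= 1 by rewrite r1 andbT; lra.
have i2 : -1 <= r' <= 1 by rewrite (ltW s1) andbT; lra.
rewrite -sin_acos//.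
set B := acos r'; set A := acos r.
have cA : cos A = r by rewrite acosK// in_itv.
have cB : cos B = r' by rewrite acosK// in_itv.
have A0 : 0 <= A by exact: acos_ge0.
have B0 : 0 < B by apply: acos_gt0; rewrite s1 andbT; lra.
have half x : 0 <= x -> x <= pi -> 0 <= cos x -> x <= pi / 2.
  move=> x0 xp cx; rewrite leNgt; apply/negP => h.
  have : cos x < cos (pi / 2).
    rewrite ltr_cos ?in_itv/= ?x0 ?xp//; by apply/andP; split; lra.
  by rewrite cos_pihalf; lra.
have A2 : A <= pi / 2 by apply: half; rewrite ?acos_lepi ?cA.
have B2 : B <= pi / 2 by apply: half; rewrite ?(ltW B0) ?acos_lepi ?cB.
have sB : 0 < sin B by apply: sin_gt0_pi; rewrite B0/=; lra.
have sinmono (u v : R) : 0 <= u -> u <= v -> v <= pi / 2 -> sin u <= sin v.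
  move=> u0 uv v2; have [->//|uv'] := eqVneq u v.
  apply: ltW; rewrite ltr_sin ?in_itv/=; first by rewrite lt_neqAle uv'.
    by apply/andP; split; lra.
  by apply/andP; split; lra.
have mvt (u v : R) : u <= v -> exists2 c, c \in `[u, v] & cos v - cos u = - sin c * (v - u).
  move=> uv; apply: (@MVT_segment R cos (fun x => - sin x) u v uv).
  exact: (continuous_subspaceT (@continuous_cos R)).
rewrite ler_pdivrMr// -cA -cB.
have [AB|BA] := leP A B.
  have [c] := mvt A B AB; rewrite in_itv/= => /andP[c1 c2] e.
  have -> : cos A - cos B = sin c * (B - A) by rewrite -opprB e mulNr opprK.
  by rewrite mulrC ler_wpM2l ?subr_ge0// sinmono// (le_trans A0).
have [c] := mvt B A (ltW BA); rewrite in_itv/= => /andP[c1 c2] e.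
rewrite e -[leRHS]opprK -mulNr opprB mulNr lerN2 mulrC ler_wpM2r ?subr_ge0 ?(ltW BA)//.
by apply: sinmono => //; [exact: ltW|exact: le_trans A2].
Qed.

(** In [cell_gain]: y = h^2, e = 1 - r, p = a b and s = (a - b)^2. The middle quantity is the Gram
    determinant of the two tilted forms; 41/100 bounds the square of the slope constant 64/100. *)
Lemma tilted_defect (y e p s : R) : 0 <= y <= 1 / 100 / 100 ->
  y / 2 - y * y / 8 <= e <= y / 2 -> 0 <= p <= 1 -> 0 <= s <= 41 / 100 * y ->
  (98 / 100) * (98 / 100) * y <= 2 * e - e * e - (s + 2 * (e * p)) / 100 <= y.
Proof.
move=> /andP[y0 y1] /andP[e1 e2] /andP[p0 p1] /andP[s0 s1].
have yy : y * y <= y * (1 / 100 / 100) by rewrite ler_wpM2l.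
have e0 : 0 <= e by lra.
have ep : e * p <= e * 1 by rewrite ler_wpM2l.
have ep0 : 0 <= e * p by rewrite mulr_ge0.
have e3 : e <= 1 / 100 / 200 by lra.
have ee : e * e <= e * (1 / 100 / 200) by rewrite ler_wpM2l.
have ee0 : 0 <= e * e by rewrite mulr_ge0.
clear p0 p1; move: yy ep ep0 ee ee0; move: (y * y) (e * p) (e * e) e1 => A B C e1 *.
by apply/andP; split; lra.
Qed.

(** [D] is the geometric mean of the tilted variances 1 - k a^2 and 1 - k b^2; it is compared with
    their arithmetic mean, up to an error of order k^2 (a - b)^2. *)
Lemma sqrt_tilt_ge (k a b D : R) : 0 <= k <= 1 / 100 -> 0 <= a <= 1 -> 0 <= b <= 1 -> 0 <= D ->
  D ^+ 2 = (1 - k * a ^+ 2) * (1 - k * b ^+ 2) ->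
  1 - k * (a ^+ 2 + b ^+ 2) / 2 - 2 * k ^+ 2 * (a - b) ^+ 2 <= D.
Proof.
move=> /andP[k0 k1] /andP[a0 a1] /andP[b0 b1] D0 DD.
set L := leLHS.
have [L0|L0] := ltP L 0; first by apply: le_trans D0; exact: ltW.
rewrite -(ler_pXn2r (n := 2))// ?nnegrE// DD -subr_ge0.
have -> : (1 - k * a ^+ 2) * (1 - k * b ^+ 2) - L ^+ 2 =
  k ^+ 2 * (a - b) ^+ 2 * (4 * (1 - k * (a ^+ 2 + b ^+ 2) / 2 - k ^+ 2 * (a - b) ^+ 2)
        - (a + b) ^+ 2 / 4) by rewrite /L; field.
rewrite mulr_ge0//; first by rewrite mulr_ge0 ?sqr_ge0.
have aa : a ^+ 2 <= 1 by rewrite exprn_ile1.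
have bb : b ^+ 2 <= 1 by rewrite exprn_ile1.
have apb : (a + b) ^+ 2 <= 2 ^+ 2 by rewrite lerXn2r ?nnegrE//; lra.
have amb : (a - b) ^+ 2 <= 1.
  rewrite -subr_ge0 (_ : 1 - _ = (1 - (a - b)) * (1 + (a - b))); last by ring.
  by rewrite mulr_ge0//; lra.
have kk : k ^+ 2 <= 1 by rewrite exprn_ile1//; lra.
have t1 : k * (a ^+ 2 + b ^+ 2) <= 1 / 100 * 2 by rewrite ler_pM ?addr_ge0 ?sqr_ge0//; lra.
have t2 : k ^+ 2 * (a - b) ^+ 2 <= (1 / 100) ^+ 2 * 1 by rewrite ler_pM ?sqr_ge0// lerXn2r ?nnegrE//; lra.
by clear L L0 DD; move: t1 t2 apb; move: (k * _) (k ^+ 2 * _) ((a + b) ^+ 2) => A B C; lra.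
Qed.

(** Tilting by the variance 1 - k turns the covariance r into r - k a b. The identity S^2 = D^2 - (r
    - k a b)^2 makes the tangent slope at the tilted correlation explicit. *)
Lemma acos_tilt (k a b r D S : R) : 0 < D -> 0 < S ->
  D ^+ 2 = (1 - k * a ^+ 2) * (1 - k * b ^+ 2) ->
  S ^+ 2 = (1 - r ^+ 2) - k * ((a - b) ^+ 2 + 2 * (1 - r) * (a * b)) ->
  0 <= r <= 1 -> 0 <= r - k * (a * b) ->
  [/\ 0 <= (r - k * (a * b)) / D <= 1 &
  (r * D - (r - k * (a * b))) / S <= acos ((r - k * (a * b)) / D) - acos r].
Proof.
move=> D0 S0 DD SS r01 rk.
have VE : S ^+ 2 = D ^+ 2 - (r - k * (a * b)) ^+ 2 by rewrite DD SS; ring.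
have r'0 : 0 <= (r - k * (a * b)) / D by rewrite divr_ge0// ltW.
have r'1 : (r - k * (a * b)) / D < 1.
  rewrite ltr_pdivrMr// mul1r -(ltr_pXn2r (n := 2))// ?nnegrE ?(ltW D0)//.
  by rewrite -subr_gt0 -VE exprn_gt0.
split; first by rewrite r'0 ltW.
apply: le_trans (acos_diff r01 _); last by rewrite r'0 r'1.
have -> : 1 - ((r - k * (a * b)) / D) ^+ 2 = (S / D) ^+ 2.
  by rewrite [in RHS]expr_div_n VE; field; rewrite gt_eqF.
rewrite sqrtr_sqr ger0_norm; last by rewrite divr_ge0// ltW.
rewrite le_eqVlt; apply/orP; left; apply/eqP.
by field; rewrite !gt_eqF.
Qed.

(** Effect of the weight on one cell, with [a] and [b] the correlations of its ends with the weight
    point. The term in h a b becomes a Riemann sum over the cells, the loss in a - b telescopes. *)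
Lemma cell_gain (a b h r : R) : let k := 1 / 100 in 0 < h <= 1 / 100 ->
  0 <= b -> b <= a -> a <= 1 -> a - b <= 64 / 100 * h ->
  1 - h ^+ 2 / 2 <= r <= 1 - h ^+ 2 / 2 + h ^+ 4 / 8 ->
  let D := Num.sqrt ((1 - k * a ^+ 2) * (1 - k * b ^+ 2)) in
  [/\ 0 < D, 0 <= (r - k * (a * b)) / D <= 1 &
  k / 2 * (199 / 200 * (h * (a * b)) - 68 / 100 * (a - b)) <=
  acos ((r - k * (a * b)) / D) - acos r].
Proof.
move=> k /andP[h0 h1] b0 ba a1 sl /andP[r1 r2] D.
have a0 : 0 <= a by lra.
have b1 : b <= 1 by lra.
have aa : a ^+ 2 <= 1 by rewrite exprn_ile1.
have bb : b ^+ 2 <= 1 by rewrite exprn_ile1.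
have ab0 : 0 <= a * b by rewrite mulr_ge0.
have ab1 : a * b <= 1 by rewrite mulr_ile1.
have W0 : 0 < (1 - k * a ^+ 2) * (1 - k * b ^+ 2) by rewrite mulr_gt0// /k; lra.
have D0 : 0 < D by rewrite /D sqrtr_gt0.
have DD : D ^+ 2 = (1 - k * a ^+ 2) * (1 - k * b ^+ 2) by rewrite /D sqr_sqrtr// ltW.
have y0 : 0 < h * h by rewrite mulr_gt0.
have y1 : h * h <= 1 / 100 / 100.
  have : h * h <= (1 / 100) * (1 / 100) by rewrite ler_pM// ltW.
  by move: (h * h) => ?; lra.
have yy : (h * h) * (h * h) <= (h * h) * (1 / 100 / 100) by rewrite ler_wpM2l// ltW.
have yy0 : 0 <= (h * h) * (h * h) by rewrite mulr_ge0// ltW.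
rewrite (_ : h ^+ 2 = h * h) in r1 r2 *; last by rewrite expr2.
rewrite (_ : h ^+ 4 = (h * h) * (h * h)) in r2; last by ring.
have x0 : 0 <= a - b by lra.
have sq : (a - b) ^+ 2 <= 41 / 100 * (h * h).
  have : (a - b) ^+ 2 <= (64 / 100 * h) ^+ 2 by rewrite lerXn2r ?nnegrE//; lra.
  rewrite (_ : (64 / 100 * h) ^+ 2 = (64 / 100) * (64 / 100) * (h * h)); last by field.
  by move: y0; clear; move: (h * h) ((a - b) ^+ 2) => *; lra.
pose e := 1 - r.
have e1 : (h * h) / 2 - (h * h) * (h * h) / 8 <= e <= (h * h) / 2.
  by rewrite /e; clear -r1 r2; apply/andP; split; lra.
have re : r = 1 - e by rewrite /e; ring.
have y01 : 0 <= h * h <= 1 / 100 / 100 by rewrite ltW.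
have p01 : 0 <= a * b <= 1 by rewrite ab0.
have s01 : 0 <= (a - b) ^+ 2 <= 41 / 100 * (h * h) by rewrite sqr_ge0.
have /andP[V1 V2] := tilted_defect y01 e1 p01 s01.
have r01 : 0 <= r <= 1.
  rewrite re; case/andP: e1; clear -y0 y1 yy yy0; move: (h * h) y0 y1 yy yy0 => y.
  by move: (y * y) => *; apply/andP; split; lra.
pose V := (1 - r ^+ 2) - k * ((a - b) ^+ 2 + 2 * (1 - r) * (a * b)).
have VE : V = 2 * e - e * e - ((a - b) ^+ 2 + 2 * (e * (a * b))) / 100.
  by rewrite /V /k re; field.
have V0 : 0 < V.
  by rewrite VE; apply: lt_le_trans V1; rewrite mulr_gt0//; lra.
have S0 : 0 < Num.sqrt V by rewrite sqrtr_gt0.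
have SS : Num.sqrt V ^+ 2 = V by rewrite sqr_sqrtr// ltW.
have SU : Num.sqrt V <= h.
  rewrite -(ler_pXn2r (n := 2))// ?nnegrE ?(ltW h0) ?(ltW S0)//.
  by rewrite SS VE (le_trans V2)// expr2.
have SL : 98 / 100 * h <= Num.sqrt V.
  have sh0 : 0 <= 98 / 100 * h by lra.
  rewrite -(ler_pXn2r (n := 2))// ?nnegrE ?(ltW S0)//.
  rewrite SS VE (le_trans _ V1)// (_ : (98 / 100 * h) ^+ 2 = (98 / 100) * (98 / 100) * (h * h)) ?lexx//.
  by field.
have rk : 0 <= r - k * (a * b).
  move: e1 ab1; rewrite re /k; clear -y0 y1 yy yy0; move: (h * h) y0 y1 yy yy0 => y.
  by move: (y * y) (a * b) => ? ? ? ? ? ? /andP[? ?] ?; lra.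
have [r'01 gain] := acos_tilt D0 S0 DD SS r01 rk.
split => //; apply: le_trans gain.
have k01 : 0 <= k <= 1 / 100 by rewrite /k; apply/andP; split; lra.
have a01 : 0 <= a <= 1 by rewrite a0.
have b01 : 0 <= b <= 1 by rewrite b0.
have Dlo := sqrt_tilt_ge k01 a01 b01 (ltW D0) DD.
(* The constant 26/25 = 1 + 4 k makes the coefficient left over for (a - b)^2 proportional to 1 - r,
   hence nonnegative. *)
have num : k / 2 * (2 * (e * (a * b)) - 26 / 25 * (a - b) ^+ 2) <= r * D - (r - k * (a * b)).
  have h6 : 0 <= r * (D - (1 - k * (a ^+ 2 + b ^+ 2) / 2 - 2 * k ^+ 2 * (a - b) ^+ 2)).
    by rewrite mulr_ge0 ?subr_ge0//; case/andP: r01.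
  rewrite -subr_ge0.
  have -> : r * D - (r - k * (a * b)) - k / 2 * (2 * (e * (a * b)) - 26 / 25 * (a - b) ^+ 2) =
    r * (D - (1 - k * (a ^+ 2 + b ^+ 2) / 2 - 2 * k ^+ 2 * (a - b) ^+ 2)) +
    (k / 2 * (26 / 25 - r) - 2 * r * k ^+ 2) * (a - b) ^+ 2 by rewrite /e; field.
  rewrite addr_ge0// mulr_ge0 ?sqr_ge0// (_ : k / 2 * (26 / 25 - r) - 2 * r * k ^+ 2 = (1 - r) * (52 / 100 / 100)).
    by rewrite mulr_ge0//; case/andP: r01 => _ ?; lra.
  by rewrite /k; field.
apply: (@le_trans _ _ ((k / 2 * (2 * (e * (a * b)) - 26 / 25 * (a - b) ^+ 2)) / Num.sqrt V)); last first.
  by rewrite ler_wpM2r// invr_ge0 ltW.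
rewrite -[leRHS]mulrA ler_wpM2l//; first by rewrite /k; lra.
rewrite mulrBl lerB//.
  rewrite ler_pdivlMr//.
  apply: (@le_trans _ _ (199 / 200 * (h * (a * b)) * h)).
    by rewrite ler_wpM2l// mulr_ge0 ?mulr_ge0 ?(ltW h0)//; lra.
  have -> : 199 / 200 * (h * (a * b)) * h = (199 / 200 * (h * h)) * (a * b) by ring.
  rewrite mulrA ler_wpM2r//.
  case/andP: e1; clear -yy y0; move: (h * h) yy y0 => y; move: (y * y) => *; lra.
rewrite ler_pdivrMr//.
apply: (@le_trans _ _ (68 / 100 * (a - b) * (98 / 100 * h))); last first.
  by rewrite ler_wpM2l// mulr_ge0//; lra.
have : 0 <= (a - b) * (64 / 100 * h - (a - b)) by rewrite mulr_ge0//; lra.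
have : 0 <= (a - b) * h by rewrite mulr_ge0// ltW.
rewrite (_ : (a - b) * (64 / 100 * h - (a - b)) = 64 / 100 * ((a - b) * h) - (a - b) ^+ 2); last by ring.
rewrite (_ : 68 / 100 * (a - b) * (98 / 100 * h) = (68 / 100) * (98 / 100) * ((a - b) * h)); last by field.
by clear; move: ((a - b) * h) ((a - b) ^+ 2) => *; lra.
Qed.

End CellEstimates.

(** * Sum of the cell gains on one side of a weight *)

Section SideSum.
Context {R : realType}.
Implicit Types (x h u : R).

(** From exp(1/6) >= 7/6. The rational bound stays far enough below (64/100)^2 to absorb the factor
    100/99 in [cos_sin_le]. *)
Lemma expR1N_le : expR (- 1) <= (6 / 7) ^+ 6 :> R.
Proof.
have h1 : (7 / 6 : R) <= expR (6^-1) by apply: le_trans (expR_ge1Dx _); lra.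
have h2 : (7 / 6 : R) ^+ 6 <= expR 1.
  have -> : (1 : R) = 6%:R * 6^-1 by rewrite mulfV.
  by rewrite expRM_natl lerXn2r ?nnegrE ?expR_ge0//; lra.
rewrite expRN -[(6 / 7) ^+ 6]invrK lef_pV2 ?posrE ?expR_gt0 ?invr_gt0 ?exprn_gt0//; last by lra.
Qed.

Lemma xexpN_le (y : R) : y * expR (- y) <= (6 / 7) ^+ 6.
Proof.
apply: le_trans expR1N_le.
have : y <= expR (y - 1) by apply: le_trans (expR_ge1Dx _); lra.
rewrite -(ler_pM2r (expR_gt0 (- y))) -expRD.
by rewrite (addrAC y) subrr add0r.
Qed.

(** As cos^2 = 1 - sin^2 <= exp(- sin^2), this is n/(n - 1) times y exp(-y) at y = (n - 1) sin^2 x.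
    In units of 1/sqrt(n) the slope of cos^n is thus about exp(-1/2), below 64/100. *)
Lemma cos_sin_le n x : (100 <= n)%N -> 0 <= x <= pi / 2 ->
  n%:R * (cos x ^+ n.-1 * sin x) ^+ 2 <= (64 / 100) ^+ 2.
Proof.
move=> n100 x0; case: n n100 => // n n99 /=.
have n0 : (0 : R) < n%:R by rewrite ltr0n; move: n99; clear; lia.
have c0 : 0 <= cos x.
  by apply: cos_ge0_pihalf; move: x0 => /andP[? ->]; rewrite andbT; have := pi_gt0 R; lra.
set s := sin x ^+ 2.
have s0 : 0 <= s by exact: sqr_ge0.
have cs : cos x ^+ 2 = 1 - s by rewrite /s sin2cos2; ring.
have e1 : (cos x ^+ 2) ^+ n <= expR (- (n%:R * s)).
  rewrite -mulrN expRM_natl lerXn2r ?nnegrE ?expR_ge0 ?sqr_ge0// cs.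
  by apply: le_trans (expR_ge1Dx _).
have := xexpN_le (n%:R * s) => e2.
have e3 : n%:R * (cos x ^+ n * sin x) ^+ 2 <= (6 / 7) ^+ 6.
  apply: le_trans e2; rewrite exprMn -exprM mulnC exprM -/s -mulrA.
  by rewrite ler_wpM2l ?(ltW n0)// mulrC ler_wpM2l.
have n99' : 99 * 1 <= n%:R :> R by rewrite mulr1 ler_nat.
have A0 : 0 <= (cos x ^+ n * sin x) ^+ 2 by exact: sqr_ge0.
move: e3 A0; move: ((cos x ^+ n * sin x) ^+ 2) => A e3 A0.
rewrite -natr1 mulrDl mul1r.
have : 99 * A <= n%:R * A by rewrite ler_wpM2r//; lra.
by move: e3; move: (n%:R * A) => B e3 h; clear -e3 h; lra.
Qed.

Lemma cosX_slope n x ph : (100 <= n)%N -> 0 <= x -> 0 <= ph -> x + ph <= pi / 2 ->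
  cos x ^+ n - cos (x + ph) ^+ n <= 64 / 100 * (Num.sqrt n%:R * ph).
Proof.
move=> n100 x0 ph0 xp.
have D (y : R) : is_derive y 1 (fun x => cos x ^+ n) (n%:R * cos y ^+ n.-1 * - sin y).
  have h := is_deriveX n (is_derive_cos y).
  have -> : (fun x : R => cos x ^+ n) = (@cos R) ^+ n by apply/funext => z; rewrite exprfctE.
  exact: (is_derive_eq h).
have [||c] := @MVT_segment R (fun x => cos x ^+ n) (fun x => n%:R * cos x ^+ n.-1 * - sin x) x (x + ph).
- by rewrite lerDl.
- by apply: continuous_subspaceT => y; exact: (is_derive_continuous D).
rewrite in_itv/= => /andP[c1 c2].
rewrite addrAC subrr add0r => e.
have -> : cos x ^+ n - cos (x + ph) ^+ n = n%:R * (cos c ^+ n.-1 * sin c) * ph.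
  by rewrite -opprB e; ring.
rewrite [leRHS]mulrA ler_wpM2r//.
have s0 : 0 <= Num.sqrt n%:R :> R by exact: sqrtr_ge0.
have ss : Num.sqrt n%:R * Num.sqrt n%:R = n%:R :> R by rewrite -expr2 sqr_sqrtr.
have c02 : 0 <= c <= pi / 2 by apply/andP; split; lra.
have := cos_sin_le n100 c02.
set A := cos c ^+ n.-1 * sin c => h.
have A0 : 0 <= A.
  rewrite mulr_ge0 ?exprn_ge0//; first by apply: cos_ge0_pihalf; rewrite (andP c02).2 andbT; have := pi_gt0 R; lra.
  by apply: sin_ge0_pi; rewrite (andP c02).1/=; have := pi_gt0 R; lra.
rewrite -[X in X * A]ss -[leLHS]mulrA [leRHS]mulrC ler_wpM2l//.
have sA : 0 <= Num.sqrt n%:R * A := mulr_ge0 s0 A0.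
have q0 : (0 : R) <= 64 / 100 by lra.
rewrite -(ler_pXn2r (n := 2))// ?nnegrE.
by rewrite exprMn expr2 ss.
Qed.

(** [G] is the primitive of (1 - x^2/2)^2, a polynomial minorant of exp(-x^2) up to 7/5 < sqrt 2. A
    cell of the Riemann sum loses at most h^2. *)
Lemma gauss_cell (u h : R) : 0 <= u -> 0 <= h <= 1 / 100 -> u + h <= 7 / 5 ->
  let G x : R := x - x ^+ 3 / 3 + x ^+ 5 / 20 in
  is_true (G (u + h) - G u - h * h <= h * ((1 - u ^+ 2 / 2) * (1 - (u + h) ^+ 2 / 2))).
Proof.
move=> u0 /andP[h0 h1] uh G; rewrite -subr_ge0.
have -> : h * ((1 - u ^+ 2 / 2) * (1 - (u + h) ^+ 2 / 2)) - (G (u + h) - G u - h * h) =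
   (h * h) * (1 - h * (1 / 6 + u ^+ 2 / 4) - h * h * u / 4 - h ^+ 3 / 20).
  by rewrite /G; field.
rewrite mulr_ge0 ?mulr_ge0//.
have u2 : u <= 2 by lra.
have uu : u ^+ 2 <= 2 ^+ 2 by rewrite lerXn2r ?nnegrE.
have t1 : h * (1 / 6 + u ^+ 2 / 4) <= 1 / 100 * 2.
  by rewrite ler_pM//; [rewrite addr_ge0 ?divr_ge0 ?sqr_ge0//; lra|move: uu; move: (u ^+ 2) => *; lra].
have t2 : h * h <= 1 / 100 * (1 / 100) by rewrite ler_pM.
have t3 : h * h * u <= (1 / 100 * (1 / 100)) * 2 by rewrite ler_pM// mulr_ge0.
have t4 : h ^+ 3 <= 1 by rewrite exprn_ile1//; lra.
by clear G; move: t1 t3 t4; move: (h * (1 / 6 + _)) (h * h * u) (h ^+ 3) => A B C; clear; lra.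
Qed.

(** The loss telescopes to at most 68/100. The gain is a Riemann sum for the integral of exp(-x^2),
    bounded below by [G] just under 7/5, about 0.737; this margin is what makes the method work. *)
Lemma side_sum (n m : nat) (ph : R) (al : nat -> R) : let h := Num.sqrt n%:R * ph in
  (forall i, al i = cos (i%:R * ph) ^+ n) ->
  (100 <= n)%N -> 0 < h <= 1 / 100 -> m%:R * ph <= pi / 2 -> 7 / 5 <= m%:R * h ->
  1 / 30 <= \sum_(i < m) (199 / 200 * (h * (al i * al i.+1)) - 68 / 100 * (al i - al i.+1)).
Proof.
move=> h alE n100 /andP[h0 h1] mph mh.
have n0 : (0 : R) < Num.sqrt n%:R by rewrite sqrtr_gt0 ltr0n; apply: leq_trans n100.
have ph0 : 0 < ph by move: h0; rewrite /h pmulr_rgt0.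
have in2 i : (i <= m)%N -> 0 <= i%:R * ph <= pi / 2.
  move=> im; rewrite mulr_ge0 ?(ltW ph0)//=; apply: le_trans mph.
  by rewrite ler_wpM2r ?(ltW ph0)// ler_nat.
have al01 i : (i <= m)%N -> 0 <= al i <= 1 by move=> im; rewrite alE; apply: cosX_ge0; exact: in2.
have alge i : (i <= m)%N -> 1 - (i%:R * h) ^+ 2 / 2 <= al i.
  move=> im; rewrite alE; have := cosX_ge n (in2 _ im).
  by rewrite (_ : Num.sqrt n%:R * (i%:R * ph) = i%:R * h) // /h; ring.
rewrite big_split/= sumrN -!mulr_sumr.
have tele : \sum_(i < m) (al i - al i.+1) = 1 - al m.
  elim: (m) => [|j IH]; last by rewrite big_ord_recr/= IH; ring.
  by rewrite big_ord0 alE mul0r cos0 expr1n subrr.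
rewrite tele.
pose W := Num.truncn (7 / 5 / h).
have W1 : W%:R * h <= 7 / 5.
  by rewrite -ler_pdivlMr// truncn_le divr_ge0 ?(ltW h0)//; lra.
have W2 : 7 / 5 < W%:R * h + h.
  have : 7 / 5 / h < W.+1%:R.
    exact: truncnS_gt.
  have e (w : nat) : w.+1%:R * h = w%:R * h + h by rewrite -natr1 mulrDl mul1r.
  by rewrite (ltr_pdivrMr _ _ h0) e.
have Wm : (W <= m)%N.
  by rewrite -(ler_nat R) -(ler_pM2r h0); apply: le_trans mh.
pose G x := x - x ^+ 3 / 3 + x ^+ 5 / 20.
have main : G (W%:R * h) - W%:R * (h * h) <= \sum_(i < m) (h * (al i * al i.+1)).
  apply: (@le_trans _ _ (\sum_(i < W) (h * (al i * al i.+1)))); last first.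
    rewrite -(subnKC Wm) big_split_ord/= lerDl; apply: sumr_ge0 => i _.
    rewrite mulr_ge0 ?(ltW h0)// mulr_ge0//.
      have /al01/andP[//] : (W + i <= m)%N by move: (ltn_ord i) Wm; clear; lia.
    by have /al01/andP[//] : ((W + i).+1 <= m)%N by move: (ltn_ord i) Wm; clear; lia.
  have key j : (j <= W)%N -> G (j%:R * h) - j%:R * (h * h) <= \sum_(i < j) (h * (al i * al i.+1)).
    elim: j => [|j IH] jW; first by rewrite big_ord0 /G; lra.
    rewrite big_ord_recr/=.
    have jh0 : 0 <= j%:R * h by rewrite mulr_ge0 ?(ltW h0).
    have jh1 : j%:R * h + h <= 7 / 5.
      apply: le_trans W1; rewrite -[X in _ + X]mul1r -mulrDl natr1.
      by rewrite ler_wpM2r ?(ltW h0)// ler_nat.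
    have h01 : 0 <= h <= 1 / 100 by rewrite ltW.
    have gc : G (j%:R * h + h) - G (j%:R * h) - h * h <=
       h * ((1 - (j%:R * h) ^+ 2 / 2) * (1 - (j%:R * h + h) ^+ 2 / 2)) := gauss_cell jh0 h01 jh1.
    have e : j.+1%:R * h = j%:R * h + h by rewrite -natr1 mulrDl mul1r.
    have e2 : j.+1%:R * (h * h) = j%:R * (h * h) + h * h by rewrite -natr1 mulrDl mul1r.
    rewrite e e2.
    have jm := leq_trans jW Wm.
    have : h * ((1 - (j%:R * h) ^+ 2 / 2) * (1 - (j%:R * h + h) ^+ 2 / 2)) <= h * (al j * al j.+1).
      rewrite ler_wpM2l ?(ltW h0)//.
      have sq x : 0 <= x -> x <= 7 / 5 -> 0 <= 1 - x ^+ 2 / 2.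
        move=> x0 x1; have : x ^+ 2 <= (7 / 5) ^+ 2 by rewrite lerXn2r ?nnegrE//; lra.
        by move: (x ^+ 2) => *; lra.
      rewrite ler_pM//.
      + by apply: sq => //; lra.
      + by apply: sq => //; lra.
      + by apply: alge; exact: ltnW.
      + by rewrite -e; apply: alge.
    have := IH (ltnW jW); move: gc.
    move: (\sum_(i < j) _) (h * (_ * (1 - (_ + h) ^+ 2 / 2))) (h * (al j * al j.+1)) (G (j%:R * h)) (G (j%:R * h + h)) (j%:R * (h * h)) (h * h) => u v w x y z k; clear; lra.
  exact: key.
have W3 : 139 / 100 <= W%:R * h by lra.
have Wh2 : W%:R * (h * h) <= 7 / 5 * (1 / 100).
  rewrite [leLHS]mulrA; apply: ler_pM => //; last exact: ltW.
  by rewrite mulr_ge0 ?(ltW h0).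
have GW : 139 / 100 * (53 / 100) <= G (W%:R * h).
  move: (W%:R * h) W1 W3 => x x1 x2.
  have -> : G x = x * (1 - x ^+ 2 / 3 + (x ^+ 2) ^+ 2 / 20) by rewrite /G; field.
  have xx : x ^+ 2 <= (7 / 5) ^+ 2 by rewrite lerXn2r ?nnegrE//; lra.
  have : 0 <= (x ^+ 2 - 2) ^+ 2 by exact: sqr_ge0.
  have -> : (x ^+ 2 - 2) ^+ 2 = (x ^+ 2) ^+ 2 - 4 * x ^+ 2 + 4 by ring.
  move=> y0; suff: 53 / 100 <= 1 - x ^+ 2 / 3 + (x ^+ 2) ^+ 2 / 20 by move=> h'; rewrite ler_pM//; lra.
  by move: xx y0; move: (x ^+ 2) => y; move: (y ^+ 2) => z; clear; lra.
have := al01 m (leqnn _) => /andP[am _].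
rewrite -mulr_sumr in main.
move: main Wh2 GW am; move: (h * \sum_(i < m) _) (W%:R * (h * h)) (G _) (al m) => a b c dd; clear; lra.
Qed.

End SideSum.

(** * Lower bound on the variance of a block *)

Section Weights.
Context d (T : measurableType d) (R : realType) (P : probability T R).
Variable omega : nat -> {RV P >-> R}.
Hypothesis iid : iid_standard_gaussian omega.
Local Notation lin := (linear_form omega).

Definition gauss_weight (e : R) N z t : R := expR (- (e * lin N z t ^+ 2)).
Local Notation weight := gauss_weight.

Lemma bdd_weight (e : R) N z : 0 <= e -> bdd (weight e N z).
Proof. by move=> e0; exact: (bdd_compY (bdd_expsq e0) (measurable_lin omega N z)). Qed.

Lemma Ex_expsq_omega (e : R) j : 0 <= e ->
  Ex P (fun t => expR (- (e * omega j t ^+ 2))) = (Num.sqrt (1 + 2 * e))^-1.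
Proof.
move=> e0; set s := (Num.sqrt (1 + 2 * e))^-1.
have g0 : 1 <= Num.sqrt (1 + 2 * e).
  by rewrite -[X in X <= _]sqrtr1 ler_wsqrtr//; lra.
have s01 : 0 < s <= 1.
  by rewrite /s invr_gt0 (lt_le_trans ltr01 g0)/= invf_le1// (lt_le_trans ltr01 g0).
have es : e = (s ^- 2 - 1) / 2.
  by rewrite /s -exprVn invrK sqr_sqrtr; [field|lra].
have := Ex_weight_cos_omega iid j 0 0 s01.
rewrite -es cos0 expr0n/= mulr0 mul0r oppr0 expR0 !mulr1 => <-.
by apply: eq_Ex => t; rewrite mul0r addr0 cos0 mulr1.
Qed.

(** The forms x + y and x - y are uncorrelated and x^2 + y^2 is half the sum of their squares, so
    the expectation splits into two one-dimensional integrals. *)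
Lemma Ex_weight2 (e : R) N x y : 0 <= e -> dot N x x = 1 -> dot N y y = 1 ->
  Ex P (fun t => weight e N x t * weight e N y t) =
  (Num.sqrt (1 + 2 * (e * (1 + dot N x y))))^-1 * (Num.sqrt (1 + 2 * (e * (1 - dot N x y))))^-1.
Proof.
move=> e0 xx yy; set r := dot N x y.
pose u j := x j + 1 * y j.
pose v j := x j + -1 * y j.
have uu : dot N u u = 2 * (1 + r).
  by rewrite /u dotDl !dotDr !dotZl !dotZr xx yy (dotC N y x) -/r; ring.
have vv : dot N v v = 2 * (1 - r).
  by rewrite /v dotDl !dotDr !dotZl !dotZr xx yy (dotC N y x) -/r; ring.
have uv : dot N u v = 0.
  by rewrite /u /v dotDl !dotDr !dotZl !dotZr xx yy (dotC N y x) -/r; ring.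
have r1 : 0 <= 1 + r.
  by rewrite -(pmulr_rge0 _ (ltr0Sn R 1)) -uu sumr_ge0// => j _; rewrite -expr2 sqr_ge0.
have r2 : 0 <= 1 - r.
  by rewrite -(pmulr_rge0 _ (ltr0Sn R 1)) -vv sumr_ge0// => j _; rewrite -expr2 sqr_ge0.
pose a := Num.sqrt (2 * (1 + r)); pose b := Num.sqrt (2 * (1 - r)).
have aa : a ^+ 2 = 2 * (1 + r) by rewrite sqr_sqrtr// mulr_ge0.
have bb : b ^+ 2 = 2 * (1 - r) by rewrite sqr_sqrtr// mulr_ge0.
pose A (i : bool) := if i then u else v.
pose A' (i : bool) (j : nat) : R := if i then a * (j == 0)%:R else b * (j == 1)%:R.
have l2 (i : bool) t : lin 2 (A' i) t = if i then a * omega 0 t else b * omega 1 t.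
  by rewrite /linear_form !big_ord_recr big_ord0 /A'/=; case: i => /=; ring.
have AA' i j : dot N (A i) (A j) = dot 2 (A' i) (A' j).
  rewrite [RHS]/dot !big_ord_recr big_ord0/= /A'; case: i; case: j => /=.
  - by rewrite uu -aa; ring.
  - by rewrite uv; ring.
  - by rewrite dotC uv; ring.
  - by rewrite vv -bb; ring.
have m M (B : bool -> nat -> R) i : measurable_fun setT (fun t => lin M (B i) t - 0).
  by apply: measurable_funB => //; exact: measurable_lin.
have e2 : 0 <= e / 2 by rewrite divr_ge0.
have bw M (B : bool -> nat -> R) i : bdd (fun t => 1 * expR (- (e / 2 * (lin M (B i) t - 0) ^+ 2))).
  by apply: bddM; [exact: bdd_cst|exact: (bdd_compY (bdd_expsq e2) (m M B i))].
have h1 := same_cf_weight (m N A) (m 2 A') (bdd_cst T 1) (bdd_cst T 1)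
   (same_cf_gram iid (fun=> 0) AA') true e2.
have := same_cf_weight (m N A) (m 2 A') (bw N A true) (bw 2 A' true) h1 false e2 (fun=> 0) 0.
have z0 M (B : bool -> nat -> R) t : cos (\sum_i 0 * (lin M (B i) t - 0) + 0 : R) = 1.
  by rewrite big1 ?addr0 ?cos0// => i _; rewrite mul0r.
rewrite mul1r.
rewrite (_ : Ex P _ = Ex P (fun t => weight e N x t * weight e N y t)); last first.
  apply: eq_Ex => t; rewrite z0 mul1r mulr1 /weight -!expRD; congr expR.
  by rewrite !subr0 /A /u /v !linD !linZ; field.
move=> ->.
pose f1 (y : R) := expR (- (e * (1 + r) * y ^+ 2)).
pose f2 (y : R) := expR (- (e * (1 - r) * y ^+ 2)).
have b1 : bdd f1 by apply: bdd_expsq; rewrite mulr_ge0.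
have b2 : bdd f2 by apply: bdd_expsq; rewrite mulr_ge0.
have := @Ex_prod _ _ _ _ _ iid.1 (fun j => if j == 0%N then f1 else f2) 2.
rewrite !big_ord_recr !big_ord0/= !mul1r !Ex_expsq_omega ?mulr_ge0// => <-.
  apply: eq_Ex => t; rewrite z0 mul1r mulr1 !big_ord_recr big_ord0/= mul1r !subr0 !l2 /f1 /f2.
  by rewrite !exprMn aa bb; congr (expR _ * expR _); field.
by move=> j; case: ifP.
Qed.

Lemma Ex_weight1 (e : R) N x : 0 <= e -> dot N x x = 1 ->
  Ex P (weight e N x) = (Num.sqrt (1 + 2 * e))^-1.
Proof.
move=> e0 xx.
have e2 : 0 <= e / 2 by rewrite divr_ge0.
have := Ex_weight2 e2 xx xx.
rewrite xx subrr mulr0 mulr0 addr0 sqrtr1 invr1 mulr1.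
have -> : e / 2 * (1 + 1) = e by field.
by move=> <-; apply: eq_Ex => t; rewrite /weight -expRD; congr expR; field.
Qed.

Lemma chgZ (a b x y : R) : 0 < a -> 0 < b -> chg (a * x) (b * y) = chg x y.
Proof. by move=> a0 b0; rewrite /chg !pmulr_rgt0. Qed.

(** [bits_tilt] replaces the forms by ones with variances 1 - k a^2, 1 - k b^2 and covariance r - k
    a b. Normalizing them does not alter signs, so Sheppard's formula applies. *)
Lemma Ex_weight_chg (s : R) N x y z : 0 < s <= 1 ->
  dot N x x = 1 -> dot N y y = 1 -> dot N z z = 1 ->
  let k := 1 - s ^+ 2 in
  let a := dot N x z in let b := dot N y z in
  0 < 1 - k * a ^+ 2 -> 0 < 1 - k * b ^+ 2 -> 0 <= dot N x y - k * (a * b) ->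
  Ex P (fun t => weight ((s ^- 2 - 1) / 2) N z t * chg (lin N x t) (lin N y t)) =
  s * (acos ((dot N x y - k * (a * b)) / Num.sqrt ((1 - k * a ^+ 2) * (1 - k * b ^+ 2))) / pi).
Proof.
move=> s01 xx yy zz k a b ka kb rk.
pose A (i : bool) := if i then x else y.
pose F (t : {ffun bool -> bool}) : R := (t true != t false)%:R.
have := bits_tilt iid A F s01 zz.
pose A' (w : nat -> R) (j : nat) := w j + (s - 1) * dot N w z * z j.
rewrite (_ : Ex P _ = Ex P (fun t => weight ((s ^- 2 - 1) / 2) N z t * chg (lin N x t) (lin N y t))); last first.
  by apply: eq_Ex => t; rewrite /F !ffunE.
move=> ->; congr (_ * _).
have A'd w w' : dot N (A' w) (A' w') = dot N w w' - k * (dot N w z * dot N w' z).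
  rewrite /A' dotDl !dotDr !dotZl !dotZr zz (dotC N z w') /k; ring.
pose B w l := \sum_(j < N) l j * w j.
pose p := (Num.sqrt (1 - k * a ^+ 2))^-1; pose q := (Num.sqrt (1 - k * b ^+ 2))^-1.
have p0 : 0 < p by rewrite invr_gt0 sqrtr_gt0.
have q0 : 0 < q by rewrite invr_gt0 sqrtr_gt0.
have pp : p ^+ 2 * (1 - k * a ^+ 2) = 1.
  by rewrite exprVn sqr_sqrtr ?(ltW ka)// mulVf ?gt_eqF.
have qq : q ^+ 2 * (1 - k * b ^+ 2) = 1.
  by rewrite exprVn sqr_sqrtr ?(ltW kb)// mulVf ?gt_eqF.
transitivity (Ex P (fun t => chg (lin N (fun j => p * A' x j) t) (lin N (fun j => q * A' y j) t))).
  by apply: eq_Ex => t; rewrite /F !ffunE !linZ chgZ.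
rewrite (sheppard iid).
- congr (acos _ / pi); rewrite dotZl dotZr A'd -/a -/b sqrtrM ?(ltW ka)// invfM.
  by rewrite -/p -/q; ring.
- by rewrite dotZl dotZr A'd xx -/a; transitivity (p ^+ 2 * (1 - k * a ^+ 2)); [ring|exact: pp].
- by rewrite dotZl dotZr A'd yy -/b; transitivity (q ^+ 2 * (1 - k * b ^+ 2)); [ring|exact: qq].
- by rewrite dotZl dotZr A'd -/a -/b !mulr_ge0// ltW.
Qed.

Lemma cov_weight_chg (h : R) N x y z : dot N x x = 1 -> dot N y y = 1 -> dot N z z = 1 ->
  let s : R := Num.sqrt (99 / 100) in let a := dot N x z in let b := dot N y z in
  0 < h <= 1 / 100 -> 0 <= b -> b <= a -> a <= 1 -> a - b <= 64 / 100 * h ->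
  1 - h ^+ 2 / 2 <= dot N x y <= 1 - h ^+ 2 / 2 + h ^+ 4 / 8 ->
  s * Ex P (fun t => chg (lin N x t) (lin N y t)) +
    s * (1 / 200 / pi) * (199 / 200 * (h * (a * b)) - 68 / 100 * (a - b)) <=
  Ex P (fun t => weight ((s ^- 2 - 1) / 2) N z t * chg (lin N x t) (lin N y t)).
Proof.
move=> xx yy zz s a b hh b0 ba a1 sl rr.
have s0 : 0 < s by rewrite sqrtr_gt0; lra.
have ss : s ^+ 2 = 99 / 100 by rewrite sqr_sqrtr//; lra.
have s1 : s <= 1 by rewrite -[X in _ <= X]sqrtr1 ler_wsqrtr//; lra.
have s01 : 0 < s <= 1 by rewrite s0.
have ks : 1 - s ^+ 2 = 1 / 100 by rewrite ss; field.
have [D0 /andP[c0 c1] gain] := cell_gain hh b0 ba a1 sl rr.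
have a0 : 0 <= a by apply: le_trans ba.
have aa : a ^+ 2 <= 1 by rewrite exprn_ile1.
have bb : b ^+ 2 <= 1 by rewrite exprn_ile1 ?(le_trans ba).
have aa0 : 0 < 1 - 1 / 100 * a ^+ 2 by lra.
have bb0 : 0 < 1 - 1 / 100 * b ^+ 2 by lra.
have rk : 0 <= dot N x y - 1 / 100 * (a * b).
  by move: c0; rewrite pmulr_lge0// invr_gt0.
have r0 : 0 <= dot N x y.
  by apply: le_trans rk _; rewrite lerBlDr lerDl !mulr_ge0//; lra.
have := Ex_weight_chg s01 xx yy zz; rewrite /= ks -/a -/b => ->//.
rewrite (sheppard iid)// -mulrA -mulrDr ler_wpM2l ?(ltW s0)//.
have pi0 := pi_gt0 R.
rewrite mulrAC -mulrDl ler_wpM2r ?invr_ge0 ?(ltW pi0)// -lerBrDl.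
by apply: le_trans gain; rewrite le_eqVlt; apply/orP; left; apply/eqP; field.
Qed.

(** Here e = 1/198 and the product under the roots is (100/99)^2 - (r/99)^2. Squaring leaves a cubic
    inequality in z = r^2 on [0, 1]. *)
Lemma cov_weight (N : nat) x y : dot N x x = 1 -> dot N y y = 1 ->
  let s : R := Num.sqrt (99 / 100) in let e := (s ^- 2 - 1) / 2 in
  is_true (Ex P (fun t => (weight e N x t - s) * (weight e N y t - s)) <= dot N x y ^+ 2).
Proof.
move=> xx yy s e; set r := dot N x y.
have s0 : 0 < s by rewrite sqrtr_gt0; lra.
have ss : s ^+ 2 = 99 / 100 by rewrite sqr_sqrtr//; lra.
have eE : e = 1 / 198 by rewrite /e ss; field.
have e0 : 0 <= e by rewrite eE; lra.
have bx := bdd_weight N x e0; have b_y := bdd_weight N y e0.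
have Ws w : dot N w w = 1 -> Ex P (weight e N w) = s.
  move=> ww; rewrite Ex_weight1// eE /s -sqrtrV; last by lra.
  by congr Num.sqrt; field.
rewrite (_ : Ex P _ = Ex P (fun t => weight e N x t * weight e N y t) - s * s); last first.
  rewrite -[in s * s](Ws x)// mulrC -ExZ// -ExB//; last 2 first.
  - exact: bddM.
  - exact: bddZ.
  transitivity (Ex P (fun t => (weight e N x t * weight e N y t - s * weight e N x t) -
    s * (weight e N y t - s))).
    by apply: eq_Ex => t; ring.
  have b1 : bdd (fun t => weight e N y t - s) by apply: bddB => //; exact: bdd_cst.
  have b2 : bdd (fun t => weight e N x t * weight e N y t - s * weight e N x t).
    by apply: bddB; [exact: bddM|exact: bddZ].
  rewrite (ExB P b2 (bddZ s b1)).
  rewrite (ExZ P s b1) (ExB P b_y (bdd_cst T s)) Ex_cst (Ws y)// subrr mulr0 subr0.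
  by rewrite Ws.
have r2 : r ^+ 2 <= 1.
  have h1 : 0 <= dot N (fun j => x j + 1 * y j) (fun j => x j + 1 * y j).
    by rewrite sumr_ge0// => j _; rewrite -expr2 sqr_ge0.
  have h2 : 0 <= dot N (fun j => x j + -1 * y j) (fun j => x j + -1 * y j).
    by rewrite sumr_ge0// => j _; rewrite -expr2 sqr_ge0.
  rewrite dotDl !dotDr !dotZl !dotZr xx yy (dotC N y x) -/r in h1.
  rewrite dotDl !dotDr !dotZl !dotZr xx yy (dotC N y x) -/r in h2.
  rewrite -subr_ge0 (_ : 1 - _ = (1 - r) * (1 + r)); last by ring.
  by rewrite mulr_ge0//; lra.
have rr0 : 0 <= r ^+ 2 by exact: sqr_ge0.
rewrite Ex_weight2// -/r -expr2 ss lerBlDr.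
have /andP[rl ru] : -1 <= r <= 1.
  by rewrite -ler_norml -(expr_le1 (n := 2))// -normrX ger0_norm.
have k1 : 0 < 1 + 2 * (e * (1 + r)).
  by rewrite eE; lra.
have k2 : 0 < 1 + 2 * (e * (1 - r)).
  by rewrite eE; lra.
rewrite -invfM -sqrtrM ?(ltW k1)//.
have k3 : (1 + 2 * (e * (1 + r))) * (1 + 2 * (e * (1 - r))) = (100 / 99) ^+ 2 - (1 / 99) ^+ 2 * r ^+ 2.
  by rewrite eE; field.
rewrite k3; set q := _ - _.
have q0 : 0 < q by rewrite /q -k3 mulr_gt0.
have v0 : 0 < r ^+ 2 + 99 / 100 by lra.
rewrite -[leRHS]invrK lef_pV2 ?posrE ?sqrtr_gt0 ?invr_gt0//.
rewrite -(ler_pXn2r (n := 2))// ?nnegrE ?invr_ge0 ?(ltW v0) ?sqrtr_ge0//.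
rewrite sqr_sqrtr ?(ltW q0)// exprVn -[leLHS]mul1r ler_pdivrMr ?exprn_gt0//.
rewrite /q; move: r2 rr0; move: (r ^+ 2) => z z1 z0.
have -> : ((100 / 99) ^+ 2 - (1 / 99) ^+ 2 * z) * (z + 99 / 100) ^+ 2 =
   1 + z * ((100 / 99) ^+ 2 * (198 / 100) - (1 / 99) ^+ 2 * (99 / 100) ^+ 2) +
   z ^+ 2 * ((100 / 99) ^+ 2 - (1 / 99) ^+ 2 * (198 / 100)) - (1 / 99) ^+ 2 * z ^+ 3 by field.
have z3 : z ^+ 3 <= 1 * z by rewrite exprSr ler_wpM2r// exprn_ile1.
have z2 : 0 <= z ^+ 2 by exact: sqr_ge0.
by move: z3 z2; move: (z ^+ 3) (z ^+ 2) => u v; lra.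
Qed.

End Weights.

Section VarianceLowerBound.
Context d (T : measurableType d) (R : realType) (P : probability T R).

(* Cauchy-Schwarz against the test statistic [\sum_k W k]. *)
Lemma var_test (B : T -> R) (K : nat) (W : nat -> T -> R) (s c : R) (r : nat -> nat -> R) :
  0 <= c -> bdd B -> (forall k, bdd (W k)) -> (forall k, Ex P (W k) = s) ->
  (forall k, (k < K)%N -> s * Ex P B + c <= Ex P (fun t => W k t * B t)) ->
  (forall i j, Ex P (fun t => (W i t - s) * (W j t - s)) <= r i j) ->
  (forall i, (i < K)%N -> \sum_(j < K) r i j <= 3) ->
  c ^+ 2 * K%:R / 3 <= Ex P (fun t => (B t - Ex P B) ^+ 2).
Proof.
move=> c0 bB bW EW cov rW rs.
(* The value c/3 maximizes 2 l K c - 3 l^2 K, the guaranteed reduction of the variance. *)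
set m := Ex P B; pose l := c / 3.
have bW' k : bdd (fun t => W k t - s) by apply: bddB => //; exact: bdd_cst.
have bB' : bdd (fun t => B t - m) by apply: bddB => //; exact: bdd_cst.
have bWB k : bdd (fun t => (W k t - s) * (B t - m)) by exact: bddM.
have bWW i j : bdd (fun t => (W i t - s) * (W j t - s)) by exact: bddM.
have E0 : 0 <= Ex P (fun t => (B t - m - l * \sum_(k < K) (W k t - s)) ^+ 2).
  by apply: Ex_ge0 => t; exact: sqr_ge0.
have bS1 : bdd (fun t => \sum_(k < K) (W k t - s) * (B t - m)) by exact: bdd_sum.
have bS2 : bdd (fun t => \sum_(i < K) \sum_(j < K) (W i t - s) * (W j t - s)).
  by apply: bdd_sum => i _; exact: bdd_sum.
rewrite (_ : Ex P _ = Ex P (fun t => (B t - m) ^+ 2) -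
   2 * l * (\sum_(k < K) Ex P (fun t => (W k t - s) * (B t - m))) +
   l ^+ 2 * \sum_(i < K) \sum_(j < K) Ex P (fun t => (W i t - s) * (W j t - s))) in E0; last first.
  rewrite -Ex_sum; last by move=> k _; exact: bWB.
  under [X in _ + _ * X]eq_bigr => i _.
    rewrite -Ex_sum; last by move=> j _; exact: bWW.
    over.
  rewrite -Ex_sum; last by move=> i _; exact: bdd_sum.
  rewrite -ExZ// -ExZ// -ExB; [|exact: bddX|exact: bddZ].
  rewrite -ExD; [|by apply: bddB; [exact: bddX|exact: bddZ]|exact: bddZ].
  apply: eq_Ex => t.
  have -> : \sum_(k < K) (W k t - s) * (B t - m) = (\sum_(k < K) (W k t - s)) * (B t - m).
    by rewrite mulr_suml.
  have -> : \sum_(i < K) \sum_(j < K) (W i t - s) * (W j t - s) = (\sum_(k < K) (W k t - s)) ^+ 2.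
    by rewrite expr2 mulr_suml; apply: eq_bigr => i _; rewrite mulr_sumr.
  by ring.
have S1 : K%:R * c <= \sum_(k < K) Ex P (fun t => (W k t - s) * (B t - m)).
  rewrite -[K in K%:R]card_ord mulr_natl -sumr_const; apply: ler_sum => k _.
  rewrite (_ : Ex P _ = Ex P (fun t => W k t * B t) - s * m).
    by have := cov k (ltn_ord k); rewrite -/m; lra.
  transitivity (Ex P (fun t => W k t * B t - s * B t - m * (W k t - s))).
    by apply: eq_Ex => t; ring.
  rewrite (ExB P (_ : bdd (fun t => W k t * B t - s * B t)) (bddZ m (bW' k))); last first.
    by apply: bddB; [exact: bddM|exact: bddZ].
  rewrite (ExB P (bddM (bW k) bB) (bddZ s bB)) !ExZ// (ExB P (bW k) (bdd_cst T s)) Ex_cst EW.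
  by rewrite subrr mulr0 subr0.
have S2 : \sum_(i < K) \sum_(j < K) Ex P (fun t => (W i t - s) * (W j t - s)) <= K%:R * 3.
  rewrite -[K in K%:R]card_ord mulr_natl -sumr_const; apply: ler_sum => i _.
  by apply: le_trans (rs i (ltn_ord i)); apply: ler_sum => j _; exact: rW.
have l0 : 0 <= l by rewrite /l divr_ge0.
have h1 : 2 * l * (K%:R * c) <= 2 * l * \sum_(k < K) Ex P (fun t => (W k t - s) * (B t - m)).
  by rewrite ler_wpM2l// mulr_ge0.
have h2 : l ^+ 2 * (\sum_(i < K) \sum_(j < K) Ex P (fun t => (W i t - s) * (W j t - s))) <=
   l ^+ 2 * (K%:R * 3).
  by rewrite ler_wpM2l// sqr_ge0.
have e1 : 2 * l * (K%:R * c) - l ^+ 2 * (K%:R * 3) = c ^+ 2 * K%:R / 3 by rewrite /l; field.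
rewrite -e1; lra.
Qed.

Lemma sum_half_le m : \sum_(j < m) (2^-1 : R) ^+ j <= 2.
Proof.
suff : \sum_(j < m) (2^-1 : R) ^+ j + 2 * 2^-1 ^+ m <= 2.
  by apply: le_trans; rewrite lerDl mulr_ge0// exprn_ge0// invr_ge0.
elim: m => [|m IH]; first by rewrite big_ord0 add0r expr0 mulr1.
apply: le_trans IH; rewrite big_ord_recr/= -addrA lerD2l exprS mulrA mulfV// mul1r.
by move: (_ ^+ m : R) => x; lra.
Qed.

(** The terms with j >= i sum to at most 2, the others to at most 1. *)
Lemma sum_half_dist i K : (i < K)%N ->
  \sum_(j < K) (2^-1 : R) ^+ `|i%:Z - j%:Z|%N <= 3.
Proof.
move=> iK; rewrite -(subnKC (ltnW iK)) big_split_ord/=.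
apply: (@le_trans _ _ (1 + 2)); last by lra.
apply: lerD; last first.
  apply: le_trans (sum_half_le (K - i)); apply: ler_sum => j _.
  by rewrite le_eqVlt; apply/orP; left; apply/eqP; congr (_ ^+ _); move: (nat_of_ord j) => k; clear; lia.
rewrite (reindex_inj rev_ord_inj)/=.
have := sum_half_le i.+1; rewrite big_ord_recl/= expr0.
suff -> : \sum_(i0 < i) (2^-1 : R) ^+ bump 0 i0 = \sum_(j < i) 2^-1 ^+ `|i%:Z - (i - j.+1)%N%:Z|%N by lra.
apply: eq_bigr => j _; congr (_ ^+ _); rewrite /bump/=.
by move: (ltn_ord j); move: (nat_of_ord j) => k; clear; lia.
Qed.

End VarianceLowerBound.

Section BlockVariance.
Context d (T : measurableType d) (R : realType) (P : probability T R).
Variable omega : nat -> {RV P >-> R}.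
Hypothesis iid : iid_standard_gaussian omega.
Local Notation X := (kostlan omega).
Local Notation cnt := (sign_changes omega).
Local Notation weight := (gauss_weight omega).
Variables (n l : nat) (th0 ph : R).
Hypothesis n100 : (100 <= n)%N.
Let h := Num.sqrt n%:R * ph.
Hypothesis h01 : 0 < h <= 1 / 100.
Hypothesis lph : l%:R * ph <= pi / 2.

Let s : R := Num.sqrt (99 / 100).
Let e : R := (s ^- 2 - 1) / 2.
Let th k := th0 + k%:R * ph.
Let W k := weight e n.+1 (xi n (th k)).
Let al i : R := cos (i%:R * ph) ^+ n.
Let g i := 199 / 200 * (h * (al i * al i.+1)) - 68 / 100 * (al i - al i.+1).

Let sn0 : 0 < Num.sqrt n%:R :> R.
Proof. by rewrite sqrtr_gt0 ltr0n; apply: leq_trans n100. Qed.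

Let ph0 : 0 < ph.
Proof. by case/andP: h01 => h0 _; move: h0; rewrite /h pmulr_rgt0. Qed.

Let s0 : 0 < s. Proof. by rewrite sqrtr_gt0; lra. Qed.

Let e0 : 0 <= e.
Proof. by rewrite /e /s sqr_sqrtr; lra. Qed.

(** The weight sits at [a3], with [a1] and [a2] the nearer and the farther end of the cell. Only
    cosines of differences are assumed, so the two sides of the weight are treated alike. *)
Let cell (a1 a2 a3 : R) i : (i < l)%N ->
  cos (a1 - a2) = cos ph -> cos (a1 - a3) = cos (i%:R * ph) -> cos (a2 - a3) = cos (i.+1%:R * ph) ->
  s * Ex P (fun t => chg (X n a1 t) (X n a2 t)) + s * (1 / 200 / pi) * g i <=
  Ex P (fun t => weight e n.+1 (xi n a3) t * chg (X n a1 t) (X n a2 t)).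
Proof.
move=> il c12 c13 c23.
have iph k : (k <= l)%N -> 0 <= k%:R * ph <= pi / 2.
  move=> kl; rewrite mulr_ge0 ?(ltW ph0)//=; apply: le_trans lph.
  by rewrite ler_wpM2r ?(ltW ph0)// ler_nat.
have p1 : 0 <= ph <= pi / 2.
  by have := iph 1%N; rewrite mul1r; apply; apply: leq_trans il.
have i1 := iph i (ltnW il); have i2 := iph i.+1 il.
have eS : i.+1%:R * ph = i%:R * ph + ph by rewrite -natr1 mulrDl mul1r.
have := cov_weight_chg iid (dot_xi1 n a1) (dot_xi1 n a2) (dot_xi1 n a3) h01.
rewrite !dot_xi c12 c13 c23 /= -/s -/e; apply.
- by case/andP: (cosX_ge0 n i2).
- have c0 : 0 <= cos (i.+1%:R * ph).
    by apply: cos_ge0_pihalf; case/andP: i2 => i20 ->; rewrite andbT; have := pi_gt0 R; lra.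
  have c1 : cos (i.+1%:R * ph) <= cos (i%:R * ph).
    apply: ltW; rewrite ltr_cos ?in_itv/= ?eS ?ltrDl//; have := pi_gt0 R.
      by case/andP: i1 => -> + _; lra.
    by move: i2; rewrite eS => /andP[-> ] + _; have := pi_gt0 R; lra.
  by rewrite lerXn2r ?nnegrE// (le_trans c0).
- by case/andP: (cosX_ge0 n i1).
- by rewrite eS; apply: cosX_slope => //; [case/andP: i1|exact: ltW|rewrite -eS; case/andP: i2].
- rewrite cosX_ge//=; apply: le_trans (cosX_le_exp n p1) _; rewrite -/h.
  have := @expN_le R (h ^+ 2 / 2); rewrite (_ : (h ^+ 2 / 2) ^+ 2 / 2 = h ^+ 4 / 8); last by field.
  by apply; rewrite divr_ge0 ?sqr_ge0.
Qed.

(** Each side of the weight point contributes at least s/(200 pi) times 1/30; s >= 99/100 and pi <=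
    4 bring the total above 1/20000. *)
Lemma cov_weight_cnt j : (j <= l)%N -> 7 / 5 <= j%:R * h -> 7 / 5 <= (l - j)%:R * h ->
  s * Ex P (cnt n th0 ph l) + 1 / 100 / 200 <= Ex P (fun t => W j t * cnt n th0 ph l t).
Proof.
move=> jl j1 j2.
have bW := bdd_weight omega n.+1 (xi n (th j)) e0.
pose ch k t := chg (X n (th k) t) (X n (th k.+1) t).
have bch k : bdd (ch k) by exact: bdd_chgX.
have cntE : cnt n th0 ph l =1 (fun t => \sum_(k < l) ch k t) by [].
rewrite (eq_Ex P cntE) Ex_sum//.
rewrite (_ : Ex P (fun t => _ * _) = \sum_(k < l) Ex P (fun t => W j t * ch k t)); last first.
  rewrite -Ex_sum; last by move=> k _; exact: bddM.
  by apply: eq_Ex => t; rewrite cntE mulr_sumr.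
have sE x y : x - y = - (y - x) :> R by rewrite opprB.
pose F k := Ex P (fun t => W j t * ch k t) - s * Ex P (ch k).
suff : 1 / 100 / 200 <= \sum_(k < l) F k.
  by rewrite /F sumrB -mulr_sumr; lra.
have right i : (j + i < l)%N -> s * (1 / 200 / pi) * g i <= F (j + i)%N.
  move=> il; rewrite /F lerBrDl; apply: cell.
  - by move: il; clear; lia.
  - by rewrite sE cosN; congr cos; rewrite /th -natr1; ring.
  - by congr cos; rewrite /th natrD; ring.
  - by congr cos; rewrite /th -addnS natrD; ring.
have left i : (i < j)%N -> s * (1 / 200 / pi) * g i <= F (j - i.+1)%N.
  move=> ij; rewrite /F lerBrDl.
  have e1 : ((j - i.+1).+1 = j - i)%N by move: ij; clear; lia.
  have chC t : ch (j - i.+1)%N t = chg (X n (th (j - i)%N) t) (X n (th (j - i.+1)%N) t).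
    by rewrite /ch e1 /chg eq_sym.
  rewrite (eq_Ex P chC); under [X in _ <= X]eq_Ex do rewrite chC.
  apply: cell.
  - by apply: leq_trans jl.
  - by congr cos; rewrite /th -e1 -natr1; ring.
  - by rewrite sE cosN; congr cos; rewrite /th natrB; [ring|exact: ltnW].
  - by rewrite sE cosN; congr cos; rewrite /th natrB//; ring.
rewrite -(subnKC jl) big_split_ord/= (reindex_inj rev_ord_inj)/=.
have pp := pi_gt0 R.
have sl : 99 / 100 <= s.
  rewrite -[leLHS]ger0_norm; last by lra.
  by rewrite -sqrtr_sqr ler_wsqrtr//; lra.
have p4 : pi <= 4 :> R.
  by have := pihalf_lt2 R; lra.
have c0 : 1 / 100 / 5 <= s * (1 / 200 / pi) * 2.
  have : 1 / 4 <= (pi : R)^-1 by rewrite mul1r lef_pV2 ?posrE//.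
  move: (pi^-1 : R) => x x4.
  have : 99 / 100 * (1 / 4) <= s * x by rewrite ler_pM//; lra.
  by rewrite (_ : s * (1 / 200 * x) * 2 = s * x / 100); [move: (s * x) => y; lra|field].
have sp : 0 <= s * (1 / 200 / pi) by rewrite mulr_ge0 ?divr_ge0 ?ltW.
have S m : (m <= l)%N -> 7 / 5 <= m%:R * h -> 1 / 30 <= \sum_(i < m) g i.
  move=> ml mh; apply: side_sum => //.
  by apply: le_trans lph; rewrite ler_wpM2r ?(ltW ph0)// ler_nat.
have := S j jl j1; have := S (l - j)%N (leq_subr _ _) j2.
have L1 : s * (1 / 200 / pi) * \sum_(i < j) g i <= \sum_(i < j) F (j - i.+1)%N.
  by rewrite mulr_sumr; apply: ler_sum => i _; exact: left.
have L2 : s * (1 / 200 / pi) * \sum_(i < l - j) g i <= \sum_(i < l - j) F (j + i)%N.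
  rewrite mulr_sumr; apply: ler_sum => i _; apply: right.
  by move: (ltn_ord i) jl; clear; lia.
move: L1 L2; move: (\sum_(i < j) g i) (\sum_(i < l - j) g i) (\sum_(i < j) F _) (\sum_(i < l - j) F _) => x y u v L1 L2 y1 x1.
have h1 : s * (1 / 200 / pi) * (1 / 30) <= s * (1 / 200 / pi) * x by rewrite ler_wpM2l.
have h2 : s * (1 / 200 / pi) * (1 / 30) <= s * (1 / 200 / pi) * y by rewrite ler_wpM2l.
by move: c0 L1 L2 h1 h2; move: (s * (1 / 200 / pi)) => c *; lra.
Qed.

(** Weights sit at the points (k + 2) s1, one unit or more apart and two from either end, which
    leaves room for 7/5 on each side. Those m steps apart have covariance at most exp(-m^2) <=
    2^(-m), so the rows sum to at most 3. *)
Lemma var_cnt_ge (s1 K : nat) : 1 <= s1%:R * h -> ((K + 3) * s1 <= l)%N ->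
  (1 / 100 / 200) ^+ 2 * K%:R / 3 <=
  Ex P (fun t => (cnt n th0 ph l t - Ex P (cnt n th0 ph l)) ^+ 2).
Proof.
move=> s1h Kl.
pose j k := ((k + 2) * s1)%N.
have jl k : (k < K)%N -> (j k + 2 * s1 <= l)%N.
  move=> kK; apply: leq_trans Kl; rewrite -mulnDl leq_mul2r; apply/orP; right.
  by move: kK; clear; lia.
have j2 k : (2 * s1 <= j k)%N by rewrite leq_mul2r leq_addl orbT.
have h0 : 0 <= h by case/andP: h01 => /ltW.
have two m : (2 * s1 <= m)%N -> 7 / 5 <= m%:R * h.
  move=> m2; apply: (@le_trans _ _ ((2 * s1)%:R * h)); last by rewrite ler_wpM2r// ler_nat.
  by rewrite natrM -mulrA; move: s1h; move: (s1%:R * h) => x; lra.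
apply: (@var_test _ _ _ _ _ K (fun k => W (j k)) s _
   (fun i k => cos ((j i)%:R * ph - (j k)%:R * ph) ^+ n ^+ 2)) => //.
- exact: bdd_cnt.
- by move=> k; exact: bdd_weight.
- move=> k; rewrite (Ex_weight1 iid e0 (dot_xi1 n _)) /e /s sqr_sqrtr; last by lra.
  by rewrite -sqrtrV; [congr Num.sqrt; field|lra].
- move=> k kK; apply: cov_weight_cnt.
  + by apply: leq_trans (jl k kK); exact: leq_addr.
  + exact: two.
  + by apply: two; move: (jl k kK); clear; lia.
- move=> i k; apply: le_trans (cov_weight iid (dot_xi1 n _) (dot_xi1 n _)) _.
  by rewrite dot_xi /th opprD addrACA subrr add0r.
move=> i iK; apply: le_trans (sum_half_dist R iK); apply: ler_sum => k _.
rewrite /j.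
have -> : cos (((i + 2) * s1)%:R * ph - ((k + 2) * s1)%:R * ph) =
   cos ((`|i%:Z - k%:Z|%N * s1)%:R * ph) :> R.
  have [ik|ki] := leqP i k.
    rewrite -opprB cosN; congr cos; rewrite -mulrBl -natrB; last by rewrite leq_mul2r leq_add2r ik orbT.
    by congr (_%:R * _); rewrite -mulnBl; congr (_ * _)%N; move: ik; move: (nat_of_ord k) => z; clear; lia.
  congr cos; rewrite -mulrBl -natrB; last by rewrite leq_mul2r leq_add2r (ltnW ki) orbT.
  by congr (_%:R * _); rewrite -mulnBl; congr (_ * _)%N; move: ki; move: (nat_of_ord k) => z; clear; lia.
set m := `|_|%N.
have mK : (m <= K)%N.
  by rewrite /m; move: (ltn_ord k) iK; move: (nat_of_ord k) => z; clear; lia.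
have m2 : 0 <= (m * s1)%:R * ph <= pi / 2.
  rewrite mulr_ge0 ?(ltW ph0)//=; apply: le_trans lph.
  rewrite ler_wpM2r ?(ltW ph0)// ler_nat; apply: leq_trans Kl.
  by rewrite leq_mul2r (leq_trans mK) ?orbT// leq_addr.
have [c0 c1] := andP (cosX_ge0 n m2).
have c2 : cos ((m * s1)%:R * ph) ^+ n <= expR (- (m%:R ^+ 2 / 2)).
  apply: le_trans (cosX_le_exp n m2) _; rewrite ler_expR lerN2 ler_wpM2r ?invr_ge0//.
  rewrite lerXn2r ?nnegrE//; first by rewrite mulr_ge0 ?(ltW sn0)//; case/andP: m2.
  rewrite (_ : Num.sqrt n%:R * _ = m%:R * (s1%:R * h)); last by rewrite /h natrM; ring.
  by rewrite ler_peMr.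
apply: (@le_trans _ _ (expR (- (m%:R ^+ 2 / 2)) ^+ 2)).
  by rewrite lerXn2r ?nnegrE ?expR_ge0.
rewrite -expRM_natl (_ : 2%:R * - (m%:R ^+ 2 / 2) = - m%:R ^+ 2); last by field.
apply: (@le_trans _ _ (expR (m%:R * - 1))).
  by rewrite ler_expR mulrN1 lerN2 -natrX ler_nat; case: (m) => // m'; rewrite -mulnn leq_pmulr.
rewrite expRM_natl lerXn2r ?nnegrE ?expR_ge0 ?invr_ge0//.
by have := expR1N_le (R := R); lra.
Qed.

End BlockVariance.

(** * Zeros and sign changes *)

Section HomogeneousForm.
Context {R : realType}.
Implicit Types (p q : {poly R}) (n m : nat) (z th u v x : R).

(** The degree-n homogenization of [p] at (sin th, cos th). Unlike [p.[tan th]] it is defined and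
    continuous at the ends of [-pi/2, pi/2]. *)
Definition hom n p th : R := \sum_(j < n.+1) p`_j * sin th ^+ j * cos th ^+ (n - j).

Lemma hom_tan n p th : (size p <= n.+1)%N -> cos th != 0 ->
  hom n p th = cos th ^+ n * p.[tan th].
Proof.
move=> sp c0; rewrite (horner_coef_wide _ sp) mulr_sumr; apply: eq_bigr => j _.
have -> : cos th ^+ n = cos th ^+ (n - j) * cos th ^+ j.
  by rewrite -exprD subnK// -ltnS ltn_ord.
rewrite /tan expr_div_n.
have cj : cos th ^+ j != 0 by rewrite expf_neq0.
by rewrite -!mulrA; field.
Qed.

Lemma hom_cos0 n p th : cos th = 0 -> hom n p th = p`_n * sin th ^+ n.
Proof.
move=> c0; rewrite /hom big_ord_recr/= subnn expr0 mulr1 big1 ?add0r// => j _.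
by rewrite c0 expr0n subn_eq0 leqNgt ltn_ord mulr0.
Qed.

Lemma hom_factor n q z th : (size q <= n.+1)%N ->
  hom n.+1 (('X - z%:P) * q) th = (sin th - z * cos th) * hom n q th.
Proof.
move=> sq.
have sp : (size (('X - z%:P) * q)%R <= n.+2)%N.
  by apply: leq_trans (size_polyMleq _ _) _; rewrite size_XsubC; exact: sq.
have [c0|c0] := eqVneq (cos th) 0; last first.
  rewrite !hom_tan// hornerM hornerXsubC exprS /tan.
  by move: (q.[_]) => w; field.
rewrite !hom_cos0// mulrBl coefB coefXM coefCM/= [q`_n.+1]nth_default//.
by rewrite c0 exprS; ring.
Qed.

Lemma continuous_sum_ord (m : nat) (F : nat -> R -> R) : (forall j, continuous (F j)) ->
  continuous (fun x => \sum_(j < m) F j x).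
Proof.
move=> cF; elim: m => [|m IH].
  rewrite (_ : (fun x => _) = cst 0); first by move=> x; exact: cvg_cst.
  by apply/funext => x; rewrite big_ord0.
rewrite (_ : (fun x => _) = (fun x => \sum_(j < m) F j x) \+ F m).
  by move=> x; apply: continuousD; [exact: IH|exact: cF].
by apply/funext => x; rewrite big_ord_recr.
Qed.

Lemma hom_continuous n p : continuous (hom n p).
Proof.
apply: (@continuous_sum_ord n.+1 (fun j th => p`_j * sin th ^+ j * cos th ^+ (n - j))) => j x.
have cX (f : R -> R) k : continuous f -> f y ^+ k @[y --> x] --> f x ^+ k.
  by move=> cf; apply: (cvg_comp f (fun y : R => y ^+ k)); [exact: cf|exact: exprn_continuous].
apply: cvgM; last by apply: cX; exact: continuous_cos.
by apply: cvgM; [exact: cvg_cst|apply: cX; exact: continuous_sin].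
Qed.

Lemma hom_bound n p x : `|hom n p x| <= \sum_(j < n.+1) `|p`_j|.
Proof.
apply: le_trans (ler_norm_sum _ _ _) _; apply: ler_sum => j _.
rewrite !normrM !normrX -mulrA ler_piMr// mulr_ile1 ?exprn_ge0// exprn_ile1//.
  by rewrite ler_norml sin_geN1 sin_le1.
by rewrite ler_norml cos_geN1 cos_le1.
Qed.

Lemma sin_sub_tan th z tau : cos tau != 0 -> z = tan tau ->
  sin th - z * cos th = sin (th - tau) / cos tau.
Proof. by move=> c0 ->; rewrite sinB /tan; field. Qed.

Lemma chg_neg x y : x * y < 0 -> chg x y = 1.
Proof.
rewrite /chg => h; have [x0|x0|x0] := ltgtP 0 x.
- by move: h; rewrite pmulr_rlt0// => y0; rewrite ltNge (ltW y0).
- by move: h; rewrite nmulr_rlt0// => ->.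
- by move: h; rewrite -x0 mul0r ltxx.
Qed.

Lemma chg_pos x y : 0 < x * y -> chg x y = 0.
Proof.
rewrite /chg => h; have [x0|x0|x0] := ltgtP 0 x.
- by move: h; rewrite pmulr_rgt0// => ->.
- by move: h; rewrite nmulr_rgt0// => y0; rewrite ltNge (ltW y0).
- by move: h; rewrite -x0 mul0r ltxx.
Qed.

Lemma chg_no_zero (f : R -> R) u v : continuous f -> u <= v ->
  (forall x, u <= x <= v -> f x != 0) -> chg (f u) (f v) = 0.
Proof.
move=> cf uv f0; apply: chg_pos.
have fu : f u != 0 by rewrite f0// lexx.
rewrite lt_neqAle eq_sym mulf_neq0 ?f0 ?lexx ?uv//= leNgt; apply/negP => neg.
have [|c] := IVT (v := 0) uv (continuous_subspaceT cf).
  rewrite ge_min le_max; have [u0|u0] := leP (f u) 0.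
    have fu0 : f u < 0 by rewrite lt_neqAle fu.
    by rewrite /=; move: neg; rewrite nmulr_rlt0// => /ltW ->; rewrite orbT.
  by rewrite (ltW u0)/=; move: neg; rewrite pmulr_rlt0// => /ltW ->.
by rewrite in_itv/= => uvc fc; have := f0 c uvc; rewrite fc eqxx.
Qed.

Lemma local_sign (f : R -> R) x : continuous f -> f x != 0 ->
  exists2 e, 0 < e & forall u v, `|u - x| < e -> `|v - x| < e -> 0 < f u * f v.
Proof.
move=> cf f0; have e0 : 0 < `|f x| / 2 by rewrite divr_gt0 ?normr_gt0.
have /cvgrPdist_lt/(_ _ e0) := cf x; rewrite near_simpl => /nbhs_ballP[e/= e1 H].
exists e => // u v ux vx.
have /H/= hu : ball x e u by rewrite /ball/= distrC.
have /H/= hv : ball x e v by rewrite /ball/= distrC.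
move: f0 e0 hu hv; move: (f u) (f v) (f x) => a b c.
have [c0|c0|c0] := ltgtP 0 c; last by move=> /negP[]; apply/eqP.
  move=> _ e0; rewrite (gtr0_norm c0) !ltr_distl => /andP[a1 a2] /andP[b1 b2].
  by rewrite mulr_gt0//; lra.
move=> _ e0; rewrite (ltr0_norm c0) !ltr_distl => /andP[a1 a2] /andP[b1 b2].
by rewrite nmulr_rgt0; lra.
Qed.

(** The factor sin(th - tau)/cos tau changes sign at [tau], while the cofactor keeps its sign
    nearby. *)
Lemma simple_zero n q z tau : (size q <= n.+1)%N -> 0 < cos tau -> z = tan tau -> q.[z] != 0 ->
  exists2 e, 0 < e & forall u v, tau - e < u -> u < tau -> tau < v -> v < tau + e ->
    chg (hom n.+1 (('X - z%:P) * q) u) (hom n.+1 (('X - z%:P) * q) v) = 1.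
Proof.
move=> sq c0 zt qz.
have h0 : hom n q tau != 0.
  have cn := lt0r_neq0 c0.
  by rewrite hom_tan// -zt mulf_neq0// expf_neq0.
have [e e0 H] := local_sign (@hom_continuous n q) h0.
(* The cap at 1 keeps th - tau in (-pi, pi), where the sine has the sign of its argument. *)
exists (Num.min e 1); first by rewrite lt_min e0 ltr01.
move=> u v u1 u2 v1 v2; apply: chg_neg; rewrite !hom_factor// !(sin_sub_tan _ (lt0r_neq0 c0) zt).
have e1 : Num.min e 1 <= e by rewrite ge_min lexx.
have e2 : Num.min e 1 <= 1 by rewrite ge_min lexx orbT.
have p2 := pi_ge2 R.
have su : sin (u - tau) < 0.
  by rewrite -opprB sinN oppr_lt0 sin_gt0_pi//; apply/andP; split; lra.
have sv : 0 < sin (v - tau) by rewrite sin_gt0_pi//; apply/andP; split; lra.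
have -> : sin (u - tau) / cos tau * hom n q u * (sin (v - tau) / cos tau * hom n q v) =
  (sin (u - tau) * sin (v - tau) / cos tau ^+ 2) * (hom n q u * hom n q v).
  by field; rewrite gt_eqF.
rewrite pmulr_llt0; last first.
  by apply: H; rewrite ltr_distl; apply/andP; split; lra.
by rewrite pmulr_llt0 ?invr_gt0 ?exprn_gt0// pmulr_llt0.
Qed.

(** A double zero forces values of order ph^2 at both ends of the cell of width ph containing it;
    this is the event shown to be null in [doubled_null]. *)
Lemma double_zero n q z tau : (size q <= n.+1)%N -> 0 < cos tau -> z = tan tau ->
  exists K, forall x, `|hom n.+2 (('X - z%:P) * (('X - z%:P) * q)) x| <= K * `|x - tau| ^+ 2.
Proof.
move=> sq c0 zt; exists ((cos tau)^-1 ^+ 2 * \sum_(j < n.+1) `|q`_j|) => x.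
have sp : (size (('X - z%:P) * q)%R <= n.+2)%N.
  by apply: leq_trans (size_polyMleq _ _) _; rewrite size_XsubC; exact: sq.
rewrite !hom_factor// !(sin_sub_tan _ (lt0r_neq0 c0) zt).
have s1 : `|sin (x - tau)| <= `|x - tau|.
  have S (y : R) : 0 <= y -> `|sin y| <= y.
    move=> y0; rewrite ler_norml; apply/andP; split; last exact: sin_le_id.
    have [x1|x1] := leP y 1.
      by rewrite (@le_trans _ _ 0) ?oppr_le0// sin_ge0_pi// y0/=; have := pi_ge2 R; lra.
    by rewrite (@le_trans _ _ (-1)) ?sin_geN1//; lra.
  have [x0|x0] := leP 0 (x - tau); first by rewrite [leRHS]ger0_norm// S.
  rewrite -[sin _]opprK -sinN normrN [leRHS]ltr0_norm//.
  by apply: S; rewrite oppr_ge0 ltW.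
rewrite !normrM normfV (gtr0_norm c0).
have -> : `|sin (x - tau)| / cos tau * (`|sin (x - tau)| / cos tau * `|hom n q x|) =
   (cos tau)^-1 ^+ 2 * `|hom n q x| * `|sin (x - tau)| ^+ 2 by ring.
have d0 : 0 <= (cos tau)^-1 ^+ 2 by exact: sqr_ge0.
apply: ler_pM; [by rewrite mulr_ge0|exact: sqr_ge0| |by rewrite lerXn2r ?nnegrE].
by rewrite ler_wpM2l// hom_bound.
Qed.

End HomogeneousForm.

Section Cells.
Context {R : realType}.
Implicit Types (s : seq R) (A ph x u v : R).

Lemma sum_incell1 A ph x m : 0 <= ph -> A < x -> x <= A + m%:R * ph ->
  \sum_(k < m) (A + k%:R * ph < x <= A + k.+1%:R * ph)%R%:R = 1 :> R.
Proof.
move=> ph0 Ax xm.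
suff H j : \sum_(k < j) (A + k%:R * ph < x <= A + k.+1%:R * ph)%R%:R = (x <= A + j%:R * ph)%R%:R :> R.
  by rewrite H xm.
elim: j => [|j IH]; first by rewrite big_ord0 mul0r addr0 leNgt Ax.
rewrite big_ord_recr/= IH.
have le : A + j%:R * ph <= A + j.+1%:R * ph by rewrite lerD2l ler_wpM2r// ler_nat.
have [xj|xj] := leP x (A + j%:R * ph); first by rewrite (le_trans xj le) addr0.
by rewrite add0r.
Qed.

Definition incell s u v : R := (has (fun x => (u < x <= v)%R) s)%:R.

Lemma sum_incell s A ph m : 0 <= ph -> uniq s ->
  (forall x, x \in s -> A < x <= A + m%:R * ph) ->
  (forall x y, x \in s -> y \in s -> x != y -> ph <= `|x - y|) ->
  \sum_(k < m) incell s (A + k%:R * ph) (A + k.+1%:R * ph) = (size s)%:R.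
Proof.
move=> ph0; elim: s => [|x s IH] /=; first by move=> *; rewrite big1.
move=> /andP[xs us] sm gap.
rewrite -natr1 -IH//; last 2 first.
- by move=> y ys; apply: sm; rewrite inE ys orbT.
- by move=> y z ys zs; apply: gap; rewrite inE ?ys ?zs orbT.
have /andP[Ax xm] := sm x (mem_head _ _).
rewrite -[X in _ = _ + X](sum_incell1 ph0 Ax xm) -big_split/=; apply: eq_bigr => k _.
rewrite /incell/=.

have [xc|xc] := boolP ((A + k%:R * ph < x <= A + k.+1%:R * ph)%R); last by rewrite /= addr0.
rewrite /=.
rewrite (_ : has _ s = false) ?add0r//; apply/hasP => -[y ys /andP[y1 y2]].
have xy : x != y by apply: contraNneq xs => ->.
have := gap x y (mem_head _ _); rewrite inE ys orbT => /(_ isT xy).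
move: xc => /andP[x1 x2]; apply/negP; rewrite -ltNge ltr_distl.
have e : k.+1%:R * ph = k%:R * ph + ph by rewrite -natr1 mulrDl mul1r.
by rewrite e in x2 y2; apply/andP; split; lra.
Qed.

Lemma uniform_radius (I : eqType) (s : seq I) (Q : R -> I -> Prop) :
  (forall (x : I) (e e' : R), 0 < e' <= e -> Q e x -> Q e' x) ->
  (forall x : I, x \in s -> exists2 e, 0 < e & Q e x) ->
  exists2 e, 0 < e & forall x : I, x \in s -> Q e x.
Proof.
move=> mono; elim: s => [|x s IH] H; first by exists 1.
have [e e0 He] := H x (mem_head _ _).
have [e' e'0 He'] := IH (fun y ys => H y (mem_behead (s := x :: s) ys)).
have m0 : 0 < Num.min e e' by rewrite lt_min e0.
exists (Num.min e e') => // y; rewrite inE => /orP[/eqP ->|ys].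
  by apply: mono He; rewrite m0 ge_min lexx.
by apply: mono (He' y ys); rewrite m0 ge_min lexx orbT.
Qed.

Lemma min_gap s : exists2 e, 0 < e & forall x y, x \in s -> y \in s -> x != y -> e <= `|x - y|.
Proof.
have [||e e0 H] := @uniform_radius _ s (fun e x => forall y, y \in s -> x != y -> e <= `|x - y|).
- by move=> x e e' /andP[_ ee'] h y ys xy; apply: le_trans ee' (h y ys xy).
- move=> x _; have [||e e0 H] := @uniform_radius _ s (fun e y => x != y -> e <= `|x - y|).
  + by move=> y e e' /andP[_ ee'] h xy; apply: le_trans ee' (h xy).
  + move=> y _; have [->|xy] := eqVneq x y; first by exists 1; rewrite ?eqxx.
    by exists `|x - y|; rewrite // normr_gt0 subr_eq0.
  by exists e.
by exists e => // x y xs; exact: H.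
Qed.

End Cells.

Section ZerosInAngle.
Context {R : realType}.
Implicit Types (p q : {poly R}) (n m : nat) (a b : \bar R).

Definition ang (a : \bar R) : R :=
  match a with r%:E => atan r | +oo%E => pi / 2 | -oo%E => - (pi / 2) end.

Lemma atan_mono : {mono (@atan R) : x y / x < y}.
Proof.
move=> x y; have [xy|yx] := ltP x y; first by rewrite lt_atan.
by apply/negbTE; rewrite -leNgt le_atan.
Qed.

Lemma lt_angl a (r : R) : (a < r%:E)%E = (ang a < atan r).
Proof.
case: a => [x||] /=; first by rewrite lte_fin atan_mono.
  by apply/esym/negbTE; rewrite -leNgt ltW// atan_ltpi2.
by rewrite ltNyr atan_gtNpi2.
Qed.

Lemma lt_angr b (r : R) : (r%:E < b)%E = (atan r < ang b).
Proof.
case: b => [x||] /=; first by rewrite lte_fin atan_mono.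
  by rewrite ltry atan_ltpi2.
by apply/esym/negbTE; rewrite -leNgt ltW// atan_gtNpi2.
Qed.

Lemma ang_range a : - (pi / 2) <= ang a <= pi / 2.
Proof.
have pp := pi_gt0 R; case: a => [x||] /=.
- by rewrite !ltW ?atan_gtNpi2 ?atan_ltpi2.
- by rewrite lexx andbT; lra.
- by rewrite lexx/=; lra.
Qed.

Lemma ang_lt a b : (a < b)%E -> ang a < ang b.
Proof.
have pp := pi_gt0 R.
case: a => [x||]; case: b => [y||] //=; rewrite ?lte_fin ?atan_mono//.
- by rewrite atan_ltpi2.
- by rewrite atan_gtNpi2.
- by move=> _; lra.
Qed.

Lemma roots_seq p a b : p != 0 -> exists s : seq R,
  [/\ uniq s, (size s < size p)%N,
      fine (counting [set x : R | (a < x%:E < b)%E /\ root p x] : \bar R) = (size s)%:R &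
      forall x, x \in s <-> (a < x%:E < b)%E /\ root p x].
Proof.
move=> p0; set A := [set x | _].
have finA : finite_set A.
  apply: contrapT => infA; have [B BA sB] := infinite_set_fset (size p) infA.
  have rB : all (root p) B by apply/allP => x xB; have [] := BA x xB.
  by have := max_poly_roots p0 rB (fset_uniq B); rewrite ltnNge sB.
exists (fset_set A : seq R); have sE x : x \in fset_set A <-> A x.
  by rewrite in_fset_set//; split=> [/set_mem//|]; exact: mem_set.
split; [exact: fset_uniq| | |exact: sE].
  apply: max_poly_roots (fset_uniq _) => //; apply/allP => x /sE[] //.
by rewrite /counting; case: asboolP.
Qed.

Lemma zeros_seq p n a b : p != 0 -> (size p <= n.+1)%N -> exists s : seq R,
  [/\ uniq s, (size s <= n)%N,
      fine (counting [set x : R | (a < x%:E < b)%E /\ root p x] : \bar R) = (size s)%:R &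
      forall th, th \in s <-> ang a < th < ang b /\ hom n p th = 0].
Proof.
move=> p0 sp; have [s [us ss cs sE]] := roots_seq a b p0.
have [/andP[a1 a2] /andP[b1 b2]] := (ang_range a, ang_range b).
exists (map (@atan R) s); rewrite size_map; split => //.
- rewrite map_inj_uniq//; exact: can_inj (@atanK R).
- by rewrite -ltnS (leq_trans ss).
move=> th; split.
  move=> /mapP[x /sE[/andP[ax xb] rx] ->].
  rewrite lt_angl in ax; rewrite lt_angr in xb; rewrite ax xb; split => //.
  have cx : cos (atan x) != 0.
    by rewrite gt_eqF// cos_gt0_pihalf// atan_gtNpi2 atan_ltpi2.
  by rewrite hom_tan// atanK (rootP rx) mulr0.
move=> [/andP[ath thb] h0].
have th2 : - (pi / 2) < th < pi / 2 by rewrite (le_lt_trans a1)//= (lt_le_trans thb).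
have cx : cos th != 0 by rewrite gt_eqF// cos_gt0_pihalf.
have e : th = atan (tan th) by rewrite tanK// in_itv.
rewrite e; apply: map_f; apply/sE; rewrite lt_angl lt_angr -e ath thb; split=> //.
apply/rootP/eqP; move: h0 => /eqP; rewrite hom_tan// mulf_eq0 expf_eq0 (negbTE cx) andbF.
by [].
Qed.

Variables (n : nat) (p : {poly R}) (A B : R) (s : seq R).
Hypothesis n0 : (0 < n)%N.
Hypothesis p0 : p != 0.
Hypothesis sp : (size p <= n.+1)%N.
Hypotheses (A2 : - (pi / 2) <= A) (B2 : B <= pi / 2).
Hypothesis us : uniq s.
Hypothesis sE : forall th, th \in s <-> A < th < B /\ hom n p th = 0.

(** Cells are open on the left, so a zero lies in only one of them; [x < B] discards a zero at the
    right end of the interval. *)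
Let zero_in u v : R := (`[< exists x, [/\ u < x <= v, x < B & hom n p x = 0] >])%:R.

Let zero_inE u v : A <= u -> zero_in u v = incell s u v.
Proof.
move=> Au; rewrite /zero_in /incell; congr (_%:R); congr nat_of_bool.
apply/asboolP/hasP => [[x [/andP[ux xv] xB x0]]|[x /sE[/andP[Ax xB] x0] uv]].
  by exists x; [apply/sE; rewrite xB (le_lt_trans Au)|rewrite ux].
by exists x.
Qed.

Let grid_ge ph k : 0 <= ph -> A <= A + k%:R * ph.
Proof. by move=> h; rewrite lerDl mulr_ge0. Qed.

Let in_grid m ph x : A + m%:R * ph = B -> x \in s -> A < x <= A + m%:R * ph.
Proof. by move=> -> /sE[/andP[-> /ltW ->]]. Qed.

(** Multiplicities do not enter here: on fine meshes the occupied cells are counted. As occupation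
    of a cell is a measurable event, this gives the measurability of the number of zeros. *)
Lemma count_cells : exists2 e, 0 < e & forall m ph, 0 <= ph < e -> A + m%:R * ph = B ->
  \sum_(k < m) zero_in (A + k%:R * ph) (A + k.+1%:R * ph) = (size s)%:R.
Proof.
have [e e0 H] := min_gap s; exists e => // m ph /andP[ph0 phe] mB.
rewrite -(@sum_incell _ s A ph m)//.
- by apply: eq_bigr => k _; rewrite zero_inE ?grid_ge.
- by move=> x; exact: in_grid.
- by move=> x y xs ys xy; apply: le_trans (ltW phe) _; exact: H.
Qed.

(** On a fine mesh a cell contains at most one zero, a simple one in its interior, and the sign
    changes exactly there. Simplicity is expressed through the absence of a quadratic bound, which
    is what the probabilistic argument excludes. *)
Lemma count_changes :
  (forall th, A < th < B -> ~ exists K, forall x, `|hom n p x| <= K * `|x - th| ^+ 2) ->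
  exists2 e, 0 < e & forall m ph, 0 <= ph < e -> A + m%:R * ph = B ->
    (forall k, (k <= m)%N -> hom n p (A + k%:R * ph) != 0) ->
    \sum_(k < m) chg (hom n p (A + k%:R * ph)) (hom n p (A + k.+1%:R * ph)) = (size s)%:R.
Proof.
move=> nodouble.
have [e1 e10 H1] := min_gap s.
have [||e2 e20 H2] := @uniform_radius R R s (fun e tau => forall u v, tau - e < u -> u < tau ->
    tau < v -> v < tau + e -> chg (hom n p u) (hom n p v) = 1).
- by move=> x e e' /andP[e'0 e'e] H u v u1 u2 v1 v2; apply: H => //; lra.
- move=> tau /sE[Atau h0].
  have /andP[t1 t2] : - (pi / 2) < tau < pi / 2.
    by case/andP: Atau => /(le_lt_trans A2) -> /lt_le_trans ->.
  have c0 : 0 < cos tau by rewrite cos_gt0_pihalf// t1.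
  have : root p (tan tau).
    by move/eqP: h0; rewrite hom_tan ?lt0r_neq0// mulf_eq0 expf_eq0 (gt_eqF c0) andbF.
  move=> /factor_theorem[q]; rewrite mulrC => pq.
  have q0 : q != 0 by apply: contraNneq p0 => q0; rewrite pq q0 mulr0.
  have szE (r : {poly R}) w : r != 0 -> size (('X - w%:P) * r)%R = (size r).+1.
    by move=> r0; rewrite mulrC size_Mmonic ?monicXsubC// size_XsubC addn2.
  have := nodouble tau Atau; move: sp n0; rewrite pq szE//; case: (n) => // n' sq _ ndb.
  apply: simple_zero => //; apply/negP => /factor_theorem[r]; rewrite mulrC => qr.
  have r0 : r != 0 by apply: contraNneq q0 => r0; rewrite qr r0 mulr0.
  move: sq ndb; rewrite qr szE//; case: n' => [|n' sr]; first by rewrite !ltnS leqn0 size_poly_eq0 (negbTE r0).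
  by apply; apply: double_zero.
exists (Num.min e1 e2); first by rewrite lt_min e10.
move=> m ph /andP[ph0]; rewrite lt_min => /andP[ph1 ph2] mB nz.
rewrite -(@sum_incell _ s A ph m)//; last 2 first.
- by move=> x; exact: in_grid.
- by move=> x y xs ys xy; apply: le_trans (ltW ph1) _; exact: H1.
apply: eq_bigr => k _; set u := A + k%:R * ph; set v := A + k.+1%:R * ph.
have uv : v = u + ph by rewrite /v /u -natr1 mulrDl mul1r addrA.
have nu : hom n p u != 0 by apply: nz; exact: ltnW.
have nv : hom n p v != 0 by exact: nz.
have vB : v <= B by rewrite -mB lerD2l ler_wpM2r// ler_nat.
have Au : A <= u by exact: grid_ge.
rewrite /incell; have [/hasP[x xs /andP[ux xv]]|/hasPn no] := boolP (has _ s).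
  have [_ x0] := (sE x).1 xs.
  have xv' : x < v by rewrite lt_neqAle xv andbT; apply: contraNneq nv => <-; rewrite x0.
  by rewrite (H2 x xs)//; lra.
rewrite chg_no_zero//; [exact: hom_continuous|by rewrite uv lerDl|].
move=> x /andP[ux xv]; apply/negP => /eqP x0.
have ux' : u < x by rewrite lt_neqAle ux andbT; apply: contraNneq nu => ->; rewrite x0.
have xv' : x < v by rewrite lt_neqAle xv andbT; apply: contraNneq nv => <-; rewrite x0.
have xs : x \in s by apply/sE; split=> //; apply/andP; split; lra.
by have := no x xs; rewrite ux' xv.
Qed.

End ZerosInAngle.

(** * Measurability of the number of zeros *)

Section NumberOfZeros.
Context d (T : measurableType d) (R : realType) (P : probability T R).
Variable omega : nat -> {RV P >-> R}.
Hypothesis iid : iid_standard_gaussian omega.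
Local Notation X := (kostlan omega).

Lemma X_hom n th t : X n th t = hom n (random_poly (fun j => omega j) n t) th.
Proof.
rewrite /kostlan /linear_form /hom; apply: eq_bigr => j _.
by rewrite coef_poly ltn_ord /xi; ring.
Qed.

Lemma size_random_poly n t : (size (random_poly (fun j => omega j) n t) <= n.+1)%N.
Proof. exact: size_poly. Qed.

Lemma X_continuous n t : continuous (fun th => X n th t).
Proof.
rewrite (_ : (fun th => _) = hom n (random_poly (fun j => omega j) n t)).
  exact: hom_continuous.
by apply/funext => th; exact: X_hom.
Qed.

(** On a compact interval a continuous function vanishes somewhere iff it gets below every 1/(i + 1)
    at rational arguments. The clamp [c] sends all rationals into [u, v]. *)
Lemma measurable_zero_closed n u v : measurable [set t | exists x, u <= x <= v /\ X n x t = 0].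
Proof.
have [uv|vu] := leP u v; last first.
  rewrite (_ : [set t | _] = set0) //; apply/seteqP; split => // t [x [/andP[ux xv] _]].
  by move: (le_trans ux xv); rewrite leNgt vu.
pose c (r : R) := Num.max u (Num.min r v).
have cin r : u <= c r <= v by rewrite /c le_max lexx/= ge_max uv ge_min lexx orbT.
have ccont : continuous c.
  apply: (@max_fun_continuous _ R R (fun=> u) (fun r => Num.min r v)); first by move=> x; exact: cvg_cst.
  by apply: (@min_fun_continuous _ R R id (fun=> v)) => x; [exact: cvg_id|exact: cvg_cst].
rewrite (_ : [set t | _] = \bigcap_i \bigcup_(q : rat) [set t | `|X n (c (ratr q)) t| < i.+1%:R^-1]).
  apply: bigcapT_measurable => i; apply: bigcupT_measurable_rat => q.
  rewrite (_ : [set t | _] = (fun t => `|X n (c (ratr q)) t|) @^-1` `]-oo, i.+1%:R^-1[); last first.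
    by apply/seteqP; split => t /=; rewrite in_itv.
  rewrite -[_ @^-1` _]setTI; apply: (measurableT_comp _ _ measurableT) => //.
  exact: measurable_X.
apply/seteqP; split => t /=.
  move=> [x [/andP[ux xv] x0]] i _.
  have cx : c x = x by rewrite /c (min_idPl xv) (max_idPr ux).
  have fc : {for x, continuous (fun r => X n (c r) t)}.
    by apply: (@continuous_comp _ _ _ c (fun x => X n x t)); [exact: ccont|exact: X_continuous].
  have e0 : 0 < i.+1%:R^-1 :> R by rewrite invr_gt0.
  have /cvgrPdist_lt/(_ _ e0) := fc; rewrite near_simpl => /nbhs_ballP[e/= e1 H].
  have [q] := @rat_in_itvoo R x (x + e) (ltr_pwDr e1 (lexx x)).
  rewrite in_itv/= => /andP[q1 q2].
  exists q => //=; have := H (ratr q); rewrite cx x0 sub0r normrN; apply.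
  by rewrite /ball/= distrC ger0_norm; lra.
move=> H; have [|x xuv xmin] := @EVT_min R (fun x => `|X n x t|) u v uv.
  apply: continuous_subspaceT => x.
  by apply: (@continuous_comp _ _ _ (fun x => X n x t) (fun y => `|y|)); [exact: X_continuous|exact: norm_continuous].
exists x; split; first by move: xuv; rewrite in_itv.
apply/eqP; rewrite -normr_le0 leNgt; apply/negP => x0.
pose i := Num.truncn `|X n x t|^-1.
have [q _] := H i I; apply/negP; rewrite -leNgt.
have := xmin (c (ratr q)); rewrite in_itv/= => /(_ (cin _)); apply: le_trans.
rewrite -[leRHS]invrK lef_pV2 ?posrE ?invr_gt0//.
by apply: ltW; exact: truncnS_gt.
Qed.

Lemma measurable_zero_in n u v B : measurable [set t | exists x, [/\ u < x <= v, x < B & X n x t = 0]].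
Proof.
rewrite (_ : [set t | _] = \bigcup_i [set t | exists x, u + i.+1%:R^-1 <= x <= Num.min v (B - i.+1%:R^-1) /\ X n x t = 0]).
  by apply: bigcupT_measurable => i; exact: measurable_zero_closed.
apply/seteqP; split => t /=.
  move=> [x [/andP[ux xv] xB x0]].
  pose e := Num.min (x - u) (B - x).
  have e0 : 0 < e by rewrite lt_min !subr_gt0 ux.
  exists (Num.truncn e^-1) => //; exists x; split => //.
  have : (Num.truncn e^-1).+1%:R^-1 <= e.
    rewrite -[leRHS]invrK lef_pV2 ?posrE ?invr_gt0//.
    by apply: ltW; exact: truncnS_gt.
  move: (Num.truncn _) => i; move: (i.+1%:R^-1 : R) => y.
  by rewrite le_min => /andP[e1 e2]; rewrite le_min xv/=; apply/andP; split; lra.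
move=> [i _ [x []]]; rewrite le_min => /andP[ux /andP[xv xB]] x0.
have i0 : 0 < i.+1%:R^-1 :> R by rewrite invr_gt0.
move: i0 ux xB; move: (i.+1%:R^-1 : R) => y y0 ux xB.
by exists x; split => //; [rewrite xv andbT|]; lra.
Qed.

Lemma random_poly_neq0 n t : (random_poly (fun j => omega j) n t != 0) =
  (\sum_(j < n.+1) omega j t ^+ 2 != 0).
Proof.
have s0 j : 0 < Num.sqrt ('C(n, j)%:R : R) = (j < n.+1)%N.
  by rewrite sqrtr_gt0 ltr0n bin_gt0.
congr (~~ _); apply/eqP/eqP => [p0|].
  apply: big1 => j _; have := congr1 (fun p : {poly R} => p`_j) p0.
  rewrite coef_poly coef0 ltn_ord => /eqP; rewrite mulf_eq0 => /orP[/eqP ->|].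
    by rewrite expr0n.
  by rewrite gt_eqF// s0.
move=> /eqP; rewrite psumr_eq0; last by move=> j _; exact: sqr_ge0.
move=> /allP H; apply/polyP => j; rewrite coef_poly coef0; case: ifP => // jn.
have := H (Ordinal jn) (mem_index_enum _); rewrite /= sqrf_eq0 => /eqP ->.
by rewrite mul0r.
Qed.

Lemma measurable_poly_neq0 n : measurable [set t | random_poly (fun j => omega j) n t != 0].
Proof.
rewrite (_ : [set t | _] = ~` ((fun t => \sum_(j < n.+1) omega j t ^+ 2) @^-1` [set 0])).
  apply: measurableC; rewrite -[X in measurable X]setTI.
  have : measurable_fun setT (fun t => \sum_(j < n.+1) omega j t ^+ 2).
    by apply: measurable_sum => j; apply: measurable_funX.
  by apply => //; exact: measurable_set1.
by apply/seteqP; split => t /=; rewrite random_poly_neq0; [move/eqP|move=> h; apply/eqP].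
Qed.

Section Interval.
Variables (n : nat) (a b : \bar R).
Hypothesis n0 : (0 < n)%N.
Hypothesis ab : (a < b)%E.
Local Notation N := (nb_zeros (fun j => omega j) n a b).
Let A : R := ang a.
Let B : R := ang b.
Let AB : A < B. Proof. exact: ang_lt. Qed.
Let A2 : - (pi / 2) <= A. Proof. by case/andP: (ang_range a). Qed.
Let B2 : B <= pi / 2. Proof. by case/andP: (ang_range b). Qed.

(** For the zero polynomial the root set is the whole interval; its counting measure is then
    infinite and [nb_zeros] takes the value 0. *)
Lemma infinite_interval : infinite_set [set x : R | (a < x%:E < b)%E].
Proof.
move=> fin; pose F := fset_set [set x : R | (a < x%:E < b)%E].
have FE x : (x \in F) = (A < atan x < B).
  by rewrite in_fset_set// -lt_angl -lt_angr; apply/idP/idP => [/set_mem//|]; exact: mem_set.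
pose K := size (F : seq R).
pose y (k : nat) : R := A + (B - A) * (k.+1%:R / K.+2%:R).
have BA : 0 < B - A by rewrite subr_gt0.
have y01 k : (k <= K)%N -> A < y k < B.
  move=> kK; have k0 : 0 < k.+1%:R / K.+2%:R :> R by rewrite divr_gt0.
  have k1 : k.+1%:R / K.+2%:R < 1 :> R by rewrite ltr_pdivrMr// mul1r ltr_nat.
  rewrite /y ltrDl mulr_gt0//= -ltrBrDl -[ltRHS]mulr1 ltr_pM2l//.
have atany k : (k <= K)%N -> atan (tan (y k)) = y k.
  by move=> /y01/andP[y1 y2]; rewrite tanK// in_itv/= (le_lt_trans A2)// (lt_le_trans y2).
have us : uniq [seq tan (y k) | k <- iota 0 K.+1].
  rewrite map_inj_in_uniq ?iota_uniq// => i j; rewrite !mem_iota !add0n /= !ltnS => iK jK.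
  move=> /(congr1 (@atan R)); rewrite !atany// => /addrI /(mulfI (lt0r_neq0 BA)) /eqP.
  by rewrite eqr_div ?pnatr_eq0// -!natrM eqr_nat eqn_mul2r/= eqSS => /eqP.
suff /(uniq_leq_size us) : {subset [seq tan (y k) | k <- iota 0 K.+1] <= (F : seq R)}.
  by rewrite size_map size_iota ltnn.
move=> _ /mapP[k + ->].
by rewrite mem_iota add0n ltnS => kK; rewrite -[_ \in _]/(tan (y k) \in F) FE atany// y01.
Qed.

Lemma nb_zeros_bound t : 0 <= N t <= n%:R.
Proof.
rewrite /nb_zeros; have [p0|p0] := eqVneq (random_poly (fun j => omega j) n t) 0.
  rewrite p0 (_ : [set x : R | _] = [set x : R | (a < x%:E < b)%E]).
    by rewrite /counting; case: asboolP => [/infinite_interval//|_] /=; rewrite lexx ler0n.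
  by apply/seteqP; split => x /=; rewrite root0; [case|].
have [s [_ sn -> _]] := zeros_seq a b p0 (size_random_poly n t).
by rewrite ler0n ler_nat.
Qed.

Lemma nb_zeros_poly0 t : random_poly (fun j => omega j) n t = 0 -> N t = 0.
Proof.
move=> p0; rewrite /nb_zeros p0 (_ : [set x : R | _] = [set x : R | (a < x%:E < b)%E]).
  by rewrite /counting; case: asboolP => [/infinite_interval|].
by apply/seteqP; split => x /=; rewrite root0; [case|].
Qed.

Let zero_in u v t : R := `[< exists x, [/\ u < x <= v, x < B & X n x t = 0] >]%:R.

Let measurable_indicator (D : set T) : measurable D -> measurable_fun setT (fun t => `[< D t >]%:R : R).
Proof.
move=> mD; rewrite (_ : (fun t => _) = \1_D); first exact: measurable_indic.
by apply/funext => t; rewrite indicE.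
Qed.

(** A limit of numbers of occupied cells. The indicator of a nonzero polynomial restores the default
    value 0 on the exceptional event. *)
Lemma measurable_nb_zeros : measurable_fun setT N.
Proof.
pose ph (j : nat) : R := (B - A) / j.+1%:R.
pose h j t := `[< random_poly (fun j => omega j) n t != 0 >]%:R *
   \sum_(k < j.+1) zero_in (A + k%:R * ph j) (A + k.+1%:R * ph j) t.
apply: (@measurable_fun_cvg _ _ _ _ h).
  move=> j; apply: measurable_funM.
    exact: (measurable_indicator (measurable_poly_neq0 n)).
  apply: measurable_sum => k.
  exact: (measurable_indicator (measurable_zero_in n _ _ B)).
move=> t _; have [p0|p0] := eqVneq (random_poly (fun j => omega j) n t) 0.
  rewrite nb_zeros_poly0// (_ : h ^~ t = cst 0); first exact: cvg_cst.
  by apply/funext => j; rewrite /h p0 eqxx/= asboolF ?mul0r.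
have [s [us sn Ns sE]] := zeros_seq a b p0 (size_random_poly n t).
rewrite /nb_zeros Ns.
have [e e0 H] := count_cells us sE.
apply: cvg_near_cst.
exists (Num.truncn ((B - A) / e)) => // j /= ej.
rewrite /h asboolT// mul1r -(H j.+1 (ph j)).
- apply: eq_bigr => k _; rewrite /zero_in; congr (_%:R); congr nat_of_bool; congr asbool.
  by apply/propext; split => -[x [x1 x2 x3]]; exists x; split => //; rewrite -x3 X_hom.
- rewrite divr_ge0 ?subr_ge0 ?(ltW AB)//= ltr_pdivrMr// mulrC -ltr_pdivrMr//.
  by apply: lt_le_trans (truncnS_gt _) _; rewrite ler_nat ltnS.
- by rewrite /ph mulrC divfK ?pnatr_eq0// addrC subrK.
Qed.

End Interval.
End NumberOfZeros.

(** * Convergence of dyadic sign counts to the number of zeros *)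

Section AlmostSure.
Context d (T : measurableType d) (R : realType) (P : probability T R).
Variable omega : nat -> {RV P >-> R}.
Hypothesis iid : iid_standard_gaussian omega.
Local Notation X := (kostlan omega).
Local Notation cnt := (sign_changes omega).
Local Notation weight := (gauss_weight omega).

Lemma null_of_Ex (E : set T) : measurable E -> Ex P (\1_E) <= 0 -> P.-negligible E.
Proof.
move=> mE; rewrite Ex_indic// => E0; exists E; split => //.
have f : P E \is a fin_num by exact: fin_num_measure.
by rewrite -(fineK f); congr (_%:E); apply/eqP; rewrite eq_le E0 fine_ge0.
Qed.

Lemma le0_of_pow2 (x c : R) : (forall j, x <= c / 2 ^+ j) -> x <= 0.
Proof.
move=> H; rewrite leNgt; apply/negP => x0.
pose j := Num.truncn (c / x).
have : c / x < 2 ^+ j.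
  apply: lt_le_trans (truncnS_gt _) _.
  by rewrite -natrX ler_nat ltn_expl.
by rewrite ltr_pdivrMr// mulrC -ltr_pdivrMr ?exprn_gt0// ltNge H.
Qed.

Lemma ae_X_neq0 n th : P.-negligible [set t | X n th t = 0].
Proof.
rewrite (_ : [set t | _] = X n th @^-1` [set 0]) //.
apply: null_of_Ex.
  by rewrite -[X in measurable X]setTI; apply: measurable_X => //; exact: measurable_set1.
rewrite -[leRHS](lin_neq0 iid (dot_xi1 n th)).
rewrite le_eqVlt; apply/orP; left; apply/eqP; apply: eq_Ex => t; rewrite indicE.
congr (_%:R); congr nat_of_bool; apply/idP/eqP => [/set_mem h|h]. 
- exact h.
- apply/mem_set; exact h.
Qed.

(** For large [e] the two weights majorize, up to a constant, the indicator that two neighbouring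
    values are both small. The correlation r <= cos ph gives sqrt(1 - r^2) >= sin ph >= ph/2. *)
Lemma Ex_two_small n th ph e : 0 < ph <= 1 -> (0 < n)%N -> 0 < e ->
  Ex P (fun t => weight e n.+1 (xi n th) t * weight e n.+1 (xi n (th + ph)) t) <=
  (e * ph)^-1.
Proof.
move=> /andP[p0 p1] n0 e0.
have p2 := pi_ge2 R; have pp := pi_gt0 R.
rewrite (Ex_weight2 iid (ltW e0) (dot_xi1 _ _) (dot_xi1 _ _)) dot_xi opprD addNKr cosN.
have ph2 : 0 <= ph <= pi / 2 by apply/andP; split; lra.
have /andP[r0 r1] := cosX_ge0 n ph2.
have c0 : 0 <= cos ph by apply: cos_ge0_pihalf; apply/andP; split; lra.
have rc : cos ph ^+ n <= cos ph.
  by case: (n) n0 => // n' _; rewrite exprS ler_piMr// exprn_ile1// cos_le1.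
have sph : ph / 2 <= sin ph.
  have := sin_ge3 (ltW p0); have : ph ^+ 3 <= ph.
    by rewrite exprS ler_piMr ?(ltW p0)// exprn_ile1// ltW.
  by move: (ph ^+ 3) (sin ph) => u v; lra.
set r := cos ph ^+ n in r0 r1 rc *.
have k1 : 0 < 2 * (e * (1 + r)) by rewrite !mulr_gt0//; lra.
have rr : ph / 2 <= Num.sqrt ((1 + r) * (1 - r)).
  have s0 : 0 <= sin ph by lra.
  apply: (le_trans sph); rewrite -[leLHS](ger0_norm s0).
  rewrite -sqrtr_sqr ler_wsqrtr// sin2cos2.
  rewrite (_ : (1 + r) * (1 - r) = 1 - r ^+ 2); last by ring.
  by rewrite lerB// lerXn2r ?nnegrE.
have r2 : 0 <= 1 - r by lra.
rewrite -invfM -sqrtrM; last by lra.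
rewrite lef_pV2 ?posrE ?mulr_gt0// ?sqrtr_gt0 ?mulr_gt0//; last 2 first.
- by lra.
- by have := mulr_ge0 (ltW e0) r2; lra.
apply: (@le_trans _ _ (Num.sqrt ((2 * e) ^+ 2 * ((1 + r) * (1 - r))))).
  rewrite sqrtrM ?sqr_ge0// sqrtr_sqr ger0_norm ?mulr_ge0 ?(ltW e0)//.
  by rewrite -mulrA mulrCA ler_wpM2l ?(ltW e0)//; lra.
rewrite ler_wsqrtr//.
have -> : (1 + 2 * (e * (1 + r))) * (1 + 2 * (e * (1 - r))) = (2 * e) ^+ 2 * ((1 + r) * (1 - r)) + (1 + 4 * e).
  by ring.
by rewrite lerDl; lra.
Qed.

Section Interval.
Variables (n : nat) (a b : \bar R).
Hypothesis n0 : (0 < n)%N.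
Hypothesis ab : (a < b)%E.
Local Notation N := (nb_zeros (fun j => omega j) n a b).
Let A : R := ang a.
Let B : R := ang b.
Variables (m0 : nat) (ph0 : R).
Hypothesis ph01 : 0 < ph0 <= 1.
Hypothesis mB : A + m0%:R * ph0 = B.
Let ph j : R := ph0 / 2 ^+ j.
Let m j := (2 ^ j * m0)%N.

Let phj j : 0 < ph j <= 1.
Proof.
case/andP: ph01 => p0 p1; rewrite divr_gt0 ?exprn_gt0//= ler_pdivrMr ?exprn_gt0// mul1r.
by apply: le_trans p1 _; rewrite exprn_ege1// ler1n.
Qed.

Let mphj j : A + (m j)%:R * ph j = B.
Proof.
rewrite -mB /m /ph natrM natrX; congr (_ + _); field.
by rewrite expf_neq0.
Qed.

Let small (M : nat) j k : set T := [set t | `|X n (A + k%:R * ph j) t| <= M.+1%:R * ph j ^+ 2 /\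
  `|X n (A + k.+1%:R * ph j) t| <= M.+1%:R * ph j ^+ 2].

Let measurable_small M j k : measurable (small M j k).
Proof.
rewrite (_ : small M j k = ((fun t => `|X n (A + k%:R * ph j) t|) @^-1` `]-oo, M.+1%:R * ph j ^+ 2]) `&`
  ((fun t => `|X n (A + k.+1%:R * ph j) t|) @^-1` `]-oo, M.+1%:R * ph j ^+ 2])); last first.
  by apply/seteqP; split => t; rewrite /small/= !in_itv.
apply: measurableI; rewrite -[X in measurable X]setTI; apply: (measurableT_comp _ _ measurableT) => //;
  exact: measurable_X.
Qed.

Let Ex_small M j k : Ex P (\1_(small M j k)) <= expR 1 * (2 * (M.+1%:R ^+ 2 * ph j ^+ 3)).
Proof.
have /andP[p0 p1] := phj j.
set e := M.+1%:R * ph j ^+ 2; have e0 : 0 < e by rewrite mulr_gt0 ?exprn_gt0.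
(* With this parameter each exponent is at most 1/2 on the event, so the product of the weights is
   at least exp(-1). *)
pose w : R := (2 * e ^+ 2)^-1; have w0 : 0 < w by rewrite invr_gt0 mulr_gt0 ?exprn_gt0.
have := Ex_two_small (A + k%:R * ph j) (phj j) n0 w0.
rewrite (_ : A + k%:R * ph j + ph j = A + k.+1%:R * ph j); last by rewrite -natr1; ring.
set x := xi _ _; set y := xi _ _ => H.
have bx := bdd_weight omega n.+1 x (ltW w0); have b_y := bdd_weight omega n.+1 y (ltW w0).
have -> : 2 * (M.+1%:R ^+ 2 * ph j ^+ 3) = (w * ph j)^-1.
  by rewrite /w invfM invrK /e; field; rewrite gt_eqF.
apply: le_trans (ler_wpM2l (expR_ge0 1) H); rewrite -ExZ; last exact: bddM.
apply: Ex_le; [exact: bdd_indic|by apply: bddZ; exact: bddM|] => t.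
rewrite indicE; have [|_] := boolP (t \in _); last first.
  by rewrite !mulr_ge0 ?expR_ge0// /gauss_weight ?expR_ge0.
move=> /set_mem[h1 h2]; rewrite /= /gauss_weight -!expRD -[leLHS]expR0 ler_expR.
have sq u : `|u| <= e -> w * u ^+ 2 <= 1 / 2.
  move=> ue; rewrite -[u ^+ 2]ger0_norm ?sqr_ge0// normrX.
  apply: (@le_trans _ _ (w * e ^+ 2)); first by rewrite ler_wpM2l ?(ltW w0)// lerXn2r ?nnegrE// ltW.
  by rewrite /w le_eqVlt; apply/orP; left; apply/eqP; field; rewrite gt_eqF.
by have := sq _ h1; have := sq _ h2; rewrite /kostlan -/x -/y; lra.
Qed.

(** Every level has a cell with two values of order ph^2. One cell has probability O(ph^3) and there
    are O(1/ph) cells, so the event is null. It contains the double zeros with constant at most M +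
    1. *)
Let doubled (M : nat) : set T := \bigcap_j \bigcup_(k < m j) small M j k.

Let doubled_null M : P.-negligible (doubled M).
Proof.
have mU j : measurable (\bigcup_(k < m j) small M j k) by exact: bigcup_measurable.
have mD : measurable (doubled M) by exact: bigcapT_measurable.
apply: null_of_Ex => //.
apply: (@le0_of_pow2 _ ((m0%:R * ph0) * (expR 1 * (2 * M.+1%:R ^+ 2)))) => j.
have /andP[p0 p1] := phj j.
apply: (@le_trans _ _ (\sum_(k < m j) Ex P (\1_(small M j k)))).
  rewrite -Ex_sum; last by move=> k _; exact: bdd_indic.
  apply: Ex_le; [exact: bdd_indic|by apply: bdd_sum => k _; exact: bdd_indic|] => t.
  rewrite indicE; have [|_] := boolP (t \in _); last by apply: sumr_ge0 => k _; rewrite indicE.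
  move=> /set_mem /(_ j I)[k /= km st].
  rewrite (bigD1 (Ordinal km))//= indicE mem_set//= lerDl.
  by apply: sumr_ge0 => i _; rewrite indicE.
apply: (@le_trans _ _ (\sum_(k < m j) expR 1 * (2 * (M.+1%:R ^+ 2 * ph j ^+ 3)))).
  by apply: ler_sum => k _; exact: Ex_small.
rewrite sumr_const card_ord -[_ *+ m j]mulr_natl.
have -> : (m j)%:R * (expR 1 * (2 * (M.+1%:R ^+ 2 * ph j ^+ 3))) =
  ((m j)%:R * ph j) * (expR 1 * (2 * M.+1%:R ^+ 2)) * (ph j * ph j) by ring.
have -> : (m j)%:R * ph j = m0%:R * ph0.
  by rewrite /m /ph natrM natrX; field; rewrite expf_neq0.
have c0 : 0 <= m0%:R * ph0 * (expR 1 * (2 * M.+1%:R ^+ 2)).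
  by rewrite !mulr_ge0 ?expR_ge0 ?sqr_ge0//; case/andP: ph01 => /ltW.
rewrite ler_wpM2l//.
apply: (@le_trans _ _ (ph j)); first by rewrite ler_piMr// ltW.
rewrite /ph ler_piMl ?invr_ge0 ?exprn_ge0//.
by case/andP: ph01.
Qed.

(** Off two null events no grid point is a zero and no zero is double; the counts are then
    eventually equal to the number of zeros. *)
Lemma ae_cnt : {ae P, forall t, (fun j => cnt n A (ph j) (m j) t) @ \oo --> N t}.
Proof.
have ne1 : P.-negligible (\bigcup_j \bigcup_k [set t | X n (A + k%:R * ph j) t = 0]).
  by apply: negligible_bigcup => j; apply: negligible_bigcup => k; exact: ae_X_neq0.
have ne2 : P.-negligible (\bigcup_M doubled M) by apply: negligible_bigcup => M; exact: doubled_null.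
apply: negligibleS (negligibleU ne1 ne2) => t /= nt.
apply: contrapT => /not_orP[n1 n2]; apply: nt.
have nz j k : hom n (random_poly (fun i => omega i) n t) (A + k%:R * ph j) != 0.
  by apply/eqP => h; apply: n1; exists j => //; exists k => //=; rewrite X_hom.
have p0 : random_poly (fun i => omega i) n t != 0.
  apply: contraNneq (nz 0%N 0%N) => ->; rewrite /hom big1// => i _.
  by rewrite coef0 !mul0r.
have sp := size_random_poly omega n t.
have [s [us sn Ns sE]] := zeros_seq a b p0 sp.
have /andP[A2 _] := ang_range a; have /andP[_ B2] := ang_range b.
have nd th : ang a < th < ang b ->
    ~ exists K, forall x, `|hom n (random_poly (fun i => omega i) n t) x| <= K * `|x - th| ^+ 2.
  move=> /andP[ath thb] [K HK]; apply: n2.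
  pose M := Num.truncn K; exists M => // j _.
  have KM : K <= M.+1%:R by apply: ltW; exact: truncnS_gt.
  have /andP[pj0 _] := phj j.
  have thm : th <= A + (m j)%:R * ph j by rewrite mphj ltW.
  have [k km /andP[k1 k2]] : exists2 k, (k < m j)%N & A + k%:R * ph j < th <= A + k.+1%:R * ph j.
    apply: contrapT => no; have := sum_incell1 (ltW pj0) ath thm.
    rewrite big1 ?(eqP (oner_eq0 R))//; last first.
      by move=> k _; case: (boolP (_ < _ <= _)%R) => // h; case: no; exists k.
    by move=> /eqP; rewrite eq_sym oner_eq0.
  exists k => //.
  have e : A + k.+1%:R * ph j = A + k%:R * ph j + ph j by rewrite -natr1; ring.
  have bd x : `|x - th| <= ph j -> `|X n x t| <= M.+1%:R * ph j ^+ 2.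
    move=> xt; rewrite X_hom; apply: le_trans (HK x) _.
    apply: (@le_trans _ _ (M.+1%:R * `|x - th| ^+ 2)); first by rewrite ler_wpM2r ?sqr_ge0.
    by rewrite ler_wpM2l// lerXn2r ?nnegrE// ltW.
  rewrite e in k2; split; apply: bd; rewrite ?e ler_distl; apply/andP; split; lra.
have [e e0 H] := count_changes n0 p0 sp A2 B2 us sE nd.
rewrite /nb_zeros Ns; apply: cvg_near_cst.
exists (Num.truncn (ph0 / e)) => // j /= ej.
have /andP[pj0 _] := phj j.
rewrite -(H (m j) (ph j)) //.
- by apply: eq_bigr => k _; rewrite !X_hom.
- rewrite ltW//= /ph ltr_pdivrMr ?exprn_gt0// mulrC -ltr_pdivrMr//.
  apply: lt_le_trans (truncnS_gt _) _; rewrite -natrX ler_nat.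
  by apply: leq_ltn_trans ej _; exact: ltn_expl.
Qed.

(** The bound of [Ex_cnt_diff] is uniform in the number of further halvings. Truncation at [K]
    permits dominated convergence and is inactive in the limit, where the difference is at most
    [K]. *)
Lemma Ex_zeros_cnt J : (0 < m0)%N ->
  Ex P (fun t => (N t - cnt n A (ph J) (m J) t) ^+ 2) <=
  12 * (m0%:R ^+ 2 * (Num.sqrt n%:R * ph0) ^+ 3) / 2 ^+ J.
Proof.
move=> m00.
pose K : R := n%:R + (m J)%:R.
pose D k t := `|cnt n A (ph (J + k)) (m (J + k)) t - cnt n A (ph J) (m J) t|.
pose f k t := Num.min (D k t) K ^+ 2.
have mN := measurable_nb_zeros omega n ab.
have bN : bdd N.
  split => //; exists n%:R => t; have /andP[N0 Nn] := nb_zeros_bound omega n ab t.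
  by rewrite ger0_norm.
have bc j : bdd (cnt n A (ph j) (m j)) by exact: bdd_cnt.
have bD k : bdd (D k) by apply: bdd_norm; exact: bddB.
have K0 : 0 <= K by rewrite addr_ge0.
have min0 k t : 0 <= Num.min (D k t) K by rewrite le_min normr_ge0.
have bf k : bdd (f k).
  apply: bddX; split; first by apply: measurable_minr => //; exact: (bD k).1.
  by exists K => t; rewrite ger0_norm ?min0// ge_min lexx orbT.
have mg : measurable_fun setT (fun t => (N t - cnt n A (ph J) (m J) t) ^+ 2).
  by apply: (bddX 2 (bddB bN (bc J))).1.
have fK k t : `|f k t| <= K ^+ 2.
  by rewrite /f normrX ger0_norm ?min0// lerXn2r ?nnegrE ?min0// ge_min lexx orbT.
have cv : {ae P, forall t, f ^~ t @ \oo --> (N t - cnt n A (ph J) (m J) t) ^+ 2}.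
  apply: filterS ae_cnt => t ct.
  have NK : `|N t - cnt n A (ph J) (m J) t| <= K.
    apply: le_trans (ler_normB _ _) _; apply: lerD.
      by have /andP[N0 Nn] := nb_zeros_bound omega n ab t; rewrite ger0_norm.
    by rewrite ger0_norm ?cnt_ge0// cnt_le.
  rewrite -[_ ^+ 2]ger0_norm ?sqr_ge0// normrX -[X in X ^+ 2](min_idPl NK) /f.
  have c1 : cnt n A (ph (J + k)) (m (J + k)) t - cnt n A (ph J) (m J) t @[k --> \oo] -->
      N t - cnt n A (ph J) (m J) t.
    apply: cvgB; last exact: cvg_cst.
    have E : (fun k => cnt n A (ph (J + k)) (m (J + k)) t) =
      (fun k => cnt n A (ph (k + J)) (m (k + J)) t) by apply/funext => k; rewrite addnC.
    by rewrite E (cvg_shiftn J (fun j => cnt n A (ph j) (m j) t)).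
  have c2 := cvg_norm c1.
  apply: (cvg_comp _ (fun y : R => y ^+ 2) _ (@exprn_continuous _ 2 _)).
  apply: (cvg_comp (fun k => D k t) (fun y : R => Num.min y K)); first exact: c2.
  by apply: (@min_fun_continuous _ R R id (fun=> K)) => y; [exact: cvg_id|exact: cvg_cst].
have := @Ex_ae_cvg _ _ _ P f _ (K ^+ 2) bf mg fK cv.
move=> /cvg_lim <- //.
apply: limr_le; first by apply/cvg_ex; eexists; exact: (Ex_ae_cvg bf mg fK cv).
near=> k.
apply: le_trans (Ex_cnt_diff iid n A m0 J k _); last first.
  by have := pi_ge2 R; case/andP: ph01 => h1 h2 h3; apply/andP; split; lra.
apply: Ex_le => //; first by apply: bddX; apply: bddB; exact: bdd_cnt.
move=> t; rewrite /f -/(ph _) -/(ph _) -/(m _) -/(m _).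
rewrite -[leRHS]ger0_norm ?sqr_ge0// normrX lerXn2r ?nnegrE ?min0//.
by rewrite ge_min lexx.
Unshelve. all: by end_near.
Qed.

End Interval.
End AlmostSure.

(** * Central limit theorem for independent blocks *)

Section IndependentSums.
Context d (T : measurableType d) (R : realType) (P : probability T R).

Lemma cos_taylor (y : R) : `|cos y - (1 - y ^+ 2 / 2)| <= `|y| ^+ 3.
Proof.
wlog y0 : y / 0 <= y => [H|].
  have [/H//|/ltW y0] := leP 0 y.
  by have := H (- y); rewrite oppr_ge0 cosN sqrrN normrN; apply.
have h1 := cos_ge2 y0; have h2 := cos_le4 y0; have h3 := cos_le1 y.
have y3 : 0 <= y ^+ 3 by rewrite exprn_ge0.
rewrite [ `|y| ]ger0_norm// ger0_norm; last by lra.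
have [y1|y1] := leP y 1.
  have y4 : y ^+ 4 <= y ^+ 3 by rewrite exprS ler_piMl.
  by move: y4 y3 h2; move: (y ^+ 4) (y ^+ 3) (y ^+ 2) (cos y) => *; lra.
have y2 : y ^+ 2 <= y ^+ 3 by rewrite [leRHS]exprS ler_peMl ?sqr_ge0// ltW.
have : 0 <= y ^+ 2 by exact: sqr_ge0.
by move: y2 y3 h3; move: (y ^+ 3) (y ^+ 2) (cos y) => *; lra.
Qed.

Lemma expN_taylor (x : R) : 0 <= x -> `|expR (- x) - (1 - x)| <= x ^+ 2 / 2.
Proof.
move=> x0; have := expN_le x0; have := expR_ge1Dx (- x).
move=> h1 h2; rewrite ger0_norm; last by lra.
by move: h1 h2; move: (expR _) (x ^+ 2) => *; lra.
Qed.

Variables (Y : nat -> T -> R) (K : nat) (D2 D3 : R).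
Hypothesis bY : forall c, bdd (Y c).
Hypothesis EY : forall c, Ex P (Y c) = 0.
Hypothesis EY2 : forall c, (c < K)%N -> Ex P (fun t => Y c t ^+ 2) <= D2.
Hypothesis EY3 : forall c, (c < K)%N -> Ex P (fun t => `|Y c t| ^+ 3) <= D3.
Hypothesis indep : forall (f g : R -> R) k, (k < K)%N ->
  Ex P (fun t => f (\sum_(c < k) Y c t) * g (Y k t)) =
  Ex P (fun t => f (\sum_(c < k) Y c t)) * Ex P (fun t => g (Y k t)).

Let bS k : bdd (fun t => \sum_(c < k) Y c t).
Proof. exact: bdd_sum. Qed.

Lemma Ex_sqr_indep : Ex P (fun t => (\sum_(c < K) Y c t) ^+ 2) = \sum_(c < K) Ex P (fun t => Y c t ^+ 2).
Proof.
suff H k : (k <= K)%N -> Ex P (fun t => (\sum_(c < k) Y c t) ^+ 2) = \sum_(c < k) Ex P (fun t => Y c t ^+ 2).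
  exact: H.
elim: k => [|k IH] kK.
  by rewrite big_ord0 -[RHS](Ex_cst P); apply: eq_Ex => t; rewrite big_ord0 expr0n.
rewrite big_ord_recr/= -IH ?(ltnW kK)//.
have bb : bdd (fun t => (\sum_(c < k) Y c t) * Y k t) by exact: bddM.
transitivity (Ex P (fun t => (\sum_(c < k) Y c t) ^+ 2 + 2 * ((\sum_(c < k) Y c t) * Y k t) + Y k t ^+ 2)).
  by apply: eq_Ex => t; rewrite big_ord_recr/=; ring.
rewrite (ExD P (bddD (bddX 2 (bS k)) (bddZ 2 bb)) (bddX 2 (bY k))).
rewrite (ExD P (bddX 2 (bS k)) (bddZ 2 bb)) ExZ//.
by rewrite (indep id id kK) EY !mulr0 addr0.
Qed.

(** Adding one variable multiplies the cosine term by 1 - u^2 E[Y^2]/2 up to a cubic error, while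
    the sine term is itself cubic because Y is centred. All factors are bounded by 1, so the errors
    simply add up. *)
Lemma cos_sum_indep (u v : R) :
  `|Ex P (fun t => cos (u * (\sum_(c < K) Y c t) + v)) -
    expR (- (u ^+ 2 * (\sum_(c < K) Ex P (fun t => Y c t ^+ 2)) / 2)) * cos v| <=
  K%:R * (2 * `|u| ^+ 3 * D3 + u ^+ 4 * D2 ^+ 2).
Proof.
set er := 2 * `|u| ^+ 3 * D3 + u ^+ 4 * D2 ^+ 2.
suff H k : (k <= K)%N -> `|Ex P (fun t => cos (u * (\sum_(c < k) Y c t) + v)) -
    expR (- (u ^+ 2 * (\sum_(c < k) Ex P (fun t => Y c t ^+ 2)) / 2)) * cos v| <= k%:R * er.
  exact: H.
elim: k => [|k IH] kK.
  rewrite mul0r big_ord0 mulr0 mul0r oppr0 expR0 mul1r.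
  rewrite (_ : Ex P _ = cos v) ?subrr ?normr0//.
  by rewrite -[RHS](Ex_cst P); apply: eq_Ex => t; rewrite big_ord0 mulr0 add0r.
have bcs w (Z : T -> R) : bdd Z -> bdd (fun t => cos (u * Z t + w)).
  by move=> bZ; apply: bdd_cosY; exact: (bddD (bddZ u bZ) (bdd_cst T w)).1.
have bsn w (Z : T -> R) : bdd Z -> bdd (fun t => sin (u * Z t + w)).
  move=> bZ; have E t : sin (u * Z t + w) = cos (u * Z t + (w - pi / 2)) by rewrite addrA cosBpihalf.
  by apply: (eq_bdd E); exact: bcs.
set S := fun t => \sum_(c < k) Y c t.
have bSk : bdd S by exact: bS.
have -> : Ex P (fun t => cos (u * (\sum_(c < k.+1) Y c t) + v)) =
   Ex P (fun t => cos (u * S t + v)) * Ex P (fun t => cos (u * Y k t + 0)) -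
   Ex P (fun t => sin (u * S t + v)) * Ex P (fun t => sin (u * Y k t + 0)).
  rewrite -(indep (fun x => cos (u * x + v)) (fun x => cos (u * x + 0)) kK).
  rewrite -(indep (fun x => sin (u * x + v)) (fun x => sin (u * x + 0)) kK).
  rewrite -ExB; [|by apply: bddM; exact: bcs|by apply: bddM; exact: bsn].
  apply: eq_Ex => t; rewrite big_ord_recr/= !addr0 -cosD; congr cos.
  by rewrite /S; ring.
set C := Ex P (fun t => cos (u * S t + v)).
set x := u ^+ 2 * Ex P (fun t => Y k t ^+ 2) / 2.
have y20 : 0 <= Ex P (fun t => Y k t ^+ 2) by apply: Ex_ge0 => t; exact: sqr_ge0.
have x0 : 0 <= x by rewrite divr_ge0// mulr_ge0// sqr_ge0.
have bY3 : bdd (fun t => `|u| ^+ 3 * `|Y k t| ^+ 3).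
  by apply: bddZ; apply: bddX; exact: bdd_norm.
have u30 : 0 <= `|u| ^+ 3 by rewrite exprn_ge0.
have E3 : Ex P (fun t => `|u| ^+ 3 * `|Y k t| ^+ 3) <= `|u| ^+ 3 * D3.
  by rewrite ExZ ?ler_wpM2l ?EY3//; apply: bddX; exact: bdd_norm.
have c1 : `|Ex P (fun t => cos (u * Y k t + 0)) - (1 - x)| <= `|u| ^+ 3 * D3.
  have bq : bdd (fun t => 1 - u ^+ 2 / 2 * Y k t ^+ 2).
    by apply: bddB; [exact: bdd_cst|apply: bddZ; exact: bddX].
  have -> : 1 - x = Ex P (fun t => 1 - u ^+ 2 / 2 * Y k t ^+ 2).
    rewrite (ExB P (bdd_cst T 1) (bddZ (u ^+ 2 / 2) (bddX 2 (bY k)))) Ex_cst ExZ; last exact: bddX.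
    by rewrite /x; ring.
  rewrite -(ExB P (bcs 0 _ (bY k)) bq) (le_trans (Ex_norm P (bddB (bcs 0 _ (bY k)) bq)))//.
  apply: le_trans E3; apply: Ex_le => //.
    by apply: bdd_norm; apply: bddB => //; exact: bcs.
  move=> t; rewrite addr0 -exprMn -normrM.
  by rewrite (_ : 1 - u ^+ 2 / 2 * Y k t ^+ 2 = 1 - (u * Y k t) ^+ 2 / 2) ?cos_taylor//; ring.
have s1 : `|Ex P (fun t => sin (u * Y k t + 0))| <= `|u| ^+ 3 * D3.
  have -> : Ex P (fun t => sin (u * Y k t + 0)) = Ex P (fun t => sin (u * Y k t + 0) - u * Y k t).
    by rewrite (ExB P (bsn 0 _ (bY k)) (bddZ u (bY k))) ExZ// EY mulr0 subr0.
  have bq := bddB (bsn 0 _ (bY k)) (bddZ u (bY k)).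
  rewrite (le_trans (Ex_norm P bq))//; apply: le_trans E3; apply: Ex_le => //; first exact: bdd_norm.
  move=> t; rewrite addr0 -exprMn -normrM; apply: le_trans (sin_sub_id _) _.
  by rewrite ler_pdivrMr// ler_peMr ?exprn_ge0//; lra.
have e1 : `|expR (- x) - (1 - x)| <= u ^+ 4 * D2 ^+ 2.
  apply: le_trans (expN_taylor x0) _.
  have : x <= u ^+ 2 * D2.
    rewrite /x ler_pdivrMr// -[leRHS]mulrA; apply: ler_wpM2l; first exact: sqr_ge0.
    by have := EY2 kK; lra.
  move=> xu; have : x ^+ 2 <= (u ^+ 2 * D2) ^+ 2 by rewrite lerXn2r ?nnegrE// (le_trans x0).
  rewrite (_ : (u ^+ 2 * D2) ^+ 2 = u ^+ 4 * D2 ^+ 2); last by ring.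
  have := sqr_ge0 x.
  by move: (x ^+ 2) (u ^+ 4 * _) => *; lra.
have Cn : `|C| <= 1 by apply: Ex_normc => [|t]; [exact: bcs|exact: cos_max].
have Sn : `|Ex P (fun t => sin (u * S t + v))| <= 1 by apply: Ex_normc => [|t]; [exact: bsn|exact: sin_max].
rewrite big_ord_recr/= mulrDr mulrDl opprD expRD -/x.
have IH' := IH (ltnW kK); rewrite -/C in IH'.
set E0 := expR (- (u ^+ 2 * (\sum_(c < k) Ex P (fun t => Y c t ^+ 2)) / 2)) in IH' *.
set c := Ex P (fun t => cos (u * Y k t + 0)) in c1 *.
set s := Ex P (fun t => sin (u * Y k t + 0)) in s1 *.
set Z := Ex P (fun t => sin (u * S t + v)) in Sn *.
have -> : C * c - Z * s - E0 * expR (- x) * cos v =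
  C * (c - (1 - x)) - C * (expR (- x) - (1 - x)) - Z * s + expR (- x) * (C - E0 * cos v) by ring.
have ex1 : 0 <= expR (- x) <= 1 by rewrite expR_ge0/= -expR0 ler_expR oppr_le0.
have n1 : `|C * (c - (1 - x))| <= `|u| ^+ 3 * D3.
  by rewrite normrM; apply: le_trans c1; rewrite ler_piMl.
have n2 : `|C * (expR (- x) - (1 - x))| <= u ^+ 4 * D2 ^+ 2.
  by rewrite normrM; apply: le_trans e1; rewrite ler_piMl.
have n3 : `|Z * s| <= `|u| ^+ 3 * D3.
  by rewrite normrM; apply: le_trans s1; rewrite ler_piMl.
have n4 : `|expR (- x) * (C - E0 * cos v)| <= k%:R * er.
  rewrite normrM; apply: le_trans IH'; rewrite ler_piMl// ger0_norm; by case/andP: ex1.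
rewrite (le_trans (ler_normD _ _))//.
rewrite -natr1 mulrDl mul1r addrC lerD//.
rewrite (le_trans (ler_normB _ _))//.
have := le_trans (ler_normB (C * (c - (1 - x))) (C * (expR (- x) - (1 - x)))) (lerD n1 n2).
by rewrite /er -[2 * _ * D3]mulrA; move: n3; move: `|_ - _| `|Z * s| (`|u| ^+ 3 * D3) => ? ? ? ? ?; lra.
Qed.

End IndependentSums.

Section Normalization.
Context d (T : measurableType d) (R : realType) (P : probability T R).

Lemma Ex_sqr_norm (f : T -> R) : bdd f -> Ex P (fun t => `|f t|) ^+ 2 <= Ex P (fun t => f t ^+ 2).
Proof.
move=> bf; set m := Ex P _.
have bn := bdd_norm bf.
have : 0 <= Ex P (fun t => (`|f t| - m) ^+ 2) by apply: Ex_ge0 => t; exact: sqr_ge0.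
rewrite (_ : Ex P _ = Ex P (fun t => f t ^+ 2) - m ^+ 2) ?subr_ge0//.
transitivity (Ex P (fun t => f t ^+ 2 - 2 * m * `|f t| + m ^+ 2)).
  by apply: eq_Ex => t; rewrite -[f t ^+ 2]ger0_norm ?sqr_ge0// normrX; ring.
rewrite (ExD P (bddB (bddX 2 bf) (bddZ (2 * m) bn)) (bdd_cst T (m ^+ 2))) Ex_cst.
rewrite (ExB P (bddX 2 bf) (bddZ (2 * m) bn)) (ExZ P _ bn) -/m.
by ring.
Qed.

Lemma cos_lip (x y : R) : `|cos x - cos y| <= `|x - y|.
Proof.
wlog xy : x y / y <= x => [H|].
  by have [/H//|/ltW/H] := leP y x; rewrite distrC [X in _ <= X -> _]distrC.
have [c _ ->] : exists2 c, c \in `[y, x] & cos x - cos y = - sin c * (x - y).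
  apply: (@MVT_segment R cos (fun x => - sin x)) => //.
  exact: (continuous_subspaceT (@continuous_cos R)).
by rewrite normrM normrN ler_piMl// sin_max.
Qed.

Lemma expN_lip (a b : R) : 0 <= a -> 0 <= b -> `|expR (- a) - expR (- b)| <= `|a - b|.
Proof.
wlog ab : a b / a <= b => [H|] a0 b0.
  by have [/H//|/ltW/H h] := leP a b; [exact|rewrite distrC [X in _ <= X]distrC; exact: h].
rewrite ger0_norm; last by rewrite subr_ge0 ler_expR lerN2.
rewrite distrC ger0_norm ?subr_ge0//.
have -> : expR (- a) - expR (- b) = expR (- a) * (1 - expR (- (b - a))).
  by rewrite mulrBr mulr1 -expRD; congr (_ - expR _); ring.
apply: (@le_trans _ _ (1 * (b - a))); last by rewrite mul1r.
rewrite ler_pM ?expR_ge0//.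
- by rewrite subr_ge0 -expR0 ler_expR oppr_le0 subr_ge0.
- by rewrite -expR0 ler_expR oppr_le0.
- by have := expR_ge1Dx (- (b - a)); lra.
Qed.

(** [e] is the L^2 distance of [W] and [S] relative to the size of [S]. The three errors come from
    replacing W by S inside the cosine, s2 by V in the exponent, and from [S] itself; e <= 1/6
    ensures V >= s2/2. *)
Lemma cos_normalized (W S : T -> R) (s2 e er u v : R) : bdd W -> bdd S ->
  0 < s2 -> 0 < e <= 1 / 6 ->
  Ex P (fun t => S t ^+ 2) = s2 ->
  Ex P (fun t => (W t - S t) ^+ 2) <= e ^+ 2 * s2 ->
  let V := Ex P (fun t => W t ^+ 2) in
  `|Ex P (fun t => cos (u / Num.sqrt V * S t + v)) -
    expR (- ((u / Num.sqrt V) ^+ 2 * s2 / 2)) * cos v| <= er ->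
  `|Ex P (fun t => cos (u * (W t / Num.sqrt V) + v)) - expR (- (u ^+ 2 / 2)) * cos v| <=
  2 * e * `|u| + 3 * e * u ^+ 2 + er.
Proof.
move=> bW bS s0 /andP[e0 e6] ES ER V H.
have bR : bdd (fun t => W t - S t) by exact: bddB.
set r2 := Ex P (fun t => (W t - S t) ^+ 2) in ER.
have bSR : bdd (fun t => S t * (W t - S t)) by exact: bddM.
have r20 : 0 <= r2 by apply: Ex_ge0 => t; exact: sqr_ge0.
have VE : V = s2 + 2 * Ex P (fun t => S t * (W t - S t)) + r2.
  transitivity (Ex P (fun t => S t ^+ 2 + 2 * (S t * (W t - S t)) + (W t - S t) ^+ 2)).
    by apply: eq_Ex => t; ring.
  rewrite (ExD P (bddD (bddX 2 bS) (bddZ 2 bSR)) (bddX 2 bR)).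
  by rewrite (ExD P (bddX 2 bS) (bddZ 2 bSR)) (ExZ P _ bSR) ES.
have cross : `|2 * Ex P (fun t => S t * (W t - S t))| <= 2 * e * s2.
  rewrite -(ExZ P 2 bSR) (le_trans (Ex_norm P (bddZ 2 bSR)))//.
  (* Weighted arithmetic-geometric inequality; the weight [e] balances the two terms, since the
     second moment of W - S is at most e^2 s2. *)
  have b2 := bddD (bddZ e (bddX 2 bS)) (bddZ e^-1 (bddX 2 bR)).
  apply: (@le_trans _ _ (Ex P (fun t => e * S t ^+ 2 + e^-1 * (W t - S t) ^+ 2))).
    apply: Ex_le => //; first by apply: bdd_norm; exact: bddZ.
    move=> t; move: (S t) (W t - S t) => x y.
    have : 0 <= e^-1 * (e * x - y) ^+ 2 by rewrite mulr_ge0 ?sqr_ge0// invr_ge0 ltW.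
    have : 0 <= e^-1 * (e * x + y) ^+ 2 by rewrite mulr_ge0 ?sqr_ge0// invr_ge0 ltW.
    have -> : e^-1 * (e * x + y) ^+ 2 = e * x ^+ 2 + e^-1 * y ^+ 2 + 2 * (x * y).
      by field; rewrite gt_eqF.
    have -> : e^-1 * (e * x - y) ^+ 2 = e * x ^+ 2 + e^-1 * y ^+ 2 - 2 * (x * y).
      by field; rewrite gt_eqF.
    by move=> h1 h2; rewrite ler_norml; apply/andP; split; lra.
  rewrite (ExD P (bddZ e (bddX 2 bS)) (bddZ e^-1 (bddX 2 bR))) !ExZ; [|exact: bddX|exact: bddX].
  rewrite ES -/r2.
  have : e^-1 * r2 <= e^-1 * (e ^+ 2 * s2) by rewrite ler_wpM2l// invr_ge0 ltW.
  have -> : e^-1 * (e ^+ 2 * s2) = e * s2 by field; rewrite gt_eqF.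
  by rewrite -[2 * e * s2]mulrA; move: (e * s2) (e^-1 * r2) => *; lra.
have es : e * s2 <= s2 / 6 by rewrite mulrC ler_wpM2l ?(ltW s0)//; lra.
have ee : e ^+ 2 * s2 <= e * s2 / 6.
  by rewrite expr2 -mulrA mulrC ler_wpM2l ?mulr_ge0 ?(ltW e0) ?(ltW s0)//; lra.
have es0 : 0 <= e * s2 by rewrite mulr_ge0 ?ltW.
have Vs : `|s2 - V| <= 3 * (e * s2).
  move: cross; rewrite VE -[2 * e * s2]mulrA.
  move: (2 * Ex P (fun t => S t * (W t - S t))) => x; rewrite !ler_norml => /andP[c1 c2].
  apply/andP; move: c1 c2 r20 ER ee es0; move: (e * s2) (e ^+ 2 * s2) => y z *.
  by split; lra.
have V2 : s2 / 2 <= V.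
  by move: Vs; rewrite ler_distl => /andP[]; move: es; move: (e * s2) => *; lra.
have V0 : 0 < V by lra.
have q0 : 0 < Num.sqrt V by rewrite sqrtr_gt0.
have qq : Num.sqrt V ^+ 2 = V by rewrite sqr_sqrtr// ltW.
have bcs w (Z : T -> R) (a : R) : bdd Z -> bdd (fun t => cos (a * Z t + w)).
  by move=> bZ; apply: bdd_cosY; exact: (bddD (bddZ a bZ) (bdd_cst T w)).1.
have step1 : `|Ex P (fun t => cos (u * (W t / Num.sqrt V) + v)) -
    Ex P (fun t => cos (u / Num.sqrt V * S t + v))| <= 2 * e * `|u|.
  have E1 : Ex P (fun t => cos (u * (W t / Num.sqrt V) + v)) = Ex P (fun t => cos (u / Num.sqrt V * W t + v)).
    by apply: eq_Ex => t; congr (cos (_ + _)); ring.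
  rewrite E1 -(ExB P (bcs v W _ bW) (bcs v S _ bS)).
  rewrite (le_trans (Ex_norm P (bddB (bcs v W _ bW) (bcs v S _ bS))))//.
  apply: (@le_trans _ _ (Ex P (fun t => `|u| / Num.sqrt V * `|W t - S t|))).
    apply: Ex_le.
    - by apply: bdd_norm; apply: bddB; exact: bcs.
    - by apply: bddZ; exact: bdd_norm.
    - move=> t; apply: le_trans (cos_lip _ _) _.
      rewrite (_ : _ - _ = u / Num.sqrt V * (W t - S t)); last by ring.
      by rewrite normrM normrM normfV (gtr0_norm q0).
  rewrite ExZ; last exact: bdd_norm.
  rewrite mulrAC -mulrA mulrC ler_wpM2r// ler_pdivrMr//.
  rewrite -(ler_pXn2r (n := 2))// ?nnegrE; last 2 first.
  - by apply: Ex_ge0.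
  - by rewrite !mulr_ge0// ltW.
  apply: le_trans (Ex_sqr_norm bR) _; apply: le_trans ER _.
  rewrite exprMn qq exprMn -mulrA mulrCA ler_wpM2l ?sqr_ge0//.
  by rewrite expr2; lra.
have step2 : `|expR (- ((u / Num.sqrt V) ^+ 2 * s2 / 2)) * cos v - expR (- (u ^+ 2 / 2)) * cos v| <= 3 * e * u ^+ 2.
  rewrite -mulrBl normrM (@le_trans _ _ (`|expR (- ((u / Num.sqrt V) ^+ 2 * s2 / 2)) - expR (- (u ^+ 2 / 2))|))//.
    by rewrite ler_piMr// cos_max.
  have u20 := sqr_ge0 u.
  have a0 : 0 <= (u / Num.sqrt V) ^+ 2 * s2 / 2 by rewrite divr_ge0// mulr_ge0 ?sqr_ge0// ltW.
  have b0 : 0 <= u ^+ 2 / 2 by rewrite divr_ge0.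
  apply: le_trans (expN_lip a0 b0) _.
  rewrite (_ : _ - _ = u ^+ 2 / (2 * V) * (s2 - V)); last first.
    by rewrite expr_div_n qq; field; rewrite gt_eqF.
  rewrite normrM ger0_norm; last by rewrite divr_ge0// mulr_ge0// ltW.
  rewrite mulrAC ler_pdivrMr ?mulr_gt0//.
  rewrite (_ : 3 * e * u ^+ 2 * (2 * V) = u ^+ 2 * (6 * e * V)); last by ring.
  rewrite ler_wpM2l//; apply: le_trans Vs _.
  have : e * (s2 / 2) <= e * V by rewrite ler_wpM2l// ltW.
  rewrite -[6 * e * V]mulrA (_ : e * (s2 / 2) = e * s2 / 2); last by ring.
  by move: (e * V) (e * s2) => *; lra.
have := ler_normD (Ex P (fun t => cos (u * (W t / Num.sqrt V) + v)) - Ex P (fun t => cos (u / Num.sqrt V * S t + v)))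
  (Ex P (fun t => cos (u / Num.sqrt V * S t + v)) - expR (- (u ^+ 2 / 2)) * cos v).
rewrite addrA subrK => /le_trans; apply.
rewrite -addrA lerD//.
have := ler_normD (Ex P (fun t => cos (u / Num.sqrt V * S t + v)) - expR (- ((u / Num.sqrt V) ^+ 2 * s2 / 2)) * cos v)
  (expR (- ((u / Num.sqrt V) ^+ 2 * s2 / 2)) * cos v - expR (- (u ^+ 2 / 2)) * cos v).
rewrite addrA subrK => /le_trans; apply.
by rewrite addrC lerD.
Qed.

End Normalization.

(** * From cosines to distribution functions *)

Section CosineLimit.
Context d (T : measurableType d) (R : realType) (P : probability T R).
Implicit Types (f : R -> R).

Lemma newton_le (x y : R) : -1 <= x -> x <= y -> y <= 1 -> newton.[x] <= newton.[y].
Proof.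
move=> x1 xy y1; rewrite !newtonE ler_wpM2r// -subr_ge0.
have -> : y * (3 - y ^+ 2) - x * (3 - x ^+ 2) = (y - x) * (3 - (x ^+ 2 + x * y + y ^+ 2)) by ring.
rewrite mulr_ge0 ?subr_ge0//.
have sq (z : R) : -1 <= z -> z <= 1 -> z ^+ 2 <= 1.
  by move=> z1 z2; rewrite -subr_ge0 (_ : 1 - z ^+ 2 = (1 - z) * (1 + z)) ?mulr_ge0//; [lra|lra|ring].
have := sq x x1 (le_trans xy y1); have := sq y (le_trans x1 xy) y1.
have : 0 <= (x - y) ^+ 2 by exact: sqr_ge0.
rewrite (_ : (x - y) ^+ 2 = x ^+ 2 + y ^+ 2 - 2 * (x * y)); last by ring.
by move: (x ^+ 2) (y ^+ 2) (x * y) => *; lra.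
Qed.

Lemma sgnp_le n (x y : R) : -1 <= x -> x <= y -> y <= 1 -> (sgnp n).[x] <= (sgnp n).[y].
Proof.
move=> x1 xy y1; elim: n => [|n IH]; first by rewrite /sgnp/= !hornerX.
have N (z : R) : -1 <= z -> z <= 1 -> -1 <= (sgnp n).[z] <= 1.
  by move=> z1 z2; rewrite -ler_norml; apply: sgnp_norm; rewrite ler_norml z1.
rewrite /sgnp !iterS -/(sgnp n) !horner_comp; apply: newton_le => //.
  by have /andP[] := N x x1 (le_trans xy y1).
by have /andP[] := N y (le_trans x1 xy) y1.
Qed.

(* A polynomial in [sin (y / K)] close to the Heaviside function on [-K, K] off a neighbourhood of 0. *)
Definition step (m : nat) (K y : R) : R := (1 + (sgnp m).[sin (K^-1 * y)]) / 2.

Lemma step_01 m K y : 0 <= step m K y <= 1.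
Proof.
have := @sgnp_norm R m (sin (K^-1 * y)) (sin_max _); rewrite ler_norml /step.
by move=> /andP[? ?]; apply/andP; split; lra.
Qed.

(** On [-K, K] the approximant is increasing in y and its sign polynomial is odd, so closeness at
    the single point [eta] controls everything beyond distance [eta] from 0. *)
Lemma step_close (K eta e : R) : 0 < eta -> eta <= K -> 0 < e ->
  exists m, forall y, `|y| <= K ->
    (eta <= y -> 1 - e <= step m K y) /\ (y <= - eta -> step m K y <= e).
Proof.
move=> eta0 etaK e0; have K0 : 0 < K by apply: lt_le_trans etaK.
have p2 := pi_ge2 R.
pose dl := sin (K^-1 * eta).
have sinmono (u v : R) : -1 <= u -> u <= v -> v <= 1 -> sin u <= sin v.
  move=> u1 uv v1; have [->//|uv'] := eqVneq u v; apply: ltW.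
  rewrite ltr_sin ?in_itv/=; first by rewrite lt_neqAle uv'.
    by apply/andP; split; lra.
  by apply/andP; split; lra.
have Ky y : `|y| <= K -> -1 <= K^-1 * y <= 1.
  by move=> yK; rewrite -ler_norml normrM gtr0_norm ?invr_gt0// mulrC ler_pdivrMr// mul1r.
have dl0 : 0 < dl.
  have : 0 < K^-1 * eta by rewrite mulr_gt0 ?invr_gt0.
  have : `|eta| <= K by rewrite gtr0_norm.
  move=> /Ky/andP[_ h1] h0; apply: sin_gt0_pi; rewrite h0/=; lra.
have dl1 : `|dl| <= 1 by exact: sin_max.
have c := sgnp_cvg dl1; rewrite gtr0_sg// in c.
have e2 : 0 < 2 * e by rewrite mulr_gt0.
move/cvgrPdist_le/(_ _ e2): c => -[m _ /(_ m (leqnn m))/= h1].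
exists m => y yK; have /andP[y1 y2] := Ky y yK.
have s1 := sin_geN1 (K^-1 * y); have s2 := sin_le1 (K^-1 * y).
move: dl1; rewrite ler_norml => /andP[d1 d2].
split=> [ey|ye].
  have : dl <= sin (K^-1 * y).
    apply: sinmono => //; last by rewrite ler_wpM2l// invr_ge0 ltW.
    by apply: (@le_trans _ _ 0); rewrite ?mulr_ge0 ?invr_ge0 ?ltW//; lra.
  move=> h; have := sgnp_le m d1 h s2; rewrite /step.
  by move: h1; rewrite ler_norml => /andP[? ?] ?; lra.
have : sin (K^-1 * y) <= - dl.
  rewrite /dl -sinN -mulrN; apply: sinmono => //; first by rewrite ler_wpM2l// invr_ge0 ltW.
  by rewrite mulrN lerNl (@le_trans _ _ 0) ?mulr_ge0 ?invr_ge0 ?ltW//; lra.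
have d3 : - dl <= 1 by lra.
move=> h; have := sgnp_le m s1 h d3; rewrite sgnpN /step.
by move: h1; rewrite ler_norml => /andP[? ?] ?; lra.
Qed.

Variables (Z : nat -> T -> R) (G : T -> R).
Hypothesis mZ : forall k, measurable_fun setT (Z k).
Hypothesis mG : measurable_fun setT G.
Hypothesis limcos : forall u v, Ex P (fun t => cos (u * Z k t + v)) @[k --> \oo] -->
  Ex P (fun t => cos (u * G t + v)).

Let H f := bdd f /\ forall u v, Ex P (fun t => f (Z k t) * cos (u * Z k t + v)) @[k --> \oo] -->
  Ex P (fun t => f (G t) * cos (u * G t + v)).

Let bc (Y : T -> R) u v : measurable_fun setT Y -> bdd (fun t => cos (u * Y t + v)).
Proof. by move=> mY; apply: bdd_cosY; apply: measurable_funD => //; exact: measurable_funM. Qed.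

Let bf f (Y : T -> R) u v : bdd f -> measurable_fun setT Y ->
  bdd (fun t => f (Y t) * cos (u * Y t + v)).
Proof. by move=> b mY; apply: bddM; [exact: bdd_compY|exact: bc]. Qed.

Let H_lin f1 f2 a : H f1 -> H f2 -> H (fun y => a * f1 y + f2 y).
Proof.
move=> [b1 h1] [b2 h2]; split; first by apply: bddD => //; exact: bddZ.
move=> u v; have E (Y : T -> R) : measurable_fun setT Y ->
    Ex P (fun t => (a * f1 (Y t) + f2 (Y t)) * cos (u * Y t + v)) =
    a * Ex P (fun t => f1 (Y t) * cos (u * Y t + v)) + Ex P (fun t => f2 (Y t) * cos (u * Y t + v)).
  move=> mY; rewrite -(ExZ P a (bf u v b1 mY)) -(ExD P (bddZ a (bf u v b1 mY)) (bf u v b2 mY)).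
  by apply: eq_Ex => t; ring.
under eq_fun do rewrite E//; rewrite E//.
by apply: cvgD; [apply: cvgM; [exact: cvg_cst|exact: h1]|exact: h2].
Qed.

Let H_cst a : H (fun=> a).
Proof.
split; first exact: bdd_cst.
move=> u v; have E (Y : T -> R) : measurable_fun setT Y ->
   Ex P (fun t => a * cos (u * Y t + v)) = a * Ex P (fun t => cos (u * Y t + v)).
  by move=> mY; rewrite ExZ//; exact: bc.
under eq_fun do rewrite E//; rewrite E//.
by apply: cvgM; [exact: cvg_cst|exact: limcos].
Qed.

Let H_sin f a b : H f -> H (fun y => sin (a * y + b) * f y).
Proof.
move=> [b1 h1]; split; first by apply: bddM => //; exact: bdd_sinM.
move=> u v; have E (Y : T -> R) : measurable_fun setT Y ->
    Ex P (fun t => sin (a * Y t + b) * f (Y t) * cos (u * Y t + v)) =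
    2^-1 * (Ex P (fun t => f (Y t) * cos ((u + a) * Y t + (v + b - pi / 2))) +
            Ex P (fun t => f (Y t) * cos ((a - u) * Y t + (b - v - pi / 2)))).
  move=> mY; rewrite -(ExD P (bf _ _ b1 mY) (bf _ _ b1 mY)) -ExZ; last by apply: bddD; exact: bf.
  apply: eq_Ex => t; rewrite !addrA !cosBpihalf.
  have -> : (u + a) * Y t + v + b = (a * Y t + b) + (u * Y t + v) by ring.
  have -> : (a - u) * Y t + b - v = (a * Y t + b) - (u * Y t + v) by ring.
  by move: (a * Y t + b) (u * Y t + v) (f _) => p q w; rewrite [sin (p + q)]sinD [sin (p - q)]sinB; field.
under eq_fun do rewrite E//; rewrite E//.
by apply: cvgM; [exact: cvg_cst|apply: cvgD; exact: h1].
Qed.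

Lemma limit_poly_sin (q : {poly R}) (a b : R) :
  Ex P (fun t => q.[sin (a * Z k t + b)]) @[k --> \oo] --> Ex P (fun t => q.[sin (a * G t + b)]).
Proof.
have [_ h] : H (fun y => q.[sin (a * y + b)]).
  elim/poly_ind: q => [|q c IH].
    rewrite (_ : (fun y => _) = (fun=> 0)); first exact: H_cst.
    by apply/funext => y; rewrite horner0.
  rewrite (_ : (fun y => _) = (fun y => 1 * (sin (a * y + b) * q.[sin (a * y + b)]) + c)).
    by apply: H_lin; [exact: H_sin|exact: H_cst].
  by apply/funext => y; rewrite !hornerE mulrC.
have E (Y : T -> R) : Ex P (fun t => q.[sin (a * Y t + b)]) =
    Ex P (fun t => q.[sin (a * Y t + b)] * cos (0 * Y t + 0)).
  by apply: eq_Ex => t; rewrite mul0r addr0 cos0 mulr1.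
by under eq_fun do rewrite E; rewrite E; exact: h.
Qed.

Lemma bdd_step m K (Y : T -> R) a : measurable_fun setT Y -> bdd (fun t => step m K (Y t - a)).
Proof.
move=> mY; split; last first.
  by exists 1 => t; have /andP[h0 h1] := step_01 m K (Y t - a); rewrite ger0_norm.
have ms : continuous (step m K).
  move=> y; rewrite /step; apply: cvgM; last exact: cvg_cst.
  apply: cvgD; first exact: cvg_cst.
  apply: (@continuous_comp _ _ _ (fun y => sin (K^-1 * y)) (horner (sgnp m))); last exact: continuous_horner.
  apply: (@continuous_comp _ _ _ (fun y : R => K^-1 * y) sin); last exact: continuous_sin.
  by apply: cvgM; [exact: cvg_cst|exact: cvg_id].
apply: (measurableT_comp (measurable_cont ms)).
exact: measurable_funB.
Qed.

Lemma limit_step m K a :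
  Ex P (fun t => step m K (Z k t - a)) @[k --> \oo] --> Ex P (fun t => step m K (G t - a)).
Proof.
have E (Y : T -> R) : Ex P (fun t => step m K (Y t - a)) =
    Ex P (fun t => ((1 + sgnp m) * (2^-1)%:P).[sin (K^-1 * Y t + - (K^-1 * a))]).
  by apply: eq_Ex => t; rewrite /step !hornerE mulrBr.
by under eq_fun do rewrite E; rewrite E; exact: limit_poly_sin.
Qed.

Hypothesis bZ : forall k, bdd (Z k).
(** Tightness by Chebyshev's inequality, because [step] imitates a Heaviside function only on
    [-K, K]. *)
Hypothesis Z2 : \forall k \near \oo, Ex P (fun t => Z k t ^+ 2) <= 1.

Let far (Y : T -> R) a K t : R := (K < `|Y t - a|)%R%:R.

Let bdd_far (Y : T -> R) a K : measurable_fun setT Y -> bdd (far Y a K).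
Proof.
move=> mY; apply: (eq_bdd (fun t => (_ : far Y a K t = bit (`|Y t - a| - K)))) => //.
  by move=> t; rewrite /far /bit subr_gt0.
apply: bdd_bit; apply: measurable_funB => //; apply: measurableT_comp => //.
exact: measurable_funB.
Qed.

(** The tail P(Y > a), complementary to the distribution function. *)
Let F (Y : T -> R) a := Ex P (fun t => bit (Y t - a)).

Let bddF (Y : T -> R) a : measurable_fun setT Y -> bdd (fun t => bit (Y t - a)).
Proof. by move=> mY; apply: bdd_bit; exact: measurable_funB. Qed.

Let far_Z a K : 0 < K -> \forall k \near \oo,
  Ex P (far (Z k) a K) <= (2 + 2 * a ^+ 2) / K ^+ 2.
Proof.
move=> K0; apply: filterS Z2 => k Zk.
rewrite ler_pdivlMr ?exprn_gt0// mulrC -ExZ; last exact: bdd_far.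
apply: (@le_trans _ _ (Ex P (fun t => 2 * Z k t ^+ 2 + 2 * a ^+ 2))).
  apply: Ex_le.
  - by apply: bddZ; exact: bdd_far.
  - by apply: bddD; [apply: bddZ; exact: bddX|exact: bdd_cst].
  - move=> t; rewrite /far.
    have h : (Z k t - a) ^+ 2 <= 2 * Z k t ^+ 2 + 2 * a ^+ 2.
      rewrite -subr_ge0 (_ : _ - _ = (Z k t + a) ^+ 2) ?sqr_ge0//; ring.
    have [Kl|_] := ltP; last by rewrite mulr0; apply: le_trans h; exact: sqr_ge0.
    rewrite mulr1; apply: le_trans h; rewrite -[leRHS]ger0_norm ?sqr_ge0// normrX.
    by rewrite lerXn2r ?nnegrE ?(ltW K0)// ltW.
rewrite (ExD P (bddZ 2 (bddX 2 (bZ k))) (bdd_cst T (2 * a ^+ 2))) Ex_cst ExZ; last exact: bddX.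
by move: Zk; lra.
Qed.

Let far_G a : Ex P (far G a K.+1%:R) @[K --> \oo] --> (0 : R).
Proof.
have [|||_] := @Ex_cvg _ _ _ P (fun K => far G a K.+1%:R) (fun=> 0) 1; last by rewrite Ex_cst.
- by move=> K; exact: bdd_far.
- by move=> K t; rewrite /far; case: (_ < _); rewrite ?normr1 ?normr0.
move=> t; apply: cvg_near_cst; exists (Num.truncn `|G t - a|) => // K /= tK.
rewrite /far ltNge (le_trans (ltW (truncnS_gt _)))// ler_nat ltnS //.
Qed.

Let b01 (b : bool) : 0 <= (b%:R : R) <= 1.
Proof. by case: b; rewrite ?lexx ler01. Qed.

Section Fixed.
Variables (m : nat) (K eta e : R).
Hypothesis e0 : 0 < e.
Hypothesis close : forall y, `|y| <= K ->
  (eta <= y -> 1 - e <= step m K y) /\ (y <= - eta -> step m K y <= e).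

Let upper (Y : T -> R) a : measurable_fun setT Y ->
  F Y a <= Ex P (fun t => step m K (Y t - (a - eta))) + e + Ex P (far Y (a - eta) K).
Proof.
move=> mY; have e0' := ltW e0; have bs := bdd_step m K (a - eta) mY.
rewrite -[X in _ + X + _](Ex_cst P e) -(ExD P bs (bdd_cst T e)).
rewrite -(ExD P (bddD bs (bdd_cst T e)) (bdd_far _ _ mY)).
apply: Ex_le; [exact: bddF|by apply: bddD; [apply: bddD => //; exact: bdd_cst|exact: bdd_far]|].
move=> t; have /andP[s0 s1] := step_01 m K (Y t - (a - eta)).
rewrite /far /bit; have [yK|yK] := ltP K `|Y t - (a - eta)|.
  have /andP[b0 b1] := b01 (0 < Y t - a)%R; rewrite [true%:R](_ : _ = 1 :> R)//.
  by move: b0 b1 s0 s1 e0'; move: (_%:R : R) (step _ _ _) => p q *; lra.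
have [c1 _] := close yK; case: (ltP 0 (Y t - a)) => /= h; last by lra.
by have := c1 (ltac:(lra)); lra.
Qed.

Let lower (Y : T -> R) a : measurable_fun setT Y ->
  Ex P (fun t => step m K (Y t - (a + eta))) - e - Ex P (far Y (a + eta) K) <= F Y a.
Proof.
move=> mY; have e0' := ltW e0; have bs := bdd_step m K (a + eta) mY.
rewrite -[X in _ - X - _](Ex_cst P e) -(ExB P bs (bdd_cst T e)).
rewrite -(ExB P (bddB bs (bdd_cst T e)) (bdd_far _ _ mY)).
apply: Ex_le; [by apply: bddB; [apply: bddB => //; exact: bdd_cst|exact: bdd_far]|exact: bddF|].
move=> t; have /andP[s0 s1] := step_01 m K (Y t - (a + eta)).
rewrite /far /bit; have [yK|yK] := ltP K `|Y t - (a + eta)|.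
  have /andP[b0 b1] := b01 (0 < Y t - a)%R; rewrite [true%:R](_ : _ = 1 :> R)//.
  by move: b0 b1 s0 s1 e0'; move: (_%:R : R) (step _ _ _) => p q *; lra.
have [_ c2] := close yK; case: (ltP 0 (Y t - a)) => /= h; first by lra.
by have := c2 (ltac:(lra)); lra.
Qed.

(** A shift by [eta] turns [step] into a majorant or a minorant of the tail indicator, up to [e] and
    the far event. One shift for [Z k] and one for [G] make 2 eta. *)
Lemma F_sandwich k a r : 
  Ex P (far (Z k) (a - eta) K) <= r -> Ex P (far (Z k) (a + eta) K) <= r ->
  Ex P (far G (a - eta) K) <= r -> Ex P (far G (a + eta) K) <= r ->
  `|Ex P (fun t => step m K (Z k t - (a - eta))) - Ex P (fun t => step m K (G t - (a - eta)))| <= e ->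
  `|Ex P (fun t => step m K (Z k t - (a + eta))) - Ex P (fun t => step m K (G t - (a + eta)))| <= e ->
  F G (a + 2 * eta) - 3 * e - 2 * r <= F (Z k) a <= F G (a - 2 * eta) + 3 * e + 2 * r.
Proof.
move=> z1 z2 g1 g2; rewrite !ler_norml => /andP[d1 d2] /andP[d3 d4].
have u1 := upper a (mZ k); have l1 := lower a (mZ k).
have l2 := lower (a - 2 * eta) mG; have u2 := upper (a + 2 * eta) mG.
rewrite (_ : a - 2 * eta + eta = a - eta) in l2; last by ring.
rewrite (_ : a + 2 * eta - eta = a + eta) in u2; last by ring.
by apply/andP; split; lra.
Qed.

End Fixed.

Lemma limit_tail x : {for x, continuous (F G)} -> F (Z k) x @[k --> \oo] --> F G x.
Proof.
move=> cF; apply/cvgrPdist_le => e e0.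
have e1 : 0 < e / 10 by rewrite divr_gt0.
have /cvgrPdist_le/(_ _ e1) := cF; rewrite near_simpl => /nbhs_ballP[r/= r0 Hr].
pose eta := r / 4; have eta0 : 0 < eta by rewrite divr_gt0.
have c1 : `|F G x - F G (x - 2 * eta)| <= e / 10.
  by apply: Hr; rewrite /ball/= /eta opprB addrC subrK ger0_norm; lra.
have c2 : `|F G x - F G (x + 2 * eta)| <= e / 10.
  by apply: Hr; rewrite /ball/= /eta opprD addNKr normrN ger0_norm; lra.
have f1 := far_G (x - eta); have f2 := far_G (x + eta).
have [K [K1 K2 K3 K4 K5]] : exists K : nat,
  [/\ eta <= K.+1%:R, (2 + 2 * (x - eta) ^+ 2) / K.+1%:R ^+ 2 <= e / 10,
     (2 + 2 * (x + eta) ^+ 2) / K.+1%:R ^+ 2 <= e / 10,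
     Ex P (far G (x - eta) K.+1%:R) <= e / 10 & Ex P (far G (x + eta) K.+1%:R) <= e / 10].
  have near_le c : 0 <= c -> \forall K \near \oo, c / K.+1%:R ^+ 2 <= e / 10.
    move=> c0; exists (Num.truncn (c / (e / 10))) => // K /= cK.
    have K0 : (0 : R) < K.+1%:R by [].
    have le : c / (e / 10) <= K.+1%:R by rewrite (le_trans (ltW (truncnS_gt _)))// ler_nat ltnS.
    rewrite ler_pdivrMr ?exprn_gt0//; move: le; rewrite ler_pdivrMr// mulrC => /le_trans; apply.
    by rewrite ler_wpM2l ?(ltW e1)// expr2 ler_peMl// ler1n.
  have a0 (y : R) : 0 <= 2 + 2 * y ^+ 2 by rewrite addr_ge0// mulr_ge0// sqr_ge0.
  have f0 (y : R) (h : Ex P (far G y K.+1%:R) @[K --> \oo] --> (0 : R)) :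
      \forall K \near \oo, Ex P (far G y K.+1%:R) <= e / 10.
    move/cvgrPdist_le/(_ _ e1): h; apply: filterS => K; rewrite sub0r normrN.
    exact: le_trans (ler_norm _).
  have n0 : \forall K \near \oo, eta <= K.+1%:R.
    exists (Num.truncn eta) => // K /= cK.
    by rewrite (le_trans (ltW (truncnS_gt _)))// ler_nat ltnS.
  have [K _ /(_ K (leqnn K))] := filterI n0 (filterI (filterI (near_le _ (a0 (x - eta))) (near_le _ (a0 (x + eta))))
    (filterI (f0 _ f1) (f0 _ f2))).
  by move=> [/= h1 [[h2 h3] [h4 h5]]]; exists K.
have K0 : (0 : R) < K.+1%:R by [].
have [m close] := step_close eta0 K1 e1.
have /cvgrPdist_le/(_ _ e1) ls1 := @limit_step m K.+1%:R (x - eta).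
have /cvgrPdist_le/(_ _ e1) ls2 := @limit_step m K.+1%:R (x + eta).
near=> k.
have z1 : Ex P (far (Z k) (x - eta) K.+1%:R) <= e / 10.
  by apply: le_trans K2; near: k; exact: far_Z.
have z2 : Ex P (far (Z k) (x + eta) K.+1%:R) <= e / 10.
  by apply: le_trans K3; near: k; exact: far_Z.
have s1 : `|Ex P (fun t => step m K.+1%:R (Z k t - (x - eta))) - Ex P (fun t => step m K.+1%:R (G t - (x - eta)))| <= e / 10.
  by rewrite distrC; near: k; exact: ls1.
have s2 : `|Ex P (fun t => step m K.+1%:R (Z k t - (x + eta))) - Ex P (fun t => step m K.+1%:R (G t - (x + eta)))| <= e / 10.
  by rewrite distrC; near: k; exact: ls2.
have := F_sandwich e1 close z1 z2 K4 K5 s1 s2.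
move: c1 c2; rewrite !ler_norml => /andP[c1 c1'] /andP[c2 c2'] /andP[h1 h2].
by apply/andP; split; lra.
Unshelve. all: by end_near.
Qed.

Lemma cdfE (Y : T -> R) x : measurable_fun setT Y ->
  P [set t | Y t <= x] = (1 - F Y x)%:E.
Proof.
move=> mY.
have mA : measurable [set t | Y t <= x].
  rewrite (_ : [set t | _] = Y @^-1` `]-oo, x]); last by apply/seteqP; split => t /=; rewrite in_itv.
  by rewrite -[X in measurable X]setTI; exact: mY.
rewrite -[X in X - _](Ex_cst P) /F -(ExB P (bdd_cst T 1) (bddF x mY)).
rewrite -(fineK (fin_num_measure P _ mA)) -(Ex_indic P mA); congr (_%:E); apply: eq_Ex => t.
rewrite indicE /bit subr_gt0 ltNge; have [h|h] := boolP (Y t <= x).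
  by rewrite mem_set// subr0.
by rewrite memNset ?subrr//; exact/negP.
Qed.

End CosineLimit.

(** * Moments of blocks and of their independent copies *)

Section Moments.
Context d (T : measurableType d) (R : realType) (P : probability T R).

Lemma var_le (B : T -> R) (c : R) : bdd B ->
  Ex P (fun t => (B t - Ex P B) ^+ 2) <= Ex P (fun t => (B t - c) ^+ 2).
Proof.
move=> bB; set m := Ex P B.
have E x : Ex P (fun t => (B t - x) ^+ 2) = Ex P (fun t => B t ^+ 2) - 2 * x * m + x ^+ 2.
  transitivity (Ex P (fun t => B t ^+ 2 - 2 * x * B t + x ^+ 2)).
    by apply: eq_Ex => t; ring.
  rewrite (ExD P (bddB (bddX 2 bB) (bddZ (2 * x) bB)) (bdd_cst T (x ^+ 2))) Ex_cst.
  by rewrite (ExB P (bddX 2 bB) (bddZ (2 * x) bB)) (ExZ P _ bB).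
rewrite !E -subr_ge0.
have -> : Ex P (fun t => B t ^+ 2) - 2 * c * m + c ^+ 2 - (Ex P (fun t => B t ^+ 2) - 2 * m * m + m ^+ 2) =
  (m - c) ^+ 2 by ring.
exact: sqr_ge0.
Qed.

Lemma var_le2 (B : T -> R) : bdd B ->
  Ex P (fun t => (B t - Ex P B) ^+ 2) <= Ex P (fun t => B t ^+ 2).
Proof.
move=> bB; apply: le_trans (var_le 0 bB) _.
by rewrite (_ : (fun t => _) = (fun t => B t ^+ 2))//; apply/funext => t; rewrite subr0.
Qed.

(** Either B >= l and B^2 <= B^3/l, or B^2 <= l^2. With [l] near the cube root of the third moment
    this replaces an interpolation with fractional powers. *)
Lemma Ex_sqr_cube (B : T -> R) (l : R) : bdd B -> (forall t, 0 <= B t) -> 0 < l ->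
  Ex P (fun t => B t ^+ 2) <= Ex P (fun t => B t ^+ 3) / l + l ^+ 2.
Proof.
move=> bB B0 l0; rewrite mulrC -(ExZ P _ (bddX 3 bB)) -[X in _ + X](Ex_cst P).
rewrite -(ExD P (bddZ _ (bddX 3 bB)) (bdd_cst T _)); apply: Ex_le.
- exact: bddX.
- by apply: bddD; [apply: bddZ; exact: bddX|exact: bdd_cst].
move=> t; have b0 := B0 t; have [lb|bl] := leP l (B t).
  rewrite (@le_trans _ _ (l^-1 * B t ^+ 3))//; last by rewrite lerDl sqr_ge0.
  by rewrite mulrC ler_pdivlMr// [leRHS]exprSr ler_wpM2l// sqr_ge0.
rewrite (@le_trans _ _ (l ^+ 2))//; first by rewrite lerXn2r ?nnegrE ?(ltW l0)// ltW.
by rewrite lerDr mulr_ge0 ?exprn_ge0// invr_ge0 ltW.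
Qed.

(** Jensen for the cube, from B^3 - 3 m^2 B + 2 m^3 = (B - m)^2 (B + 2 m). *)
Lemma mean_cube (B : T -> R) : bdd B -> (forall t, 0 <= B t) ->
  Ex P B ^+ 3 <= Ex P (fun t => B t ^+ 3).
Proof.
move=> bB B0; set m := Ex P B; have m0 : 0 <= m by exact: Ex_ge0.
have : 0 <= Ex P (fun t => B t ^+ 3 - 3 * m ^+ 2 * B t + 2 * m ^+ 3).
  apply: Ex_ge0 => t; have b0 := B0 t.
  rewrite (_ : _ + _ = (B t - m) ^+ 2 * (B t + 2 * m)); last by ring.
  by rewrite mulr_ge0 ?sqr_ge0// addr_ge0// mulr_ge0.
rewrite (ExD P (bddB (bddX 3 bB) (bddZ (3 * m ^+ 2) bB)) (bdd_cst T (2 * m ^+ 3))) Ex_cst.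
rewrite (ExB P (bddX 3 bB) (bddZ (3 * m ^+ 2) bB)) (ExZ P _ bB) -/m.
rewrite (_ : 3 * m ^+ 2 * m = 3 * m ^+ 3); last by ring.
by move: (m ^+ 3) => x; lra.
Qed.

(** For nonnegative numbers the distance is at most the larger one, so its cube is at most B^3 +
    m^3. *)
Lemma central_cube (B : T -> R) : bdd B -> (forall t, 0 <= B t) ->
  Ex P (fun t => `|B t - Ex P B| ^+ 3) <= 2 * Ex P (fun t => B t ^+ 3).
Proof.
move=> bB B0; have mc := mean_cube bB B0; set m := Ex P B in mc *.
have m0 : 0 <= m by exact: Ex_ge0.
apply: (@le_trans _ _ (Ex P (fun t => B t ^+ 3 + m ^+ 3))).
  apply: Ex_le.
  - by apply: bddX; apply: bdd_norm; apply: bddB => //; exact: bdd_cst.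
  - by apply: bddD; [exact: bddX|exact: bdd_cst].
  - move=> t; have b0 := B0 t.
    have b3 : 0 <= B t ^+ 3 by rewrite exprn_ge0.
    have m3 : 0 <= m ^+ 3 by rewrite exprn_ge0.
    have [mb|bm] := leP m (B t).
      rewrite ger0_norm ?subr_ge0// (@le_trans _ _ (B t ^+ 3))//; last by rewrite lerDl.
      by rewrite lerXn2r ?nnegrE ?subr_ge0//; lra.
    rewrite ltr0_norm ?subr_lt0// (@le_trans _ _ (m ^+ 3))//; last by rewrite lerDr.
    by rewrite lerXn2r ?nnegrE//; lra.
rewrite (ExD P (bddX 3 bB) (bdd_cst T _)) Ex_cst.
by move: mc; move: (m ^+ 3) => x; lra.
Qed.

Section Close.
Variables (B B' : T -> R) (w e : R).
Hypotheses (bB : bdd B) (bB' : bdd B').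
Hypothesis Bw : forall t, 0 <= B t <= w.
Hypothesis Bw' : forall t, 0 <= B' t <= w.
Hypothesis BB : Ex P (fun t => `|B t - B' t|) <= e.

Let bn : bdd (fun t => `|B t - B' t|). Proof. by apply: bdd_norm; exact: bddB. Qed.

Let w0 : 0 <= w.
Proof.
have : 0 <= Ex P (fun t => w) by apply: Ex_ge0 => t; have /andP[] := Bw t; exact: le_trans.
by rewrite Ex_cst.
Qed.

Let majorize (f g : T -> R) (c : R) : 0 <= c -> bdd f -> bdd g ->
  (forall t, f t <= g t + c * `|B t - B' t|) -> Ex P f <= Ex P g + c * e.
Proof.
move=> c0 bf bg fg; apply: (@le_trans _ _ (Ex P (fun t => g t + c * `|B t - B' t|))).
  by apply: Ex_le => //; apply: bddD => //; exact: bddZ.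
by rewrite (ExD P bg (bddZ c bn)) (ExZ P _ bn) lerD2l ler_wpM2l.
Qed.

Lemma close_sqr : Ex P (fun t => (B t - B' t) ^+ 2) <= w * e.
Proof.
rewrite -[leRHS]add0r -[X in X + _](Ex_cst P); apply: majorize => //.
- by apply: bddX; exact: bddB.
- exact: bdd_cst.
move=> t; rewrite add0r -[leLHS]ger0_norm ?sqr_ge0// normrX expr2 ler_wpM2r//.
by have /andP[? ?] := Bw t; have /andP[? ?] := Bw' t; rewrite ler_norml; lra.
Qed.

Lemma close_cube : Ex P (fun t => B' t ^+ 3) <= Ex P (fun t => B t ^+ 3) + 3 * w ^+ 2 * e.
Proof.
apply: majorize; [by rewrite mulr_ge0 ?sqr_ge0|exact: bddX|exact: bddX|].
move=> t; have /andP[a0 a1] := Bw t; have /andP[b0 b1] := Bw' t.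
rewrite -lerBlDl (_ : _ - _ = (B' t - B t) * (B' t ^+ 2 + B' t * B t + B t ^+ 2)); last by ring.
apply: le_trans (ler_norm _) _; rewrite normrM distrC mulrC ler_wpM2r//.
rewrite ger0_norm ?addr_ge0 ?mulr_ge0 ?sqr_ge0//.
have h1 : B' t ^+ 2 <= w ^+ 2 by rewrite lerXn2r ?nnegrE.
have h2 : B t ^+ 2 <= w ^+ 2 by rewrite lerXn2r ?nnegrE.
have h3 : B' t * B t <= w ^+ 2 by rewrite expr2 ler_pM.
lra.
Qed.

Lemma close_var : Ex P (fun t => (B t - Ex P B) ^+ 2) <=
  Ex P (fun t => (B' t - Ex P B') ^+ 2) + 2 * w * e.
Proof.
apply: le_trans (var_le (Ex P B') bB) _.
have b' (f : T -> R) : bdd f -> bdd (fun t => (f t - Ex P B') ^+ 2).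
  by move=> h; apply: bddX; apply: bddB => //; exact: bdd_cst.
apply: majorize; [by rewrite mulr_ge0|exact: b'|exact: b'|].
move=> t; have /andP[a0 a1] := Bw t; have /andP[b0 b1] := Bw' t.
have m0 : 0 <= Ex P B' by apply: Ex_ge0 => x; have /andP[] := Bw' x.
have m1 : Ex P B' <= w.
  rewrite -[leRHS](Ex_cst P); apply: Ex_le => //; first exact: bdd_cst.
  by move=> x; have /andP[] := Bw' x.
rewrite -lerBlDl (_ : _ - _ = (B t - B' t) * (B t + B' t - 2 * Ex P B')); last by ring.
apply: le_trans (ler_norm _) _; rewrite normrM mulrC ler_wpM2r//.
by rewrite ler_norml; apply/andP; split; lra.
Qed.

End Close.

Lemma Ex_sum_sqr_ord (f : nat -> T -> R) m (A : R) : (forall k, bdd (f k)) ->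
  (forall k, (k < m)%N -> Ex P (fun t => f k t ^+ 2) <= A) ->
  Ex P (fun t => (\sum_(k < m) f k t) ^+ 2) <= m%:R ^+ 2 * A.
Proof. by move=> bf fA; exact: Ex_sum_sqr. Qed.

Lemma Ex_sqr_sum4 (f g h k : T -> R) : bdd f -> bdd g -> bdd h -> bdd k ->
  Ex P (fun t => (f t + g t + h t + k t) ^+ 2) <=
  4 * (Ex P (fun t => f t ^+ 2) + Ex P (fun t => g t ^+ 2) + Ex P (fun t => h t ^+ 2) + Ex P (fun t => k t ^+ 2)).
Proof.
move=> bf bg bh bk.
have b1 := bddD (bddX 2 bf) (bddX 2 bg); have b2 := bddD b1 (bddX 2 bh); have b3 := bddD b2 (bddX 2 bk).
rewrite -(ExD P (bddX 2 bf) (bddX 2 bg)) -(ExD P b1 (bddX 2 bh)) -(ExD P b2 (bddX 2 bk)) -(ExZ P 4 b3).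
apply: Ex_le.
- by apply: bddX; apply: bddD => //; apply: bddD => //; exact: bddD.
- exact: bddZ.
move=> t; move: (f t) (g t) (h t) (k t) => x y z v; rewrite -subr_ge0.
have -> : 4 * (x ^+ 2 + y ^+ 2 + z ^+ 2 + v ^+ 2) - (x + y + z + v) ^+ 2 =
  (x - y) ^+ 2 + (x - z) ^+ 2 + (x - v) ^+ 2 + (y - z) ^+ 2 + (y - v) ^+ 2 + (z - v) ^+ 2 by ring.
by rewrite !addr_ge0 ?sqr_ge0.
Qed.

End Moments.

Section Periods.
Context d (T : measurableType d) (R : realType) (P : probability T R).
Variable omega : nat -> {RV P >-> R}.
Local Notation cnt := (sign_changes omega).
Local Notation block := (block_changes omega).

Lemma cnt_add n th ph m1 m2 t :
  cnt n th ph (m1 + m2) t = cnt n th ph m1 t + cnt n (th + m1%:R * ph) ph m2 t.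
Proof.
rewrite /sign_changes big_split_ord/=; congr (_ + _); apply: eq_bigr => k _.
by congr chg; congr (kostlan _ _ _ _); rewrite -?addnS natrD; ring.
Qed.

Lemma cnt_periods n q w l th ph t : (l <= w)%N ->
  cnt n th ph (q * w) t =
  \sum_(c < q) block n w l th ph c t + \sum_(c < q) block n w (w - l) (th + l%:R * ph) ph c t.
Proof.
move=> lw; rewrite -big_split/=; elim: q => [|q IH].
  by rewrite mul0n /sign_changes !big_ord0.
rewrite mulSnr cnt_add IH big_ord_recr/=; congr (_ + _).
have := cnt_add n (th + (q * w)%:R * ph) ph l (w - l) t; rewrite subnKC// => ->.
rewrite /block_changes (_ : th + l%:R * ph + (q * w)%:R * ph = th + (q * w)%:R * ph + l%:R * ph)//.
by ring.
Qed.

End Periods.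

(** * Approximation by a sum of independent blocks, with explicit scales *)

Section Estimate.
Context d (T : measurableType d) (R : realType) (P : probability T R).
Variable omega : nat -> {RV P >-> R}.
Hypothesis iid : iid_standard_gaussian omega.
Local Notation cnt := (sign_changes omega).
Local Notation block := (block_changes omega).

Variables (n : nat) (a b : \bar R) (M q J : nat).
Hypothesis n100 : (100 <= n)%N.
Hypothesis ab : (a < b)%E.
Hypothesis M100 : (100 <= M)%N.
Hypothesis q0 : (0 < q)%N.
Let A : R := ang a.
Let B : R := ang b.
(** The unit of length, between 1/sqrt(n) and 2/sqrt(n) by [u12]. There are [q.+1] periods of M^5
    units, and each unit consists of 2^J grid cells. *)
Let ph0 : R := (B - A) / (q.+1 * M ^ 5)%:R.
Let ph : R := ph0 / 2 ^+ J.
Hypothesis u12 : 1 <= Num.sqrt n%:R * ph0 <= 2.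
Hypothesis J100 : 2 / 2 ^+ J <= 1 / 100 :> R.
Let w := (2 ^ J * M ^ 5)%N.
(** Bounds the L^1 cost of replacing one block, or one gap, by its copy. By [eps1] it stays harmless
    after multiplication by up to three scales. *)
Let eps : R := 2 * w.+1%:R * Num.sqrt ((q.+1 * w.+1)%:R * expR (- (M%:R ^+ 2 / 2))).
Hypothesis eps1 : (q.+1 + w.+1)%:R ^+ 3 * eps <= 1.
(** 17 = 1 + 2 * 2^3 comes from [Ex_cnt3] with units of at most 2/sqrt(n). The summand 3 in [m3] and
    [g3] below pays for passing to the copies. *)
Let T3 : R := 17 * J.+1%:R ^+ 3.
Let m3 : R := T3 * M%:R ^+ 15 + 3.
Let g3 : R := T3 * M%:R ^+ 3 + 3.

Local Notation N := (nb_zeros (fun j => omega j) n a b).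

Let n1 : (0 < n)%N. Proof. by apply: leq_trans n100. Qed.
Let AB : A < B. Proof. exact: ang_lt. Qed.
Let M5 : (M * 100 <= M ^ 5)%N.
Proof. by rewrite (expnS M 4) leq_mul2l; apply/orP; right; apply: leq_trans M100 _; rewrite -[M in (M <= _)%N]expn1 leq_exp2l//; apply: leq_trans M100. Qed.
Let M0 : (0 < M)%N. Proof. by apply: leq_trans M100. Qed.
Let den0 : (0 : R) < (q.+1 * M ^ 5)%:R.
Proof. by rewrite ltr0n muln_gt0/= expn_gt0 M0. Qed.
Let ph00 : 0 < ph0. Proof. by rewrite divr_gt0// subr_gt0. Qed.
Let J0 : (0 : R) < 2 ^+ J. Proof. by rewrite exprn_gt0. Qed.
Let phg0 : 0 < ph. Proof. by rewrite divr_gt0. Qed.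
Let BA : B - A <= pi.
Proof. by case/andP: (ang_range a) => h1 h2; case/andP: (ang_range b) => h3 h4; rewrite /B /A; lra. Qed.
Let whole : (q.+1 * M ^ 5)%:R * ph0 = B - A.
Proof. by rewrite /ph0 mulrC divfK// gt_eqF. Qed.
Let cellE (k : nat) : (2 ^ J * k)%:R * ph = k%:R * ph0.
Proof. by rewrite /ph natrM natrX; field; rewrite gt_eqF. Qed.
Let half : (M ^ 5)%:R * ph0 <= pi / 2.
Proof.
have : 2 * (M ^ 5)%:R * ph0 <= B - A.
  rewrite -whole ler_wpM2r ?(ltW ph00)// -natrM ler_nat leq_mul2r; apply/orP; right.
  by move: q0; clear; lia.
by rewrite -mulrA; have := BA; move: (_ * ph0) => x h1 h2; lra.
Qed.
Let part (k : nat) : (k <= M ^ 5)%N -> 0 <= k%:R * ph0 <= pi / 2.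
Proof.
move=> kM; rewrite mulr_ge0 ?(ltW ph00)//=; apply: le_trans half.
by rewrite ler_wpM2r ?(ltW ph00)// ler_nat.
Qed.
Let MM : (M <= M ^ 5)%N. Proof. by apply: leq_trans M5; rewrite leq_pmulr. Qed.
Let ph02 : 0 <= ph0 <= pi / 2.
Proof. by have := @part 1%N; rewrite mul1r; apply; rewrite expn_gt0 M0. Qed.

Let l1 := (2 ^ J * (M ^ 5 - M))%N.
Let l2 := (2 ^ J * M)%N.
Let wl1 : (w - l1 = l2)%N. Proof. by rewrite /w /l1 -mulnBr subKn. Qed.
Let wl2 : (w - l2 = l1)%N. Proof. by rewrite /w /l2 -mulnBr. Qed.
Let l1w : (l1 <= w)%N. Proof. by rewrite leq_mul2l leq_subr orbT. Qed.
Let l2w : (l2 <= w)%N. Proof. by rewrite leq_mul2l MM orbT. Qed.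
Let total : (q.+1 * w)%:R * ph <= pi.
Proof. by rewrite /w mulnCA cellE whole. Qed.

Let eps0 : 0 <= eps. Proof. by rewrite /eps mulr_ge0 ?mulr_ge0 ?sqrtr_ge0. Qed.

(* Every gap is at least [M] units long, so the correlation across it is at most [exp (- M ^ 2 / 2)]. *)
Let gap_eps (l k : nat) : (l <= w)%N -> (M <= k)%N -> (k <= M ^ 5)%N ->
  2 * l.+1%:R * Num.sqrt ((q.+1 * l.+1)%:R * cos (k%:R * ph0) ^+ n) <= eps.
Proof.
move=> lw Mk kM; have kp := part kM.
have [c0 _] := andP (cosX_ge0 n kp).
have c1 : cos (k%:R * ph0) ^+ n <= expR (- (M%:R ^+ 2 / 2)).
  apply: le_trans (cosX_le_exp n kp) _; rewrite ler_expR lerN2 ler_wpM2r ?invr_ge0//.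
  rewrite lerXn2r ?nnegrE//; first by rewrite mulr_ge0 ?sqrtr_ge0//; case/andP: kp.
  have /andP[h1 h2] := u12.
  rewrite mulrCA (@le_trans _ _ k%:R) ?ler_nat//.
  by rewrite ler_peMr.
rewrite /eps ler_pM ?mulr_ge0 ?sqrtr_ge0//.
  by rewrite ler_wpM2l// ler_nat ltnS.
rewrite ler_wsqrtr// ler_pM//.
by rewrite ler_nat leq_mul2l ltnS lw orbT.
Qed.

Let X0 : (0 : R) <= (q.+1 + w.+1)%:R. Proof. exact: ler0n. Qed.
Let X1 : (1 : R) <= (q.+1 + w.+1)%:R. Proof. by rewrite ler1n. Qed.

Let small (x y z : R) : 0 <= x <= (q.+1 + w.+1)%:R -> 0 <= y <= (q.+1 + w.+1)%:R ->
  0 <= z <= (q.+1 + w.+1)%:R -> x * y * z * eps <= 1.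
Proof.
move=> /andP[x0 x1] /andP[y0 y1] /andP[z0 z1]; apply: le_trans eps1.
rewrite ler_wpM2r//.
have -> : (q.+1 + w.+1)%:R ^+ 3 = (q.+1 + w.+1)%:R * (q.+1 + w.+1)%:R * (q.+1 + w.+1)%:R :> R by ring.
by rewrite ler_pM ?mulr_ge0// ler_pM.
Qed.

Let qX : 0 <= (q.+1%:R : R) <= (q.+1 + w.+1)%:R.
Proof. by rewrite ler0n ler_nat leq_addr. Qed.
Let wX (l : nat) : (l <= w)%N -> 0 <= (l%:R : R) <= (q.+1 + w.+1)%:R.
Proof. by move=> lw; rewrite ler0n ler_nat (leq_trans (leqW lw)) ?leq_addl. Qed.
Let oX : 0 <= (1 : R) <= (q.+1 + w.+1)%:R.
Proof. by rewrite ler01. Qed.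

Let block_cube l k th0 c : l = (2 ^ J * k)%N ->
  Ex P (fun t => block n w l th0 ph c t ^+ 3) <= T3 * k%:R ^+ 3.
Proof.
move=> ->; rewrite /block_changes; apply: le_trans (Ex_cnt3 iid n _ k J ph02) _.
have /andP[h1 h2] := u12.
rewrite (_ : T3 * k%:R ^+ 3 = J.+1%:R ^+ 3 * (k%:R ^+ 3 * 17)); last by rewrite /T3; ring.
rewrite !ler_wpM2l ?exprn_ge0//.
have : (Num.sqrt n%:R * ph0) ^+ 3 <= 2 ^+ 3 by rewrite lerXn2r ?nnegrE//; lra.
by move: (_ ^+ 3) => x; rewrite (_ : 2 ^+ 3 = 8 :> R); [lra|ring].
Qed.

Let bdd_block l th0 c : bdd (block n w l th0 ph c).
Proof. exact: bdd_cnt. Qed.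

Let block_range l th0 c t : 0 <= block n w l th0 ph c t <= l%:R.
Proof. by rewrite cnt_ge0 cnt_le. Qed.

Let Q : R := q.+1%:R.
Let Q0 : 0 < Q. Proof. by rewrite ltr0n. Qed.

Let sum_close l th0 (Bt : nat -> T -> R) : (l <= w)%N ->
  (forall c, bdd (Bt c) /\ forall t, 0 <= Bt c t <= l%:R) ->
  (forall c, (c < q.+1)%N -> Ex P (fun t => `|block n w l th0 ph c t - Bt c t|) <= eps) ->
  Ex P (fun t => (\sum_(c < q.+1) (block n w l th0 ph c t - Bt c t)) ^+ 2) <= 1.
Proof.
move=> lw bB cB.
have h k : (k < q.+1)%N -> Ex P (fun t => (block n w l th0 ph k t - Bt k t) ^+ 2) <= l%:R * eps.
  move=> kq; apply: close_sqr (cB k kq) => //; [exact: (bB k).1|exact: (bB k).2].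
have := Ex_sum_sqr_ord (fun k => bddB (bdd_block l th0 k) (bB k).1) h.
move=> /le_trans; apply.
rewrite mulrA expr2; apply: small => //; exact: wX.
Qed.

(** [S] is the sum of the centred copies of the long blocks. The remainder has four parts: the
    discretization, the replacement of blocks and of gaps by copies, and the centred copies of the
    gaps. *)
Lemma estimate : exists (S : T -> R) (s2 : R),
  [/\ bdd S, Ex P (fun t => S t ^+ 2) = s2,
     Q * ((1 / 100 / 200) ^+ 2 * (M ^ 5 - M - 3)%:R / 3) - 2 <= s2,
     Ex P (fun t => (N t - Ex P N - S t) ^+ 2) <=
       4 * (96 * (Q * M%:R ^+ 5) ^+ 2 / 2 ^+ J + 2 + Q * (g3 / M%:R ^+ 2 + M%:R ^+ 4)) &
     forall u v, `|Ex P (fun t => cos (u * S t + v)) - expR (- (u ^+ 2 * s2 / 2)) * cos v| <=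
       Q * (2 * `|u| ^+ 3 * (2 * m3) + u ^+ 4 * (m3 / M%:R ^+ 6 + M%:R ^+ 12) ^+ 2)].
Proof.
have [B1 [B1b B1c B1i]] : exists B1 : nat -> T -> R,
  [/\ (forall c, bdd (B1 c) /\ forall t, 0 <= B1 c t <= l1%:R),
      (forall c, (c < q.+1)%N -> Ex P (fun t => `|block n w l1 A ph c t - B1 c t|) <= eps) &
      (forall b (f g : R -> R) (m : nat -> R), (b < q.+1)%N ->
         Ex P (fun t => f (\sum_(c < b) (B1 c t - m c)) * g (B1 b t)) =
         Ex P (fun t => f (\sum_(c < b) (B1 c t - m c))) * Ex P (fun t => g (B1 b t)))].
  have [|B1 [h1 h2 h3]] := decouple_blocks iid n A (ltW phg0) l1w _ total.
    by rewrite wl1 cellE; case/andP: (part MM).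
  exists B1; split => // c cq; apply: le_trans (h2 c cq) _.
  by rewrite wl1 cellE; apply: gap_eps.
(* The gaps are decoupled as well, as short blocks separated by the long ones. Independence makes
   their variance linear in the number of periods instead of quadratic. *)
have [B2 [B2b B2c B2i]] : exists B2 : nat -> T -> R,
  [/\ (forall c, bdd (B2 c) /\ forall t, 0 <= B2 c t <= l2%:R),
      (forall c, (c < q.+1)%N -> Ex P (fun t => `|block n w l2 (A + l1%:R * ph) ph c t - B2 c t|) <= eps) &
      (forall b (f g : R -> R) (m : nat -> R), (b < q.+1)%N ->
         Ex P (fun t => f (\sum_(c < b) (B2 c t - m c)) * g (B2 b t)) =
         Ex P (fun t => f (\sum_(c < b) (B2 c t - m c))) * Ex P (fun t => g (B2 b t)))].
  have [|B2 [h1 h2 h3]] := decouple_blocks iid n (A + l1%:R * ph) (ltW phg0) l2w _ total.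
    by rewrite wl2 cellE; case/andP: (part (leq_subr M (M ^ 5)%N)).
  exists B2; split => // c cq; apply: le_trans (h2 c cq) _.
  rewrite wl2 cellE; apply: gap_eps => //; last exact: leq_subr.
  by move: M5 M100; clear; lia.
pose Y1 c t := B1 c t - Ex P (B1 c).
pose Y2 c t := B2 c t - Ex P (B2 c).
have bY1 c : bdd (Y1 c) by apply: bddB; [exact: (B1b c).1|exact: bdd_cst].
have bY2 c : bdd (Y2 c) by apply: bddB; [exact: (B2b c).1|exact: bdd_cst].
have EY1 c : Ex P (Y1 c) = 0 by rewrite (ExB P (B1b c).1 (bdd_cst T _)) Ex_cst subrr.
have EY2 c : Ex P (Y2 c) = 0 by rewrite (ExB P (B2b c).1 (bdd_cst T _)) Ex_cst subrr.
have i1 (f g : R -> R) k : (k < q.+1)%N ->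
  Ex P (fun t => f (\sum_(c < k) Y1 c t) * g (Y1 k t)) =
  Ex P (fun t => f (\sum_(c < k) Y1 c t)) * Ex P (fun t => g (Y1 k t)).
  by move=> kq; exact: (B1i k f (fun x => g (x - Ex P (B1 k))) (fun c => Ex P (B1 c)) kq).
have i2 (f g : R -> R) k : (k < q.+1)%N ->
  Ex P (fun t => f (\sum_(c < k) Y2 c t) * g (Y2 k t)) =
  Ex P (fun t => f (\sum_(c < k) Y2 c t)) * Ex P (fun t => g (Y2 k t)).
  by move=> kq; exact: (B2i k f (fun x => g (x - Ex P (B2 k))) (fun c => Ex P (B2 c)) kq).
have M0R : (0 : R) < M%:R by rewrite ltr0n.
have T30 : 0 <= T3 by rewrite mulr_ge0// exprn_ge0.
have cube1 c : (c < q.+1)%N -> Ex P (fun t => B1 c t ^+ 3) <= m3.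
  move=> cq; have [bb rr] := B1b c.
  apply: le_trans (close_cube (bdd_block l1 A c) bb (block_range l1 A c) rr (B1c c cq)) _.
  apply: lerD.
    apply: le_trans (block_cube A c (erefl l1)) _; rewrite ler_wpM2l//.
    have -> : M%:R ^+ 15 = (M%:R ^+ 5) ^+ 3 :> R by rewrite -exprM.
    by rewrite lerXn2r ?nnegrE ?exprn_ge0// -natrX ler_nat leq_subr.
  have := small oX (wX l1w) (wX l1w).
  have -> : 1 * l1%:R * l1%:R * eps = l1%:R ^+ 2 * eps by ring.
  by rewrite -mulrA; move: (_ * eps) => x; lra.
have cube2 c : (c < q.+1)%N -> Ex P (fun t => B2 c t ^+ 3) <= g3.
  move=> cq; have [bb rr] := B2b c.
  apply: le_trans (close_cube (bdd_block l2 (A + l1%:R * ph) c) bb (block_range l2 (A + l1%:R * ph) c) rr (B2c c cq)) _.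
  apply: lerD; first exact: (block_cube (A + l1%:R * ph) c (erefl l2)).
  have := small oX (wX l2w) (wX l2w).
  have -> : 1 * l2%:R * l2%:R * eps = l2%:R ^+ 2 * eps by ring.
  by rewrite -mulrA; move: (_ * eps) => x; lra.
(* Threshold M^6, since [m3] will be of order M^18 when J is of order M; likewise M^2 for the gaps,
   where [g3] is of order M^6. *)
have sq1 c : (c < q.+1)%N -> Ex P (fun t => Y1 c t ^+ 2) <= m3 / M%:R ^+ 6 + M%:R ^+ 12.
  move=> cq; have [bb rr] := B1b c.
  apply: le_trans (var_le2 P bb) _.
  have p6 : (0 : R) < M%:R ^+ 6 by rewrite exprn_gt0.
  apply: le_trans (Ex_sqr_cube P bb (fun t => (andP (rr t)).1) p6) _.
  rewrite -exprM lerD2r ler_wpM2r ?invr_ge0 ?(ltW p6)//; exact: cube1.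
have sq2 c : (c < q.+1)%N -> Ex P (fun t => Y2 c t ^+ 2) <= g3 / M%:R ^+ 2 + M%:R ^+ 4.
  move=> cq; have [bb rr] := B2b c.
  apply: le_trans (var_le2 P bb) _.
  have p6 : (0 : R) < M%:R ^+ 2 by rewrite exprn_gt0.
  apply: le_trans (Ex_sqr_cube P bb (fun t => (andP (rr t)).1) p6) _.
  rewrite -exprM lerD2r ler_wpM2r ?invr_ge0 ?(ltW p6)//; exact: cube2.
have cc1 c : (c < q.+1)%N -> Ex P (fun t => `|Y1 c t| ^+ 3) <= 2 * m3.
  move=> cq; have [bb rr] := B1b c.
  apply: le_trans (central_cube P bb (fun t => (andP (rr t)).1)) _.
  by rewrite ler_wpM2l//; exact: cube1.
exists (fun t => \sum_(c < q.+1) Y1 c t), (\sum_(c < q.+1) Ex P (fun t => Y1 c t ^+ 2)).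
split.
- exact: bdd_sum.
- exact: Ex_sqr_indep.
- have vb c : (c < q.+1)%N -> (1 / 100 / 200) ^+ 2 * (M ^ 5 - M - 3)%:R / 3 - 2 * l1%:R * eps <=
      Ex P (fun t => Y1 c t ^+ 2).
    move=> cq; have [bb rr] := B1b c.
    have := close_var (bdd_block l1 A c) bb (block_range l1 A c) rr (B1c c cq).
    have h01 : 0 < Num.sqrt n%:R * ph <= 1 / 100.
      rewrite mulr_gt0 ?sqrtr_gt0 ?ltr0n//=; apply: le_trans J100.
      by rewrite /ph mulrA ler_wpM2r ?invr_ge0 ?(ltW J0)//; case/andP: u12.
    have lph : l1%:R * ph <= pi / 2.
      by rewrite cellE; case/andP: (part (leq_subr M (M ^ 5)%N)).
    have s1 : 1 <= (2 ^ J)%:R * (Num.sqrt n%:R * ph).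
      have -> : (2 ^ J)%:R * (Num.sqrt n%:R * ph) = Num.sqrt n%:R * ((2 ^ J * 1)%:R * ph) by rewrite muln1; ring.
      by rewrite cellE mul1r; case/andP: u12.
    have K3 : ((M ^ 5 - M - 3 + 3) * 2 ^ J <= l1)%N.
      by rewrite mulnC leq_mul2l subnK ?leqnn ?orbT//; move: M5 M100; clear; lia.
    have := var_cnt_ge iid (A + (c * w)%:R * ph) n100 h01 lph s1 K3.
    by rewrite -/(block n w l1 A ph c) => h1 h2; rewrite lerBlDr; exact: le_trans h1 h2.
  apply: (@le_trans _ _ (\sum_(c < q.+1) ((1 / 100 / 200) ^+ 2 * (M ^ 5 - M - 3)%:R / 3 - 2 * l1%:R * eps))).
    rewrite sumr_const card_ord -[leRHS]mulr_natl -/Q mulrBr lerD2l lerN2.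
    have := small qX (wX l1w) oX.
    have -> : q.+1%:R * l1%:R * 1 * eps = Q * (l1%:R * eps) by rewrite /Q; ring.
    rewrite (_ : Q * (2 * l1%:R * eps) = 2 * (Q * (l1%:R * eps))); last by ring.
    by move: (Q * (l1%:R * eps)) => x; lra.
  by apply: ler_sum => c _; exact: vb.
- pose D t := N t - cnt n A ph (q.+1 * w) t.
  pose R1 t := \sum_(c < q.+1) (block n w l1 A ph c t - B1 c t).
  pose R2 t := \sum_(c < q.+1) (block n w l2 (A + l1%:R * ph) ph c t - B2 c t).
  pose R3 t := \sum_(c < q.+1) Y2 c t.
  have mN := measurable_nb_zeros omega n ab.
  have bN : bdd N.
    split => //; exists n%:R => t; have /andP[N0 Nn] := nb_zeros_bound omega n ab t.
    by rewrite ger0_norm.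
  have bD : bdd D by apply: bddB => //; exact: bdd_cnt.
  have bR1 : bdd R1 by apply: bdd_sum => c _; apply: bddB; [exact: bdd_block|exact: (B1b c).1].
  have bR2 : bdd R2 by apply: bdd_sum => c _; apply: bddB; [exact: bdd_block|exact: (B2b c).1].
  have bR3 : bdd R3 by exact: bdd_sum.
  have Nt t : N t = D t + R1 t + R2 t + R3 t + \sum_(c < q.+1) Y1 c t +
      \sum_(c < q.+1) Ex P (B1 c) + \sum_(c < q.+1) Ex P (B2 c).
    rewrite /D (cnt_periods _ _ _ _ _ _ l1w) wl1 /R1 /R2 /R3 /Y1 /Y2 !sumrB; ring.
  have bb1 := bddD bD bR1; have bb2 := bddD bb1 bR2; have bb3 := bddD bb2 bR3.
  have bS1 : bdd (fun t => \sum_(c < q.+1) Y1 c t) by exact: bdd_sum.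
  have EN : Ex P N = Ex P D + Ex P R1 + Ex P R2 + \sum_(c < q.+1) Ex P (B1 c) + \sum_(c < q.+1) Ex P (B2 c).
    rewrite (eq_Ex P Nt).
    rewrite (ExD P (bddD (bddD bb3 bS1) (bdd_cst T _)) (bdd_cst T _)) (ExD P (bddD bb3 bS1) (bdd_cst T _)) !Ex_cst.
    rewrite (ExD P bb3 bS1) (ExD P bb2 bR3) (ExD P bb1 bR2) (ExD P bD bR1).
    rewrite [Ex P (fun t => \sum_(c < q.+1) Y1 c t)]Ex_sum// [X in _ + X + _ + _](big1 _ _)//.
    by rewrite /R3 [Ex P (fun t => \sum_(c < q.+1) Y2 c t)]Ex_sum// [X in _ + X + _ + _ + _](big1 _ _)// !addr0.
  have cen (f : T -> R) : bdd f -> bdd (fun t => f t - Ex P f).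
    by move=> bf; apply: bddB => //; exact: bdd_cst.
  have -> : Ex P (fun t => (N t - Ex P N - \sum_(c < q.+1) Y1 c t) ^+ 2) =
     Ex P (fun t => ((D t - Ex P D) + (R1 t - Ex P R1) + (R2 t - Ex P R2) + R3 t) ^+ 2).
    apply: eq_Ex => t; congr (_ ^+ 2); rewrite EN {1}Nt.
    by move: (\sum_(c < q.+1) Y1 c t) (\sum_(c < q.+1) Ex P (B1 c)) (\sum_(c < q.+1) Ex P (B2 c)) => x y z; ring.
  apply: le_trans (Ex_sqr_sum4 P (cen _ bD) (cen _ bR1) (cen _ bR2) bR3) _.
  rewrite ler_wpM2l//.
  have eD : Ex P (fun t => (D t - Ex P D) ^+ 2) <= 96 * (Q * M%:R ^+ 5) ^+ 2 / 2 ^+ J.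
    apply: le_trans (var_le2 P bD) _.
    have ph01 : 0 < ph0 <= 1.
      rewrite ph00/=; have h1 : 100 * ph0 <= pi / 2.
        by have := @part 100%N; case/(_ _)/andP => //; apply: leq_trans M100 MM.
      by have := pihalf_lt2 R; lra.
    have mB : A + (q.+1 * M ^ 5)%:R * ph0 = B by rewrite whole addrC subrK.
    have := Ex_zeros_cnt iid n1 ab ph01 mB J _; rewrite muln_gt0/= expn_gt0 M0 => /(_ isT).
    rewrite -/ph -[(2 ^ J * (q.+1 * M ^ 5))%N]mulnCA -/w => /le_trans; apply.
    rewrite ler_wpM2r ?invr_ge0 ?(ltW J0)// natrM natrX -/Q.
    have /andP[h1 h2] := u12.
    have : (Num.sqrt n%:R * ph0) ^+ 3 <= 2 ^+ 3 by rewrite lerXn2r ?nnegrE//; lra.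
    have : 0 <= (Q * M%:R ^+ 5) ^+ 2 by exact: sqr_ge0.
    move: ((Q * _) ^+ 2) (_ ^+ 3) => x y x0; rewrite (_ : 2 ^+ 3 = 8 :> R); last by ring.
    move=> y8; have : x * y <= x * 8 by rewrite ler_wpM2l.
    by move: (x * y) => z; lra.
  have e1 : Ex P (fun t => (R1 t - Ex P R1) ^+ 2) <= 1.
    by apply: le_trans (var_le2 P bR1) _; exact: sum_close.
  have e2 : Ex P (fun t => (R2 t - Ex P R2) ^+ 2) <= 1.
    by apply: le_trans (var_le2 P bR2) _; exact: sum_close.
  have e3 : Ex P (fun t => R3 t ^+ 2) <= Q * (g3 / M%:R ^+ 2 + M%:R ^+ 4).
    rewrite (Ex_sqr_indep bY2 EY2 i2).
    apply: (@le_trans _ _ (\sum_(c < q.+1) (g3 / M%:R ^+ 2 + M%:R ^+ 4))).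
      by apply: ler_sum => c _; exact: sq2.
    by rewrite sumr_const card_ord -[_ *+ q.+1]mulr_natl.
  apply: le_trans (lerD (lerD (lerD eD e1) e2) e3) _.
  by rewrite lerD2r -addrA lerD2l -mulr2n lexx.
- by move=> u v; exact: cos_sum_indep.
Qed.

End Estimate.

(** * Conclusion *)

Section Asymptotics.
Context {R : realType}.

(** The square root leaves exp(-M^2/4), at most exp(-400 M) once M >= 1600, while the scales
    contribute at most 16 Z^5 = 2^(350 M + 4). *)
Lemma tiny (M q w : nat) : (1600 <= M)%N -> (q <= 2 ^ (70 * M))%N -> (w <= 2 ^ (70 * M))%N ->
  (q + w)%:R ^+ 3 * (2 * w%:R * Num.sqrt ((q * w)%:R * expR (- (M%:R ^+ 2 / 2)))) <= 1 :> R.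
Proof.
move=> M0 qZ wZ; pose Z : R := (2 ^ (70 * M))%:R.
have Z0 : 0 <= Z by exact: ler0n.
have qZ' : q%:R <= Z by rewrite ler_nat.
have wZ' : w%:R <= Z by rewrite ler_nat.
pose E : R := expR (- (400 * M)%:R).
have E1 : E * 2 ^+ (400 * M) <= 1.
  have h : (2 : R) ^+ (400 * M) <= expR (400 * M)%:R.
    rewrite -[X in expR X]mulr1 expRM_natl lerXn2r ?nnegrE ?expR_ge0//.
    by have := expR_ge1Dx (1 : R).
  by rewrite /E expRN mulrC ler_pdivrMr ?expR_gt0// mul1r.
have sq : Num.sqrt ((q * w)%:R * expR (- (M%:R ^+ 2 / 2))) <= Z * E.
  rewrite -[leRHS]ger0_norm ?mulr_ge0 ?expR_ge0// -sqrtr_sqr ler_wsqrtr// exprMn.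
  rewrite ler_pM ?expR_ge0//; first by rewrite natrM expr2 ler_pM.
  rewrite /E -expRM_natl ler_expR mulrN lerN2 [(400 * M)%:R]natrM.
  have : (400 : R) * 4 <= M%:R by rewrite -natrM ler_nat.
  have m0 : (0 : R) <= M%:R by exact: ler0n.
  move: (M%:R : R) m0 => m m0 h.
  have : m * (400 * 4) <= m * m by rewrite ler_wpM2l.
  by rewrite expr2; move: (m * m) => x; lra.
apply: (@le_trans _ _ ((2 * Z) ^+ 3 * (2 * Z * (Z * E)))).
  rewrite ler_pM ?exprn_ge0 ?mulr_ge0 ?sqrtr_ge0//.
    by rewrite lerXn2r ?nnegrE ?mulr_ge0// natrD mulr_natl mulr2n lerD.
  by rewrite ler_pM ?mulr_ge0 ?sqrtr_ge0// ler_wpM2l.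
have -> : (2 * Z) ^+ 3 * (2 * Z * (Z * E)) = (16 * Z ^+ 5) * E by ring.
apply: le_trans E1; rewrite mulrC ler_wpM2l ?expR_ge0//.
have -> : Z ^+ 5 = 2 ^+ (350 * M) by rewrite /Z natrX -exprM; congr (_ ^+ _); lia.
have -> : (16 : R) = 2 ^+ 4 by ring.
by rewrite -exprD ler_eXn2l ?ltr1n//; lia.
Qed.

End Asymptotics.

(** * Choice of the scales and rate of convergence *)

Section PerIndex.
Context d (T : measurableType d) (R : realType) (P : probability T R).
Variable omega : nat -> {RV P >-> R}.
Hypothesis iid : iid_standard_gaussian omega.

(** [c0] is the variance per unit from [var_cnt_ge], [K3] the third moment constant when J + 1 <= 65
    M, C2/M the relative squared error of the approximation, and [c1] the constant in the lower
    bound for the variance of the number of zeros. *)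
Let c0 : R := (1 / 100 / 200) ^+ 2 / 3.
Let c0_gt0 : 0 < c0. Proof. by rewrite divr_gt0 ?exprn_gt0// !divr_gt0. Qed.
Let K3 : R := 17 * (65 ^+ 3) + 3.
Let K3_gt0 : 0 < K3. Proof. by rewrite addr_gt0 ?mulr_gt0 ?exprn_gt0. Qed.
Let C2 : R := 4 * (99 + K3) * (4 / c0).
Let C2_gt0 : 0 < C2. Proof. by rewrite !mulr_gt0 ?invr_gt0// addr_gt0. Qed.
Let c1 : R := c0 / 16.
Let c1_gt0 : 0 < c1. Proof. by rewrite divr_gt0. Qed.
Let s1 : R := Num.sqrt c1.
Let s1_gt0 : 0 < s1. Proof. by rewrite sqrtr_gt0. Qed.
Let C3 : R := 4 * K3 / (c1 * s1).
Let C4 : R := (K3 + 1) ^+ 2 / c1 ^+ 2.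

Definition clt_rate (u m : R) : R :=
  2 * Num.sqrt (C2 / m) * `|u| + 3 * Num.sqrt (C2 / m) * u ^+ 2 + (C3 * `|u| ^+ 3 + C4 * u ^+ 4) / m.

Lemma clt_rate_cvg u : clt_rate u k.+1%:R @[k --> \oo] --> (0 : R).
Proof.
have hC (C : R) : C / k.+1%:R @[k --> \oo] --> (0 : R).
  by rewrite -[X in _ --> X](mulr0 C); apply: cvgM; [exact: cvg_cst|exact: cvg_harmonic].
have sC : Num.sqrt (C2 / k.+1%:R) @[k --> \oo] --> (0 : R).
  rewrite -[X in _ --> X]sqrtr0.
  by apply: (cvg_comp (fun k => C2 / k.+1%:R) (@Num.sqrt R)); [exact: hC|exact: sqrt_continuous].
rewrite (_ : 0 = 2 * 0 * `|u| + 3 * 0 * u ^+ 2 + 0 :> R); last by ring.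
apply: cvgD; last exact: hC.
by apply: cvgD; apply: cvgM; try exact: cvg_cst; apply: cvgM => //; exact: cvg_cst.
Qed.

Section Bounds.
(** Real values standing for M, the number of periods, J + 1 and 2^J. *)
Variables (m Q j e2J : R).
Hypothesis m1 : 100 <= m.
Hypothesis Q1 : m ^+ 23 <= Q.
Hypothesis big1 : 8 / c0 <= m.
Hypothesis big2 : 36 * C2 <= m.
Hypothesis J1 : 0 <= j <= 65 * m.
Hypothesis J2 : Q * m ^+ 5 * m <= e2J.
Let m3 : R := 17 * j ^+ 3 * m ^+ 15 + 3.
Let g3 : R := 17 * j ^+ 3 * m ^+ 3 + 3.

Let m0 : 0 < m. Proof. by apply: lt_le_trans m1. Qed.
Let m01 : 1 <= m. Proof. by apply: le_trans m1; rewrite ler1n. Qed.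
Let mX k : 0 < m ^+ k. Proof. by rewrite exprn_gt0. Qed.
Let mX1 k : 1 <= m ^+ k. Proof. by rewrite exprn_ege1. Qed.
Let Qgt0 : 0 < Q. Proof. by apply: lt_le_trans Q1. Qed.
Let Q1' : 1 <= Q. Proof. by apply: le_trans Q1. Qed.

Lemma third_moment_bound k : 17 * j ^+ 3 * m ^+ k + 3 <= K3 * m ^+ (k + 3).
Proof.
have /andP[j0 j1] := J1.
have : j ^+ 3 <= (65 * m) ^+ 3 by rewrite lerXn2r ?nnegrE// mulr_ge0// ltW.
rewrite exprMn => h.
have -> : K3 * m ^+ (k + 3) = 17 * (65 ^+ 3 * m ^+ 3) * m ^+ k + 3 * m ^+ (k + 3).
  by rewrite /K3 exprD; ring.
apply: lerD; last by rewrite ler_peMr.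
by rewrite ler_wpM2r ?(ltW (mX k))// ler_wpM2l.
Qed.

Lemma variance_bound x : (m ^+ 5 / 2 <= x) -> c0 * Q * m ^+ 5 / 4 <= Q * ((1 / 100 / 200) ^+ 2 * x / 3) - 2.
Proof.
move=> hx.
have -> : Q * ((1 / 100 / 200) ^+ 2 * x / 3) = c0 * Q * x by rewrite /c0; field.
have cQ : 0 <= c0 * Q by rewrite mulr_ge0 ?ltW.
have h1 : c0 * Q * (m ^+ 5 / 2) <= c0 * Q * x by rewrite ler_wpM2l.
have h2 : 8 <= c0 * Q * m ^+ 5.
  have b1 := big1; move: b1; rewrite ler_pdivrMr// mulrC => /le_trans; apply.
  rewrite -mulrA ler_wpM2l ?(ltW c0_gt0)// (@le_trans _ _ (1 * m ^+ 5))//.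
    by rewrite mul1r -[leLHS]expr1 ler_weXn2l.
  by rewrite ler_wpM2r// ltW.
by move: h1 h2; rewrite mulrA; move: (c0 * Q * m ^+ 5) (c0 * Q * x) => y z; lra.
Qed.

(** All parts of the remainder are O(Q m^4), the discretization because 2^J exceeds Q m^6, while s2
    is at least of order Q m^5. *)
Lemma remainder_bound s2 : c0 * Q * m ^+ 5 / 4 <= s2 ->
  4 * (96 * (Q * m ^+ 5) ^+ 2 / e2J + 2 + Q * (g3 / m ^+ 2 + m ^+ 4)) <= Num.sqrt (C2 / m) ^+ 2 * s2.
Proof.
move=> hs; have C2m : 0 <= C2 / m by rewrite divr_ge0 ?ltW.
rewrite sqr_sqrtr//.
have QX k : 0 < Q * m ^+ k by rewrite mulr_gt0.
have e0 : 0 < e2J by apply: lt_le_trans J2; rewrite mulr_gt0.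
have t1 : (Q * m ^+ 5) ^+ 2 / e2J <= Q * m ^+ 4.
  rewrite ler_pdivrMr//; apply: le_trans (ler_wpM2l (ltW (QX 4%N)) J2).
  by rewrite le_eqVlt; apply/orP; left; apply/eqP; ring.
have t2 : 1 <= Q * m ^+ 4 by rewrite mulr_ege1.
have t3 : Q * (g3 / m ^+ 2) <= K3 * (Q * m ^+ 4).
  have -> : K3 * (Q * m ^+ 4) = Q * (K3 * m ^+ 4) by ring.
  rewrite ler_wpM2l ?(ltW Qgt0)// ler_pdivrMr//.
  by rewrite -[leRHS]mulrA -exprD; exact: (third_moment_bound 3).
apply: (@le_trans _ _ (4 * (99 + K3) * (Q * m ^+ 4))).
  rewrite -[leRHS]mulrA ler_wpM2l// [Q * (_ + _)]mulrDr [leRHS]mulrDl -[96 * _ / _]mulrA.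
  move: t1 t2 t3; move: (K3 * _) => a.
  by move: (Q * m ^+ 4) (Q * (g3 / m ^+ 2)) ((Q * _) ^+ 2 / e2J) => x y z *; lra.
apply: le_trans (ler_wpM2l C2m hs).
rewrite le_eqVlt; apply/orP; left; apply/eqP; rewrite /C2; field.
by rewrite !gt_eqF.
Qed.

Lemma rate_small : 0 < Num.sqrt (C2 / m) <= 1 / 6.
Proof.
rewrite sqrtr_gt0 divr_gt0//=.
have -> : (1 / 6 : R) = Num.sqrt ((1 / 6) ^+ 2) by rewrite sqrtr_sqr ger0_norm.
rewrite ler_wsqrtr// ler_pdivrMr//.
by have := big2; rewrite (_ : (1 / 6) ^+ 2 = 36^-1 :> R); [lra|field].
Qed.

(** The cubic term is of order Q m^18 against V sqrt(V), at least of order Q m^5 m^14, so 1/m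
    remains. In the quartic term Q m^24 meets V^2, at least of order Q m^33. *)
Lemma lyapunov_bound (u V : R) : c1 * Q * m ^+ 5 <= V ->
  Q * (2 * `|u / Num.sqrt V| ^+ 3 * (2 * m3) + (u / Num.sqrt V) ^+ 4 * (m3 / m ^+ 6 + m ^+ 12) ^+ 2) <=
  (C3 * `|u| ^+ 3 + C4 * u ^+ 4) / m.
Proof.
move=> hV.
have cQ0 : 0 < c1 * Q * m ^+ 5 := mulr_gt0 (mulr_gt0 c1_gt0 Qgt0) (mX 5).
have c28 : 0 < c1 * m ^+ 28 := mulr_gt0 c1_gt0 (mX 28).
have s14 : 0 < s1 * m ^+ 14 := mulr_gt0 s1_gt0 (mX 14).
have V0 : 0 < V := lt_le_trans cQ0 hV.
have q0 : 0 < Num.sqrt V by rewrite sqrtr_gt0.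
have qq : Num.sqrt V ^+ 2 = V by rewrite sqr_sqrtr// ltW.
have V28 : c1 * m ^+ 28 <= V.
  apply: le_trans hV; rewrite -mulrA ler_wpM2l ?(ltW c1_gt0)//.
  by rewrite (_ : m ^+ 28 = m ^+ 23 * m ^+ 5) ?ler_wpM2r ?(ltW (mX 5))// -exprD.
have sV : s1 * m ^+ 14 <= Num.sqrt V.
  rewrite -(ler_pXn2r (n := 2))// ?nnegrE ?(ltW s14) ?(ltW q0)//.
  by rewrite exprMn qq /s1 sqr_sqrtr ?(ltW c1_gt0)// -exprM.
have u30 : 0 <= `|u| ^+ 3 by rewrite exprn_ge0.
have u40 : 0 <= u ^+ 4 by rewrite exprn_even_ge0.
have j0 : 0 <= j by case/andP: J1.
have m30 : 0 <= m3 by rewrite addr_ge0// !mulr_ge0 ?exprn_ge0 ?(ltW m0).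
have m3b : m3 <= K3 * m ^+ 18 by exact: (third_moment_bound 15).
have P1 : Q * (2 * `|u / Num.sqrt V| ^+ 3 * (2 * m3)) <= C3 * `|u| ^+ 3 / m.
  rewrite normrM normfV (gtr0_norm q0) expr_div_n.
  rewrite (_ : Num.sqrt V ^+ 3 = V * Num.sqrt V); last by rewrite exprSr qq.
  rewrite (_ : Q * _ = 4 * `|u| ^+ 3 * (Q * m3) / (V * Num.sqrt V)); last first.
    by field; rewrite !gt_eqF.
  rewrite ler_pdivrMr ?mulr_gt0//.
  apply: (@le_trans _ _ (4 * `|u| ^+ 3 * (Q * (K3 * m ^+ 18)))).
    by rewrite ler_wpM2l ?mulr_ge0// ler_wpM2l ?(ltW Qgt0).
  have C30 : 0 <= C3 * `|u| ^+ 3 / m.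
    by apply: divr_ge0; [apply: mulr_ge0|exact: ltW]; rewrite // /C3 ltW// divr_gt0 ?mulr_gt0.
  apply: (@le_trans _ _ (C3 * `|u| ^+ 3 / m * ((c1 * Q * m ^+ 5) * (s1 * m ^+ 14)))).
    rewrite le_eqVlt; apply/orP; left; apply/eqP; rewrite /C3; field.
    by rewrite !gt_eqF.
  by apply: ler_wpM2l => //; apply: ler_pM; [exact: ltW|exact: ltW|exact: hV|exact: sV].
have P2 : Q * ((u / Num.sqrt V) ^+ 4 * (m3 / m ^+ 6 + m ^+ 12) ^+ 2) <= C4 * u ^+ 4 / m.
  rewrite expr_div_n (_ : Num.sqrt V ^+ 4 = V * V); last by rewrite -[4%N]/(2 + 2)%N exprD qq.
  have D2 : m3 / m ^+ 6 + m ^+ 12 <= (K3 + 1) * m ^+ 12.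
    rewrite (mulrDl K3 1) mul1r lerD2r ler_pdivrMr// -[leRHS]mulrA -exprD; exact: m3b.
  have D20 : 0 <= m3 / m ^+ 6 + m ^+ 12.
    by rewrite addr_ge0 ?divr_ge0 ?(ltW (mX 6)) ?(ltW (mX 12)).
  have D22 : (m3 / m ^+ 6 + m ^+ 12) ^+ 2 <= ((K3 + 1) * m ^+ 12) ^+ 2.
    by rewrite lerXn2r ?nnegrE// (le_trans D20).
  rewrite (_ : Q * _ = u ^+ 4 * (Q * (m3 / m ^+ 6 + m ^+ 12) ^+ 2) / (V * V)); last first.
    by field; rewrite !gt_eqF.
  rewrite ler_pdivrMr ?mulr_gt0//.
  apply: (@le_trans _ _ (u ^+ 4 * (Q * ((K3 + 1) * m ^+ 12) ^+ 2))).
    by rewrite ler_wpM2l// ler_wpM2l// ltW.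
  have C40 : 0 <= C4 * u ^+ 4 / m.
    by rewrite divr_ge0 ?(ltW m0)// mulr_ge0// /C4 divr_ge0 ?sqr_ge0.
  apply: (@le_trans _ _ (C4 * u ^+ 4 / m * ((c1 * Q * m ^+ 5) * (c1 * m ^+ 28)))); last first.
    by apply: ler_wpM2l => //; apply: ler_pM; [exact: ltW|exact: ltW|exact: hV|exact: V28].
  have -> : C4 * u ^+ 4 / m * ((c1 * Q * m ^+ 5) * (c1 * m ^+ 28)) =
     u ^+ 4 * (Q * ((K3 + 1) * m ^+ 12) ^+ 2) * m ^+ 8.
    by rewrite /C4; field; rewrite !gt_eqF.
  by rewrite ler_peMr//; exact: mulr_ge0 u40 (mulr_ge0 (ltW Qgt0) (sqr_ge0 _)).
by rewrite [Q * (_ + _)]mulrDr [leRHS]mulrDl; exact: lerD P1 P2.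
Qed.

End Bounds.

Local Notation N n a b := (nb_zeros (fun j => omega j) n a b).

(** The bound depends on the interval only through M, so no regularity of the sequence of intervals
    enters the limit. *)
Lemma clt_at_index : exists M0 : nat, forall (n M : nat) (a b : \bar R), (M0 <= M)%N -> (a < b)%E ->
  M%:R ^+ 28 <= Num.sqrt n%:R * (ang b - ang a) < M.+1%:R ^+ 28 ->
  let W t := N n a b t - Ex P (N n a b) in
  let V := Ex P (fun t => W t ^+ 2) in
  0 < V /\ forall u v,
  `|Ex P (fun t => cos (u * (W t / Num.sqrt V) + v)) - expR (- (u ^+ 2 / 2)) * cos v| <= clt_rate u M%:R.
Proof.
have k1P : 8 / c0 <= (Num.truncn (8 / c0)).+1%:R by exact: ltW (truncnS_gt _).
have k2P : 36 * C2 <= (Num.truncn (36 * C2)).+1%:R by exact: ltW (truncnS_gt _).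
move: k1P k2P; move: (Num.truncn _) (Num.truncn _) => k1 k2 k1P k2P.
exists (1600 + k1 + k2).+2 => n M a b MM ab /andP[L1 L2] W V.
have M1600 : (1600 <= M)%N by move: MM; clear; lia.
have M100 : (100 <= M)%N by move: MM; clear; lia.
have b1 : 8 / c0 <= M%:R :> R.
  by apply: (le_trans k1P); rewrite ler_nat; move: MM; clear; lia.
have b2 : 36 * C2 <= M%:R :> R.
  by apply: (le_trans k2P); rewrite ler_nat; move: MM; clear; lia.
have mR : 100 <= M%:R :> R by rewrite ler_nat.
have m0 : (0 : R) < M%:R by rewrite ltr0n; apply: leq_trans M100.
have m1 : (1 : R) <= M%:R by rewrite ler1n; apply: leq_trans M100.
have mX k : (0 : R) < M%:R ^+ k by rewrite exprn_gt0.
set L := Num.sqrt n%:R * (ang b - ang a) in L1 L2.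
have BA : ang b - ang a <= pi.
  by case/andP: (ang_range a) => h1 h2; case/andP: (ang_range b) => h3 h4; lra.
have L0 : 0 < L by apply: lt_le_trans L1.
have n100 : (100 <= n)%N.
  have h : 100 * 4 <= Num.sqrt n%:R * 4 :> R.
    apply: (@le_trans _ _ L).
      apply: le_trans L1; rewrite (_ : M%:R ^+ 28 = M%:R ^+ 26 * (M%:R * M%:R)); last by rewrite -expr2 -exprD.
      apply: (@le_trans _ _ (1 * (100 * 100))); first by lra.
      by rewrite ler_pM// ?exprn_ege1// ler_pM.
    rewrite /L ler_wpM2l ?sqrtr_ge0// (le_trans BA)//.
    by have := pihalf_lt2 R; lra.
  rewrite -(ler_nat R) -[leRHS](@sqr_sqrtr R)//.
  have : 100 <= Num.sqrt n%:R :> R by lra.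
  move: (Num.sqrt _ : R) => x x1; apply: (@le_trans _ _ (100 * 1)); first by rewrite mulr1.
  by rewrite expr2 ler_pM//; lra.
pose x : R := L / M%:R ^+ 5.
have x23 : M%:R ^+ 23 <= x.
  by rewrite /x ler_pdivlMr// -exprD.
have x0 : 0 <= x by apply: le_trans x23; rewrite ltW.
(* [q.+1] is the integer part of L/M^5, so a unit is between 1/sqrt(n) and 2/sqrt(n) long. *)
pose q := (Num.truncn x).-1.
have tx : M%:R ^+ 23 < (Num.truncn x).+1%:R :> R by apply: le_lt_trans x23 (truncnS_gt _).
have tq : (M ^ 23 <= Num.truncn x)%N by rewrite -ltnS -(ltr_nat R) natrX.
have M2 : (2 <= M ^ 23)%N.
  by apply: leq_trans (_ : M <= _)%N; [apply: leq_trans M100|rewrite -[M in (M <= _)%N]expn1 leq_exp2l//; apply: leq_trans M100].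
have qS : q.+1 = Num.truncn x by rewrite /q prednK//; apply: leq_trans tq; apply: leq_trans M2.
have q0 : (0 < q)%N by rewrite -ltnS qS; apply: leq_trans tq.
have Q1 : M%:R ^+ 23 <= q.+1%:R :> R by rewrite qS -natrX ler_nat.
have Qx : q.+1%:R <= x by rewrite qS truncn_le.
have Qx2 : x <= 2 * q.+1%:R.
  apply: le_trans (ltW (truncnS_gt _)) _; rewrite -qS -natrM ler_nat.
  by clear; lia.
(* Large enough for 2^J to exceed Q M^6, as Q M^5 <= 2^(28 M), and small enough for J^3 to cost only
   a factor of order M^3. *)
pose J := (64 * M)%N.
have M2M : (M.+1 <= 2 ^ M)%N by exact: ltn_expl.
have L28 : L < (2 ^ (28 * M))%:R.
  by apply: lt_le_trans L2 _; rewrite -natrX ler_nat mulnC expnM leq_exp2r.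
have QM5 : (q.+1 * M ^ 5 <= 2 ^ (28 * M))%N.
  rewrite -(ler_nat R) (le_trans _ (ltW L28))// natrM natrX.
  by rewrite -ler_pdivlMr.
have M5p : (0 < M ^ 5)%N by rewrite expn_gt0; apply/orP; left; apply: leq_trans M100.
have u12 : 1 <= Num.sqrt n%:R * ((ang b - ang a) / (q.+1 * M ^ 5)%:R) <= 2.
  have Q5 : (0 : R) < (q.+1 * M ^ 5)%:R by rewrite ltr0n muln_gt0.
  have E : Num.sqrt n%:R * ((ang b - ang a) / (q.+1 * M ^ 5)%:R) = x / q.+1%:R.
    by rewrite /x /L natrM natrX; field; rewrite !gt_eqF.
  rewrite E ler_pdivlMr ?ltr0n// mul1r Qx/= ler_pdivrMr ?ltr0n//.
have J100 : 2 / 2 ^+ J <= 1 / 100 :> R.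
  rewrite ler_pdivrMr ?exprn_gt0//.
  have : (200 : R) <= 2 ^+ J.
    rewrite -natrX ler_nat (@leq_trans (2 ^ 8))// leq_exp2l// /J.
    by move: M100; clear; lia.
  by move: (2 ^+ J) => z; lra.
have wb : ((2 ^ J * M ^ 5).+1 <= 2 ^ (70 * M))%N.
  have h : (2 ^ J * M ^ 5 <= 2 ^ (69 * M))%N.
    have -> : (69 * M = J + M * 5)%N by rewrite /J; clear; lia.
    by rewrite expnD leq_mul2l expnM leq_exp2r// (ltnW M2M) orbT.
  apply: leq_ltn_trans h _; rewrite ltn_exp2l//.
  by move: M100; clear; lia.
have qb : (q.+1 <= 2 ^ (70 * M))%N.
  apply: leq_trans (_ : _ <= q.+1 * M ^ 5)%N _; first by rewrite leq_pmulr.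
  by apply: leq_trans QM5 _; rewrite leq_exp2l//; clear; lia.
have eps1 := tiny (R := R) M1600 qb wb.
have [S [s2 [bS ES s2b RS cS]]] := estimate iid n100 ab M100 q0 u12 J100 eps1.
have J1 : 0 <= (J.+1%:R : R) <= 65 * M%:R.
  by rewrite ler0n/= -natrM ler_nat /J; move: M100; clear; lia.
have J2 : q.+1%:R * M%:R ^+ 5 * M%:R <= 2 ^+ J :> R.
  rewrite -!natrX -!natrM ler_nat (leq_trans (leq_mul QM5 (ltnW M2M)))// -expnD leq_exp2l// /J.
  by clear; lia.
have K5 : M%:R ^+ 5 / 2 <= (M ^ 5 - M - 3)%:R :> R.
  rewrite ler_pdivrMr// -natrX -natrM ler_nat.
  have : (M * 100 <= M ^ 5)%N.
    rewrite (expnS M 4) leq_mul2l; apply/orP; right; apply: leq_trans (M100) _.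
    by rewrite -[M in (M <= _)%N]expn1 leq_exp2l//; apply: leq_trans M100.
  by move: M100; move: (M ^ 5)%N => y; clear; lia.
have s2c : c0 * q.+1%:R * M%:R ^+ 5 / 4 <= s2.
  by apply: le_trans s2b; exact: variance_bound.
have Q0 : (0 : R) < q.+1%:R by rewrite ltr0n.
have s20 : 0 < s2 by apply: lt_le_trans s2c; rewrite !divr_gt0// !mulr_gt0.
have e6 := rate_small mR b2.
have RS' : Ex P (fun t => (W t - S t) ^+ 2) <= Num.sqrt (C2 / M%:R) ^+ 2 * s2.
  by apply: le_trans RS _; apply: remainder_bound.
have bN : bdd (N n a b).
  split; first exact: measurable_nb_zeros.
  exists n%:R => t; have /andP[N0 Nn] := nb_zeros_bound omega n ab t.
  by rewrite ger0_norm.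
have bW : bdd W by apply: bddB => //; exact: bdd_cst.
have Vge : c1 * q.+1%:R * M%:R ^+ 5 <= V.
  have bR := bddB bW bS.
  have h1 : s2 <= 2 * V + 2 * Ex P (fun t => (W t - S t) ^+ 2).
    rewrite -ES -(ExZ P 2 (bddX 2 bW)) -(ExZ P 2 (bddX 2 bR)) -(ExD P (bddZ 2 (bddX 2 bW)) (bddZ 2 (bddX 2 bR))).
    apply: Ex_le; [exact: bddX|by apply: bddD; apply: bddZ; exact: bddX|].
    move=> t; move: (W t) (S t) => y z; rewrite -subr_ge0.
    rewrite (_ : _ - _ = (2 * y - z) ^+ 2); last by ring.
    exact: sqr_ge0.
  have h2 : Num.sqrt (C2 / M%:R) ^+ 2 * s2 <= s2 / 4.
    rewrite mulrC ler_wpM2l ?(ltW s20)//.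
    have /andP[e0 e1] := e6; apply: (@le_trans _ _ (1 / 6 * (1 / 6))); last by lra.
    by rewrite expr2 ler_pM// ltW.
  have h3 : c1 * q.+1%:R * M%:R ^+ 5 = c0 * q.+1%:R * M%:R ^+ 5 / 4 / 4 by rewrite /c1; field.
  by rewrite h3; move: s2c h1 h2 RS'; move: (_ / 4) (Ex P _) (_ ^+ 2 * s2) => y z v *; lra.
have V0 : 0 < V by apply: lt_le_trans Vge; rewrite !mulr_gt0.
split=> // u v; rewrite /clt_rate.
apply: (cos_normalized bW bS s20 e6 ES RS').
apply: le_trans (cS _ v) _.
by apply: lyapunov_bound.
Qed.

End PerIndex.

Section AngleOfInterval.
Context {R : realType}.

(** [alpha] is the tangent of the angle. Below angle 1/2 the cosine is at least 1/2, so alpha is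
    positive and at most twice the angle; alpha <= 0 therefore forces a long interval. *)
Lemma angle_alpha (a b : \bar R) : (a < b)%E ->
  1 / 2 <= ang b - ang a \/ (0 < alpha a b <= (2 * (ang b - ang a))%:E)%E.
Proof.
move=> ab; set D := ang b - ang a.
have D0 : 0 < D by rewrite subr_gt0 ang_lt.
have [D2|D2] := leP (1 / 2) D; [by left|right].
have p2 := pi_ge2 R.
have sD0 : 0 < sin D by rewrite sin_gt0_pi// D0/=; lra.
have sD : sin D <= D by exact: sin_le_id (ltW D0).
have cD : 1 / 2 <= cos D.
  have := cos_ge2 (ltW D0); have : D ^+ 2 <= (1 / 2) ^+ 2 by rewrite lerXn2r ?nnegrE//; lra.
  by move: (D ^+ 2) => x; rewrite (_ : (1 / 2) ^+ 2 = 1 / 4 :> R); [lra|field].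
have cD0 : 0 < cos D by lra.
suff -> : alpha a b = (sin D / cos D)%:E.
  rewrite lte_fin lee_fin divr_gt0//= ler_pdivrMr//; apply: le_trans sD _.
  have : D * (1 / 2) <= D * cos D by rewrite ler_wpM2l// ltW.
  by rewrite -mulrA; move: (D * cos D) => x; lra.
have cp (r : R) : 0 < cos (atan r) by rewrite cos_gt0_pihalf// atan_gtNpi2 atan_ltpi2.
have st (r : R) : sin (atan r) = r * cos (atan r).
  by rewrite -{2}(atanK r) /tan divfK// gt_eqF.
clear sD cD; move: ab D0 sD0 cD0 D2; rewrite {}/D; case: a => [r||]; case: b => [s||]//=.
- move=> _ _ _ + _; rewrite cosB !st => c0.
  have c0' : 0 < 1 + r * s.
    move: c0; rewrite (_ : _ + _ = (1 + r * s) * (cos (atan s) * cos (atan r))); last by ring.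
    by rewrite pmulr_lgt0// mulr_gt0.
  rewrite ifF; last by apply/negP => /eqP e; move: c0'; rewrite e; lra.
  congr (_%:E); rewrite sinB !st; field.
  by rewrite !gt_eqF ?cp//= andbT.
- move=> _ _ _ + _; rewrite sinB cosB sin_pihalf cos_pihalf !mul0r mul1r subr0 add0r mul1r st => h.
  have r0 : 0 < r by move: h; rewrite pmulr_lgt0.
  rewrite gt_eqF//; congr (_%:E); field.
  by rewrite !gt_eqF.
- move=> _ _ _ + _; rewrite opprK sinD cosD sin_pihalf cos_pihalf !mulr0 !mulr1 !add0r st => h.
  have s0 : s < 0.
    move: h; rewrite -mulNr pmulr_lgt0//; lra.
  rewrite lt_eqF//; congr (_%:E); field.
  by rewrite gt_eqF// lt_eqF.
- by move=> _ _ _ _ D2; exfalso; move: D2 p2; rewrite opprK; move: (pi : R) => p; lra.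
Qed.

Lemma root28 (L : R) : 0 <= L -> exists M : nat, M%:R ^+ 28 <= L < M.+1%:R ^+ 28.
Proof.
move=> L0.
have ex : exists k, k%:R ^+ 28 <= L by exists 0%N; rewrite expr0n.
have bd k : k%:R ^+ 28 <= L -> (k <= (Num.truncn L).+1)%N.
  move=> kL; rewrite -(ler_nat R); apply: le_trans (ltW (truncnS_gt L)).
  apply: le_trans kL; case: k => [|k]; first by rewrite expr0n.
  by rewrite -[leLHS]expr1 ler_weXn2l// ler1n.
have [M ML Mmax] := ex_maxnP ex bd.
exists M; rewrite ML ltNge; apply/negP => h.
by have := Mmax _ h; rewrite ltnn.
Qed.

End AngleOfInterval.

Theorem theorem1p6 (d : measure_display) (T : measurableType d) (R : realType)
    (P : probability T R) (omega : nat -> {RV P >-> R})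
    (a b : nat -> \bar R) :
  iid_standard_gaussian omega ->
  (forall n, (a n < b n)%E) ->
  let alpha_n := fun n : nat => ((Num.sqrt (n%:R : R))%:E * alpha (a n) (b n))%E in
  let N := fun n : nat => nb_zeros omega n (a n) (b n) in
  (forall n, (alpha_n n <= 0)%E) \/ alpha_n n @[n --> \oo] --> +oo%E ->
  cvg_in_distribution P
    (fun n t => (N n t - fine ('E_P[N n])%E) / Num.sqrt (fine 'V_P[N n]%E))
    (normal_prob 0 1).
Proof.
move=> iid ab alpha_n N hyp.
pose L n : R := Num.sqrt n%:R * (ang (b n) - ang (a n)).
have sn K : \forall n \near \oo, K <= Num.sqrt n%:R :> R.
  exists (Num.truncn (K ^+ 2)).+1 => // n /= Kn.
  have [K0|/ltW K0] := leP K 0; first by rewrite (le_trans K0)// sqrtr_ge0.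
  rewrite -[leLHS]ger0_norm// -sqrtr_sqr ler_wsqrtr//.
  by rewrite (le_trans (ltW (truncnS_gt _)))// ler_nat.
(* Indices with angle at least 1/2 are settled by sqrt(n) alone. For the others alpha is positive,
   which contradicts the first alternative and bounds the angle below in the second. *)
have Lbig K : \forall n \near \oo, K <= L n.
  case: hyp => [neg|lim].
    apply: filterS2 (sn (2 * Num.max K 1)) (nbhs_infty_gt 0) => n nK n0.
    have s0 : 0 < Num.sqrt n%:R :> R by rewrite sqrtr_gt0 ltr0n.
    have [D2|/andP[a0 _]] := angle_alpha (ab n).
      rewrite /L; have : Num.sqrt n%:R * (1 / 2) <= Num.sqrt n%:R * (ang (b n) - ang (a n)) by rewrite ler_wpM2l// ltW.
      have : K <= Num.max K 1 by rewrite le_max lexx.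
      by move: nK; move: (Num.sqrt n%:R * (ang (b n) - ang (a n))) (Num.max K 1) (Num.sqrt n%:R) => x y z; lra.
    by have := neg n; rewrite leNgt mule_gt0// lte_fin.
  move/cvgeyPge/(_ (2 * K)) in lim.
  apply: filterS2 (sn (2 * K)) lim => n nK.
  have s0 : 0 <= Num.sqrt n%:R :> R by exact: sqrtr_ge0.
  have [D2 _|/andP[_ a1]] := angle_alpha (ab n).
    rewrite /L; have : Num.sqrt n%:R * (1 / 2) <= Num.sqrt n%:R * (ang (b n) - ang (a n)) by rewrite ler_wpM2l.
    by move: nK; move: (Num.sqrt n%:R * (ang (b n) - ang (a n))) (Num.sqrt n%:R) => x y; lra.
  move=> /le_trans h; have : ((2 * K)%:E <= (Num.sqrt n%:R)%:E * (2 * (ang (b n) - ang (a n)))%:E)%E.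
    by apply: h; rewrite lee_wpmul2l// lee_fin.
  by rewrite -EFinM lee_fin mulrCA /L; move: (_ * (_ - _)) => x; lra.
have bN n : bdd (N n).
  split; first exact: measurable_nb_zeros.
  exists n%:R => t; have /andP[N0 Nn] := nb_zeros_bound omega n (ab n) t.
  by rewrite ger0_norm.
pose W n t := N n t - Ex P (N n).
pose V n := Ex P (fun t => W n t ^+ 2).
have bW n : bdd (W n) by apply: bddB => //; exact: bdd_cst.
pose Z n t := W n t / Num.sqrt (V n).
have bZ n : bdd (Z n).
  rewrite (_ : Z n = fun t => (Num.sqrt (V n))^-1 * W n t); first exact: bddZ.
  by apply/funext => t; rewrite mulrC.
have mZ n : measurable_fun setT (Z n) := (bZ n).1.
have ZE n t : (N n t - fine ('E_P[N n])%E) / Num.sqrt (fine 'V_P[N n]%E) = Z n t.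
  have EE : fine ('E_P[N n])%E = Ex P (N n) by rewrite unlock.
  rewrite /Z /W /V EE; congr (_ / Num.sqrt _).
  rewrite /variance covariance.unlock EE expectation.unlock.
  by apply: eq_Ex => t0.
have [M0 key] := clt_at_index iid.
have index K : \forall n \near \oo, exists2 M, (K <= M)%N & M%:R ^+ 28 <= L n < M.+1%:R ^+ 28.
  apply: filterS (Lbig (K%:R ^+ 28)) => n Kn.
  have L0 : 0 <= L n by apply: le_trans Kn; rewrite exprn_ge0.
  have [M /andP[M1 M2]] := root28 L0; exists M; last by rewrite M1.
  rewrite -ltnS -(ltr_nat R) -(ltr_pXn2r (n := 28))// ?nnegrE//.
  exact: le_lt_trans Kn M2.
have Z2 : \forall n \near \oo, Ex P (fun t => Z n t ^+ 2) <= 1.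
  apply: filterS (index M0) => n [M MM /(key n M _ _ MM (ab n))[V0 _]].
  rewrite (_ : Ex P _ = (V n)^-1 * V n); first by rewrite mulVf// gt_eqF.
  rewrite -ExZ; last exact: bddX.
  by apply: eq_Ex => t; rewrite /Z exprMn exprVn sqr_sqrtr ?ltW// mulrC.
(* The limit variable is [omega 0], which is itself standard Gaussian. *)
have limcos u v : Ex P (fun t => cos (u * Z n t + v)) @[n --> \oo] -->
    Ex P (fun t => cos (u * omega 0 t + v)).
  rewrite (Ex_cos_omega iid).
  apply/cvgrPdist_le => e e0.
  have := @clt_rate_cvg R u; move/cvgrPdist_le/(_ _ e0) => -[K _ HK].
  (* [clt_rate_cvg] is indexed by k + 1 = M, hence the bound [K.+1] and the predecessor of [M]
     below. *)
  apply: filterS (index (maxn M0 K.+1)) => n [M]; rewrite geq_max => /andP[MM KM] ML.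
  have [_ H] := key n M _ _ MM (ab n) ML.
  rewrite distrC; apply: le_trans (H u v) _.
  have := HK M.-1 _; rewrite /= sub0r normrN prednK ?(leq_trans _ KM)//.
  move=> /(_ _)/le_trans h; apply: le_trans (ler_norm _) _; apply: h => //.
  by rewrite -ltnS prednK ?(leq_trans _ KM).
move=> x cx.
have mG : measurable_fun setT (omega 0) by [].
have muE y : normal_prob 0 1 [set` `]-oo, y]] = (1 - Ex P (fun t => bit (omega 0 t - y)))%:E.
  have mB : measurable [set` `]-oo, y]] by exact: measurable_itv.
  rewrite -(cdfE P y mG) -(iid.2 0%N _ mB).
  by apply: (congr1 P); apply/seteqP; split => t /=; rewrite in_itv.
(* The assumed continuity at [x] concerns the extended-real distribution function; it is carried
   over to the real tail function. *)
have cF : {for x, continuous (fun y => Ex P (fun t => bit (omega 0 t - y)))}.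
  have h : (1 - Ex P (fun t => bit (omega 0 t - y)))%:E @[y --> x] --> (1 - Ex P (fun t => bit (omega 0 t - x)))%:E.
    by rewrite -muE; under eq_fun do rewrite -muE; exact: cx.
  have h2 := fine_cvg h.
  rewrite (_ : (fun y => _) = (fun y => 1 - (1 - Ex P (fun t => bit (omega 0 t - y))))); last first.
    by apply/funext => y; rewrite subKr.
  by apply: cvgB; [exact: cvg_cst|exact: h2].
have lim := limit_tail mZ mG limcos bZ Z2 cF.
have : (1 - Ex P (fun t => bit (Z n t - x)))%:E @[n --> \oo] -->
    (1 - Ex P (fun t => bit (omega 0 t - x)))%:E.
  by apply: cvg_EFin; [exact: nearW|apply: cvgB; [exact: cvg_cst|exact: lim]].
rewrite -muE; under eq_fun do rewrite -(cdfE P x (mZ _)).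
rewrite (_ : (fun n => P [set t | Z n t <= x]) = (fun n => P [set t |
   (N n t - fine ('E_P[N n])%E) / Num.sqrt (fine 'V_P[N n]%E) <= x])); first by [].
apply/funext => n; apply: (congr1 P); apply/seteqP.
by split => t /=; rewrite ZE.
Qed.
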